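(* Consider the $\alpha$-robust time-consistent mean-variance reinsurance-investment problem $\sup_{\pi\in\Pi}J_\alpha^{\pi}(t,x,h)$ described in the context, in the post-default case $h=1$ (so that $\pi_p^*(t)=0$). Write $\hat\alpha=1-\alpha$ and $\hat\rho=\sqrt{1-\rho^2}$. Then the optimal (equilibrium) reinsurance and investment strategies of the insurer are as follows. (1) The equilibrium reinsurance strategy $\pi_q^*(t)$, $t\in[0,T]$, is determined by the equation $$0=\int_0^\infty\Big\{(1+\eta)z e^{r(T-t)}-\alpha\big(ze^{r(T-t)}+\gamma\pi_q^*(t)z^2e^{2r(T-t)}\big)e^{\beta_3\left(\pi_q^*(t)ze^{r(T-t)}+\frac{\gamma}{2}\pi_q^*(t)^2z^2e^{2r(T-t)}\right)}$$ $$-\hat\alpha\big(ze^{r(T-t)}+\gamma\pi_q^*(t)z^2e^{2r(T-t)}\big)e^{-\beta_3\left(\pi_q^*(t)ze^{r(T-t)}+\frac{\gamma}{2}\pi_q^*(t)^2z^2e^{2r(T-t)}\right)}\Big\}v(dz),$$ and the equilibrium investment strategy in the stock is $$\pi_s^*(t)=\frac{(\mu-r)e^{-r(T-t)}-\sigma_1\sigma_2\rho\gamma-(2\alpha-1)\beta_1\sigma_1\sigma_2\rho}{\sigma_2^2\left[\gamma+(2\alpha-1)(\beta_1\rho^2+\beta_2\hat\rho^2)\right]}.$$ (2) The corresponding equilibrium value function is $J_\alpha^{\pi^*}(t,x,1)=e^{r(T-t)}x+B_1(t)$, where $$B_1(t)=\int_t^T\Big\{\big(\theta-\eta+(1+\eta)\pi_q^*(s)\big)e^{r(T-s)}\int_0^\infty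 z\,v(dz)-\tfrac12\gamma\sigma_1^2e^{2r(T-s)}-\tfrac{2\alpha-1}{2}\beta_1\sigma_1^2e^{2r(T-s)}$$ $$+\frac{\left[\mu-r-\sigma_1\sigma_2\rho\gamma e^{r(T-s)}-(2\alpha-1)\beta_1\sigma_1\sigma_2\rho e^{r(T-s)}\right]^2}{2\sigma_2^2\left[\gamma+(2\alpha-1)(\beta_1\rho^2+\beta_2\hat\rho^2)\right]}$$ $$+\frac{\alpha}{\beta_3}\int_0^\infty\Big(1-e^{\beta_3\left(\pi_q^*(s)ze^{r(T-s)}+\frac{\gamma}{2}\pi_q^*(s)^2z^2e^{2r(T-s)}\right)}\Big)v(dz)-\frac{\hat\alpha}{\beta_3}\int_0^\infty\Big(1-e^{-\beta_3\left(\pi_q^*(s)ze^{r(T-s)}+\frac{\gamma}{2}\pi_q^*(s)^2z^2e^{2r(T-s)}\right)}\Big)v(dz)\Big\}ds.$$ (3) The associated probability distortion functions of the extremely ambiguity-averse measure ($\underline\phi^*=\underline\phi^{\pi^*}$, attaining the infimum in $J_\alpha^{\pi^*}$) and of the extremely ambiguity-seeking measure ($\overline\phi^*=\overline\phi^{\pi^*}$, attaining the supremum in $J_\alpha^{\pi^*}$) are given respectively by $$\underline\phi_1^*(t)=\beta_1(\sigma_1+\sigma_2\rho\pi_s^*(t))e^{r(T-t)},\quad \underline\phi_2^*(t)=\beta_2\sigma_2\hat\rho\pi_s^*(t)e^{r(T-t)},\quad \underline\phi_3^*(t,z)=1-e^{\beta_3\left(\pi_q^*(t)ze^{r(T-t)}+\frac{\gamma}{2}\pi_q^*(t)^2z^2e^{2r(T-t)}\right)},$$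 and $$\overline\phi_1^*(t)=-\beta_1(\sigma_1+\sigma_2\rho\pi_s^*(t))e^{r(T-t)},\quad \overline\phi_2^*(t)=-\beta_2\sigma_2\hat\rho\pi_s^*(t)e^{r(T-t)},\quad \overline\phi_3^*(t,z)=1-e^{-\beta_3\left(\pi_q^*(t)ze^{r(T-t)}+\frac{\gamma}{2}\pi_q^*(t)^2z^2e^{2r(T-t)}\right)}.$$
   Context: **Probability setting.** $(\Omega,\mathcal F,\mathbb P)$ is a complete probability space carrying independent standard Brownian motions $W_1,W_2$, a Poisson random measure $N(dt,dz)$ on $[0,\infty)\times(0,\infty)$ independent of $W_1,W_2$ with compensator $v(dz)dt$, where $v$ is a Lévy measure on $(0,\infty)$ with $\int_0^\infty z\,v(dz)<\infty$, and compensated measure $\tilde N(dt,dz)=N(dt,dz)-v(dz)dt$; and a default time $\tau$ (a nonnegative random variable) with default process $H(t)=\mathbf 1_{\{\tau\le t\}}$. $\mathbb F$ is the right-continuous $\mathbb P$-complete filtration generated by $W_1,W_2,N$; $\mathbb H$ is the filtration of $H$; $\mathbb G=\mathbb F\vee\mathbb H$. The default intensity under $\mathbb P$ is the constant $h^{\mathbb P}$, i.e. $M^{\mathbb P}(t)=H(t)-\int_0^t(1-H(u-))h^{\mathbb P}du$ is a $(\mathbb G,\mathbb P)$-martingale. $W_1,W_2$ and $\tilde N$ keep their properties with respect to $\mathbb G$. **Parameters.** $r>0$ interest rate; $\mu\in\mathbb R$, $\sigma_2>0$ stock drift and volatility; $\rho\in[-1,1]$, $\hat\rho=\sqrt{1-\rho^2}$;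 $\sigma_1$ volatility of the insurer's surplus; $\theta,\eta$ safety loadings of insurer and reinsurer with $\eta>\theta>0$; $\zeta\in[0,1]$ loss rate of the defaultable bond; $\delta=h^{\mathbb Q}\zeta$ credit spread, where $h^{\mathbb Q}$ is the constant risk-neutral default intensity; $1/\Delta=h^{\mathbb Q}/h^{\mathbb P}\ge1$ (so $\Delta\delta=\zeta h^{\mathbb P}$); $\gamma>0$ risk aversion; $\beta=(\beta_1,\beta_2,\beta_3)\in(0,\infty)^3$ ambiguity levels; $\alpha\in[\frac12,1]$, $\hat\alpha=1-\alpha$; $T$ is the investment horizon, smaller than the maturity $T_1$ of the defaultable bond. **Wealth.** A strategy is $\pi=(\pi_s,\pi_p,\pi_q)$: amounts in the stock and in the defaultable bond, and the insurance risk exposure. The wealth $X^\pi$ satisfies $$dX^\pi(t)=\Big[rX^\pi(t)+(\mu-r)\pi_s(t)+(\theta-\eta+\eta\pi_q(t))\int_0^\infty z\,v(dz)+\pi_p(t)(1-H(t))(1-\Delta)\delta\Big]dt$$ $$+(\sigma_1+\pi_s(t)\sigma_2\rho)dW_1(t)+\pi_s(t)\sigma_2\hat\rho\,dW_2(t)-\pi_q(t)\int_0^\infty z\tilde N(dt,dz)-\pi_p(t)\zeta\,dM^{\mathbb P}(t).$$ After default ($t\ge\tau$) the bond is worthless and $\pi_p(t)=0$. **Prior measures.** $\Theta$ is the set of deterministic $\phi=(\phi_1(t),\phi_2(t),\phi_3(t,z))_{t\in[0,T],z>0}$, $\phi_3<1$, with $$\exp\Big\{\int_t^T\tfrac{\phi_1(s)^2+\phi_2(s)^2}{2}ds+\int_t^T\int_0^\infty[(1-\phi_3(s,z))\ln(1-\phi_3(s,z))+\phi_3(s,z)]v(dz)ds\Big\}<\infty\quad\text{for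 all }t\in[0,T].$$ Each $\phi\in\Theta$ defines $\mathbb Q^\phi\sim\mathbb P$ with density process $$\Lambda^\phi(t)=\exp\Big\{-\int_0^t\phi_1dW_1-\tfrac12\int_0^t\phi_1^2ds-\int_0^t\phi_2dW_2-\tfrac12\int_0^t\phi_2^2ds+\int_0^t\int_0^\infty\ln(1-\phi_3)\tilde N(ds,dz)+\int_0^t\int_0^\infty[\ln(1-\phi_3)+\phi_3]v(dz)ds\Big\}.$$ Under $\mathbb Q^\phi$, $dW_i^\phi=dW_i+\phi_idt$ ($i=1,2$) are Brownian motions, $\tilde N^\phi(dt,dz)=\tilde N(dt,dz)+\phi_3(t,z)v(dz)dt$ is the compensated Poisson measure, and the default intensity remains $h^{\mathbb P}$. **Objective.** With $\mathbb E^\phi_{t,x,h}$, $\mathrm{Var}^\phi_{t,x,h}$ denoting expectation and variance under $\mathbb Q^\phi$ given $X^\pi(t)=x$, $H(t)=h\in\{0,1\}$ ($h=0$ pre-default, $h=1$ post-default), and $$h_\beta(\phi(s))=\frac{\phi_1(s)^2}{2\beta_1}+\frac{\phi_2(s)^2}{2\beta_2}+\frac1{\beta_3}\int_0^\infty[(1-\phi_3(s,z))\ln(1-\phi_3(s,z))+\phi_3(s,z)]v(dz),$$ set $$\underline J^{\pi,\phi}(t,x,h)=\mathbb E^\phi_{t,x,h}[X^\pi(T)]-\tfrac\gamma2\mathrm{Var}^\phi_{t,x,h}[X^\pi(T)]+\int_t^Th_\beta(\phi(s))ds,$$ $$\overline J^{\pi,\phi}(t,x,h)=\mathbb E^\phi_{t,x,h}[X^\pi(T)]-\tfrac\gamma2\mathrm{Var}^\phi_{t,x,h}[X^\pi(T)]-\int_t^Th_\beta(\phi(s))ds,$$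 $$J_\alpha^\pi(t,x,h)=\alpha\inf_{\phi\in\Theta}\underline J^{\pi,\phi}(t,x,h)+\hat\alpha\sup_{\phi\in\Theta}\overline J^{\pi,\phi}(t,x,h),$$ with $\underline\phi^\pi$, $\overline\phi^\pi$ the elements of $\Theta$ attaining the infimum and the supremum. **Admissibility.** $\pi\in\Pi(t,x,h)$ if: $(\pi_s,\pi_p,\pi_q)$ is $\mathbb G$-predictable; $\pi_q\ge0$; $\mathbb E^{\phi}_{t,x,h}[\int_t^T(\pi_s(u)^2+\pi_p(u)^2+\pi_q(u)^2)du]<\infty$ for $\phi=\underline\phi^\pi$ and $\phi=\overline\phi^\pi$; and $X^\pi$ is the unique strong solution of the wealth equation. **Equilibrium.** An admissible (feedback) strategy $\pi^*$ is an equilibrium strategy if for all $(t,x,h)\in[0,T]\times\mathbb R\times\{0,1\}$ and all constants $(\tilde\pi_s,\tilde\pi_p,\tilde\pi_q)\in\mathbb R\times\mathbb R\times\mathbb R_+$, $$\liminf_{\epsilon\to0}\frac{J_\alpha^{\pi^*}(t,x,h)-J_\alpha^{\pi^\epsilon}(t,x,h)}{\epsilon}\ge0,$$ where $\epsilon>0$ and $\pi^\epsilon$ equals $(\tilde\pi_s,\tilde\pi_p,\tilde\pi_q)$ on $[t,t+\epsilon)$ and $\pi^*$ on $[t+\epsilon,T]$. Then $J_\alpha^{\pi^*}$ is the equilibrium value function. ''Optimal'' and ''solution of $\sup_\pi J^\pi_\alpha$'' are understood in this equilibrium (time-consistent) sense. **Standing integrability assumption** (distortions $\phi_3(t,z)$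 allowed to depend on $z$): $\int_0^1z\,v(dz)<\infty$ and $\int_1^\infty e^{cz^2}v(dz)<\infty$ for some $c>0$. *)

(* Defs.v *)
From HB Require Import structures.
From mathcomp Require Import all_boot all_order all_algebra.
From mathcomp Require Import all_classical all_reals all_analysis.
From mathcomp Require Import measurable_realfun.

Set Implicit Arguments.
Unset Strict Implicit.
Unset Printing Implicit Defensive.

Import Order.TTheory GRing.Theory Num.Theory.
Import numFieldNormedType.Exports.

Local Open Scope classical_set_scope.
Local Open Scope ring_scope.

Record params (R : realType) := Params {
  rate : R;
  mu : R;
  sigma1 : R;
  sigma2 : R;
  rho : R;
  theta : R;
  eta : R;
  zeta : R;
  hP : R;                    (* default intensity under P *)
  hQ : R;                    (* risk-neutral default intensity *)
  gamma : R;
  beta1 : R;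
  beta2 : R;
  beta3 : R;
  alpha : R;
  horizon : R;               (* T *)
  maturity : R }.            (* maturity of the bond; only T < T_1 matters *)

Section params.
Variables (R : realType) (p : params R).

Definition params_ok : Prop :=
  [/\ 0 < rate p, 0 < sigma2 p, -1 <= rho p <= 1, 0 < theta p < eta p &
      0 <= zeta p <= 1] /\
  [/\ 0 < hP p <= hQ p, 0 < gamma p,
      [/\ 0 < beta1 p, 0 < beta2 p & 0 < beta3 p],
      2^-1 <= alpha p <= 1 & 0 < horizon p < maturity p].

Definition rhohat : R := Num.sqrt (1 - rho p ^+ 2).
Definition alphahat : R := 1 - alpha p.
Definition Delta : R := hP p / hQ p.
Definition delta : R := hQ p * zeta p.
Definition accr (t : R) : R := expR (rate p * (horizon p - t)).

End params.

(* A deterministic distortion (phi_1(t), phi_2(t), phi_3(t,z)); only its values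
   at 0 <= t <= T and z > 0 are ever used. *)
Record distortion (R : realType) := Distortion {
  phi1 : R -> R; phi2 : R -> R; phi3 : R -> R -> R }.

Record position (R : realType) := Position {
  stock : R; bond : R; risk : R }.

(* Arguments: time, wealth, default state (true = defaulted). *)
Definition feedback (R : realType) := R -> R -> bool -> position R.

Record market (R : realType) (d : measure_display) (Omega : measurableType d) :=
  Market {
    par : params R;
    levy : {sigma_finite_measure set R -> \bar R};
    Pr : probability Omega R;
    W1 : R -> Omega -> R;
    W2 : R -> Omega -> R;
    jumps : Omega -> {measure set (R * R)%type -> \bar R};
    tau : {mfun Omega >-> R};
    prior : distortion R -> probability Omega R }.

Section market.
Variables (R : realType) (d : measure_display) (Omega : measurableType d).
Variable M : market R Omega.
Notation p := (par M).
Notation v := (levy M).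
Notation P := (Pr M).
Notation T := (horizon (par M)).
Notation leb := (@lebesgue_measure R).
Notation ell := (leb \x v)%E.

Definition levy_ok : Prop :=
  [/\ v `]-oo, 0]%classic = 0%E,
      (\int[v]_(z in `]0%R, +oo[) z%:E < +oo)%E,
      (\int[v]_(z in `]0%R, 1%R[) z%:E < +oo)%E &
      exists2 c : R, 0 < c &
        (\int[v]_(z in `[1%R, +oo[) (expR (c * z ^+ 2))%:E < +oo)%E].

Definition mean_claim : R := \int[v]_(z in `]0, +oo[) z.

Definition defaulted (t : R) (w : Omega) : bool := tau M w <= t.
Definition Hproc (t : R) (w : Omega) : R := (defaulted t w)%:R.
Definition Hleft (t : R) (w : Omega) : R := ((tau M w < t)%R : bool)%:R.

Definition noise_events (t : R) : set (set Omega) :=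
  (\bigcup_(s in `[0, t]) preimage_set_system setT (W1 M s) measurable) `|`
  (\bigcup_(s in `[0, t]) preimage_set_system setT (W2 M s) measurable) `|`
  (\bigcup_(A in [set A : set (R * R) |
       measurable A /\ A `<=` `[0, t] `*` `]0, +oo[])
     preimage_set_system setT (fun w => jumps M w A) (@measurable _ (\bar R))).

Definition filtF (t : R) : set (set Omega) :=
  \bigcap_(u in `]t, +oo[) <<s noise_events u `|` P.-negligible >>.

Definition filtH (t : R) : set (set Omega) :=
  <<s \bigcup_(s in `[0, t]) preimage_set_system setT (Hproc s) measurable >>.

Definition filtG (t : R) : set (set Omega) := <<s filtF t `|` filtH t >>.

Definition Gmeasurable (t : R) (Y : Omega -> R) : Prop :=
  forall B : set R, measurable B -> filtG t (Y @^-1` B).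

Definition predictable_sets (t : R) : set (set (R * Omega)) :=
  <<s `]t, T] `*` setT,
      [set S | exists (a b : R) (E : set Omega),
         [/\ t <= a, a <= b, b <= T, filtG a E & S = `]a, b] `*` E]]>>.

Definition predictable (t : R) (f : R -> Omega -> R) : Prop :=
  forall B : set R, measurable B ->
    predictable_sets t ((`]t, T] `*` setT) `&` [set q | B (f q.1 q.2)]).

Definition martingale (Q : probability Omega R) (Y : R -> Omega -> R) : Prop :=
  [/\ forall t, 0 <= t -> Gmeasurable t (Y t),
      forall t, 0 <= t -> Q.-integrable setT (EFin \o Y t) &
      forall s t (E : set Omega), 0 <= s -> s <= t -> filtG s E ->
        \int[Q]_(w in E) (Y t w) = \int[Q]_(w in E) (Y s w)].

Definition defaultM (t : R) (w : Omega) : R :=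
  Hproc t w - \int[leb]_(u in `[0, t]) ((1 - Hleft u w) * hP p).

Definition brownian (Q : probability Omega R) (B : R -> Omega -> R) : Prop :=
  [/\ forall t, 0 <= t -> measurable_fun setT (B t),
      {ae Q, forall w, B 0 w = 0},
      {ae Q, forall w, {within `[0, +oo[, continuous (B ^~ w)}} &
      forall s t (C : set R), 0 <= s -> s < t -> measurable C ->
        Q [set w | C (B t w - B s w)] = normal_prob 0 (Num.sqrt (t - s)) C].

Definition poisson_random_measure (Q : probability Omega R)
    (nu : set (R * R) -> \bar R) : Prop :=
  let dom : set (R * R) := `[0, +oo[ `*` `]0, +oo[ in
  [/\ forall A, measurable A -> A `<=` dom ->
        measurable_fun setT (fun w => jumps M w A),
      forall A (k : nat), measurable A -> A `<=` dom -> (nu A < +oo)%E ->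
        Q [set w | jumps M w A = k%:R%:E] = poisson_prob (fine (nu A)) 0 [set k] &
      forall (m : nat) (A : 'I_m -> set (R * R)) (B : 'I_m -> set (\bar R)),
        (forall i, measurable (A i) /\ A i `<=` dom) -> trivIset setT A ->
        (forall i, measurable (B i)) ->
        Q (\bigcap_(i in [set: 'I_m]) [set w | B i (jumps M w (A i))]) =
        (\prod_(i < m) Q [set w | B i (jumps M w (A i))])%E].

Definition increments (s : R) (B : R -> Omega -> R) : set (set Omega) :=
  <<s \bigcup_(u in `[s, +oo[)
        preimage_set_system setT (fun w => B u w - B s w) measurable >>.

Definition jumps_after (s : R) : set (set Omega) :=
  <<s \bigcup_(A in [set A : set (R * R) |
        measurable A /\ A `<=` `]s, +oo[ `*` `]0, +oo[])
        preimage_set_system setT (fun w => jumps M w A) measurable >>.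

(* For every s, the noise after s splits into three parts that are mutually
   independent and independent of G_s. *)
Definition independent_noise (Q : probability Omega R) : Prop :=
  forall s (E A1 A2 A3 : set Omega), 0 <= s -> filtG s E ->
    increments s (W1 M) A1 -> increments s (W2 M) A2 -> jumps_after s A3 ->
    Q (E `&` A1 `&` A2 `&` A3) = (Q E * Q A1 * Q A2 * Q A3)%E.

Definition shifted (W : R -> Omega -> R) (f : R -> R) (t : R) (w : Omega) : R :=
  W t w + \int[leb]_(s in `[0, Order.min t T]) (f s).

(* The compensator (1 - phi_3(s,z)) v(dz) ds of N under Q^phi; phi_3 is read as
   0 after T. *)
Definition tilted (phi : distortion R) (A : set (R * R)) : \bar R :=
  (\int[ell]_(q in A) (1 - \1_(`[0, T]) q.1 * phi3 phi q.1 q.2)%:E)%E.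

Definition noise_under (Q : probability Omega R) (phi : distortion R) : Prop :=
  [/\ brownian Q (shifted (W1 M) (phi1 phi)),
      brownian Q (shifted (W2 M) (phi2 phi)),
      poisson_random_measure Q (tilted phi),
      independent_noise Q &
      martingale Q defaultM].

Definition no_distortion : distortion R :=
  Distortion (fun=> 0) (fun=> 0) (fun _ _ => 0).

Definition to0_in_prob (Y : nat -> Omega -> \bar R) : Prop :=
  forall e : R, 0 < e -> P [set w | (e%:E <= Y n w)%E] @[n --> \oo] --> 0%E.

(* sum_i value_i 1_{]left_i, right_i]} *)
Record simple := Simple {
  slen : nat;
  sleft : 'I_slen -> R;
  sright : 'I_slen -> R;
  svalue : 'I_slen -> Omega -> R }.

Definition simple_ok (t : R) (S : simple) : Prop :=
  forall i : 'I_(slen S),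
    [/\ t <= sleft i, sleft i <= sright i, sright i <= T,
        Gmeasurable (sleft i) (svalue i) &
        exists K : R, forall w, `|svalue i w| <= K].

Definition simple_value (S : simple) (s : R) (w : Omega) : R :=
  \sum_(i < slen S) svalue i w * \1_(`]sleft i, sright i]) s.

Definition simple_integral (W : R -> Omega -> R) (S : simple) (u : R)
    (w : Omega) : R :=
  \sum_(i < slen S)
    svalue i w * (W (Order.min (sright i) u) w - W (Order.min (sleft i) u) w).

(* I(u) = int_t^u f dW on [t,T]: the continuous adapted process that is the
   limit in probability of elementary integrals of simple predictable
   processes S_n with int_t^T (S_n - f)^2 ds -> 0 in probability. *)
Definition ito (W : R -> Omega -> R) (t : R) (f I : R -> Omega -> R) : Prop :=
  [/\ predictable t f,
      forall u, t <= u <= T -> Gmeasurable u (I u),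
      {ae P, forall w, {within `[t, T], continuous (I ^~ w)}} &
      exists S : nat -> simple,
        [/\ forall n, simple_ok t (S n),
            to0_in_prob (fun n w =>
              \int[leb]_(s in `[t, T])
                ((simple_value (S n) s w - f s w) ^+ 2)%:E)%E &
            forall u, t <= u <= T ->
              to0_in_prob (fun n w =>
                (`|simple_integral W (S n) u w - I u w|)%:E)]].

Definition entropy (y : R) : R := (1 - y) * ln (1 - y) + y.

Definition Theta : set (distortion R) := [set phi |
  [/\ measurable_fun `[0, T] (phi1 phi),
      measurable_fun `[0, T] (phi2 phi),
      measurable_fun (`[0, T] `*` `]0, +oo[ : set (R * R)) (fun q => phi3 phi q.1 q.2),
      forall t z, 0 <= t <= T -> 0 < z -> phi3 phi t z < 1 &
      forall t, 0 <= t <= T ->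
        (expeR (\int[leb]_(s in `[t, T])
                  ((phi1 phi s ^+ 2 + phi2 phi s ^+ 2) / 2)%:E
                + \int[leb]_(s in `[t, T]) \int[v]_(z in `]0%R, +oo[)
                    (entropy (phi3 phi s z))%:E) < +oo)%E]].

(* int ln(1-phi_3) dN~ + int [ln(1-phi_3) + phi_3] dv ds restricted to jumps
   larger than 1/(n+1).  The terms int ln(1-phi_3) dv ds cancel, and are dropped:
   on Theta they can diverge separately even on this restricted domain. *)
Definition truncated_exponent (phi : distortion R) (t : R) (n : nat)
    (w : Omega) : R :=
  let D : set (R * R) := `[0, t] `*` `]n.+1%:R^-1, +oo[ in
  \int[jumps M w]_(q in D) ln (1 - phi3 phi q.1 q.2) +
  \int[ell]_(q in D) phi3 phi q.1 q.2.

Definition density_process (phi : distortion R) (L : R -> Omega -> R) : Prop :=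
  exists I1 I2 K : R -> Omega -> R,
    [/\ ito (W1 M) 0 (fun s _ => phi1 phi s) I1,
        ito (W2 M) 0 (fun s _ => phi2 phi s) I2,
        forall t, 0 <= t <= T -> Gmeasurable t (K t) /\
          to0_in_prob (fun n w =>
            (`|truncated_exponent phi t n w - K t w|)%:E) &
        forall t w, 0 <= t <= T ->
          L t w = expR (
            - I1 t w - 2^-1 * \int[leb]_(s in `[0, t]) (phi1 phi s ^+ 2)
            - I2 t w - 2^-1 * \int[leb]_(s in `[0, t]) (phi2 phi s ^+ 2)
            + K t w)].

Definition has_density (Q : probability Omega R) (phi : distortion R) : Prop :=
  exists2 L, density_process phi L &
    forall A, measurable A -> Q A = (\int[P]_(w in A) (L T w)%:E)%E.

(* The second part is the change of measure: each Q^phi has the density process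
   Lambda^phi, the shifted noises are Brownian motions and compensated Poisson
   measure under Q^phi, and the default intensity is unchanged. *)
Definition market_ok : Prop :=
  [/\ params_ok p, levy_ok, measure_is_complete P,
      forall w, 0 <= tau M w & noise_under P no_distortion] /\
  (forall phi, Theta phi ->
     has_density (prior M phi) phi /\ noise_under (prior M phi) phi).

(* The default indicator on [t,T] given H(t) = h; it agrees with H on the event
   {H(t) = h}. *)
Definition Hfrom (h : bool) (s : R) (w : Omega) : R := (h || defaulted s w)%:R.
Definition Dleft (h : bool) (s : R) (w : Omega) : bool := h || (tau M w < s).

Definition control (pi : feedback R) (h : bool) (X : R -> Omega -> R)
    (s : R) (w : Omega) : position R :=
  pi s (lim (X u w @[u --> s^'-])) (Dleft h s w).

(* Jumps are summable (int z v(dz) < oo), so the integral against N~ is the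
   pathwise integral against N minus its compensator; H has a single jump, at
   tau, so int_t^u pi_p dH = pi_p(tau) (H(u) - H(t)). *)
Definition wealth_solution (pi : feedback R) (t x : R) (h : bool)
    (X : R -> Omega -> R) : Prop :=
  let c := control pi h X in
  let drift s w := rate p * X s w + (mu p - rate p) * stock (c s w)
    + (theta p - eta p + eta p * risk (c s w)) * mean_claim
    + bond (c s w) * (1 - Hfrom h s w) * (1 - Delta p) * delta p in
  let comp s w := bond (c s w) * (1 - (Dleft h s w)%:R) * hP p in
  (forall u, t <= u <= T -> Gmeasurable u (X u)) /\
  exists I1 I2 : R -> Omega -> R,
    [/\ ito (W1 M) t
          (fun s w => sigma1 p + stock (c s w) * sigma2 p * rho p) I1,
        ito (W2 M) t (fun s w => stock (c s w) * sigma2 p * rhohat p) I2 &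
        {ae P, forall w,
          [/\ leb.-integrable `[t, T] (EFin \o drift ^~ w),
              leb.-integrable `[t, T] (EFin \o (fun s => risk (c s w))),
              leb.-integrable `[t, T] (EFin \o comp ^~ w),
              (jumps M w).-integrable (`]t, T] `*` `]0, +oo[)
                (fun q => (risk (c q.1 w) * q.2)%:E) &
              forall u, t <= u <= T ->
                X u w = x + \int[leb]_(s in `[t, u]) drift s w
                  + I1 u w + I2 u w
                  - (\int[jumps M w]_(q in `]t, u] `*` `]0, +oo[)
                       (risk (c q.1 w) * q.2)
                     - \int[leb]_(s in `[t, u]) (risk (c s w) * mean_claim))
                  - zeta p *
                    (bond (c (tau M w) w) * (Hfrom h u w - Hfrom h t w)
                     - \int[leb]_(s in `[t, u]) comp s w)]}].

Definition unique_strong_solution (pi : feedback R) (t x : R) (h : bool) : Prop :=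
  (exists X, wealth_solution pi t x h X) /\
  (forall X Y, wealth_solution pi t x h X -> wealth_solution pi t x h Y ->
     {ae P, forall w, forall u, t <= u <= T -> X u w = Y u w}).

Definition wealth (pi : feedback R) (t x : R) (h : bool) : R -> Omega -> R :=
  xget (fun _ _ => 0) [set X | wealth_solution pi t x h X].

Definition state_event (t : R) (h : bool) : set Omega :=
  [set w | defaulted t w = h].

Lemma measurable_state_event t h : measurable (state_event t h).
Proof.
have mt : measurable ((tau M) @^-1` `]-oo, t]).
  by rewrite -[X in measurable X]setTI; exact: measurable_funP.
rewrite /state_event; case: h.
  suff -> : [set w | defaulted t w = true] = (tau M) @^-1` `]-oo, t] by [].
  by apply/seteqP; split => w /=; rewrite in_itv.
suff -> : [set w | defaulted t w = false] = ~` ((tau M) @^-1` `]-oo, t]).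
  exact: measurableC.
by apply/seteqP; split => w /=; rewrite in_itv /= /defaulted;
  [move=> -> | move/negP/negbTE].
Qed.

(* Q^phi conditioned on H(t) = h.  If that event is null (e.g. t = 0, h = 1),
   mnormalize returns Q^phi itself, i.e. the state is restarted from h. *)
Definition priorC (phi : distortion R) (t : R) (h : bool) : probability Omega R :=
  mnormalize (mrestr (prior M phi) (measurable_state_event t h)) (prior M phi).

Definition penalty (phi : distortion R) (s : R) : \bar R :=
  ((phi1 phi s ^+ 2 / (2 * beta1 p) + phi2 phi s ^+ 2 / (2 * beta2 p))%:E
   + (beta3 p)^-1%:E *
     \int[v]_(z in `]0%R, +oo[) (entropy (phi3 phi s z))%:E)%E.

Definition mean_variance (pi : feedback R) (phi : distortion R) (t x : R)
    (h : bool) : \bar R :=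
  ('E_(priorC phi t h)[wealth pi t x h T]
   - (gamma p / 2)%:E * 'V_(priorC phi t h)[wealth pi t x h T])%E.

Definition Jlow pi phi t x h : \bar R :=
  (mean_variance pi phi t x h + \int[leb]_(s in `[t, T]) penalty phi s)%E.

Definition Jup pi phi t x h : \bar R :=
  (mean_variance pi phi t x h - \int[leb]_(s in `[t, T]) penalty phi s)%E.

Definition J (pi : feedback R) (t x : R) (h : bool) : \bar R :=
  ((alpha p)%:E * ereal_inf [set Jlow pi phi t x h | phi in Theta]
   + (alphahat p)%:E * ereal_sup [set Jup pi phi t x h | phi in Theta])%E.

Definition attains_inf pi t x h (phi : distortion R) : Prop :=
  Theta phi /\
  Jlow pi phi t x h = ereal_inf [set Jlow pi psi t x h | psi in Theta].

Definition attains_sup pi t x h (phi : distortion R) : Prop :=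
  Theta phi /\
  Jup pi phi t x h = ereal_sup [set Jup pi psi t x h | psi in Theta].

Definition square_integrable pi t x h (phi : distortion R) : Prop :=
  let c := control pi h (wealth pi t x h) in
  (\int[priorC phi t h]_w \int[leb]_(u in `[t, T])
     (stock (c u w) ^+ 2 + bond (c u w) ^+ 2 + risk (c u w) ^+ 2)%:E < +oo)%E.

Definition admissible (pi : feedback R) (t x : R) (h : bool) : Prop :=
  let c := control pi h (wealth pi t x h) in
  [/\ unique_strong_solution pi t x h,
      [/\ predictable t (fun s w => stock (c s w)),
          predictable t (fun s w => bond (c s w)) &
          predictable t (fun s w => risk (c s w))],
      forall s w, t < s <= T ->
        0 <= risk (c s w) /\ (Dleft h s w -> bond (c s w) = 0),
      exists2 phi, attains_inf pi t x h phi & square_integrable pi t x h phi &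
      exists2 phi, attains_sup pi t x h phi & square_integrable pi t x h phi].

Definition perturb (pi : feedback R) (t e : R) (c : position R) : feedback R :=
  fun s x h => if t <= s < t + e then c else pi s x h.

Definition equilibrium (h : bool) (pi : feedback R) : Prop :=
  forall t x, 0 <= t <= T ->
    admissible pi t x h /\
    forall c : position R, 0 <= risk c ->
      (0 <= limf_einf (fun e : R =>
         (J pi t x h - J (perturb pi t e c) t x h) * (e^-1)%:E) 0^'+)%E.

Definition load (q : R -> R) (t z : R) : R :=
  q t * z * accr p t + gamma p / 2 * q t ^+ 2 * z ^+ 2 * accr p t ^+ 2.

Definition foc (q : R -> R) (t z : R) : R :=
  (1 + eta p) * z * accr p t
  - alpha p * (z * accr p t + gamma p * q t * z ^+ 2 * accr p t ^+ 2)
      * expR (beta3 p * load q t z)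
  - alphahat p * (z * accr p t + gamma p * q t * z ^+ 2 * accr p t ^+ 2)
      * expR (- (beta3 p * load q t z)).

Definition solves_foc (q : R -> R) : Prop :=
  forall t, 0 <= t <= T ->
    [/\ 0 <= q t,
        v.-integrable `]0, +oo[ (EFin \o foc q t) &
        \int[v]_(z in `]0, +oo[) foc q t z = 0].

Definition quad : R :=
  gamma p + (2 * alpha p - 1) * (beta1 p * rho p ^+ 2 + beta2 p * rhohat p ^+ 2).

Definition pi_s (t : R) : R :=
  ((mu p - rate p) * expR (- (rate p * (T - t)))
   - sigma1 p * sigma2 p * rho p * gamma p
   - (2 * alpha p - 1) * beta1 p * sigma1 p * sigma2 p * rho p)
  / (sigma2 p ^+ 2 * quad).

Definition B1 (q : R -> R) (t : R) : R :=
  \int[leb]_(s in `[t, T])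
    ((theta p - eta p + (1 + eta p) * q s) * accr p s * mean_claim
     - 2^-1 * gamma p * sigma1 p ^+ 2 * accr p s ^+ 2
     - (2 * alpha p - 1) / 2 * beta1 p * sigma1 p ^+ 2 * accr p s ^+ 2
     + (mu p - rate p - sigma1 p * sigma2 p * rho p * gamma p * accr p s
        - (2 * alpha p - 1) * beta1 p * sigma1 p * sigma2 p * rho p * accr p s)
         ^+ 2 / (2 * sigma2 p ^+ 2 * quad)
     + alpha p / beta3 p *
         \int[v]_(z in `]0, +oo[) (1 - expR (beta3 p * load q s z))
     - alphahat p / beta3 p *
         \int[v]_(z in `]0, +oo[) (1 - expR (- (beta3 p * load q s z)))).

(* sgn = 1: extremely ambiguity-averse; sgn = -1: extremely ambiguity-seeking *)
Definition extreme (sgn : R) (q : R -> R) : distortion R :=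
  Distortion
    (fun t => sgn * beta1 p * (sigma1 p + sigma2 p * rho p * pi_s t) * accr p t)
    (fun t => sgn * beta2 p * sigma2 p * rhohat p * pi_s t * accr p t)
    (fun t z => 1 - expR (sgn * beta3 p * load q t z)).

End market.

(* Main.v *)
(* After default the terminal wealth of a feedback strategy with deterministic positions is
   explicit: variation of constants in the linear wealth equation writes [X T] as a constant plus
   Wiener integrals of deterministic integrands and a Poisson integral, and uniqueness of Ito
   integrals together with that of a linear ODE makes every solution agree with it.  Under the
   measure of a distortion [phi] the terms are independent, so the Ito isometry and Campbell's
   formulas give the mean-variance criterion as an integral over time and claims of a function
   of [phi]; the infimum and the supremum over [phi] are then pointwise, by completing squares
   and by the convex duality between [y ln y] and [exp].
   The resulting integrand, as a function of the positions, is maximal at the equilibrium ones: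
   it is a concave quadratic in the stock, and the first order condition cancels the terms of
   first order in the retention.  Hence no perturbation on [t, t + e) improves on the equilibrium,
   for any [e].  The optimal tilt of a perturbed retention may fail to be integrable, so the
   perturbed value is only bounded above, by evaluating it at a capped tilt. *)
Require Import Defs.
From HB Require Import structures.
From mathcomp Require Import all_boot all_order all_algebra.
From mathcomp Require Import finmap.
From mathcomp Require Import all_classical all_reals all_analysis.
From mathcomp Require Import measurable_realfun.
From mathcomp Require Import ring lra.
Import Order.TTheory GRing.Theory Num.Theory.
Import numFieldNormedType.Exports.
Local Open Scope classical_set_scope.
Local Open Scope ring_scope.
Set Implicit Arguments.
Unset Strict Implicit.
Unset Printing Implicit Defensive.

(** The first order condition does two jobs. Besides cancelling the terms of first order, it says
    that [marginal], which contains the optimal jump tilt [expR (beta3 * load)], has a finite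
    integral against the Lévy measure. This bounds the retention and puts the extreme distortions in
    [Theta], although the exponential moment assumed of the Lévy measure need not cover the
    exponents involved. Conversely, Young's inequality between the entropy and [expR] turns
    membership in [Theta] into moments of the claims under the tilted measure.

    The integrands of the Wiener integrals are smooth up to one jump, so these integrals are defined
    path by path through integration by parts. This gives a continuous adapted version at once; what
    remains is the L2 theory of elementary integrals, and one estimate in probability that yields
    uniqueness for integrals defined by limits in probability.

    The cap on the near optimal tilt is the equilibrium exponent plus 1; the constant 1 works
    because [2 + 1 / e <= e]. The condition [alpha >= 1/2] enters as convexity of [alpha * expR x -
    (1 - alpha) * expR (- x)] on the half line. *)

Notation L1 mu D f := (mu.-integrable D (EFin \o f)) (only parsing).
Notation Tmeasurable f := (measurable_fun setT f) (only parsing).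

Lemma eqW (disp : Order.disp_t) (T : porderType disp) (x y : T) : x = y -> (x <= y)%O.
Proof. by move=> ->. Qed.

(** * Moments of the centred normal law *)

Section normal_moments.
Context {R : realType}.
Variable s : R.
Hypothesis s0 : 0 < s.
Let mu := @lebesgue_measure R.
Let g (x : R) := normal_pdf 0 s x.

Let gE x : g x = normal_peak s * expR (- (x ^+ 2) / (s ^+ 2 *+ 2)).
Proof. by rewrite /g normal_pdfE ?gt_eqF// /normal_fun subr0. Qed.

Let g0 x : 0 <= g x. Proof. exact: normal_pdf_ge0. Qed.

Let cg : continuous g.
Proof. by apply: continuous_normal_pdf; rewrite gt_eqF. Qed.

Let dg (x : R) : is_derive x 1 g (- x / s ^+ 2 * g x).
Proof.
rewrite /g.
have -> : normal_pdf 0 s = (fun x => normal_peak s * expR (- (x ^+ 2) / (s ^+ 2 *+ 2))).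
  by apply/funext => y; exact: gE.
apply: is_derive_eq.
rewrite /GRing.scale/= /normal_fun.
by field; rewrite gt_eqF.
Qed.

(** With [y = x ^+ 2 / (s ^+ 2 *+ 2)], the bound [y <= expR y] gives
    [x * expR (- y) <= (s ^+ 2 *+ 2) / x], hence the constant [c]. *)
Let cvg_xg : x * g x @[x --> +oo] --> (0 : R).
Proof.
pose c := normal_peak s * (s ^+ 2 *+ 2).
have c0 : 0 <= c by rewrite mulr_ge0 ?normal_peak_ge0 ?mulrn_wge0 ?sqr_ge0.
apply: (@squeeze_cvgr _ _ _ _ (fun=> 0) (fun x => c * x^-1)).
- near=> x.
  have x0 : 0 < x by near: x; apply: nbhs_pinfty_gt.
  rewrite mulr_ge0 ?g0 ?(ltW x0)//=.
  rewrite gE /c -mulrA mulrCA ler_wpM2l ?normal_peak_ge0//.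
  rewrite mulNr expRN ler_pdivlMr// mulrAC -expr2.
  rewrite ler_pdivrMr ?expR_gt0// -ler_pdivrMl; last by rewrite pmulrn_lgt0// exprn_gt0.
  rewrite mulrC; apply: le_trans (expR_ge1Dx _).
  by rewrite lerDr.
- exact: cvg_cst.
- rewrite -[X in _ --> X](mulr0 c); apply: cvgM; first exact: cvg_cst.
  by apply/gtr0_cvgV0 => //; near=> x; near: x; apply: nbhs_pinfty_gt.
Unshelve. all: by end_near. Qed.

Let cvg_g : g x @[x --> +oo] --> (0 : R).
Proof.
apply: (@squeeze_cvgr _ _ _ _ (fun=> 0) (fun x => x * g x)).
- near=> x.
  have x0 : 1 < x by near: x; apply: nbhs_pinfty_gt.
  by rewrite g0/= ler_peMl// ltW.
- exact: cvg_cst.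
- exact: cvg_xg.
Unshelve. all: by end_near. Qed.

Let cont_within (f : R -> R) (A : set R) : continuous f -> {within A, continuous f}.
Proof. by move=> cf; exact: continuous_subspaceT. Qed.

Let cxg : continuous (fun x : R => x * g x).
Proof. by move=> x; apply: cvgM; [exact: cvg_id|exact: cg]. Qed.

Let half_moment1 : (\int[mu]_(x in `[0%R, +oo[) (x * g x)%:E = (s ^+ 2 * g 0)%:E)%E.
Proof.
have dF (x : R) : is_derive x 1 (fun x => - (s ^+ 2) * g x) (x * g x).
  have := dg x => ?; apply: is_derive_eq.
  by rewrite /GRing.scale/=; field; rewrite gt_eqF.
rewrite (@ge0_continuous_FTC2y _ _ (fun x => - (s ^+ 2) * g x) 0 0).
- by rewrite -EFinB mulNr opprK add0r.
- by move=> x x0; rewrite mulr_ge0.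
- exact: cont_within.
- rewrite -(mulr0 (- s ^+ 2)); apply: cvgM; [exact: cvg_cst|exact: cvg_g].
- by move=> x _; have [] := dF x.
- apply: cvg_at_right_filter; apply: cvgM; [exact: cvg_cst|exact: cg].
- by move=> x _; rewrite derive1E; have [_ ->] := dF x.
Qed.

Lemma normal_moment1 : (\int[mu]_x (x * normal_pdf 0 s x)%:E = 0)%E.
Proof.
have mxg : Tmeasurable (EFin \o (fun x : R => x * normal_pdf 0 s x)).
  by apply/measurable_EFinP; apply: continuous_measurable_fun; exact: cxg.
(* The endpoint is written [- 0] to match the substitution [x -> - x], which turns an integral over
   []-oo, - 0]] into one over [[0, +oo[]. *)
have T : [set: R] = `]-oo, (- 0)%R[%classic `|` `[0%R, +oo[%classic.
  apply/seteqP; split => x //= _; rewrite !in_itv/= oppr0 andbT.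
  by have [h|h] := ltP x 0; [left|right].
have D : [disjoint (`]-oo, (- 0)%R[%classic : set R) & (`[0%R, +oo[%classic : set R)].
  apply/disj_setPS => x/= []; rewrite !in_itv/= oppr0 andbT => h1 h2.
  by have := lt_le_trans h1 h2; rewrite ltxx.
rewrite T.
rewrite (@integral_setU_EFin _ _ _ mu _ _ (fun x : R => x * normal_pdf 0 s x))//=; first last.
  by rewrite -T; exact/measurable_EFinP.
rewrite [X in (_ + X)%E](_ : _ = (s ^+ 2 * g 0)%:E)//.
rewrite integral_itv_bndo_bndc; last exact: measurable_funTS.
have -> : (\int[mu]_(x in `]-oo, (- 0)%R]) (x * normal_pdf 0 s x)%:E)%E =
          (- \int[mu]_(x in `]-oo, (- 0)%R]) (- x * g x)%:E)%E.
  rewrite -integral_ge0N//; last first.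
    by move=> x/=; rewrite in_itv/= oppr0 => x0; rewrite lee_fin mulr_ge0// oppr_ge0.
  by apply: eq_integral => x _; rewrite mulNr EFinN oppeK.
rewrite (@ge0_integration_by_substitutionNy _ (fun x => - x * g x)).
- rewrite (_ : (\int[_]_(x in _) _)%E = (s ^+ 2 * g 0)%:E); first by rewrite -EFinN -EFinD addNr.
  rewrite -half_moment1; apply: eq_integral => x _/=.
  by rewrite opprK !gE sqrrN.
- apply: cont_within => x; apply: cvgM; last exact: cg.
  by apply: (@cvgN _ R^o); exact: cvg_id.
- by move=> x; rewrite in_itv/= oppr0 => x0; rewrite mulr_ge0// oppr_ge0 ltW.
Qed.

(** The derivative of [x * g x] is [(1 - (x / s) ^+ 2) * g x], so both sides differ by boundary
    terms only. The half line is cut at [s], where this derivative changes sign, because the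
    fundamental theorem on an unbounded interval is applied to a nonnegative integrand. Each piece
    contributes one [s * g s], and the two cancel. *)
Let half_moment2 : (\int[mu]_(x in `[0%R, +oo[) ((x / s) ^+ 2 * g x)%:E =
   \int[mu]_(x in `[0%R, +oo[) (g x)%:E)%E.
Proof.
have cm2 : continuous (fun x : R => (x / s) ^+ 2 * g x).
  move=> x; apply: cvgM; last exact: cg.
  apply: (@continuous_comp _ _ _ (fun x : R => x / s) (fun x : R => x ^+ 2)); last exact: exprn_continuous.
  by apply: cvgM; [exact: cvg_id|exact: cvg_cst].
have dF (x : R) : is_derive x 1 (fun x => - x * g x) (((x / s) ^+ 2 - 1) * g x).
  have := dg x => ?; apply: is_derive_eq.
  by rewrite /GRing.scale/=; field; rewrite gt_eqF.
have dG (x : R) : is_derive x 1 (fun x => x * g x) ((1 - (x / s) ^+ 2) * g x).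
  have := dg x => ?; apply: is_derive_eq.
  by rewrite /GRing.scale/=; field; rewrite gt_eqF.
have m2 : Tmeasurable (fun x : R => (x / s) ^+ 2 * g x) by exact: continuous_measurable_fun.
have mg : Tmeasurable g by exact: continuous_measurable_fun.
have S : (`[0%R, +oo[%classic : set R) = `[0, s] `|` `]s, +oo[.
  apply/seteqP; split => x /=; rewrite !in_itv/= !andbT.
    by move=> ->/=; have [h|h] := leP x s; [left|right].
  by move=> [/andP[]//|]; move/ltW; apply: le_trans; exact: ltW.
have D : [disjoint (`[0, s]%classic : set R) & (`]s, +oo[%classic : set R)].
  apply/disj_setPS => x/= []; rewrite !in_itv/= andbT => /andP[_ h1] h2.
  by have := lt_le_trans h2 h1; rewrite ltxx.
have split_ (f : R -> R) : Tmeasurable f -> (forall x, 0 <= f x) ->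
    (\int[mu]_(x in `[0%R, +oo[) (f x)%:E = \int[mu]_(x in `[0%R, s]) (f x)%:E +
    \int[mu]_(x in `[s, +oo[) (f x)%:E)%E.
  move=> mf f0; rewrite S ge0_integral_setU//=.
  - by congr (_ + _)%E; rewrite integral_itv_obnd_cbnd//; exact/measurable_EFinP/measurable_funTS.
  - exact/measurable_EFinP/measurable_funTS.
  - by move=> x _; rewrite lee_fin.
have p2 x : 0 <= (x / s) ^+ 2 * g x by rewrite mulr_ge0 ?sqr_ge0.
rewrite (split_ _ m2)// (split_ g)//.
have I1 : (\int[mu]_(x in `[0%R, s]) (g x)%:E =
  \int[mu]_(x in `[0%R, s]) ((x / s) ^+ 2 * g x)%:E + (s * g s)%:E)%E.
  transitivity (\int[mu]_(x in `[0%R, s]) ((x / s) ^+ 2 * g x)%:E +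
     \int[mu]_(x in `[0%R, s]) ((1 - (x / s) ^+ 2) * g x)%:E)%E.
    rewrite -ge0_integralD//=.
    - by apply: eq_integral => x _; rewrite -EFinD; congr EFin; ring.
    - by move=> x _; rewrite lee_fin.
    - exact/measurable_EFinP/measurable_funTS.
    - move=> x; rewrite in_itv/= => /andP[x0 xs]; rewrite lee_fin mulr_ge0// subr_ge0.
      by rewrite expr_le1// ?divr_ge0 ?(ltW s0)// ler_pdivrMr// mul1r.
    - apply/measurable_EFinP/measurable_funTS.
      rewrite (_ : (fun x => _) = (fun x => g x - (x / s) ^+ 2 * g x)).
        exact: measurable_funB.
      by apply/funext => x; ring.
  congr (_ + _)%E; rewrite (@continuous_FTC2 _ _ (fun x => x * g x))//.
  - by rewrite mul0r sube0.
  - apply: cont_within; rewrite (_ : (fun x => _) = (fun x => g x - (x / s) ^+ 2 * g x)).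
      by move=> x; apply: (@cvgB _ R^o); [exact: cg|exact: cm2].
    by apply/funext => x; ring.
  - split.
    + by move=> x _; have [] := dG x.
    + by apply: cvg_at_right_filter; exact: cxg.
    + by apply: cvg_at_left_filter; exact: cxg.
  - by move=> x _; rewrite derive1E; have [_ ->] := dG x.
have I2 : (\int[mu]_(x in `[s, +oo[) ((x / s) ^+ 2 * g x)%:E =
  \int[mu]_(x in `[s, +oo[) (g x)%:E + (s * g s)%:E)%E.
  transitivity (\int[mu]_(x in `[s, +oo[) (g x)%:E +
     \int[mu]_(x in `[s, +oo[) (((x / s) ^+ 2 - 1) * g x)%:E)%E.
    rewrite -ge0_integralD//=.
    - by apply: eq_integral => x _; rewrite -EFinD; congr EFin; ring.
    - by move=> x _; rewrite lee_fin.
    - exact/measurable_EFinP/measurable_funTS.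
    - move=> x; rewrite in_itv/= andbT => xs; rewrite lee_fin mulr_ge0// subr_ge0.
      by rewrite exprn_ege1// ler_pdivlMr// mul1r.
    - apply/measurable_EFinP/measurable_funTS.
      rewrite (_ : (fun x => _) = (fun x => (x / s) ^+ 2 * g x - g x)).
        exact: measurable_funB.
      by apply/funext => x; ring.
  congr (_ + _)%E; rewrite (@ge0_continuous_FTC2y _ _ (fun x => - x * g x) s 0).
  - by rewrite -EFinB mulNr opprK add0r.
  - move=> x xs; rewrite mulr_ge0// subr_ge0.
    by rewrite exprn_ege1// ler_pdivlMr// mul1r.
  - apply: cont_within; rewrite (_ : (fun x => _) = (fun x => (x / s) ^+ 2 * g x - g x)).
      by move=> x; apply: (@cvgB _ R^o); [exact: cm2|exact: cg].
    by apply/funext => x; ring.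
  - rewrite -oppr0; under eq_fun do rewrite mulNr; apply: (@cvgN _ R^o); exact: cvg_xg.
  - by move=> x _; have [] := dF x.
  - apply: cvg_at_right_filter; under eq_fun do rewrite mulNr.
    by rewrite mulNr; apply: (@cvgN _ R^o); exact: cxg.
  - by move=> x _; rewrite derive1E; have [_ ->] := dF x.
by rewrite I1 I2 addeAC addeA.
Qed.

Lemma normal_moment2 : (\int[mu]_x (x ^+ 2 * normal_pdf 0 s x)%:E = (s ^+ 2)%:E)%E.
Proof.
have half : [set x : R | 0 <= x] = `[0, +oo[%classic.
  by apply/seteqP; split => x/=; rewrite in_itv/= andbT.
have cm2 : continuous (fun x : R => (x / s) ^+ 2 * g x).
  move=> x; apply: cvgM; last exact: cg.
  apply: (@continuous_comp _ _ _ (fun x : R => x / s) (fun x : R => x ^+ 2)); last exact: exprn_continuous.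
  by apply: cvgM; [exact: cvg_id|exact: cvg_cst].
transitivity ((s ^+ 2)%:E * \int[mu]_x ((x / s) ^+ 2 * g x)%:E)%E.
  rewrite -ge0_integralZl//.
  - by apply: eq_integral => x _; rewrite -EFinM /g; congr EFin; field; rewrite gt_eqF.
  - by apply/measurable_EFinP; exact: continuous_measurable_fun.
  - by move=> x _; rewrite lee_fin mulr_ge0 ?sqr_ge0.
  - by rewrite lee_fin sqr_ge0.
rewrite ge0_symfun_integralT//.
- rewrite half half_moment2 -half -(ge0_symfun_integralT (f := g))//.
  + by rewrite /g integral_normal_pdf mule1.
  + by move=> x/=; rewrite !gE sqrrN.
- by move=> x; rewrite mulr_ge0 ?sqr_ge0.
- by move=> x/=; rewrite !gE !exprMn sqrrN.
Qed.

End normal_moments.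

(** * Integration tools: induction on measurable functions, densities, L2 limits, independence *)

Section nonneg_induction.
Context d (T : measurableType d) (R : realType).
Import HBNNSimple.

(** A simple function is a finite sum of scaled indicators, and a nonnegative measurable function is
    an increasing limit of simple ones. This induction later carries the change of density, the
    measurability of random integrals and Campbell's formulas. *)
Lemma nonneg_measurable_ind (P : (T -> \bar R) -> Prop) :
  (forall A, measurable A -> P (fun x => (\1_A x)%:E)) ->
  (forall (k : R) f, 0 <= k -> (forall x, 0 <= f x)%E -> Tmeasurable f ->
     P f -> P (fun x => k%:E * f x)%E) ->
  (forall f g, (forall x, 0 <= f x)%E -> (forall x, 0 <= g x)%E ->
     Tmeasurable f -> Tmeasurable g -> P f -> P g ->
     P (fun x => f x + g x)%E) ->
  (forall f_ : nat -> T -> \bar R, (forall n x, 0 <= f_ n x)%E ->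
     (forall n, Tmeasurable (f_ n)) ->
     (forall x, nondecreasing_seq (f_ ^~ x)) ->
     (forall n, P (f_ n)) -> P (fun x => limn (f_ ^~ x))) ->
  forall f, (forall x, 0 <= f x)%E -> Tmeasurable f -> P f.
Proof.
move=> Pind Pscale Padd Plim f f0 mf.
pose h := nnsfun_approx measurableT mf.
have Psf (g : {nnsfun T >-> R}) : P (EFin \o g).
  have -> : EFin \o g =
      (fun x => \sum_(y <- fset_set (range g)) (y * \1_(g @^-1` [set y]) x)%:E)%E.
    by apply/funext => x /=; rewrite fimfunE fsbig_finite//= sumEFin.
  have : forall y, y \in fset_set (range g) -> 0 <= y.
    by move=> y; rewrite in_fset_set// inE => -[x _ <-].
  move=> h'; have {h'} : forall y, y \in finmap.enum_fset (fset_set (range g)) -> 0 <= y := h'.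
  move: (finmap.enum_fset (fset_set (range g))) => s.
  elim: s => [_|y s ih ys].
    have := Pind _ measurable0.
    by congr P; apply/funext => x; rewrite big_nil indic0.
  have m1 z : Tmeasurable (fun x => (z * \1_(g @^-1` [set z]) x)%:E).
    by apply/measurable_EFinP; exact: measurable_funM.
  have s0 z : z \in s -> 0 <= z by move=> zs; apply: ys; rewrite inE zs orbT.
  rewrite [X in P X](_ : _ = fun x => (y * \1_(g @^-1` [set y]) x)%:E +
      \sum_(y0 <- s) (y0 * \1_(g @^-1` [set y0]) x)%:E)%E; last first.
    by apply/funext => x; rewrite big_cons.
  apply: Padd => //.
  - by move=> x; rewrite lee_fin mulr_ge0// ys// mem_head.
  - by move=> x; rewrite big_seq; apply: sume_ge0 => z zs; rewrite lee_fin mulr_ge0// s0.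
  - exact: emeasurable_sum.
  - have := Pscale y _ (ys _ (mem_head _ _)) _ _ (Pind (g @^-1` [set y]) _).
    by apply => //; exact/measurable_EFinP.
  - exact: ih.
have -> : f = (fun x => limn ((fun n => EFin \o h n) ^~ x)).
  by apply/funext => x; apply/esym/cvg_lim => //; exact: cvg_nnsfun_approx.
apply: Plim => //.
- by move=> n x; rewrite lee_fin.
- by move=> n; exact/measurable_EFinP.
- by move=> x m n mn; rewrite lee_fin; exact/lefP/nd_nnsfun_approx.
Qed.

End nonneg_induction.

Section density.
Context d (T : measurableType d) (R : realType).
Variables mu nu : {measure set T -> \bar R}.
Variable g : T -> R.
Hypotheses (g0 : forall x, 0 <= g x) (mg : Tmeasurable g).
Hypothesis nuE : forall A, measurable A -> nu A = (\int[mu]_(x in A) (g x)%:E)%E.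

Lemma ge0_integral_density f : (forall x, 0 <= f x)%E -> Tmeasurable f ->
  (\int[nu]_x f x = \int[mu]_x (f x * (g x)%:E))%E.
Proof.
have mE : Tmeasurable (EFin \o g) by exact/measurable_EFinP.
apply: (@nonneg_measurable_ind _ _ _
  (fun f => \int[nu]_x f x = \int[mu]_x (f x * (g x)%:E))%E).
- move=> A mA; rewrite integral_indic// setIT nuE// integral_mkcond.
  apply: eq_integral => x _; rewrite patchE indicE.
  by case: ifPn => xA; [rewrite mul1e|rewrite mul0e].
- move=> k {}f k0 f0 mf fE; rewrite ge0_integralZl// fE -ge0_integralZl//.
  + by apply: eq_integral => x _; rewrite muleA.
  + exact: emeasurable_funM.
  + by move=> x _; rewrite mule_ge0// lee_fin.
- move=> f1 f2 f10 f20 mf1 mf2 f1E f2E; rewrite ge0_integralD// f1E f2E -ge0_integralD//.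
  + by apply: eq_integral => x _; rewrite ge0_muleDl.
  + by move=> x _; rewrite mule_ge0// lee_fin.
  + exact: emeasurable_funM.
  + by move=> x _; rewrite mule_ge0// lee_fin.
  + exact: emeasurable_funM.
- move=> f_ f_0 mf_ nd_ f_E.
  rewrite monotone_convergence//.
  under eq_fun do rewrite f_E.
  rewrite -monotone_convergence//.
  + apply: eq_integral => x _; apply/cvg_lim => //.
    apply: cvgeZr => //.
    by apply: ereal_nondecreasing_is_cvgn; exact: nd_.
  + by move=> n; exact: emeasurable_funM.
  + by move=> n x _; rewrite mule_ge0// lee_fin.
  + by move=> x _ a b ab; rewrite lee_wpmul2r ?lee_fin//; exact: nd_.
Qed.

End density.

Section real_integrable.
Context d (T : measurableType d) (R : realType).
Variables (mu : {measure set T -> \bar R}) (D : set T) (mD : measurable D).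
Implicit Types f g : T -> R.

Lemma integrable_realD f g : L1 mu D f ->
  L1 mu D g -> L1 mu D (fun x => f x + g x).
Proof. by move=> fi gi; have := integrableD mD fi gi. Qed.

Lemma integrable_realB f g : L1 mu D f ->
  L1 mu D g -> L1 mu D (fun x => f x - g x).
Proof. by move=> fi gi; have := integrableB mD fi gi. Qed.

Lemma integrable_realZ (k : R) f : L1 mu D f ->
  L1 mu D (fun x => k * f x).
Proof. by move=> fi; have := integrableZl mD k fi. Qed.

Lemma integrable_real_sum (I : Type) (s : seq I) (P : pred I) (h : I -> T -> R) :
  (forall i, P i -> L1 mu D (h i)) ->
  L1 mu D (fun x => \sum_(i <- s | P i) h i x).
Proof.
move=> hi.
rewrite (_ : EFin \o _ = (fun x => \sum_(i <- s | P i) (h i x)%:E)%E); last first.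
  by apply/funext => x /=; rewrite sumEFin.
exact: (integrable_sum mD s (h := fun i => EFin \o h i)).
Qed.

Lemma Rintegral_sum (I : Type) (s : seq I) (P : pred I) (h : I -> T -> R) :
  (forall i, P i -> L1 mu D (h i)) ->
  \int[mu]_(x in D) (\sum_(i <- s | P i) h i x) =
  \sum_(i <- s | P i) \int[mu]_(x in D) h i x.
Proof.
move=> hi; elim: s => [|i s ih].
  under eq_Rintegral do rewrite big_nil.
  by rewrite Rintegral_cst// mul0r big_nil.
rewrite big_cons -ih; under eq_Rintegral do rewrite big_cons.
case: ifPn => // Pi; rewrite RintegralD//; first exact: hi.
exact: integrable_real_sum.
Qed.

Lemma ge0_integrable_real f : measurable_fun D f -> (forall x, D x -> 0 <= f x) ->
  (\int[mu]_(x in D) (f x)%:E < +oo)%E -> L1 mu D f.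
Proof.
move=> mf f0 fy; apply/integrableP; split; first exact/measurable_EFinP.
rewrite (eq_integral (EFin \o f))// => x /[!inE] Dx /=.
by rewrite ger0_norm// f0.
Qed.

End real_integrable.

Section square_integrable_rv.
Context d (T : measurableType d) (R : realType).
Variable Q : probability T R.
Implicit Types X Y : T -> R.

Lemma integrable_sqr_mul X Y : Tmeasurable X -> Tmeasurable Y ->
  L1 Q setT (fun w => X w ^+ 2) ->
  L1 Q setT (fun w => Y w ^+ 2) ->
  L1 Q setT (fun w => X w * Y w).
Proof.
move=> mX mY iX iY.
apply: (@le_integrable _ _ _ _ _ _ _ (fun w => (X w ^+ 2)%:E + (Y w ^+ 2)%:E)%E) => //.
- by apply/measurable_EFinP; exact: measurable_funM.
- move=> w _ /=; rewrite lee_fin normrM [leRHS]ger0_norm ?addr_ge0 ?sqr_ge0//.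
  rewrite -(real_normK (num_real (X w))) -(real_normK (num_real (Y w))).
  by have := sqr_ge0 (`|X w| - `|Y w|); have := normr_ge0 (X w); have := normr_ge0 (Y w); nra.
- exact: integrableD.
Qed.

Lemma integrable_cst (k : R) : L1 Q setT (fun _ : T => k).
Proof. exact: finite_measure_integrable_cst. Qed.

Lemma integrable_of_sqr X : Tmeasurable X ->
  L1 Q setT (fun w => X w ^+ 2) ->
  L1 Q setT X.
Proof.
move=> mX iX; have := @integrable_sqr_mul X (fun=> 1) mX _ iX.
under [X in _ -> _ -> integrable _ _ X]eq_fun do rewrite /= mulr1.
by apply => //; exact: integrable_cst.
Qed.

Lemma expectation_cst_real (k : R) : \int[Q]_w k = k.
Proof. by rewrite Rintegral_cst// [X in _ * X](_ : _ = 1) ?mulr1//= probability_setT. Qed.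

(** Integrate [2 * m * X - m ^+ 2 <= X ^+ 2], where [m] is the mean of [X]. *)
Lemma sqr_expectation_le X : Tmeasurable X ->
  L1 Q setT (fun w => X w ^+ 2) ->
  (\int[Q]_w X w) ^+ 2 <= \int[Q]_w (X w ^+ 2).
Proof.
move=> mX iX; set m := \int[Q]_w X w.
have iX1 := integrable_of_sqr mX iX.
have im : L1 Q setT (fun w => 2 * m * X w).
  exact: integrable_realZ.
have : \int[Q]_w (2 * m * X w - m ^+ 2) <= \int[Q]_w (X w ^+ 2).
  apply: le_Rintegral => //.
  - by apply: integrable_realB => //; exact: integrable_cst.
  - by move=> w _; have := sqr_ge0 (X w - m); nra.
rewrite RintegralB//; last exact: integrable_cst.
by rewrite RintegralZl// -/m expectation_cst_real; nra.
Qed.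

Lemma integrable_sqrD X Y : Tmeasurable X -> Tmeasurable Y ->
  L1 Q setT (fun w => X w ^+ 2) ->
  L1 Q setT (fun w => Y w ^+ 2) ->
  L1 Q setT (fun w => (X w + Y w) ^+ 2).
Proof.
move=> mX mY iX iY.
rewrite (_ : (fun w => _) = (fun w => X w ^+ 2 + 2 * (X w * Y w) + Y w ^+ 2)); last first.
  by apply/funext => w; ring.
apply: integrable_realD => //; apply: integrable_realD => //.
by apply: integrable_realZ => //; exact: integrable_sqr_mul.
Qed.

Lemma integrable_sqrZ (k : R) X :
  L1 Q setT (fun w => X w ^+ 2) ->
  L1 Q setT (fun w => (k * X w) ^+ 2).
Proof.
move=> iX; under eq_fun do rewrite exprMn.
exact: integrable_realZ.
Qed.

Lemma integrable_sqrB X Y : Tmeasurable X -> Tmeasurable Y ->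
  L1 Q setT (fun w => X w ^+ 2) ->
  L1 Q setT (fun w => Y w ^+ 2) ->
  L1 Q setT (fun w => (X w - Y w) ^+ 2).
Proof.
move=> mX mY iX iY.
under eq_fun do rewrite -mulN1r.
apply: integrable_sqrD => //; last exact: integrable_sqrZ.
exact: measurable_funM.
Qed.

Section L2_limit.
Variables (Y_ : nat -> T -> R) (Y : T -> R) (e : nat -> R) (s : R).
Hypothesis mY_ : forall n, Tmeasurable (Y_ n).
Hypothesis mY : Tmeasurable Y.
Hypothesis iY_ : forall n, L1 Q setT (fun w => Y_ n w ^+ 2).
Hypothesis YY : {ae Q, forall w, Y_ ^~ w @ \oo --> Y w}.
Hypothesis cauchy : forall n m, \int[Q]_w ((Y_ n w - Y_ m w) ^+ 2) <= e n + e m.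
Hypothesis e0 : e @ \oo --> 0.

Let mYY_ n m : Tmeasurable (fun w => ((Y_ n w - Y_ m w) ^+ 2)%:E).
Proof.
by apply/measurable_EFinP/measurable_funX; exact: measurable_funB.
Qed.

Let iYY_ n m : L1 Q setT (fun w => (Y_ n w - Y_ m w) ^+ 2).
Proof. exact: integrable_sqrB. Qed.

(** Fatou's lemma as [m] tends to infinity in [cauchy], with [n] fixed: almost sure convergence of
    [Y_] identifies the lower limit of the integrands. *)
Let fatou_bound n : (\int[Q]_w ((Y_ n w - Y w) ^+ 2)%:E <= (e n)%:E)%E.
Proof.
have ecvg : limn_einf (fun m => (e n + e m)%:E) = (e n)%:E.
  have h : (e n + e m)%:E @[m --> \oo] --> (e n)%:E.
    apply: cvg_EFin; first by near=> m.
    rewrite -[X in _ --> X]addr0; apply: (@cvgD _ R^o); [exact: cvg_cst|exact: e0].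
  rewrite is_cvg_limn_einfE; last by apply/cvg_ex; eexists; exact: h.
  exact/cvg_lim.
rewrite -ecvg.
apply: (@le_trans _ _ (limn_einf (fun m => \int[Q]_w ((Y_ n w - Y_ m w) ^+ 2)%:E)%E)); last first.
  rewrite !limn_einf_lim; apply: lee_lim.
  - exact: is_cvg_einfs.
  - exact: is_cvg_einfs.
  - apply: nearW => k; apply: le_ereal_inf_tmp => _ [m /= km <-].
    apply: (@le_trans _ _ (\int[Q]_w ((Y_ n w - Y_ m w) ^+ 2)%:E)%E).
      by apply: ereal_inf_lbound; exists m.
    have := cauchy n m; rewrite -lee_fin /Rintegral fineK//.
    by apply: integrable_fin_num => //; exact: iYY_.
apply: le_trans (fatou Q measurableT (mYY_ n) _); last by move=> m w _; rewrite lee_fin sqr_ge0.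
apply: eqW.
apply: ge0_ae_eq_integral => //.
- by apply/measurable_EFinP/measurable_funX; exact: measurable_funB.
- apply: measurableT_comp => //.
  apply: (@measurable_fun_limn_esup _ _ _ _ (fun m w => - ((Y_ n w - Y_ m w) ^+ 2)%:E)%E) => m.
  exact: measurableT_comp.
- by move=> w _; rewrite lee_fin sqr_ge0.
- move=> w _; rewrite limn_einf_lim; apply: lime_ge; first exact: is_cvg_einfs.
  by apply: nearW => k; apply: le_ereal_inf_tmp => _ [m /= _ <-]; rewrite lee_fin sqr_ge0.
- apply: filterS YY => w Yw _.
  have h : ((Y_ n w - Y_ m w) ^+ 2)%:E @[m --> \oo] --> ((Y_ n w - Y w) ^+ 2)%:E.
    apply: cvg_EFin; first by near=> m.
    have hB : Y_ n w - Y_ m w @[m --> \oo] --> Y_ n w - Y w.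
      by apply: (@cvgB _ R^o); [exact: cvg_cst|exact: Yw].
    by under eq_fun do rewrite /= expr2; rewrite expr2; exact: cvgM.
  rewrite is_cvg_limn_einfE; last by apply/cvg_ex; eexists; exact: h.
  by apply/esym/cvg_lim.
Unshelve. all: by end_near. Qed.

Let iYnY n : L1 Q setT (fun w => (Y_ n w - Y w) ^+ 2).
Proof.
apply/integrableP; split.
  by apply/measurable_EFinP/measurable_funX; exact: measurable_funB.
under eq_integral do rewrite /= ger0_norm ?sqr_ge0//.
by apply: le_lt_trans (fatou_bound n) _; rewrite ltry.
Qed.

Lemma L2_limit_integrable : L1 Q setT (fun w => Y w ^+ 2).
Proof.
rewrite (_ : Y = (fun w => Y_ 0 w - (Y_ 0 w - Y w))).
  by apply: integrable_sqrB => //; exact: measurable_funB.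
by apply/funext => w; rewrite subKr.
Qed.

Let bound n : \int[Q]_w ((Y_ n w - Y w) ^+ 2) <= e n.
Proof.
by have := fatou_bound n; rewrite -lee_fin /Rintegral fineK//; exact: (integrable_fin_num measurableT (iYnY n)).
Qed.

(** [Y_ n - Y] has mean [- E Y], and the square of a mean is at most the mean of the square, which
    is at most [e n]. *)
Lemma L2_limit_expectation : (forall n, \int[Q]_w Y_ n w = 0) -> \int[Q]_w Y w = 0.
Proof.
move=> EY_0; apply/eqP; rewrite -sqrf_eq0 -[X in _ == X]/(0 : R).
rewrite eq_le sqr_ge0 andbT.
have h n : (\int[Q]_w Y w) ^+ 2 <= e n.
  apply: le_trans (bound n); apply: le_trans (sqr_expectation_le _ (iYnY n)).
    rewrite RintegralB//.
    - by rewrite EY_0 sub0r sqrrN.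
    - exact: integrable_of_sqr.
    - apply: integrable_of_sqr => //. exact: L2_limit_integrable.
  exact: measurable_funB.
rewrite -(cvg_lim _ e0)//; apply: limr_ge; first by apply/cvg_ex; eexists; exact: e0.
by apply: nearW.
Qed.

(** Second moments are compared through [|Y^2 - Y_n^2| <= (1 + 1/k) (Y_n - Y)^2 + k Y_n^2]. First
    [n] tends to infinity, which leaves [k * s], and then [k] tends to 0. *)
Lemma L2_limit_sqr : \int[Q]_w (Y_ n w ^+ 2) @[n --> \oo] --> s ->
  \int[Q]_w (Y w ^+ 2) = s.
Proof.
move=> ES.
have iY := L2_limit_integrable.
have key (k : R) n : 0 < k -> `|\int[Q]_w (Y w ^+ 2) - \int[Q]_w (Y_ n w ^+ 2)| <=
    (1 + k^-1) * e n + k * \int[Q]_w (Y_ n w ^+ 2).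
  move=> k0; rewrite -RintegralB//.
  have ip : L1 Q setT (fun w => (1 + k^-1) * (Y_ n w - Y w) ^+ 2 +
      k * Y_ n w ^+ 2).
    by apply: integrable_realD => //; exact: integrable_realZ.
  have id : L1 Q setT (fun w => Y w ^+ 2 - Y_ n w ^+ 2).
    exact: integrable_realB.
  apply: (le_trans (le_normr_Rintegral _ id)) => //.
  apply: (@le_trans _ _ (\int[Q]_w ((1 + k^-1) * (Y_ n w - Y w) ^+ 2 + k * Y_ n w ^+ 2))).
    apply: le_Rintegral => //; first exact: integrable_norm.
    move=> w _; set a := Y_ n w; set b := Y w.
    have -> : b ^+ 2 - a ^+ 2 = (a - b) ^+ 2 - 2 * a * (a - b) by ring.
    have h : `|2 * a * (a - b)| <= k^-1 * (a - b) ^+ 2 + k * a ^+ 2.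
      have k1 : k * k^-1 = 1 by rewrite divff// gt_eqF.
      have ik0 : 0 < k^-1 by rewrite invr_gt0.
      have := sqr_ge0 (a - b - k * a); have := sqr_ge0 (a - b + k * a).
      rewrite ler_norml => h1 h2.
      have h3 : 0 <= k^-1 * (a - b + k * a) ^+ 2 by rewrite mulr_ge0// ltW.
      have h4 : 0 <= k^-1 * (a - b - k * a) ^+ 2 by rewrite mulr_ge0// ltW.
      have E1 : k^-1 * (a - b + k * a) ^+ 2 =
         k^-1 * (a - b) ^+ 2 + 2 * (k * k^-1) * a * (a - b) + (k * k^-1) * k * a ^+ 2 by ring.
      have E2 : k^-1 * (a - b - k * a) ^+ 2 =
         k^-1 * (a - b) ^+ 2 - 2 * (k * k^-1) * a * (a - b) + (k * k^-1) * k * a ^+ 2 by ring.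
      rewrite k1 in E1 E2; apply/andP; split; lra.
    apply: (le_trans (ler_normB _ _)); rewrite (ger0_norm (sqr_ge0 _)).
    by rewrite [(1 + k^-1) * _]mulrDl mul1r -[leRHS]addrA lerD2l.
  rewrite RintegralD//; [|exact: integrable_realZ..].
  by rewrite !RintegralZl// lerD2r ler_wpM2l// addr_ge0// invr_ge0 ltW.
have lim_key (k : R) : 0 < k -> `|\int[Q]_w (Y w ^+ 2) - s| <= k * s.
  move=> k0.
  have h1 : `|\int[Q]_w (Y w ^+ 2) - \int[Q]_w (Y_ n w ^+ 2)| @[n --> \oo] -->
      `|\int[Q]_w (Y w ^+ 2) - s|.
    by apply: cvg_norm; apply: (@cvgB _ R^o); [exact: cvg_cst|exact: ES].
  have h2 : (1 + k^-1) * e n + k * \int[Q]_w (Y_ n w ^+ 2) @[n --> \oo] --> (1 + k^-1) * 0 + k * s.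
    by apply: (@cvgD _ R^o); apply: cvgM => //; exact: cvg_cst.
  have -> : k * s = (1 + k^-1) * 0 + k * s by rewrite mulr0 add0r.
  rewrite -(cvg_lim _ h1)// -(cvg_lim _ h2)//; apply: ler_lim.
  - by apply/cvg_ex; eexists; exact: h1.
  - by apply/cvg_ex; eexists; exact: h2.
  - by apply: nearW => n; exact: key.
apply/eqP; rewrite -subr_eq0 -normr_le0; apply/ler_addgt0Pr => k k0; rewrite add0r.
have s0 : 0 <= s.
  rewrite -(cvg_lim _ ES)//; apply: limr_ge; first by apply/cvg_ex; eexists; exact: ES.
  by apply: nearW => n; apply: Rintegral_ge0 => w _; exact: sqr_ge0.
have s1 : 0 < s + 1 by rewrite ltr_wpDl.
(* Dividing by [s + 1] and not by [s] covers [s = 0]. *)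
apply: (le_trans (lim_key (k / (s + 1)) _)); first by rewrite divr_gt0.
by rewrite -mulrA ler_piMr ?(ltW k0)// mulrC ler_pdivrMr// mul1r lerDl.
Qed.

End L2_limit.

End square_integrable_rv.

Section independence.
Context d d1 d2 (T : measurableType d) (T1 : measurableType d1)
  (T2 : measurableType d2) (R : realType).
Variable Q : probability T R.
Variables (X : T -> T1) (Y : T -> T2).
Hypotheses (mX : Tmeasurable X) (mY : Tmeasurable Y).
Hypothesis indXY : forall A B, measurable A -> measurable B ->
  Q (X @^-1` A `&` Y @^-1` B) = (Q (X @^-1` A) * Q (Y @^-1` B))%E.

Let X' : {mfun T >-> T1} := HB.pack X (isMeasurableFun.Build _ _ _ _ X mX).
Let Y' : {mfun T >-> T2} := HB.pack Y (isMeasurableFun.Build _ _ _ _ Y mY).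
Let mXY : Tmeasurable (fun w => (X w, Y w)).
Proof. exact: measurable_fun_pair. Qed.
Let XY' : {mfun T >-> (T1 * T2)%type} :=
  HB.pack (fun w => (X w, Y w)) (isMeasurableFun.Build _ _ _ _ (fun w => (X w, Y w)) mXY).

Let law A : measurable A ->
  (distribution Q X' \x distribution Q Y')%E A = distribution Q XY' A.
Proof.
apply: product_measure_unique => B C mB mC.
rewrite /= /distribution /pushforward/= -indXY//.
Qed.

(** By uniqueness of product measures, independence on rectangles makes the law of [(X, Y)] the
    product of the two laws; then Tonelli. *)
Lemma ge0_integral_indepM (f : T1 -> \bar R) (g : T2 -> \bar R) :
  (forall x, 0 <= f x)%E -> (forall x, 0 <= g x)%E ->
  Tmeasurable f -> Tmeasurable g ->
  (\int[Q]_w (f (X w) * g (Y w)) = \int[Q]_w f (X w) * \int[Q]_w g (Y w))%E.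
Proof.
move=> f0 g0 mf mg.
have mfg : Tmeasurable (fun z : T1 * T2 => f z.1 * g z.2)%E.
  by apply: emeasurable_funM; exact: measurableT_comp.
have := @ge0_integral_distribution _ _ _ _ _ Q XY' (fun z => f z.1 * g z.2)%E mfg.
move=> /(_ (fun z => mule_ge0 (f0 _) (g0 _))) <-.
rewrite -(eq_measure_integral _ (fun A mA _ => law mA)).
rewrite fubini_tonelli1//; last by move=> z; exact: mule_ge0.
rewrite /fubini_F/=.
under eq_integral do rewrite ge0_integralZl//.
rewrite ge0_integralZr//; last by apply: integral_ge0.
rewrite (ge0_integral_distribution X')// (ge0_integral_distribution Y')//.
Qed.

End independence.

Section independence_real.
Context d (T : measurableType d) (R : realType).
Variable Q : probability T R.
Variables (X Y : T -> R).
Hypotheses (mX : Tmeasurable X) (mY : Tmeasurable Y).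
Hypothesis indXY : forall A B, measurable A -> measurable B ->
  Q (X @^-1` A `&` Y @^-1` B) = (Q (X @^-1` A) * Q (Y @^-1` B))%E.
Hypotheses (iX : L1 Q setT X) (iY : L1 Q setT Y).

Lemma integrable_indepM : L1 Q setT (fun w => X w * Y w).
Proof.
apply/integrableP; split; first by apply/measurable_EFinP; exact: measurable_funM.
under eq_integral do rewrite /= normrM EFinM.
rewrite (ge0_integral_indepM mX mY indXY (f := fun x => `|x|%:E) (g := fun x => `|x|%:E))//.
- move/integrableP: iX => [_ h1]; move/integrableP: iY => [_ h2].
  by apply: lte_mul_pinfty => //; rewrite ?ge0_fin_numE//; exact: integral_ge0.
- by apply/measurable_EFinP; exact: normr_measurable.
- by apply/measurable_EFinP; exact: normr_measurable.
Qed.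

(** The nonnegative case is applied to the four products of positive and negative parts of [X] and
    [Y]. *)
Lemma Rintegral_indepM : \int[Q]_w (X w * Y w) = (\int[Q]_w X w) * (\int[Q]_w Y w).
Proof.
pose p (x : R) := Num.max x 0; pose n (x : R) := Num.max (- x) 0.
have p0 x : 0 <= p x by rewrite le_max lexx orbT.
have n0 x : 0 <= n x by rewrite le_max lexx orbT.
have pn x : x = p x - n x.
  rewrite /p /n; case: (leP 0 x) => x0.
    by rewrite max_r ?oppr_le0// subr0.
  by rewrite max_l ?opprK ?add0r// oppr_ge0 ltW.
have pl x : `|p x| <= `|x|.
  by rewrite ger0_norm// ge_max ler_norm normr_ge0.
have nl x : `|n x| <= `|x|.
  by rewrite ger0_norm// ge_max -normrN ler_norm normr_ge0.
have mp : Tmeasurable p by apply: measurable_maxr => //; exact: measurable_cst.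
have mn : Tmeasurable n by apply: measurable_maxr => //; exact: measurable_cst.
have ip (Z : T -> R) (f : R -> R) : L1 Q setT Z -> Tmeasurable f ->
    (forall x, `|f x| <= `|x|) -> L1 Q setT (f \o Z).
  move=> iZ mf fl; apply: (le_integrable _ _ _ iZ) => //.
    apply/measurable_EFinP; apply: measurableT_comp => //.
    by apply/measurable_EFinP; exact: measurable_int iZ.
  by move=> w _ /=; rewrite lee_fin.
have iM (f g : R -> R) : Tmeasurable f -> Tmeasurable g ->
   (forall x, `|f x| <= `|x|) -> (forall x, `|g x| <= `|x|) ->
   L1 Q setT (fun w => f (X w) * g (Y w)).
  move=> mf mg fl gl; apply: (le_integrable _ _ _ integrable_indepM) => //.
    by apply/measurable_EFinP; apply: measurable_funM; exact: measurableT_comp.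
  by move=> w _ /=; rewrite lee_fin !normrM ler_pM.
have key (f g : R -> R) : Tmeasurable f -> Tmeasurable g ->
   (forall x, 0 <= f x) -> (forall x, 0 <= g x) ->
   (forall x, `|f x| <= `|x|) -> (forall x, `|g x| <= `|x|) ->
   \int[Q]_w (f (X w) * g (Y w)) = (\int[Q]_w f (X w)) * (\int[Q]_w g (Y w)).
  move=> mf mg f0 g0 fl gl; rewrite /Rintegral -fineM.
  - rewrite -(ge0_integral_indepM mX mY indXY (f := EFin \o f) (g := EFin \o g))//.
      by exact/measurable_EFinP.
    by exact/measurable_EFinP.
  - exact: (integrable_fin_num measurableT (ip X f iX mf fl)).
  - exact: (integrable_fin_num measurableT (ip Y g iY mg gl)).
have EX : \int[Q]_w X w = \int[Q]_w p (X w) - \int[Q]_w n (X w).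
  rewrite -RintegralB//; [|exact: (ip _ p)|exact: (ip _ n)].
  by apply: eq_Rintegral => w _; exact: pn.
have EY : \int[Q]_w Y w = \int[Q]_w p (Y w) - \int[Q]_w n (Y w).
  rewrite -RintegralB//; [|exact: (ip _ p)|exact: (ip _ n)].
  by apply: eq_Rintegral => w _; exact: pn.
transitivity (\int[Q]_w ((p (X w) * p (Y w) - p (X w) * n (Y w)) -
   (n (X w) * p (Y w) - n (X w) * n (Y w)))).
  by apply: eq_Rintegral => w _; rewrite {1}(pn (X w)) {1}(pn (Y w)); ring.
rewrite RintegralB//; [|apply: integrable_realB => //; exact: iM..].
rewrite RintegralB//; [|exact: iM..].
rewrite RintegralB//; [|exact: iM..].
by rewrite !key// EX EY; ring.
Qed.

End independence_real.

Section normal_law.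
Context d (T : measurableType d) (R : realType).
Variables (Q : probability T R) (X : T -> R) (s : R).
Hypotheses (mX : Tmeasurable X) (s0 : 0 < s).
Hypothesis lawX : forall C, measurable C -> Q (X @^-1` C) = normal_prob 0 s C.

Let mXR : Tmeasurable (X : T -> measurableTypeR R).
Proof. exact: mX. Qed.

Let X' : {mfun T >-> measurableTypeR R} :=
  HB.pack X (isMeasurableFun.Build _ _ _ (measurableTypeR R) X mXR).

Let ge0_law f : (forall x, 0 <= f x)%E -> Tmeasurable f ->
  (\int[Q]_w f (X w) = \int[lebesgue_measure]_x (f x * (normal_pdf 0 s x)%:E))%E.
Proof.
move=> f0 mf; rewrite -(ge0_integral_distribution X')//.
apply: (@ge0_integral_density _ _ _ lebesgue_measure (distribution Q X') (normal_pdf 0 s)) => //.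
- exact: normal_pdf_ge0.
- exact: measurable_normal_pdf.
Qed.

Lemma normal_law_sqr_integrable : L1 Q setT (fun w => X w ^+ 2).
Proof.
apply: ge0_integrable_real.
- exact: measurable_funX.
- by move=> w _; exact: sqr_ge0.
- rewrite (ge0_law (f := fun x => (x ^+ 2)%:E)).
  + by under eq_integral do rewrite -EFinM; rewrite normal_moment2// ltry.
  + by move=> x; rewrite lee_fin sqr_ge0.
  + by apply/measurable_EFinP; exact: measurable_funX.
Qed.

Lemma normal_law_sqr : \int[Q]_w (X w ^+ 2) = s ^+ 2.
Proof.
rewrite /Rintegral (ge0_law (f := fun x => (x ^+ 2)%:E)).
- by under eq_integral do rewrite -EFinM; rewrite normal_moment2.
- by move=> x; rewrite lee_fin sqr_ge0.
- by apply/measurable_EFinP; exact: measurable_funX.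
Qed.

Lemma normal_law_expectation : \int[Q]_w X w = 0.
Proof.
have iX : L1 Q setT X.
  by apply: integrable_of_sqr => //; exact: normal_law_sqr_integrable.
have EFm : Tmeasurable (@EFin R) by exact/measurable_EFinP.
rewrite /Rintegral integralE.
under eq_integral do rewrite funepos_comp/=.
under [X in (_ - X)%E]eq_integral do rewrite funeneg_comp/=.
rewrite (ge0_law (f := fun x => funepos (@EFin R) x))//=; last exact: measurable_funepos.
rewrite (ge0_law (f := fun x => funeneg (@EFin R) x))//=; last exact: measurable_funeneg.
have g0 x : (0 <= (normal_pdf 0 s x)%:E)%E by rewrite lee_fin normal_pdf_ge0.
have Ep : funepos (fun x => (x * normal_pdf 0 s x)%:E) =
    (fun x => funepos (@EFin R) x * (normal_pdf 0 s x)%:E)%E.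
  apply/funext => x; rewrite !funeposE EFinM; case: (leP 0 x) => x0.
    by rewrite !max_l ?mule_ge0.
  rewrite !max_r ?mul0e ?lee_fin//; first exact: ltW.
  by rewrite mulr_le0_ge0// ?normal_pdf_ge0// ltW.
have En : funeneg (fun x => (x * normal_pdf 0 s x)%:E) =
    (fun x => funeneg (@EFin R) x * (normal_pdf 0 s x)%:E)%E.
  apply/funext => x; rewrite !funenegE EFinM; case: (leP 0 x) => x0.
    by rewrite !max_r ?mul0e// leeNl ?oppe0 ?lee_fin// mulr_ge0// normal_pdf_ge0.
  rewrite !max_l ?mulNe//; rewrite leeNr ?oppe0 ?lee_fin; first exact: ltW.
  by rewrite mulr_le0_ge0// ?normal_pdf_ge0// ltW.
by have := @normal_moment1 R s s0; rewrite integralE Ep En => ->.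
Qed.

End normal_law.

(** * First two moments of the Poisson law *)

Section poisson_moments.
Context {R : realType}.
Variable l : R.
Hypothesis l0 : 0 <= l.
Let pk (k : nat) : \bar R := poisson_prob l 0 [set k].

Let pk_ge0 k : (0 <= pk k)%E. Proof. exact: measure_ge0. Qed.

Let pk_sum : (\sum_(k <oo) pk k = 1)%E.
Proof.
have <- : poisson_prob l 0 setT = 1%E by rewrite probability_setT.
rewrite (_ : setT = \bigcup_k [set k]); last first.
  by apply/seteqP; split=> k //= _; exists k.
rewrite measure_bigcup//=; first by apply: eq_eseriesl => k; rewrite in_setT.
by move=> i j _ _ [x [/= -> ->]].
Qed.

(** Both moments follow from this recurrence by shifting the index of the series. The parameter 0 is
    separate: there [poisson_prob] is the Dirac mass at 0. *)
Let pkS k : (k.+1%:R%:E * pk k.+1 = l%:E * pk k)%E.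
Proof.
rewrite /pk /poisson_prob; case: ifPn => [lp|].
  rewrite !esum_set1; [|by rewrite lee_fin poisson_pmf_ge0..].
  rewrite /poisson_pmf lp -!EFinM; congr EFin.
  rewrite factS natrM exprS; field.
  by rewrite pnatr_eq0 -lt0n fact_gt0 addrC natr1 pnatr_eq0.
rewrite -leNgt => l0'; have -> : l = 0 by apply/eqP; rewrite eq_le l0'.
by rewrite mul0e diracE memNset ?mule0//= => -[].
Qed.

Lemma poisson_series1 : (\sum_(k <oo) k%:R%:E * pk k = l%:E)%E.
Proof.
rewrite nneseries_recl//; last by move=> k; rewrite mule_ge0.
rewrite mul0e add0e -nneseries_addn; last by move=> k; rewrite mule_ge0.
under eq_eseriesr do rewrite addn1 pkS.
by rewrite nneseriesZl// pk_sum mule1.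
Qed.

Lemma poisson_series2 : (\sum_(k <oo) (k%:R ^+ 2)%:E * pk k = (l + l ^+ 2)%:E)%E.
Proof.
have nn k : (0 <= (k%:R ^+ 2)%:E * pk k)%E by rewrite mule_ge0// lee_fin sqr_ge0.
rewrite nneseries_recl//.
rewrite expr0n/= mul0e add0e -nneseries_addn//.
under eq_eseriesr.
  move=> k _; rewrite addn1 expr2 EFinM -muleA pkS muleCA -natr1 EFinD.
  rewrite ge0_muleDl// mul1e. over.
rewrite nneseriesZl/=; last by move=> k _; rewrite adde_ge0// mule_ge0.
rewrite nneseriesD//; last by move=> k _; rewrite mule_ge0.
by rewrite poisson_series1 pk_sum -EFinD -EFinM mulrDr mulr1 addrC.
Qed.

Context d (T : measurableType d) (Q : probability T R) (N : T -> \bar R).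
Hypothesis mN : Tmeasurable N.
Hypothesis N0 : forall w, (0 <= N w)%E.
Hypothesis lawN : forall k, Q [set w | N w = k%:R%:E] = pk k.

Let A k := [set w | N w = k%:R%:E].

Let mA k : measurable (A k).
Proof.
have := mN measurableT (emeasurable_set1 k%:R%:E).
by rewrite setTI.
Qed.

Let tA : trivIset setT A.
Proof.
move=> i j _ _ [w [Ai Aj]].
have /eqP : (i%:R : R) = j%:R by apply: EFin_inj; rewrite -[LHS]Ai -[RHS]Aj.
by rewrite eqr_nat => /eqP.
Qed.

(** [N] takes values in [\bar R], but the Poisson masses add up to 1, so almost surely it is a
    natural number. Integrals of functions of [N] thereby become series. *)
Let QA : Q (\bigcup_k A k) = 1%E.
Proof.
rewrite -pk_sum; transitivity (\sum_(k <oo) Q (A k))%E.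
  by rewrite measure_bigcup//=; apply: eq_eseriesl => k; rewrite in_setT.
by apply: eq_eseriesr => k _; exact: lawN.
Qed.

Let integral_law (f : \bar R -> \bar R) : (forall x, 0 <= x -> 0 <= f x)%E ->
  Tmeasurable f ->
  (\int[Q]_w f (N w) = \sum_(k <oo) f k%:R%:E * pk k)%E.
Proof.
move=> f0 mf.
have mU : measurable (\bigcup_k A k) by exact: bigcup_measurable.
have mfN : Tmeasurable (f \o N) by exact: measurableT_comp.
rewrite (@ge0_negligible_integral _ _ _ Q setT (~` \bigcup_k A k))//.
- rewrite setTD setCK ge0_integral_bigcup//.
  + apply: eq_eseriesr => k _; rewrite -lawN.
    rewrite (eq_integral (fun=> f k%:R%:E)); first by rewrite integral_cst.
    by move=> w; rewrite inE => ->.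
  + exact: measurable_funTS.
  + by move=> w _; exact: f0.
- exact: measurableC.
- by move=> w _; exact: f0.
- by have := probability_setC Q mU; rewrite QA subee.
Qed.

Lemma poisson_law_expectation : (\int[Q]_w N w = l%:E)%E.
Proof. by rewrite (@integral_law id)// poisson_series1. Qed.

Lemma poisson_law_sqr : (\int[Q]_w (N w * N w) = (l + l ^+ 2)%:E)%E.
Proof.
rewrite (@integral_law (fun x => x * x)%E)//.
- under eq_eseriesr do rewrite -EFinM -expr2.
  exact: poisson_series2.
- by move=> x x0; exact: mule_ge0.
- exact: emeasurable_funM.
Qed.

End poisson_moments.

(** * Scalar inequalities: duality of entropy and exponential, convexity, the capped tilt *)

Section scalar_inequalities.
Context {R : realType}.
Implicit Types x y L l u v a : R.

(** With [u = 1 - y], this is [1 + x <= expR x] at [x = - (L + ln u)], multiplied by [u]. Equality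
    holds at [y = 1 - expR (- L)], the optimal distortion for the load [L]. *)
Lemma entropy_young y L : y < 1 -> 1 - expR (- L) <= entropy y + L * (1 - y).
Proof.
move=> y1; rewrite /entropy; set u := 1 - y.
have u0 : 0 < u by rewrite subr_gt0.
have h : u * (1 - (L + ln u)) <= expR (- L).
  have -> : expR (- L) = u * expR (- (L + ln u)).
    by rewrite opprD expRD expRN [expR (- ln u)]expRN lnK// mulrCA mulfV ?mulr1// gt_eqF.
  by rewrite ler_pM2l// expR_ge1Dx.
have -> : y = 1 - u by rewrite /u; ring.
by move: h; lra.
Qed.

Lemma entropy_ge0 y : y < 1 -> 0 <= entropy y.
Proof. by move=> /(@entropy_young _ 0); rewrite oppr0 expR0 subrr mul0r addr0. Qed.

Lemma entropy_expR l : entropy (1 - expR l) = l * expR l + 1 - expR l.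
Proof. by rewrite /entropy subKr expRK; ring. Qed.

Lemma derive_ge0_homo (g g' : R -> R) v :
  (forall x : R, is_derive x 1 g (g' x)) -> (forall x, 0 <= x -> 0 <= g' x) ->
  0 <= v -> g 0 <= g v.
Proof.
move=> dg g'0 v0; apply: (@ger0_derive1_ndecr _ g 0 v) => //.
- move=> x; rewrite in_itv/= => /andP[/ltW x0 _].
  by rewrite derive1E; have [_ ->] := dg x; exact: g'0.
- apply: continuous_subspaceT => x; apply: differentiable_continuous.
  by apply/derivable1_diffP; have [h _] := dg x.
Qed.

Lemma expR_odd_ge v : 0 <= v -> 2 * v <= expR v - expR (- v).
Proof.
pose g (v : R) := expR v - expR (- v) - 2 * v => v0.
suff : g 0 <= g v by rewrite /g oppr0 mulr0; lra.
apply: (@derive_ge0_homo g (fun x => expR x + expR (- x) - 2)) => // x.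
  by apply: is_derive_eq; rewrite /GRing.scale/=; ring.
by have := expR_ge1Dx x; have := expR_ge1Dx (- x); lra.
Qed.

Lemma expR_tanh_le v : 0 <= v -> expR v - expR (- v) <= v * (expR v + expR (- v)).
Proof.
pose g (v : R) := v * (expR v + expR (- v)) - (expR v - expR (- v)) => v0.
suff : g 0 <= g v by rewrite /g oppr0 mul0r; lra.
apply: (@derive_ge0_homo g (fun x => x * (expR x - expR (- x)))) => //.
  by move=> x; apply: is_derive_eq; rewrite /GRing.scale/=; ring.
move=> x x0; rewrite mulr_ge0//; have := expR_odd_ge x0; lra.
Qed.

(** On the half line the hyperbolic sine is convex, hence above its tangent at [L]. On either side
    of [L] the addition formulas split the gap into products of nonnegative factors, using
    [2 * v <= 2 sinh v] and [tanh v <= v]. *)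
Lemma sinh_tangent x L : 0 <= x -> 0 <= L ->
  (x - L) * (expR L + expR (- L)) <=
  (expR x - expR (- x)) - (expR L - expR (- L)).
Proof.
move=> x0 L0; have [Lx|xL] := leP L x.
  have [u xE] : exists u, x = L + u by exists (x - L); ring.
  have u0 : 0 <= u by lra.
  rewrite xE.
  rewrite opprD !expRD.
  have h1 := expR_odd_ge u0; have h2 := expR_ge1Dx (- u).
  have lL : expR (- L) <= expR L by rewrite ler_expR; lra.
  rewrite -subr_ge0 [X in 0 <= X](_ : _ = (expR L - expR (- L)) * (expR (- u) - 1 + u) +
    expR L * (expR u - expR (- u) - 2 * u)); last by ring.
  by rewrite addr_ge0// mulr_ge0 ?expR_ge0//; lra.
have [v LE] : exists v, L = x + v by exists (L - x); ring.
have v0 : 0 <= v by lra.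
rewrite LE.
rewrite opprD !expRD.
have h1 := expR_tanh_le v0.
have x1 : expR (- x) <= expR x by rewrite ler_expR; lra.
have h3 : 0 <= 1 - expR v + v * expR v.
  have : expR v * (1 - v) <= expR v * expR (- v).
    by rewrite ler_wpM2l ?expR_ge0//; exact: expR_ge1Dx.
  by rewrite -expRD subrr expR0; lra.
rewrite -subr_ge0 [X in 0 <= X](_ : _ = (expR x - expR (- x)) * (1 - expR v + v * expR v) +
  expR (- x) * (v * (expR v + expR (- v)) - (expR v - expR (- v)))); last by ring.
by rewrite addr_ge0// mulr_ge0 ?expR_ge0//; lra.
Qed.

(** From [(5 / 4) ^+ 4 <= expR 1], a value above 2.44, one gets [1 <= expR 1 * (expR 1 - 2)]. This
    is the numerical fact that allows the cap [L + 1]. *)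
Lemma expR1_ge : 1 + 1 + 1 / expR 1 <= expR 1 :> R.
Proof.
have h : (5 / 4) ^+ 4 <= expR 1 :> R.
  have -> : expR 1 = expR (1 / 4) ^+ 4 :> R.
    by rewrite -expRM_natl; congr expR; field.
  rewrite lerXn2r ?nnegrE ?expR_ge0//.
    by have := @expR_ge1Dx R (1 / 4); lra.
have h2 : (244 / 100 : R) <= expR 1 by apply: le_trans h; lra.
have e0 : 0 < expR 1 :> R by exact: expR_gt0.
have h3 : expR 1 * (1 / expR 1) = 1 :> R by rewrite mul1r divff// gt_eqF.
have h4 : 1 / expR 1 <= (expR 1 - 2 : R).
  by rewrite -(ler_pM2l e0) h3; nra.
by move: h4; lra.
Qed.

(* Gap between the exponent used to tilt the jumps under the perturbed strategy
   and the exponent of the equilibrium strategy: capping it at [1] keeps the tilt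
   integrable, and by [expR1_ge] loses nothing in the first order condition. *)
Lemma capped_tilt_bound a x L : 2^-1 <= a <= 1 -> 0 <= x -> 0 <= L ->
  let l := Num.min x (L + 1) in
  a * (l * expR l + 1 - expR l - x * expR l) - (1 - a) * (1 - expR (- x)) <=
  a * (1 - expR L) - (1 - a) * (1 - expR (- L))
  - (x - L) * (a * expR L + (1 - a) * expR (- L)).
Proof.
move=> /andP[a1 a2] x0 L0; cbv zeta.
have [xL|xL] := leP x (L + 1).
  (* Below the cap the gap is [2 * a - 1] times the tangent gap of [expR] plus [1 - a] times the
     tangent gap of [expR x - expR (- x)]; both weights are nonnegative because [1/2 <= a <= 1]. *)
  have := sinh_tangent x0 L0.
  have : 0 <= expR x - expR L - (x - L) * expR L.
    have : expR L * (1 + (x - L)) <= expR L * expR (x - L).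
      by rewrite ler_wpM2l ?expR_ge0//; exact: expR_ge1Dx.
    by rewrite -expRD [L + (x - L)]addrC subrK; lra.
  set A := expR x; set B := expR L; set C := expR (- x); set D := expR (- L).
  by move=> h1 h2; nra.
have [u xE] : exists u, x = L + u by exists (x - L); ring.
have u1 : 1 <= u by lra.
rewrite {}xE.
rewrite opprD !expRD.
have lL : expR (- L) <= expR L by rewrite ler_expR; lra.
have e0 := expR_gt0 (- L).
have h1 : expR (- u) <= 1 / expR 1.
  by rewrite div1r -expRN ler_expR lerN2.
have h2 := expR_ge1Dx (- u).
have h3 := expR1_ge.
have i0 : 0 < 1 / expR 1 :> R by rewrite divr_gt0 ?expR_gt0.
have h4 : 0 <= (expR 1 - 2) * (u - 1) by rewrite mulr_ge0//; lra.
have h5 : 0 <= expR L * (expR 1 * u - 1 - (2 * u - 1 + expR (- u))).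
  by rewrite mulr_ge0 ?expR_ge0//; lra.
have h6 : 0 <= (expR L - expR (- L)) * (u - 1 + expR (- u)) by rewrite mulr_ge0//; lra.
(* With [x = L + u], [u >= 1], the gap is a sum of three nonnegative terms; the first is nonnegative
   by [2 + 1 / e <= e] and [expR (- u) <= 1 / e]. *)
rewrite -subr_ge0 [X in 0 <= X](_ : _ =
  a * (expR L * (expR 1 * u - 1 - (2 * u - 1 + expR (- u)))) +
  a * ((expR L - expR (- L)) * (u - 1 + expR (- u))) +
  (2 * a - 1) * (expR (- L) * (u - 1 + expR (- u)))); last by ring.
by rewrite !addr_ge0// mulr_ge0//; try lra; rewrite mulr_ge0//; lra.
Qed.

End scalar_inequalities.

(** * The filtration: adaptedness, null sets, completeness *)

Section sigma_algebras.
Context (T : pointedType) (C : set (set T)).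

Lemma sigma_setI (A B : set T) : <<s C >> A -> <<s C >> B -> <<s C >> (A `&` B).
Proof. exact: (@measurableI _ (g_sigma_algebraType C)). Qed.

Lemma sigma_setT : <<s C >> setT.
Proof. exact: (@measurableT _ (g_sigma_algebraType C)). Qed.

End sigma_algebras.

Section filtrations.
Context {R : realType} {d} {Omega : measurableType d} (M : market R Omega) (hM : market_ok M).
Notation P := (Pr M).
Notation T := (horizon (par M)).

Notation Gtype t := (g_sigma_algebraType (filtF M t `|` filtH M t)).

(** Reading the sigma-algebra as a measurable type makes all closure properties of measurable
    functions available for adapted random variables. *)
Lemma GmeasurableE t (Y : Omega -> R) :
  Gmeasurable M t Y <-> Tmeasurable (Y : Gtype t -> R).
Proof.
split=> [GY _ B mB|mY B mB]; first by rewrite setTI; exact: GY.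
by have := mY measurableT B mB; rewrite setTI.
Qed.

Lemma filtG_setI t A B : filtG M t A -> filtG M t B -> filtG M t (A `&` B).
Proof. exact: sigma_setI. Qed.

Lemma filtG_setT t : filtG M t setT. Proof. exact: sigma_setT. Qed.

Let noP : noise_under M P (no_distortion R). Proof. by case: hM => -[]. Qed.

Let shifted0 (W : R -> Omega -> R) : shifted M W (fun=> 0) = W.
Proof.
apply/funext => t; apply/funext => w; rewrite /shifted.
by rewrite Rintegral_cst// mul0r addr0.
Qed.

Lemma brownian_P1 : brownian P (W1 M).
Proof. by case: noP; rewrite /= shifted0. Qed.

Lemma brownian_P2 : brownian P (W2 M).
Proof. by case: noP => _; rewrite /= shifted0. Qed.

Lemma filtF_le s t : s <= t -> filtF M s `<=` filtF M t.
Proof.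
move=> st A sA u /=; rewrite in_itv/= andbT => tu; apply: sA => /=.
by rewrite in_itv/= andbT (le_lt_trans st).
Qed.

Lemma filtH_le s t : s <= t -> filtH M s `<=` filtH M t.
Proof.
move=> st; apply: sub_sigma_algebra2; apply: bigcup_subset => u /=.
by rewrite !in_itv/= => /andP[-> /le_trans]; exact.
Qed.

Lemma filtG_le s t : s <= t -> filtG M s `<=` filtG M t.
Proof.
move=> st; apply: sub_sigma_algebra2 => A [] h; [left|right].
  exact: filtF_le h.
exact: filtH_le h.
Qed.

Lemma Gmeasurable_le s t Y : s <= t -> Gmeasurable M s Y -> Gmeasurable M t Y.
Proof. by move=> st GY B mB; apply: (filtG_le st); exact: GY. Qed.

Lemma negligible_filtG t A : P.-negligible A -> filtG M t A.
Proof.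
move=> nA; apply: sub_sigma_algebra; left => u _.
by apply: sub_sigma_algebra; right.
Qed.

(** [filtF] at time [t] is an intersection over [u > t], so an event enters it once it is a noise
    event for every later [u]. *)
Lemma noise_events_filtG t A : (forall u, t < u -> noise_events M u A) -> filtG M t A.
Proof.
move=> nA; apply: sub_sigma_algebra; left => u /=; rewrite in_itv/= andbT => tu.
by apply: sub_sigma_algebra; left; exact: nA.
Qed.

Lemma Gmeasurable_W1 t : 0 <= t -> Gmeasurable M t (W1 M t).
Proof.
move=> t0 B mB; apply: noise_events_filtG => u tu; left; left.
exists t; first by rewrite /= in_itv/= t0 ltW.
by exists B => //; rewrite setTI.
Qed.

Lemma Gmeasurable_W2 t : 0 <= t -> Gmeasurable M t (W2 M t).
Proof.
move=> t0 B mB; apply: noise_events_filtG => u tu; left; right.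
exists t; first by rewrite /= in_itv/= t0 ltW.
by exists B => //; rewrite setTI.
Qed.

Lemma filtG_jumps (t : R) (A : set (R * R)) B : measurable A -> A `<=` `[0, t] `*` `]0, +oo[ ->
  measurable B -> filtG M t [set w | B (jumps M w A)].
Proof.
move=> mA At mB; apply: noise_events_filtG => u tu; right.
exists A.
  split => // q /At [/=]; rewrite !in_itv/= => /andP[-> q1] ->; split => //.
  by rewrite (le_trans q1)// ltW.
by exists B => //; rewrite setTI.
Qed.

Lemma measurable_defaulted t : measurable [set w | defaulted M t w].
Proof.
rewrite (_ : [set w | _] = state_event M t true); first exact: measurable_state_event.
by apply/seteqP; split => w.
Qed.

Lemma measurable_Hproc t : Tmeasurable (Hproc M t).
Proof.
rewrite (_ : Hproc M t = \1_[set w | defaulted M t w]).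
  exact: measurable_indic (measurable_defaulted t).
apply/funext => w; rewrite indicE /Hproc; congr ((nat_of_bool _)%:R).
by apply/idP/idP; rewrite inE.
Qed.

Lemma filtG_state t h : 0 <= t -> filtG M t (state_event M t h).
Proof.
move=> t0; apply: sub_sigma_algebra; right; apply: sub_sigma_algebra.
exists t; first by rewrite /= in_itv/= t0 lexx.
exists [set h%:R : R]; first exact: measurable_set1.
rewrite setTI; apply/seteqP; split => w /=; rewrite /Hproc /state_event/=.
  by case: h (defaulted M t w) => -[]//= /eqP; rewrite ?oner_eq0 // eq_sym oner_eq0.
by move=> ->.
Qed.

(** Completeness of [P] is what makes the adjoined negligible sets measurable. The member
    [u = t + 1] of the intersection defining [filtF] is used, any [u > t] being possible. *)
Lemma filtG_measurable t : 0 <= t -> filtG M t `<=` measurable.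
Proof.
move=> t0; have [[_ _ cP _ _] _] := hM.
apply: smallest_sub; first exact: sigma_algebra_measurable.
move=> A [FA|HA].
  have {FA} := FA (t + 1); rewrite /= in_itv/= andbT ltrDl => /(_ ltr01).
  move: A; apply: smallest_sub; first exact: sigma_algebra_measurable.
  move=> A [[[]|]|].
  - move=> [s /=]; rewrite in_itv/= => /andP[s0 _] [B mB <-].
    by have [m1 _ _ _] := brownian_P1; exact: m1.
  - move=> [s /=]; rewrite in_itv/= => /andP[s0 _] [B mB <-].
    by have [m1 _ _ _] := brownian_P2; exact: m1.
  - move=> [B [mB Bt] [C mC <-]]; have [_ _ [mJ _ _] _ _] := noP.
    apply: mJ => // q /Bt [/=]; rewrite !in_itv/= => /andP[-> _] ->.
    by [].
  - exact: cP.
move: A HA; apply: smallest_sub; first exact: sigma_algebra_measurable.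
move=> A [s _ [B mB <-]].
exact: (measurable_Hproc s).
Qed.

Lemma Gmeasurable_measurable t Y : 0 <= t -> Gmeasurable M t Y -> Tmeasurable Y.
Proof. by move=> t0 GY _ B mB; rewrite setTI; apply: (filtG_measurable t0); exact: GY. Qed.

(** All negligible sets belong to every [filtG], so changing a variable on a null set preserves
    adaptedness. Pathwise limits, which exist almost surely only, are thereby adapted. *)
Lemma Gmeasurable_ae t Y Y' : {ae P, forall w, Y w = Y' w} ->
  Gmeasurable M t Y -> Gmeasurable M t Y'.
Proof.
move=> YY' GY B mB.
pose N := [set w | Y w != Y' w].
have nN : P.-negligible N.
  apply: negligibleS YY' => w /= /eqP h; exact: h.
have nN1 : P.-negligible (N `&` Y' @^-1` B) by apply: negligibleS nN => w [].
have -> : Y' @^-1` B = (Y @^-1` B `&` ~` N) `|` (N `&` Y' @^-1` B).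
  apply/seteqP; split => w /=.
    by have [YY|YY] := eqVneq (Y w) (Y' w) => h; [left; rewrite YY; split => //; rewrite /N/= YY eqxx|right].
  by move=> [[h /negP/negPn/eqP <-]|[]].
pose GT := Gtype t.
apply: (@measurableU _ GT); last exact: negligible_filtG.
apply: (@measurableI _ GT); first exact: GY.
by apply: (@measurableC _ GT); exact: negligible_filtG.
Qed.

End filtrations.

Arguments Gmeasurable_le {R d Omega M s t Y} _ _.
Arguments Gmeasurable_measurable {R d Omega M} _ {t Y} _ _.
Arguments Gmeasurable_ae {R d Omega M} {t Y Y'} _ _.
Arguments Gmeasurable_W1 {R d Omega M t} _.
Arguments Gmeasurable_W2 {R d Omega M t} _.
Arguments filtG_le {R d Omega M s t} _.
Arguments filtG_setI {R d Omega M t A B} _ _.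

(** * Laws of the noise after time t under the priors and under conditioning *)

Section noise_from.
Context {R : realType} {d} {Omega : measurableType d} (M : market R Omega) (hM : market_ok M).
Notation P := (Pr M).
Notation T := (horizon (par M)).

(** The part of [noise_under] that concerns the noise after [t]. It survives conditioning on an
    event of [filtG M t], so moments are computed once and serve both for [P] and for the
    conditioned priors. *)
Definition noise_from (Q : probability Omega R) (t : R) (phi : distortion R) : Prop :=
  [/\ forall s u (C : set R), t <= s -> s < u -> measurable C ->
        Q [set w | C (shifted M (W1 M) (phi1 phi) u w - shifted M (W1 M) (phi1 phi) s w)] =
        normal_prob 0 (Num.sqrt (u - s)) C,
      forall s u (C : set R), t <= s -> s < u -> measurable C ->
        Q [set w | C (shifted M (W2 M) (phi2 phi) u w - shifted M (W2 M) (phi2 phi) s w)] =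
        normal_prob 0 (Num.sqrt (u - s)) C,
      forall (A : set (R * R)) (k : nat), measurable A -> A `<=` `]t, +oo[ `*` `]0, +oo[ ->
        (tilted M phi A < +oo)%E ->
        Q [set w | jumps M w A = k%:R%:E] = poisson_prob (fine (tilted M phi A)) 0 [set k],
      forall (A A' : set (R * R)) (B B' : set (\bar R)), measurable A -> measurable A' ->
        A `<=` `]t, +oo[ `*` `]0, +oo[ -> A' `<=` `]t, +oo[ `*` `]0, +oo[ ->
        A `&` A' = set0 -> measurable B -> measurable B' ->
        Q ([set w | B (jumps M w A)] `&` [set w | B' (jumps M w A')]) =
        (Q [set w | B (jumps M w A)] * Q [set w | B' (jumps M w A')])%E &
      forall s (E A1 A2 A3 : set Omega), t <= s -> filtG M s E ->
        increments s (W1 M) A1 -> increments s (W2 M) A2 -> jumps_after M s A3 ->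
        Q (E `&` A1 `&` A2 `&` A3) = (Q E * Q A1 * Q A2 * Q A3)%E].

Lemma increments_sub (W : R -> Omega -> R) s u (C : set R) (c : R) : s <= u -> measurable C ->
  increments s W [set w | C (W u w - W s w + c)].
Proof.
move=> su mC; apply: sub_sigma_algebra; exists u; first by rewrite /= in_itv/= su.
exists [set x | C (x + c)]; last by rewrite setTI.
rewrite -[X in measurable X]setTI.
by apply: (measurable_funD (@measurable_id _ _ _) (@measurable_cst _ _ _ _ setT c)).
Qed.

Lemma jumps_after_sub s (A : set (R * R)) (B : set (\bar R)) : measurable A ->
  A `<=` `]s, +oo[ `*` `]0, +oo[ -> measurable B ->
  jumps_after M s [set w | B (jumps M w A)].
Proof. by move=> mA As mB; apply: sub_sigma_algebra; exists A => //; exists B; rewrite ?setTI. Qed.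

Lemma poisson_pair (Q : probability Omega R) phi (A A' : set (R * R)) (B B' : set (\bar R)) :
  poisson_random_measure M Q (tilted M phi) ->
  measurable A -> measurable A' ->
  A `<=` `[0, +oo[ `*` `]0, +oo[ -> A' `<=` `[0, +oo[ `*` `]0, +oo[ ->
  A `&` A' = set0 -> measurable B -> measurable B' ->
  Q ([set w | B (jumps M w A)] `&` [set w | B' (jumps M w A')]) =
  (Q [set w | B (jumps M w A)] * Q [set w | B' (jumps M w A')])%E.
Proof.
move=> [_ _ indA] mA mA' Ad A'd AA' mB mB'.
have := indA 2 (fun i => if val i == 0 then A else A') (fun i => if val i == 0 then B else B').
rewrite !big_ord_recl big_ord0/= mule1 => <-.
- congr (Q _); apply/seteqP; split => w /=.
    by move=> [h1 h2] i _; case: ifP.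
  by move=> h; split; [exact: (h ord0)|exact: (h (lift ord0 ord0))].
- by move=> i; case: ifP.
- move=> i j _ _ [q [qi qj]].
  case: i j qi qj => -[|[|//]] hi [[|[|//]] hj] /= qi qj; apply: val_inj => //=.
    by have : (A `&` A') q by []; rewrite AA'.
  by have : (A `&` A') q by []; rewrite AA'.
- by move=> i; case: ifP.
Qed.

Lemma itv_sub0 t : 0 <= t ->
  (`]t, +oo[ `*` `]0, +oo[ : set (R * R)) `<=` `[0, +oo[ `*` `]0, +oo[.
Proof.
move=> t0 q [/= + ->]; rewrite !in_itv/= !andbT => /ltW tq.
by split => //; exact: le_trans tq.
Qed.

Lemma noise_under_from Q phi t : 0 <= t -> noise_under M Q phi -> noise_from Q t phi.
Proof.
move=> t0 [[_ _ _ B1] [_ _ _ B2] Pois ind _].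
have ge0 s : t <= s -> 0 <= s by exact: le_trans.
split.
- by move=> s u C ts su mC; apply: B1 => //; exact: ge0.
- by move=> s u C ts su mC; apply: B2 => //; exact: ge0.
- move=> A k mA At; have [_ h _] := Pois; apply: h => //.
  by apply: (subset_trans At); exact: itv_sub0.
- move=> A A' B B' mA mA' At A't; apply: (poisson_pair Pois) => //.
    by apply: (subset_trans At); exact: itv_sub0.
  by apply: (subset_trans A't); exact: itv_sub0.
- by move=> s E A1 A2 A3 ts; apply: ind; exact: ge0.
Qed.

Section conditioned.
Variables (Q : probability Omega R) (phi : distortion R) (t : R) (h : bool).
Hypotheses (t0 : 0 <= t) (nQ : noise_under M Q phi).

Let H := state_event M t h.
Let mH : measurable H := measurable_state_event M t h.
Let K : probability Omega R := mnormalize (mrestr Q mH) Q.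

Let GH : filtG M t H. Proof. exact: filtG_state. Qed.

(** First alternative: the state has probability 0 and [mnormalize] returns [Q] itself. Second: [c]
    is the inverse of [Q H], written multiplicatively to be used in products of probabilities. *)
Lemma conditionedE : (forall A, K A = Q A) \/
  (exists2 c : R, (Q H * c%:E = 1)%E & forall A, K A = (Q (A `&` H) * c%:E)%E).
Proof.
have KE A : K A = if (Q H == 0)%E || (Q H == +oo)%E then Q A
    else (Q (A `&` H) * (fine (Q H))^-1%:E)%E.
  have -> : K A = mnormalize (mrestr Q mH) Q A by [].
  have gen x : x = Q H -> (if (x == 0)%E || (x == +oo)%E then [eta Q]
      else fun U => (mrestr Q mH U * ((fine x)^-1)%:E)%E) A =
    if (Q H == 0)%E || (Q H == +oo)%E then Q A else (Q (A `&` H) * (fine (Q H))^-1%:E)%E.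
    by move=> ->; case: ifP.
  by apply: gen; rewrite /= /mrestr setTI.
have QHfin : Q H \is a fin_num by exact: fin_num_measure.
have QHy : (Q H == +oo)%E = false by case: (Q H) QHfin.
have [QH0|QH0] := eqVneq (Q H) 0%E.
  by left => A; rewrite KE QH0 eqxx.
right; exists (fine (Q H))^-1; last by move=> A; rewrite KE QHy (negbTE QH0).
by rewrite -{1}(fineK QHfin) -EFinM divff// fine_eq0.
Qed.

Lemma conditioned_indep A : Q (A `&` H) = (Q H * Q A)%E -> K A = Q A.
Proof.
move=> QAH; have [->//|[c QHc ->]] := conditionedE.
by rewrite QAH muleAC QHc mul1e.
Qed.

Let ind s (E A1 A2 A3 : set Omega) : t <= s -> filtG M s E ->
        increments s (W1 M) A1 -> increments s (W2 M) A2 -> jumps_after M s A3 ->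
        Q (E `&` A1 `&` A2 `&` A3) = (Q E * Q A1 * Q A2 * Q A3)%E.
Proof. by move=> ts; case: nQ => _ _ _ + _; apply; exact: le_trans ts. Qed.

Let i1T s : increments s (W1 M) setT. Proof. exact: sigma_setT. Qed.
Let i2T s : increments s (W2 M) setT. Proof. exact: sigma_setT. Qed.
Let jT s : jumps_after M s setT. Proof. exact: sigma_setT. Qed.
Let GHs s : t <= s -> filtG M s H. Proof. by move=> ts; exact: filtG_le GH. Qed.

Let K1 s A : t <= s -> increments s (W1 M) A -> K A = Q A.
Proof.
move=> ts iA; apply: conditioned_indep; have := ind ts (GHs ts) iA (@i2T s) (@jT s).
by rewrite !setIT [H `&` A]setIC !probability_setT !mule1.
Qed.

Let K2 s A : t <= s -> increments s (W2 M) A -> K A = Q A.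
Proof.
move=> ts iA; apply: conditioned_indep; have := ind ts (GHs ts) (@i1T s) iA (@jT s).
by rewrite !setIT [H `&` A]setIC !probability_setT !mule1.
Qed.

Let K3 s A : t <= s -> jumps_after M s A -> K A = Q A.
Proof.
move=> ts iA; apply: conditioned_indep; have := ind ts (GHs ts) (@i1T s) (@i2T s) iA.
by rewrite !setIT [H `&` A]setIC !probability_setT !mule1.
Qed.

Let shiftedB (W : R -> Omega -> R) (f : R -> R) s u w :
  shifted M W f u w - shifted M W f s w = W u w - W s w +
  (\int[lebesgue_measure]_(x in `[0, Order.min u T]) f x -
   \int[lebesgue_measure]_(x in `[0, Order.min s T]) f x).
Proof. by rewrite /shifted; ring. Qed.

Lemma noise_from_conditioned : noise_from K t phi.
Proof.
have [N1 N2 N3 N4 N5] := noise_under_from t0 nQ.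
split.
- move=> s u C ts su mC; rewrite -(N1 s u C)//; apply: (K1 ts).
  under eq_set do rewrite shiftedB; apply: increments_sub => //; exact: ltW.
- move=> s u C ts su mC; rewrite -(N2 s u C)//; apply: (K2 ts).
  under eq_set do rewrite shiftedB; apply: increments_sub => //; exact: ltW.
- move=> A k mA At fA; rewrite -(N3 A k)//; apply: (@K3 t) => //.
  exact: (jumps_after_sub (B := [set k%:R%:E])).
- move=> A A' B B' mA mA' At A't AA' mB mB'.
  have j1 := jumps_after_sub mA At mB; have j2 := jumps_after_sub mA' A't mB'.
  rewrite !(@K3 t)//; first exact: N4.
  exact: sigma_setI.
- move=> s E A1 A2 A3 ts sE i1 i2 i3.
  rewrite (K1 ts i1) (K2 ts i2) (K3 ts i3).
  have [KE|[c _ KE]] := conditionedE; first by rewrite !KE; exact: (ind ts sE i1 i2 i3).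
  (* The conditioning event is absorbed into [E]: as [H] lies in [filtG M s], independence under [Q]
     applies to [E] intersected with [H]. *)
  rewrite !KE [_ `&` H](_ : _ = (E `&` H) `&` A1 `&` A2 `&` A3); last first.
    by rewrite -!setIA [H `&` _]setIC -!setIA.
  rewrite (ind ts _ i1 i2 i3); last by apply: filtG_setI; [exact: sE|exact: (GHs ts)].
  by rewrite -!muleA; congr (_ * _)%E; rewrite [RHS]muleC !muleA.
Qed.

Lemma conditioned_null A : Q A = 0%E -> measurable A -> K A = 0%E.
Proof.
move=> QA mA; have [->//|[c _ ->]] := conditionedE.
by rewrite (@subset_measure0 _ _ _ Q (A `&` H) A) ?mul0e//; exact: measurableI.
Qed.

End conditioned.

Lemma horizon_gt0 : 0 < T.
Proof. by case: hM => -[[_ [_ _ _ _ /andP[]]]]. Qed.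

(** [prior M phi] has density [L T] with respect to [P]. The work is to check that [L T] is
    measurable, through adaptedness of the three integrals in its exponent. *)
Lemma prior_null phi A : Theta M phi -> measurable A -> P A = 0%E -> prior M phi A = 0%E.
Proof.
move=> Tphi mA PA.
have T0 := horizon_gt0.
have TT : 0 <= T <= T by rewrite lexx ltW.
have [_ /(_ _ Tphi) [[L [I1 [I2 [K [i1 i2 iK LE]]]] QE] _]] := hM.
have mL : Tmeasurable (L T).
  have mI (I : R -> Omega -> R) : Gmeasurable M T (I T) -> Tmeasurable (I T).
    by apply: (Gmeasurable_measurable hM); exact: ltW.
  have m1 : Tmeasurable (I1 T) by case: i1 => _ h _ _; apply: mI; exact: h.
  have m2 : Tmeasurable (I2 T) by case: i2 => _ h _ _; apply: mI; exact: h.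
  have mK : Tmeasurable (K T) by apply: mI; case: (iK _ TT).
  rewrite (_ : L T = expR \o (fun w => - I1 T w -
      2^-1 * \int[lebesgue_measure]_(s in `[0, T]) (phi1 phi s ^+ 2)
      - I2 T w - 2^-1 * \int[lebesgue_measure]_(s in `[0, T]) (phi2 phi s ^+ 2)
      + K T w)); last by apply/funext => w; exact: LE.
  apply: measurableT_comp => //; apply: measurable_funD => //.
  apply: measurable_funB => //; apply: measurable_funB => //.
  apply: measurable_funB => //; exact: measurableT_comp.
rewrite QE// null_set_integral//.
by apply/measurable_EFinP; exact: measurable_funTS.
Qed.

Lemma noise_from_priorC phi t h : Theta M phi -> 0 <= t ->
  noise_from (priorC M phi t h) t phi.
Proof.
move=> Tphi t0; have [_ /(_ _ Tphi) [_ nQ]] := hM.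
exact: (noise_from_conditioned h t0 nQ).
Qed.

Lemma priorC_ae phi t h (S : set Omega) : Theta M phi -> 0 <= t ->
  {ae P, forall w, S w} -> {ae priorC M phi t h, forall w, S w}.
Proof.
move=> Tphi t0 [N [mN PN SN]]; exists N; split => //.
exact: (conditioned_null t h (prior_null Tphi mN PN) mN).
Qed.

Lemma noise_from_P t : 0 <= t -> noise_from P t (no_distortion R).
Proof. by move=> t0; have [[_ _ _ _ nP] _] := hM; exact: noise_under_from t0 nP. Qed.

End noise_from.

(** * Brownian increments and elementary integrals on a grid *)

Section brownian_increments.
Context {R : realType} {d} {Omega : measurableType d} (M : market R Omega) (hM : market_ok M).
Notation T := (horizon (par M)).

Definition brownian_from (Q : probability Omega R) (t : R) (B : R -> Omega -> R) : Prop :=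
  [/\ forall s, t <= s -> Gmeasurable M s (B s),
      forall s u (C : set R), t <= s -> s < u -> measurable C ->
        Q [set w | C (B u w - B s w)] = normal_prob 0 (Num.sqrt (u - s)) C &
      forall s u (E : set Omega) (C : set R), t <= s -> s < u -> filtG M s E -> measurable C ->
        Q (E `&` [set w | C (B u w - B s w)]) = (Q E * Q [set w | C (B u w - B s w)%R])%E].

Lemma Gmeasurable_shifted (W : R -> Omega -> R) f s : Gmeasurable M s (W s) ->
  Gmeasurable M s (shifted M W f s).
Proof.
move=> /GmeasurableE mW; apply/GmeasurableE; rewrite /shifted.
by apply: measurable_funD.
Qed.

(** The drift correction is deterministic, so an increment of the shifted process is an increment of
    [W1] plus a constant and inherits its independence of the past. *)
Lemma brownian_from_noise1 Q t phi : 0 <= t -> noise_from M Q t phi ->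
  brownian_from Q t (shifted M (W1 M) (phi1 phi)).
Proof.
move=> t0 [N1 N2 N3 N4 ind]; split => //.
  by move=> s ts; apply: Gmeasurable_shifted; apply: Gmeasurable_W1; exact: le_trans ts.
move=> s u E C ts su sE mC.
pose c := \int[lebesgue_measure]_(x in `[0, Order.min u T]) phi1 phi x -
   \int[lebesgue_measure]_(x in `[0, Order.min s T]) phi1 phi x.
have iW := @increments_sub _ _ _ (W1 M) _ _ _ c (ltW su) mC.
have -> : [set w | C (shifted M (W1 M) (phi1 phi) u w - shifted M (W1 M) (phi1 phi) s w)] =
    [set w | C (W1 M u w - W1 M s w + c)].
  by apply/seteqP; split => w /=; rewrite /shifted opprD addrACA.
have := ind s E _ setT setT ts sE iW (@sigma_setT _ _) (@sigma_setT _ _).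
by rewrite !setIT !probability_setT !mule1.
Qed.

Lemma brownian_from_noise2 Q t phi : 0 <= t -> noise_from M Q t phi ->
  brownian_from Q t (shifted M (W2 M) (phi2 phi)).
Proof.
move=> t0 [N1 N2 N3 N4 ind]; split => //.
  by move=> s ts; apply: Gmeasurable_shifted; apply: Gmeasurable_W2; exact: le_trans ts.
move=> s u E C ts su sE mC.
pose c := \int[lebesgue_measure]_(x in `[0, Order.min u T]) phi2 phi x -
   \int[lebesgue_measure]_(x in `[0, Order.min s T]) phi2 phi x.
have iW := @increments_sub _ _ _ (W2 M) _ _ _ c (ltW su) mC.
have -> : [set w | C (shifted M (W2 M) (phi2 phi) u w - shifted M (W2 M) (phi2 phi) s w)] =
    [set w | C (W2 M u w - W2 M s w + c)].
  by apply/seteqP; split => w /=; rewrite /shifted opprD addrACA.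
have := ind s E setT _ setT ts sE (@sigma_setT _ _) iW (@sigma_setT _ _).
by rewrite !setIT !probability_setT !mule1.
Qed.

Section increments.
Variables (Q : probability Omega R) (t : R) (B : R -> Omega -> R).
Hypotheses (t0 : 0 <= t) (hB : brownian_from Q t B).
Variables (s u : R).
Hypotheses (ts : t <= s) (su : s <= u).
Let Delta w := B u w - B s w.

Let s0 : 0 <= s. Proof. exact: le_trans ts. Qed.

Let mDelta : Tmeasurable Delta.
Proof.
have [GB _ _] := hB.
apply: measurable_funB.
  apply: (Gmeasurable_measurable hM (le_trans s0 su)); apply: GB; exact: le_trans su.
by apply: (Gmeasurable_measurable hM s0); exact: GB.
Qed.

Lemma increment_sqr_integrable : L1 Q setT (fun w => Delta w ^+ 2).
Proof.
have [_ law _] := hB; have [us|us] := ltP s u.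
  apply: (@normal_law_sqr_integrable _ _ _ _ _ (Num.sqrt (u - s))) => //.
    by rewrite sqrtr_gt0 subr_gt0.
  by move=> C mC; rewrite -law.
have E : u = s by apply/eqP; rewrite eq_le us su.
rewrite (_ : (fun w => _) = fun=> 0); first exact: integrable_cst.
by apply/funext => w; rewrite /Delta E subrr expr0n.
Qed.

Lemma increment_integrable : L1 Q setT Delta.
Proof. by apply: integrable_of_sqr => //; exact: increment_sqr_integrable. Qed.

Lemma increment_expectation : \int[Q]_w Delta w = 0.
Proof.
have [_ law _] := hB; have [us|us] := ltP s u.
  apply: (@normal_law_expectation _ _ _ _ _ (Num.sqrt (u - s))) => //.
    by rewrite sqrtr_gt0 subr_gt0.
  by move=> C mC; rewrite -law.
have E : u = s by apply/eqP; rewrite eq_le us su.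
rewrite (@eq_Rintegral _ _ _ _ _ (fun=> 0)) ?expectation_cst_real//.
by move=> w _; rewrite /Delta E subrr.
Qed.

Lemma increment_sqr : \int[Q]_w (Delta w ^+ 2) = u - s.
Proof.
have [_ law _] := hB; have [us|us] := ltP s u.
  rewrite (@normal_law_sqr _ _ _ _ _ (Num.sqrt (u - s))) //.
  - by rewrite sqr_sqrtr// subr_ge0.
  - by rewrite sqrtr_gt0 subr_gt0.
  - by move=> C mC; rewrite -law.
have E : u = s by apply/eqP; rewrite eq_le us su.
rewrite [in RHS]E subrr (@eq_Rintegral _ _ _ _ _ (fun=> 0)) ?expectation_cst_real//.
by move=> w _; rewrite /Delta E subrr expr0n.
Qed.

Variable X : Omega -> R.
Hypotheses (GX : Gmeasurable M s X) (iX : L1 Q setT X).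

Let mX : Tmeasurable X. Proof. exact: (Gmeasurable_measurable hM s0). Qed.

(** When [u = s] the increment vanishes identically and the event is either everything or empty,
    which is independent of anything. *)
Let ind A C : measurable A -> measurable C ->
  Q (X @^-1` A `&` Delta @^-1` C) = (Q (X @^-1` A) * Q (Delta @^-1` C))%E.
Proof.
move=> mA mC; have [_ _ indB] := hB; have [us|us] := ltP s u.
  by apply: indB => //; exact: GX.
have E : u = s by apply/eqP; rewrite eq_le us su.
have [C0|C0] := pselect (C 0).
  have -> : Delta @^-1` C = setT.
    by apply/seteqP; split => // w _; rewrite /= /Delta E subrr.
  by rewrite setIT probability_setT mule1.
have -> : Delta @^-1` C = set0.
  by apply/seteqP; split => // w; rewrite /= /Delta E subrr => /C0.
by rewrite setI0 measure0 mule0.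
Qed.

Let ind2 A C : measurable A -> measurable C ->
  Q (X @^-1` A `&` (fun w => Delta w ^+ 2) @^-1` C) =
  (Q (X @^-1` A) * Q ((fun w => Delta w ^+ 2)%R @^-1` C))%E.
Proof.
move=> mA mC; apply: (ind mA (C := [set x | C (x ^+ 2)])).
rewrite -[X in measurable X]setTI.
by apply: (measurable_funX 2 (@measurable_id _ _ _)).
Qed.

Lemma increment_mul_integrable : L1 Q setT (fun w => X w * Delta w).
Proof. by apply: integrable_indepM => //; exact: increment_integrable. Qed.

Lemma increment_mul_expectation : \int[Q]_w (X w * Delta w) = 0.
Proof.
rewrite Rintegral_indepM//; last exact: increment_integrable.
by rewrite increment_expectation mulr0.
Qed.

Let mD2 : Tmeasurable (fun w => Delta w ^+ 2). Proof. exact: measurable_funX. Qed.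

Lemma increment_mul_sqr_integrable : L1 Q setT (fun w => X w * Delta w ^+ 2).
Proof. exact: (integrable_indepM mX mD2 ind2 iX increment_sqr_integrable). Qed.

Lemma increment_mul_sqr : \int[Q]_w (X w * Delta w ^+ 2) = (\int[Q]_w X w) * (u - s).
Proof.
rewrite (Rintegral_indepM mX mD2 ind2 iX increment_sqr_integrable).
by rewrite increment_sqr.
Qed.

End increments.

Lemma Gmeasurable_cst s (k : R) : Gmeasurable M s (fun=> k).
Proof. by apply/GmeasurableE; exact: measurable_cst. Qed.

Lemma GmeasurableD s X Y : Gmeasurable M s X -> Gmeasurable M s Y ->
  Gmeasurable M s (fun w => X w + Y w).
Proof. by move=> /GmeasurableE ? /GmeasurableE ?; apply/GmeasurableE; exact: measurable_funD. Qed.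

Lemma GmeasurableB s X Y : Gmeasurable M s X -> Gmeasurable M s Y ->
  Gmeasurable M s (fun w => X w - Y w).
Proof. by move=> /GmeasurableE ? /GmeasurableE ?; apply/GmeasurableE; exact: measurable_funB. Qed.

Lemma GmeasurableM s X Y : Gmeasurable M s X -> Gmeasurable M s Y ->
  Gmeasurable M s (fun w => X w * Y w).
Proof. by move=> /GmeasurableE ? /GmeasurableE ?; apply/GmeasurableE; exact: measurable_funM. Qed.

Lemma Gmeasurable_sum s (I : Type) (r : seq I) (p : pred I) (X : I -> Omega -> R) :
  (forall i, p i -> Gmeasurable M s (X i)) ->
  Gmeasurable M s (fun w => \sum_(i <- r | p i) X i w).
Proof.
move=> GX; elim: r => [|i r ih].
  by under eq_fun do rewrite big_nil; exact: Gmeasurable_cst.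
have [pi|/negbTE npi] := boolP (p i).
  by under eq_fun do rewrite big_cons pi; apply: GmeasurableD => //; exact: GX.
by under eq_fun do rewrite big_cons npi.
Qed.

Lemma Gmeasurable_indic s A : filtG M s A -> Gmeasurable M s (\1_A).
Proof.
by move=> sA; apply/GmeasurableE; apply: measurable_indic.
Qed.

Section grid.
Variables (Q : probability Omega R) (t : R) (B : R -> Omega -> R).
Hypotheses (t0 : 0 <= t) (hB : brownian_from Q t B).
Variables (g : nat -> R) (V : nat -> Omega -> R) (K : nat -> R).
Hypotheses (g_le : forall j, g j <= g j.+1) (tg : forall j, t <= g j).
Hypotheses (GV : forall j, Gmeasurable M (g j) (V j)).
Hypothesis VK : forall j w, `|V j w| <= K j.

Let g0 j : 0 <= g j. Proof. exact: le_trans (tg j). Qed.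
Let mV j : Tmeasurable (V j).
Proof. exact: (Gmeasurable_measurable hM (g0 j)). Qed.

Definition grid_sum m w := \sum_(j < m) V j w * (B (g j.+1) w - B (g j) w).

Lemma grid_sum_Gmeasurable m : Gmeasurable M (g m) (grid_sum m).
Proof.
have gle i j : (i <= j)%N -> g i <= g j.
  by move=> ij; apply: (homo_leq (r := fun x y : R => x <= y) _ _ g_le ij) => // y x z; exact: le_trans.
have [GB _ _] := hB.
apply: Gmeasurable_sum => i _; apply: GmeasurableM.
  by apply: (Gmeasurable_le _ (@GV i)); apply: gle; exact: ltnW.
apply: GmeasurableB; apply: (Gmeasurable_le _ (GB _ (tg _))); apply: gle => //.
exact: ltnW.
Qed.

Let mS m : Tmeasurable (grid_sum m).
Proof. exact: (Gmeasurable_measurable hM (g0 m) (@grid_sum_Gmeasurable m)). Qed.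

Let iV2 j : L1 Q setT (fun w => V j w ^+ 2).
Proof.
apply: (@le_integrable _ _ _ _ _ _ _ (fun=> (K j ^+ 2)%:E)) => //.
- by apply/measurable_EFinP; exact: measurable_funX.
- move=> w _ /=; rewrite lee_fin !ger0_norm ?sqr_ge0//.
  rewrite -(real_normK (num_real (V j w))) lerXn2r ?nnegrE//.
  exact: le_trans (VK j w).
- exact: integrable_cst.
Qed.

(** One step of the isometry. [grid_sum m * V m] is known at time [g m], hence independent of the
    next increment, which has mean 0: this kills the cross term. *)
Let grid_step m : L1 Q setT (fun w => grid_sum m w ^+ 2) ->
  let D w := V m w * (B (g m.+1) w - B (g m) w) in
  [/\ L1 Q setT (fun w => D w ^+ 2),
      \int[Q]_w (D w ^+ 2) = (\int[Q]_w (V m w ^+ 2)) * (g m.+1 - g m),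
      L1 Q setT (fun w => grid_sum m w * D w),
      \int[Q]_w (grid_sum m w * D w) = 0 & \int[Q]_w D w = 0].
Proof.
move=> iS D.
have GV2 : Gmeasurable M (g m) (fun w => V m w ^+ 2) by exact: GmeasurableM.
have D2E : (fun w => D w ^+ 2) = (fun w => V m w ^+ 2 * (B (g m.+1) w - B (g m) w) ^+ 2).
  by apply/funext => w; rewrite /D exprMn.
have SDE : (fun w => grid_sum m w * D w) =
    (fun w => (grid_sum m w * V m w) * (B (g m.+1) w - B (g m) w)).
  by apply/funext => w; rewrite /D mulrA.
have GSV : Gmeasurable M (g m) (fun w => grid_sum m w * V m w).
  by apply: GmeasurableM => //; exact: grid_sum_Gmeasurable.
have iSV : L1 Q setT (fun w => grid_sum m w * V m w).
  exact: integrable_sqr_mul.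
split.
- rewrite D2E; exact: (increment_mul_sqr_integrable t0 hB).
- rewrite D2E; exact: (increment_mul_sqr t0 hB).
- rewrite SDE; exact: (increment_mul_integrable t0 hB).
- rewrite SDE; exact: (increment_mul_expectation t0 hB).
- by apply: (increment_mul_expectation t0 hB) => //; exact: integrable_of_sqr.
Qed.

Let grid_sumS m : grid_sum m.+1 = fun w => grid_sum m w + V m w * (B (g m.+1) w - B (g m) w).
Proof. by apply/funext => w; rewrite /grid_sum big_ord_recr. Qed.

Let mD m : Tmeasurable (fun w => V m w * (B (g m.+1) w - B (g m) w)).
Proof.
have [GB _ _] := hB; apply: measurable_funM => //; apply: measurable_funB.
  by apply: (Gmeasurable_measurable hM (g0 m.+1)); exact: GB.
by apply: (Gmeasurable_measurable hM (g0 m)); exact: GB.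
Qed.

Lemma grid_sum_sqr_integrable m : L1 Q setT (fun w => grid_sum m w ^+ 2).
Proof.
elim: m => [|m ih].
  rewrite (_ : (fun w => _) = fun=> 0); first exact: integrable_cst.
  by apply/funext => w; rewrite /grid_sum big_ord0 expr0n.
by have [iD _ _ _ _] := grid_step ih; rewrite grid_sumS; apply: integrable_sqrD.
Qed.

Lemma grid_sum_expectation m : \int[Q]_w grid_sum m w = 0.
Proof.
elim: m => [|m ih].
  rewrite (@eq_Rintegral _ _ _ _ _ (fun=> 0)) ?expectation_cst_real//.
  by move=> w _; rewrite /grid_sum big_ord0.
have iS := grid_sum_sqr_integrable m.
have [iD _ _ _ D0] := grid_step iS.
rewrite grid_sumS RintegralD//; last 2 first.
- exact: integrable_of_sqr.
- exact: (integrable_of_sqr (mD m)).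
by rewrite ih D0 addr0.
Qed.

Lemma grid_isometry m :
  \int[Q]_w (grid_sum m w ^+ 2) = \sum_(j < m) (\int[Q]_w (V j w ^+ 2)) * (g j.+1 - g j).
Proof.
elim: m => [|m ih].
  rewrite big_ord0 (@eq_Rintegral _ _ _ _ _ (fun=> 0)) ?expectation_cst_real//.
  by move=> w _; rewrite /grid_sum big_ord0 expr0n.
have iS := grid_sum_sqr_integrable m.
have [iD D2 iSD SD0 _] := grid_step iS.
rewrite big_ord_recr/= -ih -D2 grid_sumS.
rewrite (@eq_Rintegral _ _ _ _ _ (fun w => grid_sum m w ^+ 2 +
  2 * (grid_sum m w * (V m w * (B (g m.+1) w - B (g m) w))) +
  (V m w * (B (g m.+1) w - B (g m) w)) ^+ 2)); last by move=> w _; ring.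
rewrite RintegralD//; last exact: integrable_realD (integrable_realZ _ _ iSD).
rewrite RintegralD//; last exact: integrable_realZ.
by rewrite RintegralZl// SD0 mulr0 addr0.
Qed.

Lemma chebyshev_sqr (X : Omega -> R) a : 0 < a -> Tmeasurable X ->
  L1 Q setT (fun w => X w ^+ 2) ->
  (Q [set w | (a <= `|X w|)%R] <= ((\int[Q]_w (X w ^+ 2)) / a ^+ 2)%:E)%E.
Proof.
move=> a0 mX iX.
have mA : measurable [set w | (a <= `|X w|)%R].
  rewrite -[X in measurable X]setTI.
  have := measurableT_comp (@normr_measurable R setT) mX.
  by move=> /(_ measurableT _ (measurable_itv `[a, +oo[)); under eq_set do rewrite /= in_itv/= andbT.
have a20 : 0 < a ^+ 2 by rewrite exprn_gt0.
rewrite EFinM lee_pdivlMr//.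
rewrite /Rintegral fineK; last exact: (integrable_fin_num measurableT iX).
rewrite muleC -(setIT [set w | _]) -integral_indic// -ge0_integralZl ?lee_fin ?(ltW a20)//; last first.
  by apply/measurable_EFinP; exact: measurable_indic.
apply: ge0_le_integral => //.
- by move=> w _; rewrite -EFinM lee_fin mulr_ge0// sqr_ge0.
- by apply: emeasurable_funM => //; apply/measurable_EFinP; exact: measurable_indic.
- by apply/measurable_EFinP; exact: measurable_funX.
- move=> w _; rewrite -EFinM lee_fin indicE.
  case: (boolP (w \in _)) => [|_]; rewrite ?mulr0 ?sqr_ge0// inE/= mulr1 => aX.
  by rewrite -[leRHS]real_normK ?num_real// lerXn2r// nnegrE// ltW.
Qed.

End grid.
End brownian_increments.

Arguments Gmeasurable_shifted {R d Omega M} W f {s} _.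
Arguments GmeasurableD {R d Omega M s X Y} _ _.
Arguments GmeasurableB {R d Omega M s X Y} _ _.
Arguments GmeasurableM {R d Omega M s X Y} _ _.
Arguments Gmeasurable_indic {R d Omega M s A} _.

Section truncation.
Context {R : realType} {d} {Omega : measurableType d} (M : market R Omega) (hM : market_ok M).
Notation T := (horizon (par M)).
Variables (Q : probability Omega R) (t : R) (B : R -> Omega -> R).
Hypotheses (t0 : 0 <= t) (hB : brownian_from M Q t B).
Variables (g : nat -> R) (V : nat -> Omega -> R) (K : nat -> R).
Hypotheses (g_le : forall j, g j <= g j.+1) (tg : forall j, t <= g j).
Hypothesis GV : forall j, Gmeasurable M (g j) (V j).
Hypothesis VK : forall j w, `|V j w| <= K j.

Definition energy m w := \sum_(j < m) V j w ^+ 2 * (g j.+1 - g j).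

Let gle i j : (i <= j)%N -> g i <= g j.
Proof.
by move=> ij; apply: (homo_leq (r := fun x y : R => x <= y) _ _ g_le ij) => // y x z; exact: le_trans.
Qed.

Let energyS m w : energy m.+1 w = energy m w + V m w ^+ 2 * (g m.+1 - g m).
Proof. by rewrite /energy big_ord_recr. Qed.

Let energy_le i j w : (i <= j)%N -> energy i w <= energy j w.
Proof.
move=> ij; apply: (homo_leq (f := energy ^~ w) (r := fun x y : R => x <= y) _ _ _ ij) => //.
  by move=> y x z; exact: le_trans.
by move=> k; rewrite energyS lerDl mulr_ge0 ?sqr_ge0// subr_ge0.
Qed.

(** The energy up to and including step [j] is known already at the start [g j] of that step,
    because the integrand is fixed there. This makes the truncation below adapted. *)
Let Genergy j : Gmeasurable M (g j) (energy j.+1).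
Proof.
apply: Gmeasurable_sum => i _.
have GVj : Gmeasurable M (g j) (V i).
  by apply: (Gmeasurable_le _ (@GV i)); apply: gle; rewrite -ltnS.
apply: GmeasurableM; last exact: Gmeasurable_cst.
exact: GmeasurableM.
Qed.

Let Genergy_le j b : filtG M (g j) [set w | energy j.+1 w <= b].
Proof.
have := @Genergy j `]-oo, b]%classic (measurable_itv _).
by congr (filtG M (g j) _); apply/seteqP; split => w /=; rewrite in_itv.
Qed.

(** The integrand is switched off as soon as the energy would exceed [b]. The truncated sum has
    second moment at most [b], so Chebyshev applies to it, and it equals the original sum wherever
    the total energy is at most [b]. This transfers smallness in probability from energies to
    integrals. *)
Lemma grid_sum_prob m a b : 0 < a -> 0 <= b ->
  (Q [set w | (a <= `|grid_sum B g V m w|)%R] <=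
   Q [set w | (b < energy m w)%R] + (b / a ^+ 2)%:E)%E.
Proof.
move=> a0 b0.
pose A j := [set w | energy j.+1 w <= b].
pose V' j w := V j w * \1_(A j) w.
have GV' j : Gmeasurable M (g j) (V' j).
  by apply: GmeasurableM => //; apply: Gmeasurable_indic; exact: Genergy_le.
have V'K j w : `|V' j w| <= K j.
  rewrite normrM; apply: le_trans (VK j w).
  by rewrite ler_piMr// indicE; case: (w \in A j); rewrite ?normr1 ?normr0.
have mS V0 K0 : (forall j, Gmeasurable M (g j) (V0 j)) -> (forall j w, `|V0 j w| <= K0 j) ->
    Tmeasurable (grid_sum B g V0 m).
  move=> GV0 VK0; apply: (Gmeasurable_measurable hM (t := g m)).
    exact: le_trans (tg m).
  exact: (grid_sum_Gmeasurable hB g_le tg).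
have mabs V0 K0 : (forall j, Gmeasurable M (g j) (V0 j)) -> (forall j w, `|V0 j w| <= K0 j) ->
    measurable [set w | a <= `|grid_sum B g V0 m w|].
  move=> GV0 VK0; rewrite -[X in measurable X]setTI.
  have := measurableT_comp (@normr_measurable R setT) (mS _ _ GV0 VK0).
  by move=> /(_ measurableT _ (measurable_itv `[a, +oo[)); under eq_set do rewrite /= in_itv/= andbT.
have men : measurable [set w | b < energy m w].
  have h : Tmeasurable (energy m).
    apply: (Gmeasurable_measurable hM (t := g m)); first exact: le_trans (tg m).
    apply: Gmeasurable_sum => i _.
    have GVj : Gmeasurable M (g m) (V i).
      by apply: (Gmeasurable_le _ (@GV i)); apply: gle; exact: ltnW.
    apply: GmeasurableM; last exact: Gmeasurable_cst.
    exact: GmeasurableM.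
  rewrite -[X in measurable X]setTI.
  by have := h measurableT _ (measurable_itv `]b, +oo[); under eq_set do rewrite /= in_itv/= andbT.
have V'b k w : \sum_(j < k) V' j w ^+ 2 * (g j.+1 - g j) <= b.
  elim: k => [|k ih]; first by rewrite big_ord0.
  rewrite big_ord_recr/= {2}/V' indicE.
  have [|_] := boolP (w \in A k); last by rewrite mulr0 expr0n mul0r addr0.
  rewrite inE /A/= mulr1 => h; apply: le_trans h; rewrite energyS lerD2r.
  apply: ler_sum => i _; rewrite ler_wpM2r ?subr_ge0// /V' exprMn ler_piMr ?sqr_ge0//.
have sub : [set w | a <= `|grid_sum B g V m w|] `<=`
    [set w | b < energy m w] `|` [set w | a <= `|grid_sum B g V' m w|].
  move=> w /= aS; have [eb|be] := leP (energy m w) b; last by left.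
  right; suff <- : grid_sum B g V m w = grid_sum B g V' m w by [].
  apply: eq_bigr => j _; rewrite /V' indicE mem_set ?mulr1//=.
  by apply: le_trans eb; exact: energy_le.
apply: (@le_trans _ _ (Q ([set w | (b < energy m w)%R] `|` [set w | (a <= `|grid_sum B g V' m w|)%R]))).
  apply: le_measure => //; rewrite inE; first exact: (mabs V K).
  by apply: measurableU => //; exact: (mabs V' K).
apply: (le_trans (measureU2 _ _ _)) => //; first exact: (mabs V' K).
rewrite leeD2l//; apply: (le_trans (chebyshev_sqr a0 (mS _ _ GV' V'K) _)).
  exact: (grid_sum_sqr_integrable hM t0 hB g_le tg GV' V'K).
rewrite lee_fin ler_pM2r ?invr_gt0 ?exprn_gt0//.
rewrite (grid_isometry hM t0 hB g_le tg GV' V'K).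
have iV' j : L1 Q setT (fun w => V' j w ^+ 2).
  apply: (@le_integrable _ _ _ _ _ _ _ (fun=> (K j ^+ 2)%:E)) => //.
  - apply/measurable_EFinP; apply: measurable_funX.
    exact: (Gmeasurable_measurable hM (le_trans t0 (tg j)) (@GV' j)).
  - move=> w _ /=; rewrite lee_fin !ger0_norm ?sqr_ge0//.
    rewrite -(real_normK (num_real (V' j w))) lerXn2r ?nnegrE//.
    exact: le_trans (V'K j w).
  - exact: integrable_cst.
under eq_bigr do rewrite mulrC -RintegralZl//.
rewrite -Rintegral_sum//; last by move=> i _; exact: integrable_realZ.
apply: (@le_trans _ _ (\int[Q]_w b)); last by rewrite expectation_cst_real.
apply: le_Rintegral => //.
- by apply: integrable_real_sum => // i _; exact: integrable_realZ.
- exact: integrable_cst.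
- by move=> w _; under eq_bigr do rewrite mulrC; exact: V'b.
Qed.

End truncation.

(** * Simple processes on a common sorted grid *)

Section regrid.
Context {R : realType}.

Lemma grid_telescope (g : nat -> R) m (l r : R) (F : R -> R) :
  (forall j, g j <= g j.+1) -> l <= r -> g 0%N <= l -> r <= g m ->
  (forall j, (j < m)%N -> g j < l -> g j.+1 <= l) ->
  (forall j, (j < m)%N -> g j < r -> g j.+1 <= r) ->
  \sum_(j < m) ((l <= g j < r)%R : bool)%:R * (F (g j.+1) - F (g j)) = F r - F l.
Proof.
move=> gle lr g0 gm gl gr.
(* Clamping the grid to [[l, r]]: a cell inside contributes its increment of [F], a cell outside
   contributes 0, and no cell straddles an endpoint by [gl] and [gr]. *)
pose c x := Num.max l (Num.min x r).
have -> : F r - F l = F (c (g m)) - F (c (g 0%N)).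
  rewrite /c (min_r gm) (max_r lr) (min_l (le_trans g0 lr)).
  by rewrite (max_l g0).
rewrite -(telescope_sumr (fun j => F (c (g j)))) // big_mkord.
apply: eq_bigr => j _; rewrite /c; have jm := ltn_ord j.
have [lg|] := boolP (l <= g j); last first.
  rewrite -ltNge /= => gl'.
  rewrite mul0r (min_l (le_trans (ltW gl') lr)) (max_l (ltW gl')).
  by rewrite (min_l (le_trans (gl _ jm gl') lr)) (max_l (gl _ jm gl')) subrr.
have [gr'|] := boolP (g j < r) => /=; last first.
  rewrite -leNgt => rg.
  by rewrite mul0r (min_r rg) (min_r (le_trans rg (gle _))) subrr.
rewrite mul1r (min_l (ltW gr')) (max_r lg) (min_l (gr _ jm gr')).
by rewrite max_r// (le_trans lg).
Qed.

Lemma sorted_grid (s : seq R) (x0 T : R) : (forall x, x \in s -> x0 <= x <= T) -> x0 <= T ->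
  exists (g : nat -> R) (m : nat), [/\ forall j, g j <= g j.+1,
    forall j, x0 <= g j <= T,
    forall x, x \in s -> g 0%N <= x <= g m &
    forall x j, x \in s -> (j < m)%N -> g j < x -> g j.+1 <= x].
Proof.
move=> sb x0T.
pose s' := sort <=%R s.
have ss' : sorted <=%R s' by exact: sort_le_sorted.
have ms' x : (x \in s') = (x \in s) by rewrite mem_sort.
have [s0|s0] := eqVneq (size s') 0%N.
  have sn x : x \in s -> False by rewrite -ms' (size0nil s0).
  exists (fun=> x0), 0%N; split => //.
    by move=> j; rewrite lexx.
  by move=> x /sn.
pose L := last x0 s'.
have s_gt0 : (0 < size s')%N by rewrite lt0n.
have Ls : L \in s'.
  by rewrite /L; case: (s') s0 => //= a l _; exact: mem_last.
(* The default of [nth] is the last point, so the grid stays monotone by being constant after its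
   end. *)
pose g j := nth L s' j.
have gj j : g j \in s'.
  by rewrite /g; have [js|js] := ltnP j (size s'); [exact: mem_nth|rewrite nth_default].
have lenth i j : (i <= j)%N -> (j < size s')%N -> g i <= g j.
  move=> ij js; apply: (sorted_leq_nth le_trans lexx) => //; rewrite inE.
  exact: leq_ltn_trans js.
have gL j : (size s' <= j.+1)%N -> g j = L.
  rewrite leq_eqVlt => /predU1P[sj|]; last by move=> h; rewrite /g nth_default.
  by rewrite /g {2}/L (last_nth L) sj.
have gle j : g j <= g j.+1.
  have [js|js] := ltnP j.+1 (size s'); first exact: lenth.
  by rewrite !gL// (leq_trans js).
exists g, (size s').-1; split => //.
- by move=> j; apply: sb; rewrite -ms'.
- move=> x; rewrite -ms' => xs; rewrite -(nth_index L xs); apply/andP; split.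
    by apply: (lenth 0%N) => //; rewrite index_mem.
  apply: lenth; last by rewrite ltn_predL.
  by rewrite -ltnS prednK// index_mem.
- move=> x j; rewrite -ms' => xs jm gx; rewrite -(nth_index L xs).
  apply: (lenth j.+1); last by rewrite index_mem.
  rewrite ltnNge; apply: contraTN gx => ij; rewrite -leNgt -[X in X <= _](nth_index L xs).
  by apply: (lenth (index x s')) => //; rewrite (leq_trans jm)// leq_pred.
Qed.

Lemma indic_oc (l r x : R) : l <= r ->
  \1_(`]l, r]) x = ((x <= r)%R : bool)%:R - ((x <= l)%R : bool)%:R :> R.
Proof.
move=> lr; rewrite indicE; have [xl|xl] := leP x l.
  rewrite (le_trans xl lr) subrr; have -> // : (x \in `]l, r]%classic) = false.
  by apply/negbTE; rewrite notin_setE/= in_itv/= => /andP[]; rewrite ltNge xl.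
rewrite subr0; congr (nat_of_bool _)%:R.
by apply/idP/idP; rewrite inE/= in_itv/= xl.
Qed.

End regrid.

Section simple_processes.
Context {R : realType} {d} {Omega : measurableType d} (M : market R Omega) (hM : market_ok M).
Notation P := (Pr M).
Notation T := (horizon (par M)).
Notation leb := (@lebesgue_measure R).

(** On a cell of the sorted grid the new value [V j] is the sum of the old values whose intervals
    contain that cell. The identity is stated for every [F], so that it applies to Brownian paths,
    giving integrals, and to indicators, giving the process itself. *)
Lemma simple_regrid (S : simple R Omega) t : simple_ok M t S -> t <= T ->
  exists (g : nat -> R) (m : nat) (V : nat -> Omega -> R) (K : nat -> R),
  [/\ forall j, g j <= g j.+1, forall j, t <= g j <= T,
      forall j, Gmeasurable M (g j) (V j), forall j w, `|V j w| <= K j &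
      forall (F : R -> R) w, \sum_(i < slen S) svalue i w * (F (sright i) - F (sleft i)) =
        \sum_(j < m) V j w * (F (g j.+1) - F (g j))].
Proof.
move=> okS tT.
pose s := [seq sleft i | i <- enum 'I_(slen S)] ++ [seq sright i | i <- enum 'I_(slen S)].
have ls i : sleft (s := S) i \in s by rewrite mem_cat map_f ?mem_enum.
have rs i : sright (s := S) i \in s by rewrite mem_cat orbC map_f ?mem_enum.
have sb x : x \in s -> t <= x <= T.
  rewrite mem_cat => /orP[] /mapP[i _ ->].
    by have [tl lr rT _ _] := okS i; rewrite tl (le_trans lr).
  by have [tl lr rT _ _] := okS i; rewrite rT (le_trans tl).
have [g [m [gle gb gs gstep]]] := sorted_grid sb tT.
have /choice[c cP] : forall i : 'I_(slen S), exists K : R, forall w, `|svalue i w| <= K.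
  by move=> i; have [] := okS i.
exists g, m, (fun j w => \sum_(i < slen S) ((sleft i <= g j < sright i)%R : bool)%:R * svalue i w),
  (fun j => \sum_(i < slen S) c i); split => //.
- move=> j; apply: Gmeasurable_sum => i _.
  have [lg|lg] := boolP (sleft i <= g j); last first.
    by under eq_fun do rewrite mul0r; exact: Gmeasurable_cst.
  apply: GmeasurableM; first exact: Gmeasurable_cst.
  by have [_ _ _ GS _] := okS i; exact: (Gmeasurable_le lg).
- move=> j w; apply: (le_trans (ler_norm_sum _ _ _)); apply: ler_sum => i _.
  rewrite normrM; apply: le_trans (cP i w).
  by rewrite ler_piMl//; case: (_ && _); rewrite ?normr1 ?normr0.
- move=> F w.
  under [RHS]eq_bigr do rewrite mulr_suml.
  rewrite exchange_big/=; apply: eq_bigr => i _.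
  have [_ lr _ _ _] := okS i.
  have /andP[g0l _] := gs _ (ls i); have /andP[_ rgm] := gs _ (rs i).
  rewrite -(grid_telescope (g := g) (m := m) F gle lr g0l rgm); first last.
  - by move=> j jm; exact: gstep.
  - by move=> j jm; exact: gstep.
  by rewrite mulr_sumr; apply: eq_bigr => j _; rewrite mulrA [svalue i w * _]mulrC.
Qed.

Lemma simple_valueE (S : simple R Omega) t s w : simple_ok M t S ->
  simple_value S s w = \sum_(i < slen S) svalue i w *
   (((s <= sright i)%R : bool)%:R - ((s <= sleft i)%R : bool)%:R).
Proof.
move=> okS; apply: eq_bigr => i _; rewrite indic_oc//.
by have [] := okS i.
Qed.

(** The cells are disjoint, so squaring a step function produces no cross terms. *)
Lemma step_sqr (g : nat -> R) (c : nat -> R) m (s : R) : (forall j, g j <= g j.+1) ->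
  (\sum_(j < m) c j * (((s <= g j.+1)%R : bool)%:R - ((s <= g j)%R : bool)%:R)) ^+ 2 =
  \sum_(j < m) c j ^+ 2 * \1_(`]g j, g j.+1]) s.
Proof.
move=> gle; under [RHS]eq_bigr do rewrite indic_oc//.
elim: m => [|m ih]; first by rewrite !big_ord0 expr0n.
rewrite !big_ord_recr/= -ih.
have [sm|sm] := leP s (g m).
  by rewrite (le_trans sm (gle m)) subrr !mulr0 !addr0.
have -> : \sum_(j < m) c j * (((s <= g j.+1)%R : bool)%:R - ((s <= g j)%R : bool)%:R) = 0 :> R.
  apply: big1 => j _.
  have h i : (i <= m)%N -> g i < s.
    move=> im; apply: le_lt_trans sm.
    by apply: (homo_leq (r := fun x y : R => x <= y) _ _ gle im) => // y x z; exact: le_trans.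
  by rewrite !leNgt !h ?subrr ?mulr0// ltnW.
by rewrite add0r expr0n add0r subr0 exprMn; case: (s <= g m.+1); rewrite ?expr1n ?expr0n.
Qed.

Lemma simple_energy (S : simple R Omega) t : simple_ok M t S -> t <= T ->
  forall (g : nat -> R) m (V : nat -> Omega -> R), (forall j, g j <= g j.+1) -> (forall j, t <= g j <= T) ->
  (forall (F : R -> R) w, \sum_(i < slen S) svalue i w * (F (sright i) - F (sleft i)) =
        \sum_(j < m) V j w * (F (g j.+1) - F (g j))) ->
  forall w, (\int[leb]_(s in `[t, T]) ((simple_value S s w) ^+ 2)%:E = (energy g V m w)%:E)%E.
Proof.
move=> okS tT g m V gle gb SE w.
under eq_integral.
  move=> s _; rewrite (simple_valueE _ _ okS).
  (* The regridding identity with [F] the indicator of [s <= x], whose increments are the indicators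
     of the half-open intervals. *)
  rewrite (SE (fun x => ((s <= x)%R : bool)%:R)) (step_sqr (V ^~ w))// -sumEFin.
  over.
rewrite /= ge0_integral_sum//.
- rewrite /energy -sumEFin; apply: eq_bigr => j _.
  under eq_integral do rewrite EFinM.
  rewrite ge0_integralZl//; last first.
    by rewrite lee_fin sqr_ge0.
  + by apply/measurable_EFinP; exact: measurable_indic.
  rewrite [RHS]EFinM integral_indic//=; congr (_ * _)%E.
  have /andP[tg gT] := gb j; have /andP[tg' gT'] := gb j.+1.
  rewrite setIidl; last first.
    move=> x /=; rewrite !in_itv/= => /andP[/ltW gx xg].
    by rewrite (le_trans tg gx) (le_trans xg).
  rewrite lebesgue_measure_itv/= lte_fin; case: ltP => h; first by rewrite EFinB.
  by rewrite (_ : g j.+1 = g j) ?subrr//; apply/eqP; rewrite eq_le h gle.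
- move=> j; apply/measurable_EFinP; exact: measurable_funM.
- by move=> j s _; rewrite lee_fin mulr_ge0// sqr_ge0.
Qed.

Variables (Q : probability Omega R) (t : R) (B : R -> Omega -> R).
Hypotheses (t0 : 0 <= t) (tT : t <= T) (hB : brownian_from M Q t B).

(** The integral up to [u] is a grid sum on the grid cut at [u]. Values on cells starting after [u]
    are set to 0, which keeps them known at the new grid point [u]; these cells have collapsed
    anyway. *)
Let stopped (S : simple R Omega) u : simple_ok M t S -> t <= u ->
  exists (g : nat -> R) (m : nat) (V : nat -> Omega -> R) (K : nat -> R) (g' : nat -> R),
  [/\ (forall j, g j <= g j.+1) /\ (forall j, t <= g j),
      (forall j, Gmeasurable M (g j) (V j)), (forall j w, `|V j w| <= K j),
      (forall w, simple_integral B S u w = grid_sum B g V m w) &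
      (forall w, ((energy g V m w)%:E <=
         \int[leb]_(s in `[t, T]) ((simple_value S s w) ^+ 2)%:E)%E) /\
      (T <= u -> (forall w, ((energy g V m w)%:E =
         \int[leb]_(s in `[t, T]) ((simple_value S s w) ^+ 2)%:E)%E))].
Proof.
move=> okS tu; have [g [m [V [K [gle gb GV VK SE]]]]] := simple_regrid okS tT.
pose g' j := Num.min (g j) u.
pose V' j w := ((g j <= u)%R : bool)%:R * V j w.
have g'le j : g' j <= g' j.+1 by rewrite /g' le_min2.
exists g', m, V', K, g'; split.
- by split=> // j; rewrite le_min tu andbT; case/andP: (gb j).
- move=> j; rewrite /V' /g'; have [gu|gu] := leP (g j) u.
    by apply: GmeasurableM; [exact: Gmeasurable_cst|exact: GV].
  by under eq_fun do rewrite mul0r; exact: Gmeasurable_cst.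
- move=> j w; apply: le_trans (VK j w).
  by rewrite normrM ler_piMl//; case: (g j <= u); rewrite ?normr1 ?normr0.
- move=> w; rewrite /simple_integral (SE (fun x => B (Num.min x u) w)).
  apply: eq_bigr => j _; rewrite /V' /g'; have [gu|gu] := leP (g j) u; first by rewrite mul1r.
  by rewrite min_r ?subrr ?mulr0 ?mul0r// (le_trans (ltW gu)).
- have E w := simple_energy okS tT gle gb SE w; split => [w|Tu w]; rewrite E.
    rewrite lee_fin; apply: ler_sum => j _; rewrite /V' exprMn /g'.
    have [gu|gu] := leP (g j) u.
      rewrite expr1n mul1r ler_wpM2l ?sqr_ge0// lerD2r.
      by rewrite ge_min lexx.
    by rewrite expr0n !mul0r mulr_ge0 ?sqr_ge0// subr_ge0.
  congr EFin; apply: eq_bigr => j _; rewrite /V' /g'.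
  have /andP[_ h1] := gb j; have /andP[_ h2] := gb j.+1.
  by rewrite !min_l ?(le_trans h1 Tu) ?(le_trans h2 Tu)// mul1r.
Qed.

Lemma simple_integral_sqr_integrable S u : simple_ok M t S -> t <= u ->
  L1 Q setT (fun w => simple_integral B S u w ^+ 2).
Proof.
move=> okS tu; have [g [m [V [K [g' [[gle tg] GV VK SE _]]]]]] := stopped okS tu.
under [X in _.-integrable _ (_ \o X)]eq_fun do rewrite SE.
exact: (grid_sum_sqr_integrable hM t0 hB gle tg GV VK).
Qed.

Lemma simple_integral_expectation S u : simple_ok M t S -> t <= u ->
  \int[Q]_w simple_integral B S u w = 0.
Proof.
move=> okS tu; have [g [m [V [K [g' [[gle tg] GV VK SE _]]]]]] := stopped okS tu.
under eq_Rintegral do rewrite SE.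
exact: (grid_sum_expectation hM t0 hB gle tg GV VK).
Qed.

Lemma simple_integral_Gmeasurable S u : simple_ok M t S -> t <= u ->
  Gmeasurable M u (simple_integral B S u).
Proof.
move=> okS tu; have [GB _ _] := hB; apply: Gmeasurable_sum => i _.
have [tl lr rT GS _] := okS i.
have [lu|ul] := leP (sleft i) u; last first.
  rewrite min_r; last exact: le_trans (ltW ul) lr.
  by under eq_fun do rewrite subrr mulr0; exact: Gmeasurable_cst.
apply: GmeasurableM; first exact: (Gmeasurable_le lu).
apply: GmeasurableB.
  apply: (@Gmeasurable_le _ _ _ _ (Num.min (sright i) u)); first by rewrite ge_min lexx orbT.
  by apply: GB; rewrite le_min tu andbT (le_trans tl).
by apply: (@Gmeasurable_le _ _ _ _ (sleft i)) => //; exact: GB.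
Qed.

(** The values of [S] may be random one by one, but the energy equals the integral of [f ^+ 2],
    which is deterministic; averaging the energy therefore gives the integral itself. *)
Lemma simple_integral_isometry S (f : R -> R) : simple_ok M t S ->
  (forall s w, simple_value S s w = f s) ->
  ((\int[Q]_w (simple_integral B S T w ^+ 2))%:E = \int[leb]_(s in `[t, T]) ((f s) ^+ 2)%:E)%E.
Proof.
move=> okS Sf; have [g [m [V [K [g' [[gle tg] GV VK SE [_ E]]]]]]] := stopped okS tT.
under eq_Rintegral do rewrite SE.
rewrite (grid_isometry hM t0 hB gle tg GV VK).
have iV j : L1 Q setT (fun w => V j w ^+ 2).
  apply: (@le_integrable _ _ _ _ _ _ _ (fun=> (K j ^+ 2)%:E)) => //.
  - apply/measurable_EFinP; apply: measurable_funX.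
    exact: (Gmeasurable_measurable hM (le_trans t0 (tg j)) (@GV j)).
  - move=> w _ /=; rewrite lee_fin !ger0_norm ?sqr_ge0//.
    rewrite -(real_normK (num_real (V j w))) lerXn2r ?nnegrE//.
    exact: le_trans (VK j w).
  - exact: integrable_cst.
under eq_bigr do rewrite mulrC -RintegralZl//.
rewrite -Rintegral_sum//; last by move=> i _; exact: integrable_realZ.
have EE w : \sum_(i < m) (g i.+1 - g i) * V i w ^+ 2 =
    fine (\int[leb]_(s in `[t, T]) ((f s) ^+ 2)%:E)%E.
  under eq_integral do rewrite -(Sf _ w).
  by rewrite -E//=; apply: eq_bigr => i _; rewrite mulrC.
under eq_Rintegral do rewrite EE.
rewrite expectation_cst_real fineK//.
have -> : (\int[leb]_(s in `[t, T]) ((f s) ^+ 2)%:E = (energy g V m point)%:E)%E.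
  by under eq_integral do rewrite -(Sf _ point); rewrite E.
by [].
Qed.

Lemma simple_integral_prob S u a b : simple_ok M t S -> t <= u -> 0 < a -> 0 <= b ->
  Tmeasurable (fun w => \int[leb]_(s in `[t, T]) ((simple_value S s w) ^+ 2)%:E)%E ->
  (Q [set w | (a <= `|simple_integral B S u w|)%R] <=
   Q [set w | b%:E < \int[leb]_(s in `[t, T]) ((simple_value S s w) ^+ 2)%:E] + (b / a ^+ 2)%:E)%E.
Proof.
move=> okS tu a0 b0 mI; have [g [m [V [K [g' [[gle tg] GV VK SE [E _]]]]]]] := stopped okS tu.
under [X in (Q X <= _)%E]eq_set do rewrite SE.
apply: (le_trans (grid_sum_prob hM t0 hB gle tg GV VK m a0 b0)).
rewrite leeD2r//; apply: le_measure; rewrite ?inE//.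
- have h : Tmeasurable (energy g V m).
    apply: measurable_sum => i; apply: measurable_funM => //; apply: measurable_funX.
    exact: (Gmeasurable_measurable hM (le_trans t0 (tg i)) (@GV i)).
  rewrite -[X in measurable X]setTI.
  by have := h measurableT _ (measurable_itv `]b, +oo[); under eq_set do rewrite /= in_itv/= andbT.
- rewrite -[X in measurable X]setTI.
  exact: emeasurable_fun_o_infty.
- by move=> w /= bE; apply: lt_le_trans (E w); rewrite lte_fin.
Qed.

End simple_processes.

Arguments simple_integral_Gmeasurable {R d Omega M Q t B} hB {S u} _ _.

(** * Uniqueness of Ito integrals *)

Section ito_uniqueness.
Context {R : realType} {d} {Omega : measurableType d} (M : market R Omega) (hM : market_ok M).
Notation P := (Pr M).
Notation T := (horizon (par M)).
Notation leb := (@lebesgue_measure R).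

Definition simple_sub (S S' : simple R Omega) : simple R Omega :=
  @Simple R d Omega (slen S + slen S')
    (fun i => match fintype.split i with inl j => sleft j | inr j => sleft j end)
    (fun i => match fintype.split i with inl j => sright j | inr j => sright j end)
    (fun i => match fintype.split i with inl j => svalue j | inr j => fun w => - svalue j w end).

Lemma simple_sub_ok t S S' : simple_ok M t S -> simple_ok M t S' ->
  simple_ok M t (simple_sub S S').
Proof.
move=> okS okS' i; rewrite /=; case: fintype.split => j; first exact: okS.
have [tl lr rT GS [K SK]] := okS' j; split => //; last first.
  by exists K => w; rewrite normrN.
have := GmeasurableB (@Gmeasurable_cst _ _ _ M (sleft j) 0) GS.
by under eq_fun do rewrite sub0r.
Qed.

Lemma simple_sub_value S S' s w :
  simple_value (simple_sub S S') s w = simple_value S s w - simple_value S' s w.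
Proof.
rewrite /simple_value big_split_ord/= -sumrN; congr (_ + _); apply: eq_bigr => i _.
  by case: split_ordP => j => [/lshift_inj <-//|/eqP]; rewrite eq_lrshift.
case: split_ordP => j => [/eqP|/rshift_inj <-]; first by rewrite eq_rlshift.
by rewrite mulNr.
Qed.

Lemma simple_sub_integral (W : R -> Omega -> R) S S' u w :
  simple_integral W (simple_sub S S') u w = simple_integral W S u w - simple_integral W S' u w.
Proof.
rewrite /simple_integral big_split_ord/= -sumrN; congr (_ + _); apply: eq_bigr => i _.
  by case: split_ordP => j => [/lshift_inj <-//|/eqP]; rewrite eq_lrshift.
case: split_ordP => j => [/eqP|/rshift_inj <-]; first by rewrite eq_rlshift.
by rewrite mulNr.
Qed.

Section measurability.
Variables (t : R) (S : simple R Omega).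
Hypotheses (t0 : 0 <= t) (okS : simple_ok M t S).

Let mS i : Tmeasurable (svalue (s := S) i).
Proof.
have [tl _ _ GS _] := okS i.
exact: (Gmeasurable_measurable hM (le_trans t0 tl) GS).
Qed.

Lemma measurable_simple_value_time w : Tmeasurable (simple_value S ^~ w).
Proof.
apply: measurable_sum => i; apply: measurable_funM => //; exact: measurable_indic.
Qed.

Lemma measurable_simple_error (f : R -> R) : measurable_fun `[t, T] f ->
  measurable_fun setT
    (fun w => \int[leb]_(s in `[t, T]) ((simple_value S s w - f s) ^+ 2)%:E)%E.
Proof.
move=> mf.
pose h (q : R * Omega) :=
  (((simple_value S q.1 q.2 - (f \_ `[t, T]) q.1) ^+ 2 * \1_`[t, T] q.1)%:E).
have mft : Tmeasurable (f \_ `[t, T]).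
  by apply/(measurable_restrictT f (measurable_itv _)).
have mh : Tmeasurable h.
  apply/measurable_EFinP; apply: measurable_funM; last first.
    exact: (measurableT_comp (measurable_indic (measurable_itv `[t, T])) measurable_fst).
  apply: measurable_funX; apply: measurable_funB; last exact: (measurableT_comp mft).
  apply: measurable_sum => i; apply: measurable_funM.
    exact: (measurableT_comp (@mS i)).
  exact: (measurableT_comp (measurable_indic (measurable_itv `]sleft i, sright i])) measurable_fst).
have h0 q : (0 <= h q)%E by rewrite lee_fin mulr_ge0// sqr_ge0.
have := @measurable_fun_fubini_tonelli_G _ _ _ _ R leb h mh h0.
apply: eq_measurable_fun => w _; rewrite /fubini_G [RHS]integral_mkcond.
apply: eq_integral => s _; rewrite /h /= !patchE indicE; case: (s \in _).
  by rewrite mulr1.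
by rewrite mulr0.
Qed.

End measurability.

Section unique.
Variables (W : R -> Omega -> R) (t : R) (f : R -> R).
Hypotheses (t0 : 0 <= t) (tT : t <= T) (mf : measurable_fun `[t, T] f).
Hypothesis hW : brownian_from M P t W.

(** The differences of two approximating sequences are simple processes whose energy tends to 0 in
    probability, hence so do their integrals by [simple_integral_prob], and the two limits agree
    almost surely. *)
Lemma ito_unique_at (I I' : R -> Omega -> R) u : t <= u <= T ->
  ito M W t (fun s _ => f s) I -> ito M W t (fun s _ => f s) I' ->
  {ae P, forall w, I u w = I' u w}.
Proof.
move=> /[dup] uT /andP[tu _] [_ GI _ [S [okS Sf SI]]] [_ GI' _ [S' [okS' S'f S'I]]].
have mSI n : Tmeasurable (simple_integral W (S n) u).
  exact: (Gmeasurable_measurable hM (le_trans t0 tu) (simple_integral_Gmeasurable hW (okS n) tu)).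
have mS'I n : Tmeasurable (simple_integral W (S' n) u).
  exact: (Gmeasurable_measurable hM (le_trans t0 tu) (simple_integral_Gmeasurable hW (okS' n) tu)).
have mI : Tmeasurable (I u).
  exact: (Gmeasurable_measurable hM (le_trans t0 tu) (GI u uT)).
have mI' : Tmeasurable (I' u).
  exact: (Gmeasurable_measurable hM (le_trans t0 tu) (GI' u uT)).
have mge (X : Omega -> R) (a : R) : Tmeasurable X -> measurable [set w | a <= `|X w|].
  move=> mX; rewrite -[X in measurable X]setTI.
  have := measurableT_comp (@normr_measurable R setT) mX.
  by move=> /(_ measurableT _ (measurable_itv `[a, +oo[)); under eq_set do rewrite /= in_itv/= andbT.
have mgee (X : Omega -> \bar R) (a : \bar R) : Tmeasurable X ->
    measurable [set w | (a <= X w)%E].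
  by move=> mX; rewrite -[X in measurable X]setTI; exact: emeasurable_fun_c_infty.
pose err (Z : simple R Omega) w :=
  (\int[leb]_(s in `[t, T]) ((simple_value Z s w - f s) ^+ 2)%:E)%E.
have merr n : Tmeasurable (err (S n)).
  exact: (measurable_simple_error t0 (okS n) mf).
have merr' n : Tmeasurable (err (S' n)).
  exact: (measurable_simple_error t0 (okS' n) mf).
pose D n := simple_sub (S n) (S' n).
have okD n : simple_ok M t (D n) by exact: simple_sub_ok.
have mD n : measurable_fun setT
    (fun w => \int[leb]_(s in `[t, T]) ((simple_value (D n) s w) ^+ 2)%:E)%E.
  have := @measurable_simple_error t (D n) t0 (okD n) (fun=> 0) (measurable_cst _).
  by under eq_fun do under eq_integral do rewrite subr0.
have Derr n w : (\int[leb]_(s in `[t, T]) ((simple_value (D n) s w) ^+ 2)%:E <=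
    2%:E * err (S n) w + 2%:E * err (S' n) w)%E.
  have mE Z : simple_ok M t Z ->
      measurable_fun `[t, T] (fun s => ((simple_value Z s w - f s) ^+ 2)%:E).
    move=> okZ; apply/measurable_EFinP; apply: measurable_funX; apply: measurable_funB => //.
    by apply: measurable_funTS; exact: measurable_simple_value_time.
  have sq0 Z s : (0 <= ((simple_value Z s w - f s) ^+ 2)%:E)%E by rewrite lee_fin sqr_ge0.
  rewrite /err -!ge0_integralZl//; [|exact: mE|exact: mE].
  rewrite -ge0_integralD//.
  - apply: ge0_le_integral => //.
    + by move=> s _; rewrite lee_fin sqr_ge0.
    + apply/measurable_EFinP; apply: measurable_funX; apply: measurable_funTS.
      exact: measurable_simple_value_time.
    + by apply: emeasurable_funD; apply: measurable_funeM; exact: mE.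
    + move=> s _; rewrite -!EFinM -EFinD lee_fin simple_sub_value.
      set x := simple_value (S n) s w; set y := simple_value (S' n) s w.
      by have := sqr_ge0 (x + y - 2 * f s); nra.
  - by move=> s _; rewrite mule_ge0.
  - by apply: measurable_funeM; exact: mE.
  - by move=> s _; rewrite mule_ge0.
  - by apply: measurable_funeM; exact: mE.
(* The factor 3 comes from splitting [I - I'] into the two approximation errors and the integral of
   the difference. The level [b / 4] is such that two errors below it keep the energy of the
   difference, at most twice the one plus twice the other, below [b]. *)
have key (a b : R) : 0 < a -> 0 < b ->
    (P [set w | (3 * a <= `|I u w - I' u w|)%R] <= (b / a ^+ 2)%:E)%E.
  move=> a0 b0; have b40 : 0 < b / 4 by rewrite divr_gt0.
  pose u1 n := P [set w | a%:E <= (`|simple_integral W (S n) u w - I u w|)%:E]%E.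
  pose u2 n := P [set w | a%:E <= (`|simple_integral W (S' n) u w - I' u w|)%:E]%E.
  pose u3 n := P [set w | (b / 4)%:E <= err (S n) w]%E.
  pose u4 n := P [set w | (b / 4)%:E <= err (S' n) w]%E.
  have u10 : u1 n @[n --> \oo] --> 0%E by exact: SI.
  have u20 : u2 n @[n --> \oo] --> 0%E by exact: S'I.
  have u30 : u3 n @[n --> \oo] --> 0%E by exact: Sf.
  have u40 : u4 n @[n --> \oo] --> 0%E by exact: S'f.
  have cv : (u1 n + u2 n + (u3 n + u4 n + (b / a ^+ 2)%:E))%E @[n --> \oo] --> (b / a ^+ 2)%:E.
    rewrite -[X in _ --> X]add0e -[X in _ --> (X + _)%E]add0e
      -[X in _ --> (_ + X)%E]add0e -[X in _ --> (_ + (X + _))%E]add0e.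
    by apply: cvgeD => //; [exact: cvgeD|apply: cvgeD => //; [exact: cvgeD|exact: cvg_cst]].
  rewrite -(cvg_lim _ cv)//; apply: lime_ge; first by apply/cvg_ex; eexists; exact: cv.
  apply: nearW => n.
  have m1 : measurable [set w | (a%:E <= (`|simple_integral W (S n) u w - I u w|)%:E)%E].
    by apply: (mge (fun w => simple_integral W (S n) u w - I u w)); exact: measurable_funB.
  have m2 : measurable [set w | (a%:E <= (`|simple_integral W (S' n) u w - I' u w|)%:E)%E].
    by apply: (mge (fun w => simple_integral W (S' n) u w - I' u w)); exact: measurable_funB.
  have m3 : measurable [set w | ((b / 4)%:E <= err (S n) w)%E] by exact: mgee.
  have m4 : measurable [set w | ((b / 4)%:E <= err (S' n) w)%E] by exact: mgee.
  pose SD := [set w | a <= `|simple_integral W (D n) u w|].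
  have mSD : measurable SD.
    apply: mge; exact: (Gmeasurable_measurable hM (le_trans t0 tu) (simple_integral_Gmeasurable hW (okD n) tu)).
  apply: (@le_trans _ _ (P (([set w | (a%:E <= (`|simple_integral W (S n) u w - I u w|)%:E)%E] `|`
      [set w | (a%:E <= (`|simple_integral W (S' n) u w - I' u w|)%:E)%E]) `|` SD))).
    apply: le_measure; rewrite ?inE.
    - by apply: (mge (fun w => I u w - I' u w)); exact: measurable_funB.
    - by apply: measurableU => //; exact: measurableU.
    - move=> w /= h; rewrite /SD/= !lee_fin simple_sub_integral.
      set x := simple_integral W (S n) u w; set y := simple_integral W (S' n) u w.
      have [xI|xI] := leP a `|x - I u w|; first by left; left.
      have [yI|yI] := leP a `|y - I' u w|; first by left; right.
      right; move: h; rewrite (_ : I u w - I' u w = (x - y) - (x - I u w) + (y - I' u w)); last by ring.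
      move=> h; have := ler_normD (x - y - (x - I u w)) (y - I' u w).
      have := ler_normB (x - y) (x - I u w); lra.
  apply: (le_trans (measureU2 _ _ _)) => //; first exact: measurableU.
  apply: leeD; first exact: measureU2.
  apply: (le_trans (simple_integral_prob hM t0 tT hW (okD n) tu a0 (ltW b0) (mD n))).
  rewrite leeD2r//.
  apply: (@le_trans _ _ (P ([set w | ((b / 4)%:E <= err (S n) w)%E] `|`
     [set w | ((b / 4)%:E <= err (S' n) w)%E]))); last exact: measureU2.
  apply: le_measure; rewrite ?inE.
  - by rewrite -[X in measurable X]setTI; exact: emeasurable_fun_o_infty.
  - exact: measurableU.
  - move=> w /= bD; have [xI|xI] := leP (b / 4)%:E (err (S n) w); first by left.
    have [yI|yI] := leP (b / 4)%:E (err (S' n) w); first by right.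
    have e0 Z : (0 <= err Z w)%E by apply: integral_ge0 => s _; rewrite lee_fin sqr_ge0.
    have := lt_le_trans bD (Derr n w).
    have f1 : err (S n) w \is a fin_num by rewrite ge0_fin_numE// (lt_trans xI)// ltry.
    have f2 : err (S' n) w \is a fin_num by rewrite ge0_fin_numE// (lt_trans yI)// ltry.
    move: xI yI; rewrite -(fineK f1) -(fineK f2) -!EFinM -EFinD !lte_fin.
    lra.
have null (a : R) : 0 < a -> P [set w | (3 * a <= `|I u w - I' u w|)%R] = 0%E.
  move=> a0; apply/eqP; rewrite eq_le measure_ge0 andbT; apply/lee_addgt0Pr => e e0.
  rewrite add0e; have := key a (e * a ^+ 2) a0.
  rewrite mulfK; last by rewrite expf_neq0// gt_eqF.
  by apply; rewrite mulr_gt0// exprn_gt0.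
have : P.-negligible (\bigcup_(n : nat) [set w | (3 * n.+1%:R^-1 <= `|I u w - I' u w|)%R]).
  apply: negligible_bigcup => n; apply/negligibleP; last by apply: null; rewrite invr_gt0.
  by apply: (mge (fun w => I u w - I' u w)); exact: measurable_funB.
apply: negligibleS => w /= /eqP; rewrite -subr_eq0 -normr_gt0 => n0.
have n30 : 0 < `|I u w - I' u w| / 3 by rewrite divr_gt0.
have [n _ hn] := near_infty_natSinv_lt (PosNum n30).
exists n => //=.
have /ltW : n.+1%:R^-1 < `|I u w - I' u w| / 3 := hn n (leqnn n).
by rewrite ler_pdivlMr// mulrC.
Qed.

End unique.

Lemma within_continuous_seq (g : R -> R) (t u : R) (x : nat -> R) (l : R) :
  {within `[t, u], continuous g} -> (forall n, t <= x n <= u) -> t <= l <= u ->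
  x @ \oo --> l -> g (x n) @[n --> \oo] --> g l.
Proof.
move=> /subspace_continuousP cg xtu ltu xl.
have gl := cg l; move: gl; rewrite /= in_itv/= => /(_ ltu) gl.
apply: (cvg_comp x g _ gl).
move=> A /= wA.
have : \forall n \near \oo, (`[t, u]%classic (x n) -> A (x n)) := xl _ wA.
by apply: (@filterS _ \oo) => n; apply; rewrite /= in_itv/=; exact: xtu.
Qed.

(** The processes agree at all points [pt n i] outside one null set, a countable union; these points
    are dense in the interval, and continuity does the rest. *)
Lemma ae_eq_within_continuous t (X Y : R -> Omega -> R) : t <= T ->
  {ae P, forall w, {within `[t, T], continuous (X ^~ w)}} ->
  {ae P, forall w, {within `[t, T], continuous (Y ^~ w)}} ->
  (forall u, t <= u <= T -> {ae P, forall w, X u w = Y u w}) ->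
  {ae P, forall w, forall u, t <= u <= T -> X u w = Y u w}.
Proof.
move=> tT cX cY XY.
pose pt (n i : nat) := Num.min T (t + i%:R / n.+1%:R).
have ptT n i : t <= pt n i <= T.
  by rewrite /pt le_min tT lerDl divr_ge0// ge_min lexx.
have : {ae P, forall w, forall n i, X (pt n i) w = Y (pt n i) w}.
  have : P.-negligible (\bigcup_n \bigcup_i ~` [set w | X (pt n i) w = Y (pt n i) w]).
    by apply: negligible_bigcup => n; apply: negligible_bigcup => i; exact: XY.
  apply: negligibleS => w /=; rewrite -existsNP => -[n].
  by rewrite -existsNP => -[i h]; exists n => //; exists i.
move: cX cY; apply: filterS3 => w cX cY XYw u tuT.
(* The largest grid point of mesh [1 / (n + 1)] that does not exceed [u]. *)
pose x n := pt n (Num.truncn ((u - t) * n.+1%:R)).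
have xu : x n @[n --> \oo] --> u.
  apply: (@squeeze_cvgr _ _ _ _ (fun n => u - n.+1%:R^-1) (fun=> u)).
  - near=> n; rewrite /x /pt.
    have n0 : 0 < n.+1%:R :> R by [].
    have u0 : 0 <= (u - t) * n.+1%:R by rewrite mulr_ge0// subr_ge0; case/andP: tuT.
    have /andP[h1 h2] := truncn_itv u0.
    have k1 : t + (Num.truncn ((u - t) * n.+1%:R))%:R / n.+1%:R <= u.
      by rewrite -lerBrDl ler_pdivrMr.
    have k2 : u - n.+1%:R^-1 <= t + (Num.truncn ((u - t) * n.+1%:R))%:R / n.+1%:R.
      have : (u - t) * n.+1%:R / n.+1%:R <= ((Num.truncn ((u - t) * n.+1%:R)).+1%:R) / n.+1%:R.
        by rewrite ler_pM2r ?invr_gt0// ltW.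
      rewrite mulfK ?gt_eqF// -[X in _ <= X / _]natr1 mulrDl mul1r.
      by move=> h; rewrite lerBlDr -addrA -lerBlDl.
    apply/andP; split; last by rewrite ge_min k1 orbT.
    rewrite le_min k2 andbT; have /andP[_ uT] := tuT.
    by rewrite (le_trans _ uT)// gerBl invr_ge0.
  - rewrite -[X in _ --> X]subr0; apply: (@cvgB _ R^o); [exact: cvg_cst|].
    exact: cvg_harmonic.
  - exact: cvg_cst.
have h1 := within_continuous_seq cX (fun n => ptT n _) tuT xu.
have h2 := within_continuous_seq cY (fun n => ptT n _) tuT xu.
rewrite -(cvg_lim _ h1)// -(cvg_lim _ h2)//.
by congr (limn _); apply/funext => n; exact: XYw.
Unshelve. all: by end_near. Qed.

End ito_uniqueness.

(** * Piecewise smooth integrands and pathwise integration by parts *)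

Section uniform_continuity.
Context {R : realType}.

Lemma segment_uniform_continuity (w : R -> R) (a b e : R) :
  {within `[a, b], continuous w} -> 0 < e ->
  exists2 dl : R, 0 < dl & forall x y, a <= x <= b -> a <= y <= b -> `|x - y| < dl ->
    `|w x - w y| < e.
Proof.
move=> cw e0.
have /compact_near_coveringP := @segment_compact R a b.
move=> /(_ R 0^'+ (fun dl x => a <= x <= b -> forall y, a <= y <= b -> `|x - y| < dl ->
  `|w x - w y| < e) _) [].
  move=> x0; rewrite /= in_itv/= => x0ab.
  move/subspace_continuousP : cw => /(_ x0); rewrite /= in_itv/= => /(_ x0ab) cw.
  have /cvgrPdist_lt /(_ (e / 2)) := cw; rewrite divr_gt0// => /(_ erefl).
  rewrite /within/= => -[eta /= eta0 H].
  have eta20 : 0 < eta / 2 by rewrite divr_gt0.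
  exists (ball x0 (eta / 2), [set dl | dl < eta / 2]).
    split; first exact: nbhsx_ballx.
    by exists (eta / 2) => //= z; rewrite /ball_/= sub0r normrN => h /gtr0_norm zE; rewrite -zE.
  move=> [x dl]/= [xx0 dle] xab y yab xy.
  rewrite /ball/= in xx0.
  have hx : `|w x0 - w x| < e / 2.
    by apply: H; rewrite /= ?in_itv//=; apply: lt_trans xx0 _; rewrite ltr_pdivrMr// ltr_pMr// ltr1n.
  have hy : `|w x0 - w y| < e / 2.
    apply: H; rewrite /= ?in_itv//=.
    have -> : x0 - y = (x0 - x) + (x - y) by ring.
    by apply: (le_lt_trans (ler_normD _ _)); lra.
  have -> : w x - w y = (w x0 - w y) - (w x0 - w x) by ring.
  by apply: (le_lt_trans (ler_normB _ _)); lra.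
move=> dl0 /= dl00 H; exists (dl0 / 2); first by rewrite divr_gt0.
move=> x y xab yab xy.
apply: (H (dl0 / 2)) => //=; rewrite ?in_itv//=.
- by rewrite /ball_/= sub0r normrN gtr0_norm ?divr_gt0// ltr_pdivrMr// ltr_pMr// ltr1n.
- by rewrite divr_gt0.
Qed.

End uniform_continuity.

Section coefficient.
Context {R : realType}.
Notation leb := (@lebesgue_measure R).
Implicit Types (f g : R -> R).

(* [f] has a bounded derivative [g], except for a jump of size [k] at [c]. *)
Definition step_smooth (a b c k C : R) f g : Prop :=
  [/\ a <= c <= b, Tmeasurable g, forall s, `|g s| <= C &
    forall s u, a <= s -> s <= u -> u <= b ->
      f u - f s = k * ((s < c <= u)%R : bool)%:R + \int[leb]_(x in `[s, u]) g x].

Section step_smooth.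
Variables (a b c k C : R) (f g : R -> R).
Hypotheses (ab : a <= b) (fP : step_smooth a b c k C f g).

Let mg : Tmeasurable g. Proof. by case: fP. Qed.
Let gC s : `|g s| <= C. Proof. by case: fP. Qed.
Let C0 : 0 <= C. Proof. exact: le_trans (gC 0). Qed.

Lemma bounded_integrable_itv (h : R -> R) (K s u : R) : measurable_fun `[s, u] h ->
  (forall x, s <= x <= u -> `|h x| <= K) -> L1 leb `[s, u] h.
Proof.
move=> mh hK; apply: measurable_bounded_integrable => //.
  by rewrite /= lebesgue_measure_itv/=; case: ifP => _; rewrite -?EFinB ltry.
exists K; split; first exact: num_real.
move=> x Kx y /=; rewrite in_itv/= => sy.
exact: le_trans (hK y sy) (ltW Kx).
Qed.

Lemma step_smooth_integrable (s u : R) : L1 leb `[s, u] g.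
Proof. by apply: (@bounded_integrable_itv _ C) => //; exact: measurable_funTS. Qed.

Lemma step_smooth_int_bound (s u : R) : s <= u -> `|\int[leb]_(x in `[s, u]) g x| <= C * (u - s).
Proof.
move=> su; apply: (le_trans (le_normr_Rintegral _ (step_smooth_integrable s u))) => //.
apply: (@le_trans _ _ (\int[leb]_(x in `[s, u]) C)).
  apply: le_Rintegral => //.
  - by apply: integrable_norm; exact: step_smooth_integrable.
  - by apply: (@bounded_integrable_itv _ `|C|) => //; exact: measurable_cst.
rewrite Rintegral_cst//= lebesgue_measure_itv/= lte_fin.
by case: ltP => h //=; rewrite mulr0 mulr_ge0// subr_ge0.
Qed.

Lemma step_smooth_increment s u : a <= s -> s <= u -> u <= b ->
  `|f u - f s| <= `|k| * ((s < c <= u)%R : bool)%:R + C * (u - s).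
Proof.
move=> sa su ub; have [_ _ _ ->//] := fP.
apply: (le_trans (ler_normD _ _)); rewrite normrM lerD//; last exact: step_smooth_int_bound.
by rewrite ler_wpM2l//; case: (_ && _); rewrite ?normr1 ?normr0.
Qed.

Definition step_smooth_bound := `|f a| + `|k| + C * (b - a).

Lemma step_smooth_le s : a <= s <= b -> `|f s| <= step_smooth_bound.
Proof.
move=> /andP[sa sb]; have := step_smooth_increment (lexx a) sa sb => h.
have := ler_normD (f s - f a) (f a); rewrite subrK => h2.
apply: (le_trans h2); rewrite /step_smooth_bound addrC -[leRHS]addrA lerD2l; apply: (le_trans h).
apply: lerD; last by rewrite ler_wpM2l// lerD2r.
by rewrite ler_piMr//; case: (_ && _).
Qed.

(** Integration by parts for the integral of [f] against [w]: the measure [df] is an atom of mass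
    [k] at [c] plus the density [g]. No regularity of [w] beyond continuity is involved. *)
Definition parts_integral (w : R -> R) (u : R) : R :=
  f u * w u - f a * w a - k * ((a < c <= u)%R : bool)%:R * w c
  - \int[leb]_(x in `[a, u]) (g x * w x).

Lemma step_smooth_measurable : measurable_fun `[a, b] f.
Proof.
have E s : s \in `[a, b]%classic -> f s = f a + k * ((a < c <= s)%R : bool)%:R + \int[leb]_(x in `[a, s]) g x.
  rewrite inE/= in_itv/= => /andP[sa sb].
  by have [_ _ _ /(_ a s (lexx _) sa sb)] := fP; lra.
apply: (eq_measurable_fun _ (fun s sab => esym (E s sab))).
apply: measurable_funD.
  apply: measurable_funD => //; apply: measurable_funM => //.
  rewrite (_ : (fun s => _) = (fun s => ((a < c)%R : bool)%:R * \1_(`[c, +oo[) s)).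
    by apply: measurable_funM => //; exact: measurable_indic.
  apply/funext => s; rewrite indicE; have -> : (s \in `[c, +oo[%classic) = (c <= s).
    by apply/idP/idP; rewrite inE/= in_itv/= andbT.
  by case: (a < c); case: (c <= s); rewrite ?mulr1 ?mulr0 ?mul0r.
apply: subspace_continuous_measurable_fun => //.
exact: parameterized_integral_continuous ab (step_smooth_integrable a b).
Qed.

Section path.
Variable w : R -> R.
Hypothesis cw : {within `[a, b], continuous w}.

Lemma within_measurable : measurable_fun `[a, b] w.
Proof. exact: subspace_continuous_measurable_fun. Qed.

Lemma within_bounded : exists2 K, 0 <= K & forall x, a <= x <= b -> `|w x| <= K.
Proof.
have cn : {within `[a, b], continuous (fun x => `|w x|)}.
  by move=> x; apply: cvg_norm; exact: cw.
have [m mab mP] := EVT_max ab cn.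
by exists `|w m| => // x xab; apply: mP; rewrite in_itv.
Qed.

Lemma parts_integrand_integrable (s u : R) : a <= s -> u <= b ->
  L1 leb `[s, u] (fun x => g x * w x).
Proof.
move=> sa ub; have [K K0 wK] := within_bounded.
have sub : `[s, u] `<=` `[a, b] by apply: subset_itv; rewrite bnd_simp.
apply: (@bounded_integrable_itv _ (C * K)).
  apply: measurable_funM; first exact: measurable_funTS.
  by apply: measurable_funS sub _ => //; exact: within_measurable.
move=> x /andP[sx xu]; rewrite normrM ler_pM// wK//.
by rewrite (le_trans sa sx) (le_trans xu).
Qed.

Lemma parts_integral_continuous : {within `[a, b], continuous (parts_integral w)}.
Proof.
pose F x := f a + \int[leb]_(y in `[a, x]) g y.
have cF : {within `[a, b], continuous F}.
  move=> x; apply: (@cvgD _ R^o); first exact: cvg_cst.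
  exact: (parameterized_integral_continuous ab (step_smooth_integrable a b)).
have cGw := parameterized_integral_continuous ab (parts_integrand_integrable (lexx a) (lexx b)).
have cab : a <= c <= b by case: fP.
have cmax : {within `[a, b], continuous (fun x => w (Num.max x c))}.
  apply/subspace_continuousP => x; rewrite /= in_itv/= => xab.
  have mab : a <= Num.max x c <= b.
    by case/andP: xab => ? ?; case/andP: cab => ? ?; rewrite le_max ge_max; apply/andP; split; [apply/orP; left|apply/andP].
  move/subspace_continuousP : cw => /(_ (Num.max x c)); rewrite /= in_itv/= => /(_ mab) h.
  apply: (cvg_comp (fun x => Num.max x c) w _ h).
  move=> A /= wA.
  have : \forall y \near x, `[a, b]%classic (Num.max y c) -> A (Num.max y c).
    have cm : Num.max y c @[y --> x] --> Num.max x c.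
      by apply: (@continuous_max _ _ id (fun=> c)); [exact: cvg_id|exact: cvg_cst].
    exact: cm _ wA.
  apply: filterS => y H yab; apply: H; move: yab; rewrite /= !in_itv/= => /andP[? ?].
  by case/andP: cab => ? ?; rewrite le_max ge_max; apply/andP; split; [apply/orP; left|apply/andP].
(* With [F] the continuous part of [f], the jump of [f * w] at [c] and the jump of the correction
   combine into [k * (w (max x c) - w c)], which is continuous in [x]. *)
pose I x := F x * w x - f a * w a + k * ((a < c)%R : bool)%:R * (w (Num.max x c) - w c)
   - \int[leb]_(y in `[a, x]) (g y * w y).
have cI : {within `[a, b], continuous I}.
  move=> x; apply: (@cvgB _ R^o); last exact: cGw.
  apply: (@cvgD _ R^o); first by apply: (@cvgB _ R^o); [apply: cvgM; [exact: cF|exact: cw]|exact: cvg_cst].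
  by apply: cvgM; [exact: cvg_cst|apply: (@cvgB _ R^o); [exact: cmax|exact: cvg_cst]].
apply: (subspace_eq_continuous _ cI) => x; rewrite inE/= in_itv/= => /andP[ax xb].
rewrite /from_subspace /I /parts_integral.
have [_ _ _ /(_ a x (lexx _) ax xb) fx] := fP.
have -> : f x = F x + k * ((a < c <= x)%R : bool)%:R by rewrite /F; lra.
have [cx|xc] := leP c x.
  by rewrite andbT; ring.
by rewrite andbF [w c - w c]subrr /=; ring.
Qed.

(** The error of one left-point step is the integral of [w u - w x] against [df(x)]: oscillation of
    [w] times variation of [f]. *)
Lemma parts_integral_step s u e : a <= s -> s <= u -> u <= b ->
  (forall x, s <= x <= u -> `|w u - w x| <= e) ->
  `|parts_integral w u - parts_integral w s - f s * (w u - w s)| <=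
  `|k| * e * (((c <= u)%R : bool)%:R - ((c <= s)%R : bool)%:R) + C * e * (u - s).
Proof.
move=> sa su ub we.
have e0 : 0 <= e by apply: le_trans (we u _); rewrite ?subrr ?normr0// su lexx.
have ca : a <= c by case: fP => /andP[].
have bE : ((c <= u)%R : bool)%:R - ((c <= s)%R : bool)%:R = ((s < c <= u)%R : bool)%:R :> R.
  have [cs|sc] := leP c s; first by rewrite (le_trans cs su) subrr.
  by rewrite subr0.
have kE : k * ((a < c <= u)%R : bool)%:R - k * ((a < c <= s)%R : bool)%:R =
    k * ((s < c <= u)%R : bool)%:R.
  rewrite -bE -mulrBr; congr (_ * _).
  have [ac|ca'] := ltP a c; first by [].
  by rewrite subrr !(le_trans ca') ?subrr// (le_trans sa).
have fE : f u - f s = k * ((s < c <= u)%R : bool)%:R + \int[leb]_(x in `[s, u]) g x.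
  by have [_ _ _] := fP; apply.
have iE : \int[leb]_(x in `[a, u]) (g x * w x) - \int[leb]_(x in `[a, s]) (g x * w x) =
    \int[leb]_(x in `[s, u]) (g x * w x).
  rewrite Rintegral_itvB ?bnd_simp//.
    rewrite Rintegral_itv_obnd_cbnd//.
    apply: integrableS (parts_integrand_integrable sa ub) => //.
    by apply: subset_itv; rewrite bnd_simp.
  by apply: parts_integrand_integrable.
have wuE : \int[leb]_(x in `[s, u]) (g x * (w u - w x)) =
    w u * \int[leb]_(x in `[s, u]) g x - \int[leb]_(x in `[s, u]) (g x * w x).
  rewrite -RintegralZl//; last exact: step_smooth_integrable.
  rewrite -RintegralB//; last 2 first.
  - by apply: integrable_realZ => //; exact: step_smooth_integrable.
  - exact: parts_integrand_integrable.
  by apply: eq_Rintegral => x _; ring.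
have -> : parts_integral w u - parts_integral w s - f s * (w u - w s) =
    k * ((s < c <= u)%R : bool)%:R * (w u - w c) + \int[leb]_(x in `[s, u]) (g x * (w u - w x)).
  rewrite wuE -iE /parts_integral -kE.
  have -> : f u = f s + (k * ((a < c <= u)%R : bool)%:R - k * ((a < c <= s)%R : bool)%:R) +
    \int[leb]_(x in `[s, u]) g x by rewrite kE; lra.
  ring.
rewrite bE; apply: (le_trans (ler_normD _ _)); apply: lerD.
  rewrite !normrM; case: (boolP (s < c <= u)) => [/andP[/ltW sc cu]|_]; last first.
    by rewrite /= !mulr0n normr0 !mulr0 mul0r.
  by rewrite /= normr1 !mulr1 ler_wpM2l// we// sc cu.
have mgw : measurable_fun `[s, u] (fun x => g x * (w u - w x)).
  apply: measurable_funM; first exact: measurable_funTS.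
  apply: measurable_funB => //; apply: (measurable_funS _ _ within_measurable) => //.
  by apply: subset_itv; rewrite bnd_simp.
have bgw x : s <= x <= u -> `|g x * (w u - w x)| <= C * e.
  by move=> xsu; rewrite normrM ler_pM// we.
have igw := bounded_integrable_itv mgw bgw.
apply: (le_trans (le_normr_Rintegral _ igw)) => //.
apply: (@le_trans _ _ (\int[leb]_(x in `[s, u]) (C * e))).
  apply: le_Rintegral => //.
  - by apply: integrable_norm.
  - by apply: (@bounded_integrable_itv _ `|C * e|) => //; exact: measurable_cst.
rewrite Rintegral_cst//= lebesgue_measure_itv/= lte_fin.
by case: ltP => h //=; rewrite mulr0 mulr_ge0 ?mulr_ge0// subr_ge0.
Qed.

(** The step errors add up, and the total variation of [f] is at most [|k| + C * (b - a)]. *)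
Lemma riemann_parts_error (gr : nat -> R) n u e :
  (forall i, gr i <= gr i.+1) -> gr 0%N = a -> gr n = b -> a <= u <= b ->
  (forall x y i, gr i <= x <= gr i.+1 -> gr i <= y <= gr i.+1 -> `|w x - w y| <= e) ->
  `|parts_integral w u - \sum_(i < n) f (gr i) * (w (Num.min (gr i.+1) u) - w (Num.min (gr i) u))| <=
  (`|k| + C * (b - a)) * e.
Proof.
move=> grle gr0 grn /andP[au ub] we.
have e0 : 0 <= e.
  by apply: le_trans (we (gr 0%N) (gr 0%N) 0%N _ _); rewrite ?subrr ?normr0// lexx grle.
have grmono i j : (i <= j)%N -> gr i <= gr j.
  by move=> ij; apply: (homo_leq (r := fun x y : R => x <= y) _ _ grle ij) => // y x z; exact: le_trans.
pose h i := Num.min (gr i) u.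
have hle i : h i <= h i.+1 by rewrite /h le_min2.
have ha i : a <= h i by rewrite /h le_min au andbT -gr0 grmono.
have hb i : h i <= b by rewrite /h ge_min ub orbT.
have key m : `|parts_integral w (h m) - parts_integral w (h 0%N) -
    \sum_(i < m) f (gr i) * (w (h i.+1) - w (h i))| <=
    `|k| * e * (((c <= h m)%R : bool)%:R - ((c <= h 0%N)%R : bool)%:R) + C * e * (h m - h 0%N).
  elim: m => [|m ih]; first by rewrite big_ord0 !subrr normr0 !mulr0 addr0.
  rewrite big_ord_recr/=.
  (* Beyond [u] the increment of [w] is 0, so the coefficient may be evaluated at the cut point
     [h m]. *)
  have fh : f (gr m) * (w (h m.+1) - w (h m)) = f (h m) * (w (h m.+1) - w (h m)).
    have [gu|ug] := leP (gr m) u; first by rewrite /h (min_l gu).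
    by rewrite /h !min_r ?subrr ?mulr0// ltW// (lt_le_trans ug).
  have wm x : h m <= x <= h m.+1 -> `|w (h m.+1) - w x| <= e.
    move=> /andP[hx xh].
    have [gu|ug] := leP (gr m) u.
      apply: (we _ _ m); rewrite /h.
        by rewrite le_min grle gu ge_min lexx.
      move: hx xh; rewrite /h (min_l gu) le_min => -> /andP[->].
      by [].
    have hu : h m.+1 = u by rewrite /h min_r// ltW// (lt_le_trans ug).
    have hmu : h m = u by rewrite /h min_r// ltW.
    have -> : x = u by apply/eqP; rewrite eq_le -{1}hu xh -hmu hx.
    by rewrite hu subrr normr0.
  have := parts_integral_step (ha m) (hle m) (hb m.+1) wm.
  rewrite fh; set X := \sum_(_ < _) _ in ih *.
  set p := parts_integral w (h m.+1) in ih *; set p' := parts_integral w (h m) in ih *.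
  move=> step.
  have -> : p - parts_integral w (h 0%N) - (X + f (h m) * (w (h m.+1) - w (h m))) =
     (p' - parts_integral w (h 0%N) - X) + (p - p' - f (h m) * (w (h m.+1) - w (h m))) by ring.
  apply: (le_trans (ler_normD _ _)); apply: (le_trans (lerD ih step)).
  by apply: eqW; ring.
have := key n.
have -> : h n = u by rewrite /h grn min_r.
have -> : h 0%N = a by rewrite /h gr0 min_l.
have -> : parts_integral w a = 0.
  have nac : (a < c <= a) = false by apply/negP => /andP[/lt_le_trans h1 /h1]; rewrite ltxx.
  by rewrite /parts_integral set_itv1 Rintegral_set1 nac /= mulr0 mul0r subrr !subr0.
rewrite subr0 => /le_trans; apply.
rewrite mulrDl lerD//.
  by rewrite ler_piMr ?mulr_ge0//; case: (c <= u); case: (c <= a); rewrite /= ?subrr ?subr0 ?sub0r// lerN10.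
by rewrite mulrAC ler_wpM2r// ler_wpM2l// lerD2r.
Qed.

End path.
End step_smooth.
End coefficient.

Section riemann_steps.
Context {R : realType}.
Notation leb := (@lebesgue_measure R).
Variables (a b c k C : R) (f g : R -> R).
Hypotheses (ab : a <= b) (fP : step_smooth a b c k C f g).

Definition mesh n : R := (b - a) / n.+1%:R.
Definition grid_point n i : R := a + i%:R * mesh n.
Definition riemann_step n s : R :=
  \sum_(i < n.+1) f (grid_point n i) * \1_(`]grid_point n i, grid_point n i.+1]) s.

Let C0 : 0 <= C. Proof. by case: fP => _ _ /(_ 0) h _; exact: le_trans h. Qed.
Let F := step_smooth_bound a b k C f.

Lemma mesh_ge0 n : 0 <= mesh n. Proof. by rewrite divr_ge0// subr_ge0. Qed.

Lemma grid_pointS n i : grid_point n i.+1 = grid_point n i + mesh n.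
Proof. by rewrite /grid_point -natr1; ring. Qed.

Lemma grid_point_le n i : grid_point n i <= grid_point n i.+1.
Proof. by rewrite grid_pointS lerDl mesh_ge0. Qed.

Lemma grid_point0 n : grid_point n 0 = a.
Proof. by rewrite /grid_point mul0r addr0. Qed.

Lemma grid_point_last n : grid_point n n.+1 = b.
Proof. by rewrite /grid_point /mesh; field; rewrite addrC natr1 pnatr_eq0. Qed.

Lemma grid_point_itv n i : (i <= n.+1)%N -> a <= grid_point n i <= b.
Proof.
move=> i_n; rewrite -{1}(grid_point0 n) -(grid_point_last n).
rewrite /grid_point !lerD2l !ler_wpM2r ?mesh_ge0//.
by rewrite ler_nat.
Qed.

Lemma mesh_cvg0 : mesh @ \oo --> 0.
Proof.
rewrite -(mulr0 (b - a)); apply: cvgM; first exact: cvg_cst.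
exact: cvg_harmonic.
Qed.

Let partition_unity n s : a < s <= b ->
  \sum_(i < n.+1) \1_(`]grid_point n i, grid_point n i.+1]) s = 1 :> R.
Proof.
move=> /andP[sa sb].
under eq_bigr do rewrite indic_oc ?grid_point_le//.
pose G i : R := ((s <= grid_point n i)%R : bool)%:R.
rewrite -(big_mkord predT (fun i => G i.+1 - G i)) telescope_sumr// /G.
by rewrite grid_point_last grid_point0 sb leNgt sa subr0.
Qed.

Lemma riemann_step_measurable n : Tmeasurable (riemann_step n).
Proof. by apply: measurable_sum => i; apply: measurable_funM => //; exact: measurable_indic. Qed.

(** The left-point value misses the jump only when [c] lies between the grid point and [s], that is
    for [s] within one mesh after [c]. *)
Lemma riemann_step_error n s : a < s <= b ->
  `|riemann_step n s - f s| <= `|k| * \1_(`[c, c + mesh n]) s + C * mesh n.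
Proof.
move=> sab; have pu := partition_unity n sab; have /andP[sa sb] := sab.
rewrite -[X in _ - X]mulr1 -pu mulr_sumr -sumrB -[leRHS]mulr1 -pu mulr_sumr.
apply: (le_trans (ler_norm_sum _ _ _)); apply: ler_sum => i _.
rewrite -mulrBl normrM !indicE.
have [|_] := boolP (s \in `]grid_point n i, grid_point n i.+1]%classic); last by rewrite normr0 !mulr0.
rewrite inE/= in_itv/= => /andP[gs sg]; rewrite normr1 !mulr1.
have /andP[ga _] := grid_point_itv (ltnW (ltn_ord i) : i <= n.+1)%N.
rewrite distrC; apply: (le_trans (step_smooth_increment fP ga (ltW gs) sb)).
have smesh : s - grid_point n i <= mesh n by move: sg; rewrite grid_pointS; lra.
apply: lerD; last by rewrite ler_wpM2l.
rewrite ler_wpM2l//; case: (boolP (_ < c <= s)) => [/andP[gc cs]|_] //=.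
by rewrite mem_set//= in_itv/= cs; lra.
Qed.

Lemma riemann_step_le n s : `|riemann_step n s| <= F.
Proof.
have F0 : 0 <= F by apply: le_trans (step_smooth_le fP (s := a) _); rewrite ?lexx.
have [sab|nsab] := boolP (a < s <= b); last first.
  rewrite /riemann_step big1 ?normr0// => i _; rewrite indicE.
  have /andP[ga _] := grid_point_itv (ltnW (ltn_ord i) : i <= n.+1)%N.
  have /andP[_ gb] := grid_point_itv (ltn_ord i : i.+1 <= n.+1)%N.
  rewrite (_ : (s \in _) = false) ?mulr0//; apply: contraNF nsab.
  by rewrite inE/= in_itv/= => /andP[/(le_lt_trans ga) -> /le_trans]; exact.
have pu := partition_unity n sab.
rewrite -[leRHS]mulr1 -pu mulr_sumr.
apply: (le_trans (ler_norm_sum _ _ _)); apply: ler_sum => i _.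
rewrite normrM (@ger0_norm _ (\1__ _)) ?indicE// ler_wpM2r//.
by apply: (step_smooth_le fP); apply: grid_point_itv; rewrite ltnW.
Qed.

Let mf : measurable_fun `[a, b] f. Proof. exact: step_smooth_measurable ab fP. Qed.

(** Integral of [2 A^2 + 2 B^2], with [A = |k|] on a window of length at most one mesh and
    [B = C * mesh n] on all of [[a, b]]. *)
Definition step_error n := (2 * k ^+ 2 + 2 * C ^+ 2 * mesh n * (b - a)) * mesh n.

Lemma step_error_cvg0 : step_error @ \oo --> 0.
Proof.
rewrite -(mulr0 (2 * k ^+ 2 + 2 * C ^+ 2 * 0 * (b - a))).
apply: cvgM; last exact: mesh_cvg0.
apply: (@cvgD _ R^o); first exact: cvg_cst.
by apply: cvgM; [apply: cvgM; [exact: cvg_cst|exact: mesh_cvg0]|exact: cvg_cst].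
Qed.

Let int_window n : (\int[leb]_(s in `[a, b]) (\1_(`[c, c + mesh n]) s)%:E <= (mesh n)%:E)%E.
Proof.
rewrite integral_indic//=; apply: (@le_trans _ _ (leb `[c, c + mesh n])).
  by apply: le_measure; rewrite ?inE//=; exact: measurableI.
rewrite lebesgue_measure_itv/= lte_fin; case: ltP => _; last by rewrite lee_fin mesh_ge0.
by rewrite -EFinB lee_fin; lra.
Qed.

Let int_cst (K : R) : (\int[leb]_(s in `[a, b]) K%:E = (K * (b - a))%:E)%E.
Proof.
rewrite integral_cst//= lebesgue_measure_itv/= lte_fin; case: ltP => h.
  by rewrite -EFinB -EFinM.
by rewrite (_ : b = a) ?subrr ?mulr0 ?mule0//; apply/eqP; rewrite eq_le h ab.
Qed.

Let oc_integral (h : R -> \bar R) : measurable_fun `[a, b] h ->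
  (\int[leb]_(s in `[a, b]) h s = \int[leb]_(s in `]a, b]) h s)%E.
Proof.
move=> mh; rewrite integral_itv_obnd_cbnd//.
by apply: measurable_funS mh => //; apply: subset_itv; rewrite bnd_simp.
Qed.

Let sub_oc : `]a, b] `<=` `[a, b].
Proof. by apply: subset_itv; rewrite bnd_simp. Qed.

Lemma riemann_step_sqr_error n :
  (\int[leb]_(s in `[a, b]) ((riemann_step n s - f s) ^+ 2)%:E <= (step_error n)%:E)%E.
Proof.
have mr : measurable_fun `[a, b] (fun s => ((riemann_step n s - f s) ^+ 2)%:E).
  apply/measurable_EFinP; apply: measurable_funX; apply: measurable_funB => //.
  by apply: measurable_funTS; exact: riemann_step_measurable.
pose h s := ((2 * k ^+ 2) * \1_(`[c, c + mesh n]) s + 2 * C ^+ 2 * mesh n ^+ 2)%:E.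
have mh : measurable_fun `[a, b] h.
  by apply/measurable_EFinP; apply: measurable_funD => //; apply: measurable_funM.
apply: (@le_trans _ _ (\int[leb]_(s in `[a, b]) h s)%E).
  rewrite !oc_integral//; apply: ge0_le_integral => //.
  - by move=> s _; rewrite lee_fin sqr_ge0.
  - exact: measurable_funS mr.
  - exact: measurable_funS mh.
  - move=> s /=; rewrite in_itv/= => /(riemann_step_error n).
    set x := riemann_step n s - f s; set i := \1__ _ => xi.
    have i2 : i ^+ 2 = i by rewrite /i indicE; case: (_ \in _); rewrite ?expr1n ?expr0n.
    rewrite lee_fin -(real_normK (num_real x)).
    apply: (@le_trans _ _ ((`|k| * i + C * mesh n) ^+ 2)).
      have i0 : 0 <= i by rewrite /i indicE.
      apply: lerXn2r => //; rewrite nnegrE//.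
      by apply: addr_ge0; apply: mulr_ge0; rewrite ?mesh_ge0.
    have := sqr_ge0 (`|k| * i - C * mesh n).
    have -> : 2 * k ^+ 2 * i = 2 * (`|k| * i) ^+ 2 by rewrite exprMn i2 real_normK ?num_real ?mulrA.
    have -> : 2 * C ^+ 2 * mesh n ^+ 2 = 2 * (C * mesh n) ^+ 2 by ring.
    by move: (`|k| * i) (C * mesh n) => A B; nra.
rewrite /h; under eq_integral do rewrite EFinD EFinM.
have k20 : 0 <= 2 * k ^+ 2 by rewrite mulr_ge0 ?sqr_ge0.
rewrite ge0_integralD//=; first last.
- by move=> s _; rewrite lee_fin; apply: mulr_ge0; [apply: mulr_ge0 => //|]; exact: sqr_ge0.
- by apply: emeasurable_funM => //; apply/measurable_EFinP; apply: measurable_funTS; exact: measurable_indic.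
- by move=> s _; rewrite -EFinM lee_fin mulr_ge0.
rewrite ge0_integralZl//; last by apply/measurable_EFinP; apply: measurable_funTS; exact: measurable_indic.
rewrite int_cst; apply: (@le_trans _ _ ((2 * k ^+ 2)%:E * (mesh n)%:E + (2 * C ^+ 2 * mesh n ^+ 2 * (b - a))%:E)%E).
  by rewrite leeD2r// lee_wpmul2l// lee_fin.
by rewrite -EFinM -EFinD lee_fin /step_error; apply: eqW; ring.
Qed.

Let irf n : L1 leb `[a, b] (fun s => (riemann_step n s - f s) ^+ 2).
Proof.
apply: ge0_integrable_real => //.
- apply: measurable_funX; apply: measurable_funB => //.
  by apply: measurable_funTS; exact: riemann_step_measurable.
- by move=> s _; exact: sqr_ge0.
- by apply: le_lt_trans (riemann_step_sqr_error n) _; rewrite ltry.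
Qed.

Lemma step_smooth_sqr_integrable : L1 leb `[a, b] (fun s => f s ^+ 2).
Proof.
apply: (@bounded_integrable_itv _ _ (F ^+ 2)); first exact: measurable_funX.
by move=> s sab; rewrite normrX lerXn2r ?nnegrE ?step_smooth_le//; apply: le_trans (step_smooth_le fP sab).
Qed.

Lemma riemann_step_sqr_integrable n :
  L1 leb `[a, b] (fun s => riemann_step n s ^+ 2).
Proof.
apply: (@bounded_integrable_itv _ _ (F ^+ 2)).
  by apply: measurable_funX; apply: measurable_funTS; exact: riemann_step_measurable.
by move=> s sab; rewrite normrX lerXn2r ?nnegrE ?riemann_step_le//; apply: le_trans (riemann_step_le n s).
Qed.

Let Rerr n : \int[leb]_(s in `[a, b]) ((riemann_step n s - f s) ^+ 2) <= step_error n.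
Proof.
have := riemann_step_sqr_error n; rewrite -lee_fin /Rintegral fineK//.
exact: (integrable_fin_num _ (irf n)).
Qed.

(** The weighted inequality [|x y| <= x^2 / l + l y^2] bounds the difference by the L2 error over
    [l] plus [l] times the energy of [phi]; then [l] is chosen small, and [n] large. *)
Lemma riemann_step_mul_cvg (phi : R -> R) : measurable_fun `[a, b] phi ->
  L1 leb `[a, b] (fun s => phi s ^+ 2) ->
  L1 leb `[a, b] (fun s => f s * phi s) /\
  \int[leb]_(s in `[a, b]) (riemann_step n s * phi s) @[n --> \oo] -->
  \int[leb]_(s in `[a, b]) (f s * phi s).
Proof.
move=> mphi iphi2.
have iprod (u : R -> R) : measurable_fun `[a, b] u ->
    L1 leb `[a, b] (fun s => u s ^+ 2) ->
    L1 leb `[a, b] (fun s => u s * phi s).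
  move=> mu iu; apply: (@le_integrable _ _ _ leb _ _ _ (EFin \o (fun s => u s ^+ 2 + phi s ^+ 2))) => //.
  - by apply/measurable_EFinP; exact: measurable_funM.
  - move=> s _ /=; rewrite lee_fin normrM [leRHS]ger0_norm ?addr_ge0 ?sqr_ge0//.
    rewrite -(real_normK (num_real (u s))) -(real_normK (num_real (phi s))).
    by have := sqr_ge0 (`|u s| - `|phi s|); have := normr_ge0 (u s); have := normr_ge0 (phi s); nra.
  - exact: integrable_realD.
have mrs n : measurable_fun `[a, b] (riemann_step n).
  by apply: measurable_funTS; exact: riemann_step_measurable.
have if1 := iprod f mf step_smooth_sqr_integrable.
have ir n := iprod (riemann_step n) (mrs n) (riemann_step_sqr_integrable n).
split => //.
set c2 := \int[leb]_(s in `[a, b]) (phi s ^+ 2).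
have c20 : 0 <= c2 by apply: Rintegral_ge0 => s _; exact: sqr_ge0.
have key (l : R) n : 0 < l -> `|\int[leb]_(s in `[a, b]) (f s * phi s) -
     \int[leb]_(s in `[a, b]) (riemann_step n s * phi s)| <= l^-1 * step_error n + l * c2.
  move=> l0; rewrite -RintegralB//; try exact: step_smooth_sqr_integrable.
  have id : L1 leb `[a, b] (fun s => f s * phi s - riemann_step n s * phi s).
    exact: integrable_realB.
  apply: (le_trans (le_normr_Rintegral _ id)) => //.
  apply: (@le_trans _ _ (\int[leb]_(s in `[a, b]) (l^-1 * (riemann_step n s - f s) ^+ 2 + l * phi s ^+ 2))).
    apply: le_Rintegral => //.
    - exact: integrable_norm.
    - by apply: integrable_realD => //; exact: integrable_realZ.
    - move=> s _; rewrite -mulrBl; set x := riemann_step n s - f s; set y := phi s.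
      have -> : f s - riemann_step n s = - x by rewrite /x; ring.
      rewrite normrM normrN -(real_normK (num_real x)) -(real_normK (num_real y)).
      have il0 : 0 < l^-1 by rewrite invr_gt0.
      have ll : l * l^-1 = 1 by rewrite divff// gt_eqF.
      have h : 0 <= l^-1 * (`|x| - l * `|y|) ^+ 2 by rewrite mulr_ge0 ?sqr_ge0// ltW.
      have E : l^-1 * (`|x| - l * `|y|) ^+ 2 = l^-1 * `|x| ^+ 2 - 2 * (l * l^-1) * (`|x| * `|y|)
        + (l * l^-1) * l * `|y| ^+ 2 by ring.
      rewrite ll in E; have : 0 <= `|x| * `|y| by rewrite mulr_ge0.
      by move: h; rewrite E; lra.
  rewrite RintegralD//; [|exact: integrable_realZ..].
  by rewrite !RintegralZl// lerD2r ler_wpM2l// invr_ge0 ltW.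
apply/cvgrPdist_le => e e0.
pose l := e / 2 / (c2 + 1).
have l0 : 0 < l by rewrite !divr_gt0// ltr_wpDl.
have lc : l * c2 <= e / 2.
  by rewrite /l -mulrA ler_piMr ?divr_ge0 ?(ltW e0)// mulrC ler_pdivrMr ?ltr_wpDl// mul1r lerDl.
have le0 : 0 < l * (e / 2) by rewrite mulr_gt0// divr_gt0.
have /cvgrPdist_le /(_ _ le0) := step_error_cvg0.
apply: filterS => n; rewrite sub0r normrN => h.
apply: (le_trans (key l n l0)).
have : l^-1 * step_error n <= e / 2.
  by rewrite mulrC ler_pdivrMr// mulrC; apply: le_trans h; exact: ler_norm.
by lra.
Qed.

Lemma riemann_step_sqr_cvg : \int[leb]_(s in `[a, b]) (riemann_step n s ^+ 2) @[n --> \oo] -->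
  \int[leb]_(s in `[a, b]) (f s ^+ 2).
Proof.
have [ifs fcv] := riemann_step_mul_cvg mf step_smooth_sqr_integrable.
have E n : \int[leb]_(s in `[a, b]) (riemann_step n s ^+ 2) =
   \int[leb]_(s in `[a, b]) ((riemann_step n s - f s) ^+ 2) +
   2 * \int[leb]_(s in `[a, b]) (riemann_step n s * f s) - \int[leb]_(s in `[a, b]) (f s ^+ 2).
  have mrs : measurable_fun `[a, b] (riemann_step n).
    by apply: measurable_funTS; exact: riemann_step_measurable.
  have ir : L1 leb `[a, b] (fun s => riemann_step n s * f s).
    apply: (@bounded_integrable_itv _ _ (F * F)); first exact: measurable_funM.
    by move=> s sab; rewrite normrM ler_pM ?riemann_step_le ?(step_smooth_le fP).
  rewrite -RintegralZl// -RintegralD//; last exact: integrable_realZ.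
  rewrite -RintegralB//; try exact: step_smooth_sqr_integrable.
  - by apply: eq_Rintegral => s _; ring.
  - by apply: integrable_realD => //; exact: integrable_realZ.
under eq_fun do rewrite E.
set I := \int[leb]_(s in `[a, b]) (f s ^+ 2).
have E2 : 0 + 2 * \int[leb]_(s in `[a, b]) (f s * f s) - I = I.
  rewrite add0r; have -> : \int[leb]_(s in `[a, b]) (f s * f s) = I.
    by apply: eq_Rintegral => s _; rewrite expr2.
  ring.
have h : (\int[leb]_(s in `[a, b]) ((riemann_step n s - f s) ^+ 2) +
    2 * \int[leb]_(s in `[a, b]) (riemann_step n s * f s) - I) @[n --> \oo] -->
    0 + 2 * \int[leb]_(s in `[a, b]) (f s * f s) - I; last by rewrite E2 in h.
apply: (@cvgB _ R^o); last exact: cvg_cst.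
apply: (@cvgD _ R^o).
  apply: (@squeeze_cvgr _ _ _ _ (fun=> 0) step_error).
  - by apply: nearW => n; rewrite Rerr andbT; apply: Rintegral_ge0 => s _; exact: sqr_ge0.
  - exact: cvg_cst.
  - exact: step_error_cvg0.
by apply: cvgM; [exact: cvg_cst|exact: fcv].
Qed.

Lemma riemann_step_cauchy n m :
  (\int[leb]_(s in `[a, b]) ((riemann_step n s - riemann_step m s) ^+ 2)%:E <=
   (2 * step_error n + 2 * step_error m)%:E)%E.
Proof.
have mrs j : measurable_fun `[a, b] (riemann_step j).
  by apply: measurable_funTS; exact: riemann_step_measurable.
have me j : measurable_fun `[a, b] (fun s => ((riemann_step j s - f s) ^+ 2)%:E).
  by apply/measurable_EFinP; apply: measurable_funX; exact: measurable_funB.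
have me2 j : measurable_fun `[a, b] (fun s => (2%:E * ((riemann_step j s - f s) ^+ 2)%:E)%E).
  by apply: emeasurable_funM => //; exact: measurable_cst.
have mnm : measurable_fun `[a, b] (fun s => ((riemann_step n s - riemann_step m s) ^+ 2)%:E).
  by apply/measurable_EFinP; apply: measurable_funX; exact: measurable_funB.
apply: (@le_trans _ _ (\int[leb]_(s in `[a, b]) (2%:E * ((riemann_step n s - f s) ^+ 2)%:E +
    2%:E * ((riemann_step m s - f s) ^+ 2)%:E))%E).
  apply: ge0_le_integral => //.
  - by move=> s _; rewrite lee_fin sqr_ge0.
  - by move: (emeasurable_funD (me2 n) (me2 m)).
  - move=> s _; rewrite -!EFinM -EFinD lee_fin.
    by have := sqr_ge0 (riemann_step n s + riemann_step m s - 2 * f s); nra.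
have sq0 j s : (0 <= ((riemann_step j s - f s) ^+ 2)%:E)%E by rewrite lee_fin sqr_ge0.
have -> : (\int[leb]_(s in `[a, b]) (2%:E * ((riemann_step n s - f s) ^+ 2)%:E +
    2%:E * ((riemann_step m s - f s) ^+ 2)%:E) =
    \int[leb]_(s in `[a, b]) (2%:E * ((riemann_step n s - f s) ^+ 2)%:E) +
    \int[leb]_(s in `[a, b]) (2%:E * ((riemann_step m s - f s) ^+ 2)%:E))%E.
  by apply: ge0_integralD => //; [move=> s _; rewrite mule_ge0|exact: me2|move=> s _; rewrite mule_ge0|exact: me2].
have Z j : (\int[leb]_(s in `[a, b]) (2%:E * ((riemann_step j s - f s) ^+ 2)%:E) =
    2%:E * \int[leb]_(s in `[a, b]) ((riemann_step j s - f s) ^+ 2)%:E)%E.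
  by apply: ge0_integralZl => //; exact: me.
rewrite !Z [leRHS]EFinD !EFinM.
by apply: leeD; apply: lee_wpmul2l => //; exact: riemann_step_sqr_error.
Qed.

(** Uniform continuity of the path makes its oscillation on a cell at most [e / B], where [B]
    exceeds the total variation of [f]. *)
Lemma riemann_parts_cvg (w : R -> R) u : {within `[a, b], continuous w} -> a <= u <= b ->
  \sum_(i < n.+1) f (grid_point n i) * (w (Num.min (grid_point n i.+1) u) -
     w (Num.min (grid_point n i) u)) @[n --> \oo] --> parts_integral a c k f g w u.
Proof.
move=> cw uab; apply/cvgrPdist_le => e e0.
pose B := `|k| + C * (b - a) + 1.
have B0 : 0 < B by rewrite ltr_wpDl// addr_ge0// mulr_ge0// subr_ge0.
have [dl dl0 wdl] := segment_uniform_continuity cw (divr_gt0 e0 B0).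
have /cvgrPdist_lt /(_ _ dl0) := mesh_cvg0.
apply: filterS => n; rewrite sub0r normrN ger0_norm ?mesh_ge0// => md.
have step x y i : (i < n.+1)%N -> grid_point n i <= x <= grid_point n i.+1 ->
    grid_point n i <= y <= grid_point n i.+1 -> `|w x - w y| <= e / B.
  move=> i_n; rewrite grid_pointS => /andP[x1 x2] /andP[y1 y2].
  have /andP[ga _] := grid_point_itv (ltnW i_n).
  have /andP[_] := grid_point_itv i_n; rewrite grid_pointS => gb.
  apply/ltW/wdl.
  - by rewrite (le_trans ga x1) (le_trans x2 gb).
  - by rewrite (le_trans ga y1) (le_trans y2 gb).
  - by apply: le_lt_trans md; rewrite ler_norml; lra.
(* [riemann_parts_error] controls the oscillation on every cell of an infinite grid, so the grid is
   continued by the constant [b]. *)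
pose gr i := if (i <= n.+1)%N then grid_point n i else b.
have grle i : gr i <= gr i.+1.
  rewrite /gr; case: ifPn => h1; case: ifPn => h2 //.
  - exact: grid_point_le.
  - by have /andP[] := grid_point_itv h1.
  - by move: h1; rewrite (ltnW h2).
have := riemann_parts_error ab fP cw (gr := gr) (n := n.+1) (e := e / B) grle _ _ uab _.
rewrite /gr/= leqnn grid_point0 grid_point_last => /(_ erefl erefl).
have H x y i : (if (i <= n.+1)%N then grid_point n i else b) <= x <=
      (if (i < n.+1)%N then grid_point n i.+1 else b) ->
    (if (i <= n.+1)%N then grid_point n i else b) <= y <=
      (if (i < n.+1)%N then grid_point n i.+1 else b) -> `|w x - w y| <= e / B.
  case: ifPn => [i1|]; last rewrite -ltnNge => i1.
    case: ifPn => i2; first exact: step.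
    have -> : i = n.+1 by apply/eqP; rewrite eqn_leq i1 leqNgt.
    rewrite grid_point_last -!eq_le => /eqP <- /eqP <-.
    by rewrite subrr normr0 divr_ge0// ltW.
  have -> : (i < n.+1)%N = false by apply/negbTE; rewrite -leqNgt ltnW.
  rewrite -!eq_le => /eqP <- /eqP <-.
  by rewrite subrr normr0 divr_ge0// ltW.
move=> /(_ H) h.
rewrite [X in `|_ - X|](_ : _ = \sum_(i < n.+1) f (if (i <= n.+1)%N then grid_point n i else b) *
   (w (Num.min (if (i < n.+1)%N then grid_point n i.+1 else b) u) -
    w (Num.min (if (i <= n.+1)%N then grid_point n i else b) u))); last first.
  by apply: eq_bigr => i _; rewrite ltn_ord (ltnW (ltn_ord i)).
apply: (le_trans h); rewrite mulrA ler_pdivrMr// mulrC ler_wpM2l ?(ltW e0)//.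
by rewrite /B lerDl.
Qed.

End riemann_steps.

Section limits.
Context {R : realType} {d} {Omega : measurableType d}.

(** [Y] is the finite part of the upper limit: it is measurable without any convergence, and equals
    the limit wherever there is one. *)
Lemma sigma_limit (C : set (set Omega)) (Y_ : nat -> Omega -> R) :
  (forall n (B : set R), measurable B -> <<s C >> (Y_ n @^-1` B)) ->
  exists2 Y : Omega -> R, (forall B : set R, measurable B -> <<s C >> (Y @^-1` B)) &
    forall w l, Y_ ^~ w @ \oo --> l -> Y w = l.
Proof.
move=> mY; pose G := g_sigma_algebraType C.
have mYG n : Tmeasurable (Y_ n : G -> R).
  by move=> _ B mB; rewrite setTI; exact: mY.
exists (fun w => fine (limn_esup (fun n => (Y_ n w)%:E))).
  have mlim : Tmeasurable (fun w : G => limn_esup (fun n => (Y_ n w)%:E)).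
    apply: (@measurable_fun_limn_esup _ G R setT (fun n w => (Y_ n w)%:E)) => n.
    exact/measurable_EFinP.
  have mf : Tmeasurable (fun w : G => fine (limn_esup (fun n => (Y_ n w)%:E))).
    exact: (measurableT_comp (@fine_measurable R setT measurableT)).
  by move=> B mB; have := mf measurableT B mB; rewrite setTI.
move=> w l Yl; have Yl' : (fun n => (Y_ n w)%:E) @ \oo --> l%:E by apply/fine_cvgP; split => //; exact: nearW.
by have [_ ->] := cvg_limn_einf_sup Yl'.
Qed.

Variable M : market R Omega.
Hypothesis hM : market_ok M.
Notation P := (Pr M).
Notation T := (horizon (par M)).

Lemma Gmeasurable_limit t (Y_ : nat -> Omega -> R) Y :
  (forall n, Gmeasurable M t (Y_ n)) -> {ae P, forall w, Y_ ^~ w @ \oo --> Y w} ->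
  Gmeasurable M t Y.
Proof.
move=> GY YY; have [Z mZ ZE] := sigma_limit GY.
apply: (@Gmeasurable_ae _ _ _ M t Z); last exact: mZ.
by apply: filterS YY => w; exact: ZE.
Qed.

(** Dominated convergence for the indicators of the sets where [|Y n|] is at least [e]. *)
Lemma ae_to0_in_prob (Y : nat -> Omega -> R) : (forall n, Tmeasurable (Y n)) ->
  {ae P, forall w, Y ^~ w @ \oo --> 0} ->
  to0_in_prob M (fun n w => (`|Y n w|)%:E).
Proof.
move=> mY Y0 e e0; pose A n := [set w | e <= `|Y n w|].
have mA n : measurable (A n).
  rewrite -[X in measurable X]setTI.
  have := measurableT_comp (@normr_measurable R setT) (mY n).
  by move=> /(_ measurableT _ (measurable_itv `[e, +oo[)); under eq_set do rewrite /= in_itv/= andbT.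
have mI n : Tmeasurable (fun w => (\1_(A n) w)%:E : \bar R).
  by apply/measurable_EFinP; exact: measurable_indic.
have [|||] := @dominated_convergence _ _ _ P setT measurableT
  (fun n w => (\1_(A n) w)%:E) (cst 0%E) (cst 1%E) mI (measurable_cst _).
- apply: filterS Y0 => w Yw _; apply: cvg_near_cst.
  have /cvgrPdist_lt/(_ _ e0) := Yw; apply: filterS => n; rewrite sub0r normrN => h.
  by rewrite indicE memNset// /A/= leNgt h.
- exact: integrable_cst.
- by apply: filterE => w n _; rewrite /= ger0_norm// lee_fin indicE lern1 leq_b1.
- move=> _ _; rewrite integral0 => h.
  rewrite (_ : (fun n => P _) = (fun n => \int[P]_(w in setT) (\1_(A n) w)%:E)%E)//.
  by apply/funext => n; rewrite integral_indic// setIT; congr (P _); apply/seteqP; split => w /=; rewrite lee_fin.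
Qed.

(** Suffices for intervals []x, y]], which generate the Borel sets: each gives a rectangle over the
    whole of [Omega], an admissible generator at any time. *)
Lemma predictable_det (f : R -> R) t : measurable_fun `]t, T] f ->
  predictable M t (fun s _ => f s).
Proof.
move=> mf B mB.
have key (A : set R) : measurable A ->
    predictable_sets M t ((`]t, T] `&` A) `*` setT : set (R * Omega)).
  apply: (@smallest_sub _ (@sigma_algebra R setT) (@ocitv R)
    (fun A : set R => predictable_sets M t ((`]t, T] `&` A) `*` setT))).
    split.
    - by rewrite setI0 set0X; exact: sigma_algebra0.
    - move=> A' hA; have := sigma_algebraCD hA; congr (predictable_sets M t _).
      by apply/seteqP; split => -[x w] /=; tauto.
    - move=> A_ hA; have := sigma_algebra_bigcup hA; congr (predictable_sets M t _).
      by apply/seteqP; split => -[x w] /=; [move=> [n _ [[? ?] _]]|move=> [[? [n _ ?]] _]]; do ?split => //; exists n.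
  move=> _ [[x y] _ <-]/=.
  rewrite (_ : `]t, T] `&` `]x, y] = `]Num.max t x, Num.min T y]%classic); last first.
    apply/seteqP; split => s /=; rewrite !in_itv/= gt_max le_min.
      by move=> [/andP[-> ->] /andP[-> ->]].
    by move=> /andP[/andP[-> ->] /andP[-> ->]].
  have [le|lt] := leP (Num.max t x) (Num.min T y).
    apply: sub_sigma_algebra; exists (Num.max t x), (Num.min T y), setT.
    by split => //; [rewrite le_max lexx|rewrite ge_min lexx|exact: filtG_setT].
  by rewrite set_itv_ge ?set0X; [exact: sigma_algebra0|rewrite bnd_simp -leNgt ltW].
have := key _ (mf (measurable_itv _) _ mB); congr (predictable_sets M t _).
by apply/seteqP; split => -[x w] /=; tauto.
Qed.

End limits.

(** * Wiener integrals: existence as Ito integrals, and their moments under a prior *)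

Section wiener_integral.
Context {R : realType} {d} {Omega : measurableType d} (M : market R Omega) (hM : market_ok M).
Notation P := (Pr M).
Notation T := (horizon (par M)).
Notation leb := (@lebesgue_measure R).
Variables (t c k C : R) (f g : R -> R).
Hypotheses (t0 : 0 <= t) (tT : t <= T) (fP : step_smooth t T c k C f g).

Definition riemann_simple n : simple R Omega :=
  @Simple R d Omega n.+1 (fun i => grid_point t T n i) (fun i => grid_point t T n i.+1)
    (fun i _ => f (grid_point t T n i)).

Lemma riemann_simple_ok n : simple_ok M t (riemann_simple n).
Proof.
move=> i /=; have /andP[h1 _] := grid_point_itv tT (ltnW (ltn_ord i) : i <= n.+1)%N.
have /andP[_ h2] := grid_point_itv tT (ltn_ord i : i.+1 <= n.+1)%N.
split => //; [exact: grid_point_le|exact: Gmeasurable_cst|].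
by exists `|f (grid_point t T n i)|.
Qed.

Arguments riemann_simple_ok : clear implicits.

Variable W : R -> Omega -> R.
Hypothesis hW : brownian_from M P t W.
Hypothesis cW : {ae P, forall w, {within `[t, T], continuous (W ^~ w)}}.

Definition wiener u w := parts_integral t c k f g (W ^~ w) u.

Lemma riemann_simple_cvg : {ae P, forall w, forall u, t <= u <= T ->
  simple_integral W (riemann_simple n) u w @[n --> \oo] --> wiener u w}.
Proof. by apply: filterS cW => w cw u tu; exact: (riemann_parts_cvg tT fP). Qed.

Lemma wiener_Gmeasurable u : t <= u <= T -> Gmeasurable M u (wiener u).
Proof.
move=> /[dup] tu /andP[tu' _].
apply: (@Gmeasurable_limit _ _ _ M u (fun n => simple_integral W (riemann_simple n) u)).
  by move=> n; exact: (simple_integral_Gmeasurable hW (riemann_simple_ok n) tu').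
by apply: filterS riemann_simple_cvg => w; exact.
Qed.

(** Left-point sums are integrals of deterministic simple processes. They converge pathwise to
    [parts_integral], and their integrands converge in L2, uniformly in the scenario. *)
Lemma wiener_ito : ito M W t (fun s _ => f s) wiener.
Proof.
have mf : measurable_fun `[t, T] f by exact: step_smooth_measurable tT fP.
split.
- have mft : measurable_fun `]t, T] f.
    by apply: measurable_funS mf => //; apply: subset_itv; rewrite bnd_simp.
  exact: (@predictable_det _ _ _ M f t mft).
- exact: wiener_Gmeasurable.
- by apply: filterS cW => w cw; exact: (parts_integral_continuous tT fP cw).
exists riemann_simple; split; first exact: riemann_simple_ok.
- move=> e e0; apply: cvg_near_cst.
  have /cvgrPdist_lt/(_ _ e0) := @step_error_cvg0 _ t T k C.
  apply: filterS => n; rewrite sub0r normrN => h.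
  rewrite (_ : [set w | _] = set0) ?measure0//; apply/seteqP; split => // w /=.
  apply/negP; rewrite -ltNge; apply: (@le_lt_trans _ _ (step_error t T k C n)%:E).
    exact: (riemann_step_sqr_error tT fP n).
  by rewrite lte_fin; apply: le_lt_trans h; exact: ler_norm.
- move=> u tuT; have /andP[tu _] := tuT; have u0 := le_trans t0 tu.
  apply: ae_to0_in_prob.
    move=> n; apply: measurable_funB.
      exact: (Gmeasurable_measurable hM u0 (simple_integral_Gmeasurable hW (riemann_simple_ok n) tu)).
    exact: (Gmeasurable_measurable hM u0 (@wiener_Gmeasurable u tuT)).
  apply: filterS riemann_simple_cvg => w /(_ u tuT) h.
  by rewrite -(subrr (wiener u w)); apply: (@cvgB _ R^o) => //; exact: cvg_cst.
Qed.

Section moments.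
Variables (Q : probability Omega R) (phi : R -> R).
Notation B := (shifted M W phi).
Hypothesis hB : brownian_from M Q t B.
Hypothesis PQ : forall S : set Omega, {ae P, forall w, S w} -> {ae Q, forall w, S w}.
Hypothesis mphi : measurable_fun `[0, T] phi.
Hypothesis iphi : L1 leb `[0, T] phi.
Hypothesis iphi2 : L1 leb `[t, T] (fun s => phi s ^+ 2).

(** The integral of [f] against the Brownian motion under [Q], expressed through [W]: the drift
    correction [phi] is added back. *)
Definition shifted_wiener w := wiener T w + \int[leb]_(s in `[t, T]) (f s * phi s).

Let sub_tT : `[t, T] `<=` `[0, T].
Proof. by apply: subset_itv; rewrite bnd_simp. Qed.

Lemma simple_integral_shifted n w : simple_integral B (riemann_simple n) T w =
  simple_integral W (riemann_simple n) T w +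
  \int[leb]_(s in `[t, T]) (riemann_step t T f n s * phi s).
Proof.
have itT : L1 leb `[t, T] phi by exact: integrableS iphi.
have it (a b : R) : t <= a -> b <= T -> L1 leb `[t, T] (fun s => \1_(`]a, b]) s * phi s).
  move=> ta bT; apply: (@le_integrable _ _ _ leb _ _ _ (EFin \o phi)) => //.
  - apply/measurable_EFinP; apply: measurable_funM.
      by apply: measurable_funTS; exact: measurable_indic.
    exact: measurable_funS mphi.
  - move=> s _ /=; rewrite lee_fin normrM ler_piMl// indicE.
    by case: (_ \in _); rewrite ?normr1 ?normr0.
pose gp := grid_point t T n.
rewrite /simple_integral -/gp.
have -> : \int[leb]_(s in `[t, T]) (riemann_step t T f n s * phi s) =
   \sum_(i < n.+1) f (gp i) * (\int[leb]_(s in `]gp i, gp i.+1]) phi s).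
  have E s : riemann_step t T f n s * phi s =
     \sum_(i < n.+1) f (gp i) * (\1_(`]gp i, gp i.+1]) s * phi s).
    by rewrite /riemann_step mulr_suml; apply: eq_bigr => i _; rewrite mulrA.
  under eq_Rintegral do rewrite E.
  have h i : (i < n.+1)%N -> t <= gp i /\ gp i.+1 <= T.
    move=> i_n; have /andP[h1 _] := grid_point_itv tT (ltnW i_n).
    by have /andP[_ h2] := grid_point_itv tT i_n.
  rewrite Rintegral_sum//; last first.
    move=> i _; apply: integrable_realZ => //.
    by have [h1 h2] := h i (ltn_ord i); exact: it.
  apply: eq_bigr => i _; have [h1 h2] := h i (ltn_ord i).
  rewrite RintegralZl//; last exact: it.
  congr (_ * _); rewrite Rintegral_mkcond [RHS]Rintegral_mkcond.
  apply: eq_Rintegral => s _; rewrite /restrict indicE.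
  case: ifPn => s1; case: ifPn => s2; rewrite ?mul1r ?mul0r//.
  move: s2 s1; rewrite inE/= in_itv/= => /andP[s3 s4] /negP[]; rewrite inE/= in_itv/=.
  by rewrite (ltW (le_lt_trans h1 s3)) (le_trans s4 h2).
rewrite -big_split/=; apply: eq_bigr => i _.
have /andP[h1 h3] := grid_point_itv tT (ltnW (ltn_ord i) : i <= n.+1)%N.
have /andP[_ h2] := grid_point_itv tT (ltn_ord i : i.+1 <= n.+1)%N.
have h4 := grid_point_le tT n i.
rewrite -mulrDr; congr (_ * _); rewrite -/gp in h1 h2 h3 h4 *.
rewrite (min_idPl h3) (min_idPl h2) /shifted (min_idPl h3) (min_idPl h2).
have i0 b : b <= T -> L1 leb `[0, b] phi.
  by move=> bT; apply: integrableS iphi => //; apply: subset_itv; rewrite bnd_simp.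
rewrite opprD addrACA; congr (_ + _).
rewrite Rintegral_itvB//; [exact: i0|rewrite bnd_simp; exact: le_trans h1].
Qed.

Let Y n := simple_integral B (riemann_simple n) T.

Let mY n : Tmeasurable (Y n).
Proof.
exact: (Gmeasurable_measurable hM (le_trans t0 tT) (simple_integral_Gmeasurable hB (riemann_simple_ok n) tT)).
Qed.

Let mZ : Tmeasurable shifted_wiener.
Proof.
apply: measurable_funD => //.
by apply: (Gmeasurable_measurable hM (le_trans t0 tT)); apply: wiener_Gmeasurable; rewrite tT lexx.
Qed.

Let YZ : {ae Q, forall w, Y ^~ w @ \oo --> shifted_wiener w}.
Proof.
apply: PQ; apply: filterS riemann_simple_cvg => w /(_ T); rewrite tT lexx => /(_ erefl) h.
rewrite /Y; under eq_fun do rewrite simple_integral_shifted.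
apply: (@cvgD _ R^o) => //.
by apply: (riemann_step_mul_cvg tT fP _ iphi2).2; exact: measurable_funS mphi.
Qed.

Let iY n : L1 Q setT (fun w => Y n w ^+ 2).
Proof. exact: (simple_integral_sqr_integrable hM t0 tT hB (riemann_simple_ok n)). Qed.

(** The difference of two elementary integrals is the elementary integral of the difference, to
    which the isometry applies. *)
Let Ycauchy n m : \int[Q]_w ((Y n w - Y m w) ^+ 2) <=
  2 * step_error t T k C n + 2 * step_error t T k C m.
Proof.
have okD := simple_sub_ok (riemann_simple_ok n) (riemann_simple_ok m).
have := simple_integral_isometry hM t0 tT hB okD
  (f := fun s => riemann_step t T f n s - riemann_step t T f m s).
move=> /(_ (fun s w => simple_sub_value _ _ _ _)) h.
rewrite -lee_fin; apply: le_trans (riemann_step_cauchy tT fP n m); rewrite -h.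
have E w : Y n w - Y m w =
    simple_integral B (simple_sub (riemann_simple n) (riemann_simple m)) T w.
  by rewrite simple_sub_integral.
by under eq_Rintegral do rewrite E.
Qed.

Let err0 : (fun n => 2 * step_error t T k C n) @ \oo --> 0.
Proof.
rewrite -(mulr0 2); apply: cvgM; first exact: cvg_cst.
exact: step_error_cvg0.
Qed.

Lemma shifted_wiener_measurable : Tmeasurable shifted_wiener. Proof. exact: mZ. Qed.

Lemma shifted_wiener_sqr_integrable :
  L1 Q setT (fun w => shifted_wiener w ^+ 2).
Proof. exact: (L2_limit_integrable mY mZ iY YZ Ycauchy err0). Qed.

Lemma shifted_wiener_expectation : \int[Q]_w shifted_wiener w = 0.
Proof.
apply: (L2_limit_expectation mY mZ iY YZ Ycauchy err0) => n.
exact: (simple_integral_expectation hM t0 tT hB (riemann_simple_ok n)).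
Qed.

Lemma shifted_wiener_sqr :
  \int[Q]_w (shifted_wiener w ^+ 2) = \int[leb]_(s in `[t, T]) (f s ^+ 2).
Proof.
apply: (L2_limit_sqr mY mZ iY YZ Ycauchy err0).
have E n : \int[Q]_w (Y n w ^+ 2) = \int[leb]_(s in `[t, T]) (riemann_step t T f n s ^+ 2).
  apply: EFin_inj; rewrite (simple_integral_isometry hM t0 tT hB (riemann_simple_ok n)
    (f := riemann_step t T f n))//.
  rewrite /Rintegral fineK//; apply: integrable_fin_num => //.
  exact: riemann_step_sqr_integrable fP n.
under eq_fun do rewrite E.
exact: riemann_step_sqr_cvg fP.
Qed.

(** A version measurable with respect to the increments of [W] after [t]. Independence of the noises
    is stated for these sigma-algebras, so the version is what makes terms driven by different
    noises uncorrelated. *)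
Lemma shifted_wiener_increments : exists2 Z : Omega -> R,
  (forall A : set R, measurable A -> increments t W (Z @^-1` A)) &
  {ae Q, forall w, Z w = shifted_wiener w}.
Proof.
have [|Z mZ' ZE] := @sigma_limit R d Omega (\bigcup_(u in `[t, +oo[)
        preimage_set_system setT (fun w => W u w - W t w) measurable) Y.
  move=> n A mA; pose G := g_sigma_algebraType (\bigcup_(u in `[t, +oo[)
        preimage_set_system setT (fun w => W u w - W t w) measurable).
  have mi u : t <= u -> Tmeasurable ((fun w => W u w - W t w) : G -> R).
    move=> tu _ D mD; rewrite setTI.
    have := @increments_sub _ _ _ W t u D 0 tu mD.
    by under eq_set do rewrite addr0.
  have mG : Tmeasurable (Y n : G -> R).
    rewrite (_ : (Y n : G -> R) = (fun w => simple_integral W (riemann_simple n) T w +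
        \int[leb]_(s in `[t, T]) (riemann_step t T f n s * phi s))); last first.
      by apply/funext => w; rewrite /Y simple_integral_shifted.
    apply: measurable_funD => //; apply: measurable_sum => i; apply: measurable_funM => //=.
    have /andP[h1 h3] := grid_point_itv tT (ltnW (ltn_ord i) : i <= n.+1)%N.
    have /andP[h4 h2] := grid_point_itv tT (ltn_ord i : i.+1 <= n.+1)%N.
    rewrite (min_idPl h3) (min_idPl h2).
    rewrite (_ : (fun w => _) = (fun w => (W (grid_point t T n i.+1) w - W t w) - (W (grid_point t T n i) w - W t w))).
      by apply: measurable_funB; exact: mi.
    by apply/funext => w; ring.
  by have := mG measurableT A mA; rewrite setTI.
exists Z; first exact: mZ'.
by apply: filterS YZ => w; exact: ZE.
Qed.

End moments.
End wiener_integral.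

(** * Campbell's formulas for a random measure *)

Section nonnegative_limits.
Context {R : realType}.
Local Open Scope ereal_scope.

(** Only [c = +oo] needs care: either all [u n] vanish, or they are positive from some rank on and
    both sides are infinite. *)
Lemma limn_mulr (u : nat -> \bar R) c : (forall n, 0 <= u n) -> nondecreasing_seq u ->
  0 <= c -> limn (fun n => u n * c) = limn u * c.
Proof.
move=> u0 nu; have cu := ereal_nondecreasing_is_cvgn nu.
case: c => [r _|_|//].
  apply/cvg_lim => //; exact: (cvgeZr (isT : r%:E \is a fin_num) cu).
have [h|/existsNP [n0 /eqP un0]] := pselect (forall n, u n = 0).
  have -> : (fun n => u n * +oo) = cst 0 by apply/funext => n; rewrite h mul0e.
  have -> : u = cst 0 by exact/funext.
  by rewrite lim_cst// mul0e.
have un0' : 0 < u n0 by rewrite lt_neqAle eq_sym un0 u0.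
rewrite gt0_muley.
  apply/cvg_lim => //; apply: cvg_near_cst; exists n0 => // n /= n0n.
  by rewrite gt0_muley//; apply: lt_le_trans un0' _; exact: nu.
apply: (lt_le_trans un0'); rewrite (cvg_lim _ (ereal_nondecreasing_cvgn nu))//.
by apply: ereal_sup_ubound; exists n0.
Qed.

Lemma limn_add (u v : nat -> \bar R) : (forall n, 0 <= u n) -> (forall n, 0 <= v n) ->
  nondecreasing_seq u -> nondecreasing_seq v ->
  limn (fun n => u n + v n) = limn u + limn v.
Proof.
move=> u0 v0 nu nv; have cu := ereal_nondecreasing_is_cvgn nu.
have cv := ereal_nondecreasing_is_cvgn nv.
apply: limeD => //; apply: ge0_adde_def; rewrite inE/=.
  by apply: lime_ge => //; exact: nearW.
by apply: lime_ge => //; exact: nearW.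
Qed.

End nonnegative_limits.

Lemma ge0_integralD4 d (T : measurableType d) (R : realType) (mu : {measure set T -> \bar R})
  (f1 f2 f3 f4 : T -> \bar R) : (forall x, 0 <= f1 x)%E -> (forall x, 0 <= f2 x)%E ->
  (forall x, 0 <= f3 x)%E -> (forall x, 0 <= f4 x)%E -> Tmeasurable f1 ->
  Tmeasurable f2 -> Tmeasurable f3 -> Tmeasurable f4 ->
  (\int[mu]_x (f1 x + (f2 x + (f3 x + f4 x))) =
   \int[mu]_x f1 x + (\int[mu]_x f2 x + (\int[mu]_x f3 x + \int[mu]_x f4 x)))%E.
Proof.
move=> f10 f20 f30 f40 m1 m2 m3 m4.
have m34 := emeasurable_funD m3 m4; have m234 := emeasurable_funD m2 m34.
have f340 x : (0 <= f3 x + f4 x)%E by exact: adde_ge0.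
rewrite [LHS]ge0_integralD//; last by move=> x _; exact: adde_ge0.
by rewrite [X in (_ + X = _)%E]ge0_integralD// [X in (_ + (_ + X) = _)%E]ge0_integralD.
Qed.

Section random_measure.
Context d (U : measurableType d) (R : realType) d' (G : measurableType d').
Variables (N : G -> {measure set U -> \bar R}) (D : set U).
Hypothesis mD : measurable D.
Hypothesis mN : forall A, measurable A -> A `<=` D -> Tmeasurable (fun w => N w A).
Local Open Scope ereal_scope.

Lemma measurable_limn (f_ : nat -> G -> \bar R) : (forall n, Tmeasurable (f_ n)) ->
  (forall w, nondecreasing_seq (f_ ^~ w)) -> Tmeasurable (fun w => limn (f_ ^~ w)).
Proof.
move=> mf nf; rewrite (_ : (fun w => _) = (fun w => limn_esup (f_ ^~ w))).
  exact: measurable_fun_limn_esup.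
by apply/funext => w; rewrite is_cvg_limn_esupE//; exact: ereal_nondecreasing_is_cvgn.
Qed.

Lemma measurable_random_integral F : (forall x, 0 <= F x) -> Tmeasurable F ->
  Tmeasurable (fun w => \int[N w]_(x in D) F x).
Proof.
apply: (nonneg_measurable_ind (P := fun F => Tmeasurable (fun w => \int[N w]_(x in D) F x))).
- move=> A mA; under eq_fun do rewrite integral_indic//.
  by apply: mN; [exact: measurableI|exact: subIsetr].
- move=> k f k0 f0 mf mI.
  rewrite (_ : (fun w => _) = (fun w => k%:E * \int[N w]_(x in D) f x)).
    exact: measurable_funeM.
  by apply/funext => w; rewrite ge0_integralZl_EFin//; exact: measurable_funTS.
- move=> f g f0 g0 mf mg mI mJ.
  rewrite (_ : (fun w => _) = (fun w => \int[N w]_(x in D) f x + \int[N w]_(x in D) g x)).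
    exact: emeasurable_funD.
  by apply/funext => w; rewrite ge0_integralD//; exact: measurable_funTS.
- move=> f_ f0 mf nf mI.
  rewrite (_ : (fun w => _) = (fun w => limn (fun n => \int[N w]_(x in D) f_ n x))).
    apply: measurable_limn => // w n m nm; apply: ge0_le_integral => //.
    + exact: measurable_funTS.
    + exact: measurable_funTS.
    + by move=> x _; exact: nf.
  apply/funext => w; rewrite monotone_convergence// => n.
  exact: measurable_funTS.
Qed.

End random_measure.

Section campbell.
Context d (U : measurableType d) (R : realType) d' (T : measurableType d').
Variables (Q : probability T R) (N : T -> {measure set U -> \bar R}).
Context d1 (U1 : measurableType d1) (emb : U1 -> U) (memb : Tmeasurable emb).
Variables (mu : {measure set U1 -> \bar R}) (rho : U1 -> R) (D : set U) (D_ : nat -> set U).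
Hypotheses (rho0 : forall x, 0 <= rho x) (mrho : Tmeasurable rho).
Hypotheses (mD : measurable D) (mD_ : forall n, measurable (D_ n)).
Hypotheses (nD_ : nondecreasing_seq D_) (DD_ : \bigcup_n D_ n = D).
Local Open Scope ereal_scope.
(** [emb] reconciles two measurable structures on the plane: the product of Lebesgue and Lévy
    measures lives on [measurableTypeR R * R], the jumps on [R * R]. *)
Definition intensity (F : U -> \bar R) := \int[mu]_(x in emb @^-1` D) (F (emb x) * (rho x)%:E).
Hypothesis mN : forall A, measurable A -> A `<=` D -> Tmeasurable (fun w => N w A).
Hypothesis fin_intensity : forall n, intensity (fun x => (\1_(D_ n) x)%:E) < +oo.
Hypothesis mean_N : forall n A, measurable A -> A `<=` D_ n ->
  \int[Q]_w N w A = intensity (fun x => (\1_A x)%:E).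
Hypothesis sqr_N : forall n A, measurable A -> A `<=` D_ n ->
  \int[Q]_w (N w A * N w A) = intensity (fun x => (\1_A x)%:E) +
    intensity (fun x => (\1_A x)%:E) * intensity (fun x => (\1_A x)%:E).
Hypothesis indep_N : forall n A B, measurable A -> measurable B -> A `<=` D_ n -> B `<=` D_ n ->
  A `&` B = set0 -> \int[Q]_w (N w A * N w B) = \int[Q]_w N w A * \int[Q]_w N w B.

Let rhoE0 x : 0 <= (rho x)%:E. Proof. by rewrite lee_fin. Qed.
Let mrhoE : Tmeasurable (fun x => (rho x)%:E). Proof. exact/measurable_EFinP. Qed.
Hint Resolve rhoE0 mrhoE : core.

Let mgD : measurable (emb @^-1` D).
Proof. by rewrite -[X in measurable X]setTI; exact: memb. Qed.

Let NF (F : U -> \bar R) w := \int[N w]_(x in D) F x.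

Let D_D n : D_ n `<=` D. Proof. by rewrite -DD_; exact: bigcup_sup. Qed.

Let mNF F : (forall x, 0 <= F x) -> Tmeasurable F -> Tmeasurable (NF F).
Proof. exact: measurable_random_integral. Qed.

Let NF0 F w : (forall x, 0 <= F x) -> 0 <= NF F w.
Proof. by move=> F0; exact: integral_ge0. Qed.

Let NFZ (k : R) F w : (0 <= k)%R -> (forall x, 0 <= F x) -> Tmeasurable F ->
  NF (fun x => k%:E * F x) w = k%:E * NF F w.
Proof. by move=> k0 F0 mF; rewrite /NF ge0_integralZl_EFin//; exact: measurable_funTS. Qed.

Let NFD F G w : (forall x, 0 <= F x) -> (forall x, 0 <= G x) -> Tmeasurable F ->
  Tmeasurable G -> NF (fun x => F x + G x) w = NF F w + NF G w.
Proof. by move=> F0 G0 mF mG; rewrite /NF ge0_integralD//; exact: measurable_funTS. Qed.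

Let NFlim F_ w : (forall n x, 0 <= F_ n x) -> (forall n, Tmeasurable (F_ n)) ->
  (forall x, nondecreasing_seq (F_ ^~ x)) -> NF (fun x => limn (F_ ^~ x)) w = limn (fun n => NF (F_ n) w).
Proof.
move=> F0 mF nF; rewrite /NF monotone_convergence// => n.
exact: measurable_funTS.
Qed.

Let NF_le F G w : (forall x, 0 <= F x) -> Tmeasurable F -> Tmeasurable G ->
  (forall x, F x <= G x) -> NF F w <= NF G w.
Proof.
by move=> F0 mF mG FG; apply: ge0_le_integral => //; exact: measurable_funTS.
Qed.

Let mI (F : U -> \bar R) : Tmeasurable F ->
  Tmeasurable (fun x => F (emb x) * (rho x)%:E).
Proof. by move=> mF; apply: emeasurable_funM => //; exact: (measurableT_comp mF memb). Qed.

Lemma intensity_ge0 F : (forall x, 0 <= F x) -> 0 <= intensity F.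
Proof. by move=> F0; apply: integral_ge0 => x _; rewrite mule_ge0. Qed.

Lemma intensityZ (k : R) F : (0 <= k)%R -> (forall x, 0 <= F x) -> Tmeasurable F ->
  intensity (fun x => k%:E * F x) = k%:E * intensity F.
Proof.
move=> k0 F0 mF; rewrite /intensity; under eq_integral do rewrite -muleA.
rewrite ge0_integralZl_EFin//; last by apply: measurable_funTS; exact: mI.
by move=> x _; rewrite mule_ge0.
Qed.

Lemma intensityD F G : (forall x, 0 <= F x) -> (forall x, 0 <= G x) -> Tmeasurable F ->
  Tmeasurable G -> intensity (fun x => F x + G x) = intensity F + intensity G.
Proof.
move=> F0 G0 mF mG; rewrite /intensity; under eq_integral do rewrite ge0_muleDl//.
rewrite ge0_integralD//; try by move=> x _; rewrite mule_ge0.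
- by apply: measurable_funTS; exact: mI.
- by apply: measurable_funTS; exact: mI.
Qed.

Lemma intensity_lim F_ : (forall n x, 0 <= F_ n x) -> (forall n, Tmeasurable (F_ n)) ->
  (forall x, nondecreasing_seq (F_ ^~ x)) ->
  intensity (fun x => limn (F_ ^~ x)) = limn (fun n => intensity (F_ n)).
Proof.
move=> F0 mF nF; rewrite /intensity.
rewrite -(@monotone_convergence _ _ _ mu _ mgD (fun n x => F_ n (emb x) * (rho x)%:E)).
- by apply: eq_integral => x _; rewrite limn_mulr.
- by move=> n; apply: measurable_funTS; exact: mI.
- by move=> n x _; rewrite mule_ge0.
- by move=> x _ n m nm; rewrite lee_wpmul2r//; exact: nF.
Qed.

Lemma intensity_le F G : (forall x, 0 <= F x) -> Tmeasurable F -> Tmeasurable G ->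
  (forall x, F x <= G x) -> intensity F <= intensity G.
Proof.
move=> F0 mF mG FG; apply: ge0_le_integral => //.
- by move=> x _; rewrite mule_ge0.
- by apply: measurable_funTS; exact: mI.
- by apply: measurable_funTS; exact: mI.
- by move=> x _; rewrite lee_wpmul2r.
Qed.

Let m1 (A : set U) : measurable A -> Tmeasurable (fun x => (\1_A x : R)%:E).
Proof. by move=> mA; apply/measurable_EFinP; exact: measurable_indic. Qed.

(** The moments of the random measure are known on subsets of some [D_ n], where the intensity is
    finite. The induction starts from such sets because [A] is the increasing union of its
    intersections with [D_ n] together with the complement of [D]. *)
Let ind (P : (U -> \bar R) -> Prop) :
  (forall A n, measurable A -> A `&` D `<=` D_ n -> P (fun x => (\1_A x)%:E)) ->
  (forall (k : R) f, (0 <= k)%R -> (forall x, 0 <= f x) -> Tmeasurable f ->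
     P f -> P (fun x => k%:E * f x)) ->
  (forall f g, (forall x, 0 <= f x) -> (forall x, 0 <= g x) ->
     Tmeasurable f -> Tmeasurable g -> P f -> P g ->
     P (fun x => f x + g x)) ->
  (forall f_ : nat -> U -> \bar R, (forall n x, 0 <= f_ n x) ->
     (forall n, Tmeasurable (f_ n)) ->
     (forall x, nondecreasing_seq (f_ ^~ x)) ->
     (forall n, P (f_ n)) -> P (fun x => limn (f_ ^~ x))) ->
  forall f, (forall x, 0 <= f x) -> Tmeasurable f -> P f.
Proof.
move=> P1 PZ PD PL; apply: nonneg_measurable_ind => // A mA.
pose E n := A `&` (D_ n `|` ~` D).
have mE n : measurable (E n).
  by apply: measurableI => //; apply: measurableU => //; exact: measurableC.
rewrite (_ : (fun x => _) = (fun x => limn (fun n => (\1_(E n) x)%:E : \bar R))).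
  apply: PL => //.
  - by move=> n; exact: m1.
  - move=> x n m nm; rewrite lee_fin !indicE ler_nat; case: (boolP (x \in E n)) => //.
    rewrite inE => -[Ax h]; rewrite mem_set//; split => //; case: h => [h|]; last by right.
    by left; move: h; have /subsetPset := nD_ nm; exact.
  - by move=> n; apply: (P1 _ n) => // x [[Ax [|]]].
apply/funext => x; apply/esym/cvg_lim => //; apply: cvg_near_cst.
rewrite indicE; case: (boolP (x \in A)) => [|xA]; last first.
  apply: nearW => n; rewrite indicE memNset//; move/negP: xA => xA [Ax _]; apply: xA.
  by rewrite inE.
rewrite inE => Ax; have [xD|xD] := pselect (D x); last first.
  by apply: nearW => n; rewrite indicE mem_set//; split => //; right.
move: (xD); rewrite -DD_ => -[n0 _ xn0]; exists n0 => // n /= n0n.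
rewrite indicE mem_set//; split => //; left.
by move: xn0; have /subsetPset := nD_ n0n; exact.
Qed.

Let NF1 A w : measurable A -> NF (fun x => (\1_A x)%:E) w = N w (A `&` D).
Proof. by move=> mA; rewrite /NF integral_indic. Qed.

Let intensity1 A : intensity (fun x => (\1_A x)%:E) = intensity (fun x => (\1_(A `&` D) x)%:E).
Proof.
apply: eq_integral => x; rewrite inE/= => xD; congr (_%:E * _).
by rewrite !indicE in_setI (mem_set xD) andbT.
Qed.

Lemma campbell_mean F : (forall x, 0 <= F x) -> Tmeasurable F ->
  \int[Q]_w \int[N w]_(x in D) F x = intensity F.
Proof.
apply: (ind (P := fun F => \int[Q]_w NF F w = intensity F)).
- move=> A n mA AD; under eq_integral do rewrite NF1//.
  by rewrite intensity1 (mean_N _ AD)//; exact: measurableI.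
- move=> k f k0 f0 mf Pf; under eq_integral do rewrite NFZ//.
  rewrite intensityZ// -Pf ge0_integralZl_EFin//; last exact: mNF.
  by move=> w _; exact: NF0.
- move=> f g f0 g0 mf mg Pf Pg; under eq_integral do rewrite NFD//.
  rewrite intensityD// -Pf -Pg ge0_integralD//; try by move=> w _; exact: NF0.
  - exact: mNF.
  - exact: mNF.
- move=> f_ f0 mf nf Pf; under eq_integral do rewrite NFlim//.
  rewrite intensity_lim// monotone_convergence//.
  - by congr (limn _); apply/funext => n; rewrite Pf.
  - by move=> n; exact: mNF.
  - by move=> n w _; exact: NF0.
  - by move=> w _ n m nm; apply: NF_le => // x; exact: nf.
Qed.

(** The polarised second moment formula. It is linear in each argument, so that the induction can be
    run in one variable at a time; the quadratic formula is the diagonal. *)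
Let bil F G := \int[Q]_w (NF F w * NF G w) =
  intensity (fun x => F x * G x) + intensity F * intensity G.

Let bilC F G : bil F G -> bil G F.
Proof.
move=> h; rewrite /bil; under eq_integral do rewrite muleC.
by rewrite h muleC; congr (_ + _); apply: eq_integral => x _; rewrite (muleC (F (emb x))).
Qed.

Let bil_ind G : (forall x, 0 <= G x) -> Tmeasurable G ->
  (forall A n, measurable A -> A `&` D `<=` D_ n -> bil (fun x => (\1_A x)%:E) G) ->
  forall F, (forall x, 0 <= F x) -> Tmeasurable F -> bil F G.
Proof.
move=> G0 mG h; apply: ind => //.
- move=> k f k0 f0 mf Pf; rewrite /bil.
  under eq_integral do rewrite NFZ// -muleA.
  rewrite ge0_integralZl_EFin//; first last.
  - by apply: emeasurable_funM; exact: mNF.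
  - by move=> w _; apply: mule_ge0; exact: NF0.
  under [X in _ = X + _]eq_integral do rewrite -(muleA k%:E).
  rewrite [X in _ = X + _](@intensityZ k (fun x => f x * G x))//.
  + rewrite intensityZ// -muleA -ge0_muleDr ?Pf//.
    - by apply: intensity_ge0 => x; exact: mule_ge0.
    - by apply: mule_ge0; exact: intensity_ge0.
  + by move=> x; exact: mule_ge0.
  + exact: emeasurable_funM.
- move=> f g f0 g0 mf mg Pf Pg; rewrite /bil.
  under eq_integral do rewrite NFD// ge0_muleDl ?NF0//.
  rewrite ge0_integralD//; first last.
  - by apply: emeasurable_funM; exact: mNF.
  - by move=> w _; apply: mule_ge0; exact: NF0.
  - by apply: emeasurable_funM; exact: mNF.
  - by move=> w _; apply: mule_ge0; exact: NF0.
  rewrite Pf Pg intensityD// [X in _ = _ + X](_ : _ =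
    intensity f * intensity G + intensity g * intensity G); last first.
    by apply: ge0_muleDl; exact: intensity_ge0.
  have -> : intensity (fun x => (f x + g x) * G x) =
      intensity (fun x => f x * G x) + intensity (fun x => g x * G x).
    rewrite -intensityD//.
    + by apply: eq_integral => x _; rewrite ge0_muleDl.
    + by move=> x; exact: mule_ge0.
    + by move=> x; exact: mule_ge0.
    + exact: emeasurable_funM.
    + exact: emeasurable_funM.
  by rewrite addeACA.
- move=> f_ f0 mf nf Pf; rewrite /bil.
  have nNF w : nondecreasing_seq (fun n => NF (f_ n) w).
    by move=> n m nm; apply: NF_le => // x; exact: nf.
  have nint : nondecreasing_seq (fun n => intensity (f_ n)).
    by move=> n m nm; apply: intensity_le => // x; exact: nf.
  have E1 w : NF (fun x => limn (f_ ^~ x)) w * NF G w = limn (fun n => NF (f_ n) w * NF G w).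
    by rewrite NFlim// limn_mulr//; [move=> n; exact: NF0|exact: NF0].
  under eq_integral do rewrite E1.
  rewrite monotone_convergence//; first last.
  + by move=> w _ n m nm; rewrite lee_wpmul2r ?NF0//; exact: nNF.
  + by move=> n w _; apply: mule_ge0; exact: NF0.
  + by move=> n; apply: emeasurable_funM; exact: mNF.
  rewrite intensity_lim// -limn_mulr ?intensity_ge0//; last first.
    by move=> n; exact: intensity_ge0.
  have -> : intensity (fun x => limn (f_ ^~ x) * G x) = limn (fun n => intensity (fun x => f_ n x * G x)).
    rewrite -intensity_lim.
    + by apply: eq_integral => x _; rewrite limn_mulr.
    + by move=> n x; exact: mule_ge0.
    + by move=> n; exact: emeasurable_funM.
    + by move=> x n m nm; rewrite lee_wpmul2r//; exact: nf.
  rewrite -limn_add.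
  + by congr (limn _); apply/funext => n; rewrite Pf.
  + by move=> n; apply: intensity_ge0 => x; exact: mule_ge0.
  + by move=> n; apply: mule_ge0; exact: intensity_ge0.
  + move=> n m nm; apply: intensity_le => //.
    * by move=> x; exact: mule_ge0.
    * exact: emeasurable_funM.
    * exact: emeasurable_funM.
    * by move=> x; rewrite lee_wpmul2r//; exact: nf.
  + by move=> n m nm; rewrite lee_wpmul2r ?intensity_ge0//; exact: nint.
Qed.

(** [A] and [B] are cut into their intersection and two differences. The second moment formula
    handles the intersection, and independence on disjoint sets the other products. *)
Let bil_indic A B n : measurable A -> measurable B -> A `<=` D_ n -> B `<=` D_ n ->
  bil (fun x => (\1_A x)%:E) (fun x => (\1_B x)%:E).
Proof.
move=> mA mB An Bn.
have D1 E : E `<=` D_ n -> E `&` D = E by move=> En; apply/setIidPl; exact: subset_trans (@D_D n).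
pose I := A `&` B; pose A' := A `\` B; pose B' := B `\` A.
have mI' : measurable I by exact: measurableI.
have mA' : measurable A' by exact: measurableD.
have mB' : measurable B' by exact: measurableD.
have In : I `<=` D_ n by move=> x [/An].
have A'n : A' `<=` D_ n by move=> x [/An].
have B'n : B' `<=` D_ n by move=> x [/Bn].
have SE (X Y : set U) : X = (X `&` Y) `|` (X `\` Y).
  by apply/seteqP; split => x /=; case: (pselect (Y x)); tauto.
have NA w : N w A = N w I + N w A'.
  rewrite -measureU//; first by rewrite -SE.
  by apply/seteqP; split => // x [[_ ?] [_]].
have NB w : N w B = N w I + N w B'.
  rewrite -measureU//; first by rewrite /I setIC -SE.
  by apply/seteqP; split => // x [[? _] [_]].
rewrite /bil; under eq_integral do rewrite !NF1// !D1// NA NB.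
pose L E := intensity (fun x => (\1_E x)%:E).
have mNE E : measurable E -> E `<=` D_ n -> Tmeasurable (fun w => N w E).
  by move=> mE En; apply: mN => //; exact: subset_trans (@D_D n).
have E4 w : (N w I + N w A') * (N w I + N w B') =
   N w I * N w I + (N w I * N w B' + (N w A' * N w I + N w A' * N w B')).
  by rewrite ge0_muleDl// !ge0_muleDr// -addeA.
under eq_integral do rewrite E4.
have mM E E' : measurable E -> measurable E' -> E `<=` D_ n -> E' `<=` D_ n ->
   Tmeasurable (fun w => N w E * N w E').
  by move=> mE mE' En En'; apply: emeasurable_funM; exact: mNE.
rewrite ge0_integralD4//; try (by move=> w; exact: mule_ge0); try exact: mM.
rewrite (sqr_N mI' In) !(indep_N (n := n))//; first last.
- by apply/seteqP; split => x //=; rewrite /A' /B' /I /=; tauto.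
- by apply/seteqP; split => x //=; rewrite /A' /B' /I /=; tauto.
- by apply/seteqP; split => x //=; rewrite /A' /B' /I /=; tauto.
rewrite !(mean_N (n := n))// -!/(L _).
have L0 E : 0 <= L E by apply: intensity_ge0 => x; rewrite lee_fin.
have LD E E' : measurable E -> measurable E' -> E `&` E' = set0 -> L (E `|` E') = L E + L E'.
  move=> mE mE' EE'; rewrite /L -intensityD//; try exact: m1.
  apply: eq_integral => x _; congr (_ * _); rewrite -EFinD; congr EFin.
  rewrite !indicE in_setU; case: (boolP (emb x \in E)) => xE; case: (boolP (emb x \in E')) => xE' //=; rewrite ?addr0 ?add0r//.
  move: xE xE'; rewrite !inE => xE xE'.
  by have : (E `&` E') (emb x) by []; rewrite EE'.
have -> : intensity (fun x => (\1_A x)%:E * (\1_B x)%:E) = L I.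
  by apply: eq_integral => x _; rewrite -EFinM /I indicI.
have -> : L A = L I + L A'.
  rewrite -LD//; first by rewrite -SE.
  by apply/seteqP; split => // x [[_ ?] [_]].
have -> : L B = L I + L B'.
  rewrite -LD//; first by rewrite /I setIC -SE.
  by apply/seteqP; split => // x [[? _] [_]].
move: (L I) (L A') (L B') (L0 I) (L0 A') (L0 B') => x y z x0 y0 z0.
by rewrite ge0_muleDl// !ge0_muleDr// -!addeA.
Qed.

Lemma campbell_sqr F : (forall x, 0 <= F x) -> Tmeasurable F ->
  \int[Q]_w (\int[N w]_(x in D) F x * \int[N w]_(x in D) F x) =
  intensity (fun x => F x * F x) + intensity F * intensity F.
Proof.
move=> F0 mF; suff : bil F F by [].
have b1 A n : measurable A -> A `&` D `<=` D_ n -> bil (fun x => (\1_A x)%:E) F.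
  move=> mA An; apply: bilC; apply: bil_ind => //; first exact: m1.
  move=> B m mB Bm.
  have mAD : measurable (A `&` D) by exact: measurableI.
  have mBD : measurable (B `&` D) by exact: measurableI.
  have : bil (fun x => (\1_(B `&` D) x)%:E) (fun x => (\1_(A `&` D) x)%:E).
    apply: (@bil_indic _ _ (maxn n m)) => //.
      by apply: (subset_trans Bm); apply/subsetPset; apply: nD_; exact: leq_maxr.
    by apply: (subset_trans An); apply/subsetPset; apply: nD_; exact: leq_maxl.
  have NN E w : measurable E -> NF (fun x => (\1_(E `&` D) x)%:E) w = NF (fun x => (\1_E x)%:E) w.
    by move=> mE; rewrite !NF1//; [rewrite -setIA setIid|exact: measurableI].
  rewrite /bil -!intensity1 => h.
  transitivity (\int[Q]_w (NF (fun x => (\1_(B `&` D) x)%:E) w * NF (fun x => (\1_(A `&` D) x)%:E) w)).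
    by apply: eq_integral => w _; rewrite (NN B)// (NN A).
  rewrite h; congr (_ + _); apply: eq_integral => x; rewrite inE/= => xD.
  by rewrite !indicE !in_setI (mem_set xD) !andbT.
exact: (bil_ind F0 mF b1).
Qed.

End campbell.

(** * Lévy measure, jump domains, and integrability granted by Theta *)

Section product_integral.
Context {R : realType} (v : {sigma_finite_measure set R -> \bar R}).
Notation leb := (@lebesgue_measure R).

Notation ell := (leb \x v)%E.
Local Open Scope ereal_scope.

Lemma integral_setX (A B : set R) (F : R * R -> \bar R) : measurable A -> measurable B ->
  (forall q, 0 <= F q) -> Tmeasurable F ->
  \int[ell]_(q in A `*` B) F q = \int[leb]_(s in A) \int[v]_(z in B) F (s, z).
Proof.
move=> mA mB F0 mF; have mAB : measurable (A `*` B) by exact: measurableX.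
rewrite integral_mkcond fubini_tonelli1.
- rewrite [RHS]integral_mkcond; apply: eq_integral => s _; rewrite [RHS]patchE.
  case: ifPn => sA; last first.
    apply: integral0_eq => z _; rewrite patchE memNset// => -[/= As _].
    by move: sA; rewrite notin_setE.
  rewrite /fubini_F [RHS]integral_mkcond; apply: eq_integral => z _; rewrite !patchE.
  have -> // : ((s, z) \in A `*` B) = (z \in B).
  apply/idP/idP; rewrite !inE; first by case.
  by move=> Bz; split => //=; move: sA; rewrite inE.
- by apply/(measurable_restrictT _ mAB); exact: measurable_funTS.
- by move=> q; apply: erestrict_ge0.
Qed.

Lemma measurable_integral_section (B : set R) (F : R * R -> \bar R) : measurable B ->
  (forall q, 0 <= F q) -> Tmeasurable F ->
  Tmeasurable (fun s => \int[v]_(z in B) F (s, z)).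
Proof.
move=> mB F0 mF; have mTB : measurable (setT `*` B : set (R * R)) by exact: measurableX.
have := @measurable_fun_fubini_tonelli_F _ _ _ _ _ v (F \_ (setT `*` B)).
move=> /(_ _ _)/wrap[]; first by apply/(measurable_restrictT _ mTB); exact: measurable_funTS.
  by move=> q; exact: erestrict_ge0.
congr (Tmeasurable _); apply/funext => s; rewrite /fubini_F [RHS]integral_mkcond.
apply: eq_integral => z _; rewrite !patchE.
have -> // : ((s, z) \in setT `*` B) = (z \in B).
by apply/idP/idP; rewrite !inE; [case|].
Qed.

End product_integral.

Section levy.
Context {R : realType} {d} {Omega : measurableType d} (M : market R Omega) (hM : market_ok M).
Notation v := (levy M).
Notation T := (horizon (par M)).
Notation leb := (@lebesgue_measure R).
Notation ell := (leb \x v)%E.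

Lemma levy_okM : levy_ok M. Proof. by case: hM => -[]. Qed.

Lemma params_okM : params_ok (par M). Proof. by case: hM => -[]. Qed.

Lemma levy_first_moment : (\int[v]_(z in `]0%R, +oo[) z%:E < +oo)%E.
Proof. by have [] := levy_okM. Qed.

Lemma levy_mean_integrable : v.-integrable `]0%R, +oo[ EFin.
Proof.
have h : L1 v `]0%R, +oo[ id; last exact: h.
apply: ge0_integrable_real => //.
- by move=> z /=; rewrite in_itv/= andbT => /ltW.
- exact: levy_first_moment.
Qed.

Lemma mean_claimE : (\int[v]_(z in `]0%R, +oo[) z%:E = (mean_claim M)%:E)%E.
Proof.
rewrite /mean_claim /Rintegral fineK// ge0_fin_numE; first exact: levy_first_moment.
by apply: integral_ge0 => z /=; rewrite in_itv/= andbT => /ltW; rewrite lee_fin.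
Qed.

Lemma mean_claim_ge0 : 0 <= mean_claim M.
Proof. by apply: Rintegral_ge0 => z /=; rewrite in_itv/= andbT => /ltW. Qed.

(** Markov's inequality from the finite first moment. *)
Lemma levy_away_from0 n : (v `](n.+1%:R^-1)%R, +oo[%classic < +oo)%E.
Proof.
pose a : R := n.+1%:R^-1; have a0 : 0 < a by rewrite invr_gt0.
have h : (a%:E * v `]a, +oo[%classic <= \int[v]_(z in `]0%R, +oo[) z%:E)%E.
  apply: (@le_trans _ _ (\int[v]_(z in `]a, +oo[) z%:E)%E).
    rewrite -integral_cst//; apply: ge0_le_integral => //.
    - by move=> z _; rewrite lee_fin ltW.
    - by move=> z /=; rewrite in_itv/= andbT lee_fin => /ltW.
  apply: ge0_subset_integral => //.
  - by move=> z /=; rewrite in_itv/= andbT lee_fin => /ltW.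
  - by move=> z /=; rewrite !in_itv/= !andbT; exact: lt_trans.
have := le_lt_trans h levy_first_moment; rewrite -/a.
by case: (v `]a, +oo[%classic) => [x|//|]; rewrite ?ltry ?ltNyr//= gt0_muley ?lte_fin// ltxx.
Qed.

Definition jump_domain (t u : R) : set (R * R) := `]t, u] `*` `]0, +oo[.

Definition large_jumps (t u : R) (n : nat) : set (R * R) :=
  `]t, u] `*` `]n.+1%:R^-1, +oo[.

Lemma jump_domain_measurable t u : measurable (jump_domain t u).
Proof. exact: measurableX. Qed.

Lemma large_jumps_measurable t u n : measurable (large_jumps t u n).
Proof. exact: measurableX. Qed.

Lemma large_jumps_nondecreasing t u : nondecreasing_seq (large_jumps t u).
Proof.
move=> n m nm; apply/subsetPset => -[s z] [/= su]; rewrite !in_itv/= !andbT => h.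
split => //=; rewrite in_itv/= andbT; apply: le_lt_trans h.
by rewrite lef_pV2 ?posrE// ler_nat.
Qed.

Lemma large_jumps_bigcup t u : \bigcup_n large_jumps t u n = jump_domain t u.
Proof.
apply/seteqP; split => -[s z].
  move=> [n _ [/= su]]; rewrite in_itv/= andbT => h; split => //=; rewrite in_itv/= andbT.
  by apply: lt_trans h; rewrite invr_gt0.
move=> [/= su]; rewrite in_itv/= andbT => z0.
have [n _ h] := near_infty_natSinv_lt (PosNum z0).
by exists n => //; split => //=; rewrite in_itv/= andbT; exact: (h n (leqnn n)).
Qed.

Lemma large_jumps_finite t u n : (ell (large_jumps t u n) < +oo)%E.
Proof.
have -> : ell (large_jumps t u n) = (leb `]t, u]%classic * v `](n.+1%:R^-1)%R, +oo[%classic)%E.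
  exact: product_measure1E.
rewrite lebesgue_measure_itv/=.
have /fineK <- : v `](n.+1%:R^-1)%R, +oo[%classic \is a fin_num.
  by rewrite ge0_fin_numE//; exact: levy_away_from0.
by case: ifP => _; rewrite ?mul0e// -EFinB -EFinM ltry.
Qed.

Lemma params_gt0 : [/\ 0 < gamma (par M), 0 < beta1 (par M), 0 < beta2 (par M), 0 < beta3 (par M) &
  0 < horizon (par M)].
Proof. by have [_ [_ ? [? ? ?] _ /andP[? _]]] := params_okM. Qed.

End levy.

Section theta.
Context {R : realType} {d} {Omega : measurableType d} (M : market R Omega) (hM : market_ok M).
Notation v := (levy M).
Notation T := (horizon (par M)).
Notation leb := (@lebesgue_measure R).
Notation ell := (leb \x v)%E.
Variables (phi : distortion R) (t : R).
Hypotheses (Tphi : Theta M phi) (t0 : 0 <= t) (tT : t <= T).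

Let phi3_lt1 s z : 0 <= s <= T -> 0 < z -> phi3 phi s z < 1.
Proof. by case: Tphi => _ _ _ h _; exact: h. Qed.

Let mphi1 : measurable_fun `[0, T] (phi1 phi). Proof. by case: Tphi. Qed.
Let mphi2 : measurable_fun `[0, T] (phi2 phi). Proof. by case: Tphi. Qed.

(** The exponential of a sum of two nonnegative terms is finite only if both are. *)
Lemma Theta_energy s0 : 0 <= s0 <= T ->
  (\int[leb]_(s in `[s0, T]) ((phi1 phi s ^+ 2 + phi2 phi s ^+ 2) / 2)%:E < +oo)%E /\
  (\int[leb]_(s in `[s0, T]) \int[v]_(z in `]0%R, +oo[) (entropy (phi3 phi s z))%:E < +oo)%E.
Proof.
move=> s0T; have [_ _ _ _ /(_ _ s0T)] := Tphi.
set x := (X in expeR (X + _)%E); set y := (X in expeR (_ + X)%E).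
have x0 : (0 <= x)%E by apply: integral_ge0 => s _; rewrite lee_fin divr_ge0// addr_ge0 ?sqr_ge0.
have y0 : (0 <= y)%E.
  apply: integral_ge0 => s /=; rewrite in_itv/= => /andP[s1 s2]; apply: integral_ge0 => z /=.
  rewrite in_itv/= andbT => z0; rewrite lee_fin entropy_ge0//; apply: phi3_lt1 => //.
  by rewrite s2 andbT (le_trans _ s1)//; case/andP: s0T.
move=> h; rewrite -/x -/y; move: x y x0 y0 h.
by case=> [x| |]// [y| |]// *; rewrite ?ltry.
Qed.

Lemma Theta_sqr_integrable s0 : 0 <= s0 <= T ->
  L1 leb `[s0, T] (fun s => phi1 phi s ^+ 2) /\
  L1 leb `[s0, T] (fun s => phi2 phi s ^+ 2).
Proof.
move=> /[dup] s0T /andP[s00 _]; have [h _] := Theta_energy s0T.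
have sub : `[s0, T] `<=` `[0, T] by apply: subset_itv; rewrite bnd_simp.
have m1 : measurable_fun `[s0, T] (phi1 phi) by exact: measurable_funS mphi1.
have m2 : measurable_fun `[s0, T] (phi2 phi) by exact: measurable_funS mphi2.
have ih : L1 leb `[s0, T] (fun s => (phi1 phi s ^+ 2 + phi2 phi s ^+ 2) / 2).
  apply: ge0_integrable_real => //.
  - by apply: measurable_funM => //; apply: measurable_funD; exact: measurable_funX.
  - by move=> s _; rewrite divr_ge0// addr_ge0 ?sqr_ge0.
have i2 : L1 leb `[s0, T] (fun x => 2 * ((phi1 phi x ^+ 2 + phi2 phi x ^+ 2) / 2)).
  exact: integrable_realZ.
split; apply: (@le_integrable _ _ _ leb _ _ _ (EFin \o (fun x => 2 * ((phi1 phi x ^+ 2 + phi2 phi x ^+ 2) / 2)))) => //.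
- by apply/measurable_EFinP; exact: measurable_funX.
- move=> s _ /=; rewrite lee_fin !ger0_norm ?sqr_ge0//; first by have := sqr_ge0 (phi2 phi s); lra.
  by rewrite mulr_ge0// divr_ge0// addr_ge0 ?sqr_ge0.
- by apply/measurable_EFinP; exact: measurable_funX.
- move=> s _ /=; rewrite lee_fin !ger0_norm ?sqr_ge0//; first by have := sqr_ge0 (phi1 phi s); lra.
  by rewrite mulr_ge0// divr_ge0// addr_ge0 ?sqr_ge0.
Qed.

Lemma sqr_integrable_itv (a b : R) (f : R -> R) : measurable_fun `[a, b] f ->
  L1 leb `[a, b] (fun s => f s ^+ 2) -> L1 leb `[a, b] f.
Proof.
move=> mf if2; apply: (@le_integrable _ _ _ leb _ _ _ (EFin \o (fun x => f x ^+ 2 + 1))) => //.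
- exact/measurable_EFinP.
- move=> s _ /=; rewrite lee_fin [leRHS]ger0_norm ?addr_ge0 ?sqr_ge0//.
  by rewrite -(real_normK (num_real (f s))); have := sqr_ge0 (`|f s| - 1); have := normr_ge0 (f s); nra.
- apply: integrable_realD => //; apply: (@bounded_integrable_itv _ (cst 1) 1) => //.
  by move=> x _; rewrite normr1.
Qed.

(** The compensator of the jumps under the prior relative to the one under [P]. It is cut off
    outside the jump domain because [Theta] controls the sign and measurability of [1 - phi3] only
    over the horizon. *)
Definition tilt_density (u : R) (q : R * R) : R :=
  \1_(jump_domain t u) q * (1 - phi3 phi q.1 q.2).

Let dom_sub q : jump_domain t T q -> [/\ 0 <= q.1, q.1 <= T & 0 < q.2].
Proof.
move=> [/=]; rewrite !in_itv/= andbT => /andP[tq qT] q0; split => //.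
exact: le_trans t0 (ltW tq).
Qed.

Let mcut (g : R * R -> R) : measurable_fun (`[0, T] `*` `]0, +oo[ : set (R * R)) g ->
  Tmeasurable (fun q => \1_(jump_domain t T) q * g q).
Proof.
move=> mg; rewrite (_ : (fun q => _) = g \_ (jump_domain t T)).
  apply/(measurable_restrictT _ (jump_domain_measurable t T)).
  apply: measurable_funS mg; first exact: measurableX.
  by move=> q /dom_sub[? ? ?]; split; rewrite /= in_itv/= ?andbT//; apply/andP.
apply/funext => q; rewrite /restrict indicE; case: (_ \in _); by rewrite ?mul1r ?mul0r.
Qed.

Lemma tilt_density_ge0 q : 0 <= tilt_density T q.
Proof.
rewrite /tilt_density indicE; have [|_] := boolP (q \in _); last by rewrite mul0r.
rewrite inE mul1r => /dom_sub[? ? ?]; rewrite subr_ge0 ltW// phi3_lt1//; exact/andP.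
Qed.

Lemma tilt_density_measurable : Tmeasurable (tilt_density T).
Proof. by apply: mcut; apply: measurable_funB => //; case: Tphi. Qed.

Definition cut_entropy q : R := \1_(jump_domain t T) q * entropy (phi3 phi q.1 q.2).

Lemma cut_entropy_ge0 q : 0 <= cut_entropy q.
Proof.
rewrite /cut_entropy indicE; have [|_] := boolP (q \in _); last by rewrite mul0r.
rewrite inE mul1r => /dom_sub[? ? ?]; apply: entropy_ge0; apply: phi3_lt1 => //; exact/andP.
Qed.

Lemma cut_entropy_measurable : Tmeasurable cut_entropy.
Proof.
apply: mcut; have m3 : measurable_fun (`[0, T] `*` `]0, +oo[ : set (R * R)) (fun q : R * R => 1 - phi3 phi q.1 q.2).
  by apply: measurable_funB => //; case: Tphi.
rewrite /entropy; apply: measurable_funD; last by case: Tphi.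
apply: measurable_funM => //.
exact: (measurableT_comp (@measurable_ln R)).
Qed.

Lemma entropy_setX :
  (\int[ell]_(q in jump_domain t T) (cut_entropy q)%:E =
   \int[leb]_(s in `[t, T]) \int[v]_(z in `]0%R, +oo[) (entropy (phi3 phi s z))%:E)%E.
Proof.
have mE : Tmeasurable (fun q => (cut_entropy q)%:E).
  by apply/measurable_EFinP; exact: cut_entropy_measurable.
have cE0 q : (0 <= (cut_entropy q)%:E)%E by rewrite lee_fin cut_entropy_ge0.
rewrite (@integral_setX _ v _ _ _ (measurable_itv _) (measurable_itv _) cE0 mE).
have E s : s \in `]t, T]%classic -> (\int[v]_(z in `]0%R, +oo[) (cut_entropy (s, z))%:E =
   \int[v]_(z in `]0%R, +oo[) (entropy (phi3 phi s z))%:E)%E.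
  move=> sT; apply: eq_integral => z z0; rewrite /cut_entropy indicE mem_set ?mul1r//.
  by split; [move: sT|move: z0]; rewrite inE.
transitivity (\int[leb]_(s in `]t, T]) \int[v]_(z in `]0%R, +oo[) (entropy (phi3 phi s z))%:E)%E.
  by apply: eq_integral => s sT; exact: E.
rewrite integral_itv_obnd_cbnd//.
apply: (eq_measurable_fun (fun s => \int[v]_(z in `]0%R, +oo[) (cut_entropy (s, z))%:E)%E) => //.
have mm := @measurable_integral_section _ v `]0%R, +oo[%classic _ (measurable_itv _) cE0 mE.
exact: measurable_funTS mm.
Qed.

Lemma entropy_setX_finite : (\int[ell]_(q in jump_domain t T) (cut_entropy q)%:E < +oo)%E.
Proof. by rewrite entropy_setX; apply: (Theta_energy _).2; rewrite t0. Qed.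

(** [entropy_young] at [- L]: any load with an integrable exponential excess [expR L - 1] becomes
    integrable against the tilted compensator. *)
Lemma tilt_young q L : jump_domain t T q -> L * tilt_density T q <= cut_entropy q + (expR L - 1).
Proof.
move=> /[dup] qD /dom_sub[? ? ?]; rewrite /tilt_density /cut_entropy indicE mem_set// !mul1r.
have y1 : phi3 phi q.1 q.2 < 1 by apply: phi3_lt1 => //; exact/andP.
by have := entropy_young (- L) y1; rewrite opprK; lra.
Qed.

End theta.

(** * Moments of claim sums under a prior *)

Section jump_moments.
Context {R : realType} {d} {Omega : measurableType d} (M : market R Omega) (hM : market_ok M).
Notation P := (Pr M).
Notation v := (levy M).
Notation T := (horizon (par M)).
Notation leb := (@lebesgue_measure R).
Notation ell := (leb \x v)%E.

Lemma no_distortion_Theta : Theta M (no_distortion R).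
Proof.
split => //=; try exact: measurable_cst.
move=> t tT; rewrite expr0n/= addr0 mul0r !integral0_eq ?adde0//= ?ltry//.
by move=> z _; rewrite /entropy subr0 mul1r ln1 addr0.
Qed.

Lemma jumps_measurable (A : set (R * R)) : measurable A -> A `<=` (`[0, +oo[ `*` `]0, +oo[ : set (R * R)) ->
  Tmeasurable (fun w => jumps M w A).
Proof. by have [[_ _ _ _ [_ _ [mN _ _] _ _]] _] := hM; exact: mN. Qed.

Lemma jump_domain_sub t u : 0 <= t -> jump_domain t u `<=` (`[0, +oo[ `*` `]0, +oo[ : set (R * R)).
Proof.
move=> t0 q [/=]; rewrite !in_itv/= !andbT => /andP[tq _] q0.
by split => //; exact: le_trans t0 (ltW tq).
Qed.

Lemma jump_domain_after t u : jump_domain t u `<=` (`]t, +oo[ `*` `]0, +oo[ : set (R * R)).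
Proof. by move=> q [/=]; rewrite !in_itv/= !andbT => /andP[tq _] q0. Qed.

Lemma jump_integral_Gmeasurable t u (F : R * R -> \bar R) : 0 <= t -> t <= u ->
  (forall q, 0 <= F q)%E -> Tmeasurable F ->
  Gmeasurable M u (fun w => fine (\int[jumps M w]_(q in jump_domain t u) F q)%E).
Proof.
move=> t0 tu F0 mF; apply/GmeasurableE; pose G := g_sigma_algebraType (filtF M u `|` filtH M u).
have := @measurable_random_integral _ (R * R)%type R _ G (fun w => jumps M w)
   (jump_domain t u) (jump_domain_measurable t u) _ F F0 mF.
move=> h; apply: (measurableT_comp (@fine_measurable R setT measurableT)); apply: h.
move=> A mA At _ B mB; rewrite setTI; apply: filtG_jumps => //.
move=> q /At [/=]; rewrite !in_itv/= !andbT => /andP[tq qu] q0; split => //=.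
by rewrite qu andbT (le_trans t0 (ltW tq)).
Qed.

Lemma jump_integral_jumps_after t u (F : R * R -> \bar R) :
  (forall q, 0 <= F q)%E -> Tmeasurable F -> forall B : set R, measurable B ->
  jumps_after M t ((fun w => fine (\int[jumps M w]_(q in jump_domain t u) F q)%E) @^-1` B).
Proof.
move=> F0 mF B mB; pose G := g_sigma_algebraType (\bigcup_(A in [set A : set (R * R) |
        measurable A /\ A `<=` `]t, +oo[ `*` `]0, +oo[])
        preimage_set_system setT (fun w => jumps M w A) measurable).
have := @measurable_random_integral _ (R * R)%type R _ G (fun w => jumps M w)
   (jump_domain t u) (jump_domain_measurable t u) _ F F0 mF.
move=> h; have mf : Tmeasurable ((fun w => fine (\int[jumps M w]_(q in jump_domain t u) F q)%E) : G -> R).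
  apply: (measurableT_comp (@fine_measurable R setT measurableT)); apply: h.
  move=> A mA At _ C mC; rewrite setTI; apply: jumps_after_sub => //.
  exact: subset_trans At (@jump_domain_after t u).
by have := mf measurableT B mB; rewrite setTI.
Qed.

Let mid : Tmeasurable (idfun : (measurableTypeR R * R)%type -> (R * R)%type).
Proof. by move=> _ B mB; rewrite setTI; exact: mB. Qed.

Section tilted_moments.
Variables (phi : distortion R) (t : R) (Q : probability Omega R).
Hypotheses (Tphi : Theta M phi) (t0 : 0 <= t) (tT : t <= T) (hQ : noise_from M Q t phi).
Notation D := (jump_domain t T).
Notation rho := (tilt_density phi t T).
Notation Jint := (intensity (idfun : (measurableTypeR R * R)%type -> (R * R)%type) ell rho D).

Let rho0 (q : (measurableTypeR R * R)%type) : 0 <= rho q.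
Proof. exact: (tilt_density_ge0 Tphi t0). Qed.

Let mrho : Tmeasurable (rho : (measurableTypeR R * R)%type -> R).
Proof. exact: (tilt_density_measurable Tphi t0). Qed.

Let D_D n : large_jumps t T n `<=` D.
Proof. by rewrite -large_jumps_bigcup; exact: bigcup_sup. Qed.

Let mN A : measurable A -> A `<=` D -> Tmeasurable (fun w => jumps M w A).
Proof.
by move=> mA AD; apply: jumps_measurable => //; exact: subset_trans AD (jump_domain_sub t0).
Qed.

Lemma tilted_intensity A : measurable A -> A `<=` D ->
  tilted M phi A = Jint (fun x => (\1_A x)%:E).
Proof.
move=> mA AD; rewrite /tilted /intensity [LHS]integral_mkcond [RHS]integral_mkcond.
apply: eq_integral => q _; rewrite !patchE.
case: ifPn => qA; last first.
  by case: ifPn => // _; rewrite indicE (negbTE qA) mul0e.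
have qD : q \in D by move: qA; rewrite !inE => /AD.
rewrite (_ : (q \in idfun @^-1` D) = true); last exact: qD.
rewrite (_ : \1_A (idfun q) = 1); last by rewrite indicE/= qA.
rewrite mul1e /tilt_density (_ : \1_D q = 1); last by rewrite indicE/= qD.
rewrite mul1r (_ : \1_(`[0, T]) q.1 = 1) ?mul1r// indicE mem_set//.
move: qD; rewrite inE => -[/=]; rewrite !in_itv/= => /andP[tq ->] _.
by rewrite andbT (le_trans t0 (ltW tq)).
Qed.

(** [tilt_young] with [L = 1] bounds the density by the entropy plus [expR 1 - 1], and the large
    jumps have finite measure. *)
Let finD n : (Jint (fun x => (\1_(large_jumps t T n) x)%:E) < +oo)%E.
Proof.
have e1 : 0 <= expR 1 - 1 :> R by rewrite subr_ge0 -expR0 ler_expR.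
have m1 : Tmeasurable (fun x : R * R => (\1_(large_jumps t T n) x)%:E : \bar R).
  by apply/measurable_EFinP; apply: measurable_indic; exact: large_jumps_measurable.
have mc : Tmeasurable (fun x => (cut_entropy M phi t x)%:E : \bar R).
  by apply/measurable_EFinP; exact: cut_entropy_measurable.
apply: (@le_lt_trans _ _ (\int[ell]_(q in D) ((cut_entropy M phi t q)%:E +
    (expR 1 - 1)%:E * (\1_(large_jumps t T n) q)%:E))%E).
  apply: ge0_le_integral.
  - exact: jump_domain_measurable.
  - by move=> q _; rewrite -EFinM lee_fin mulr_ge0.
  - apply: measurable_funTS; apply: emeasurable_funM => //; exact/measurable_EFinP.
  - by apply: measurable_funTS; apply: emeasurable_funD => //; apply: emeasurable_funM => //; exact: measurable_cst.
  - move=> q qD; rewrite -!EFinM -EFinD lee_fin indicE.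
    have := cut_entropy_ge0 Tphi t0 q; have := tilt_young Tphi t0 1 qD.
    by case: (_ \in _); rewrite ?mul1r ?mulr1 ?mul0r ?mulr0 ?addr0.
have -> : (\int[ell]_(q in D) ((cut_entropy M phi t q)%:E +
    (expR 1 - 1)%:E * (\1_(large_jumps t T n) q)%:E) =
    \int[ell]_(q in D) (cut_entropy M phi t q)%:E +
    \int[ell]_(q in D) ((expR 1 - 1)%:E * (\1_(large_jumps t T n) q)%:E))%E.
  apply: ge0_integralD; [exact: jump_domain_measurable|move=> q _|exact: measurable_funTS|move=> q _|].
  - by rewrite lee_fin cut_entropy_ge0.
  - by rewrite -EFinM lee_fin mulr_ge0.
  - by apply: measurable_funTS; apply: emeasurable_funM => //; exact: measurable_cst.
rewrite lte_add_pinfty//; first exact: entropy_setX_finite.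
rewrite ge0_integralZl_EFin//; first last.
- exact: measurable_funTS.
- exact: jump_domain_measurable.
rewrite lte_mul_pinfty//; rewrite integral_indic; [|exact: jump_domain_measurable|exact: large_jumps_measurable].
apply: le_lt_trans (large_jumps_finite hM t T n); apply: le_measure; rewrite ?inE.
- by apply: measurableI; [exact: large_jumps_measurable|exact: jump_domain_measurable].
- exact: large_jumps_measurable.
- by [].
Qed.

Let finA n A : measurable A -> A `<=` large_jumps t T n -> (tilted M phi A < +oo)%E.
Proof.
move=> mA An; rewrite (tilted_intensity mA (subset_trans An (@D_D n))).
have m1 (E : set (R * R)) : measurable E -> Tmeasurable (fun x : R * R => (\1_E x)%:E : \bar R).
  by move=> mE; apply/measurable_EFinP; apply: measurable_indic.
have p1 (E : set (R * R)) x : (0 <= (\1_E x)%:E :> \bar R)%E by rewrite lee_fin.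
have le1 x : ((\1_A x)%:E <= (\1_(large_jumps t T n) x)%:E :> \bar R)%E.
  rewrite lee_fin !indicE ler_nat; case: (boolP (x \in A)) => //.
  by rewrite inE => /An ?; rewrite mem_set.
have := @intensity_le _ _ R _ _ (idfun : (measurableTypeR R * R)%type -> (R * R)%type) mid ell rho D
  rho0 mrho (jump_domain_measurable t T) (fun x => (\1_A x)%:E) (fun x => (\1_(large_jumps t T n) x)%:E)
  (p1 A) (m1 _ mA) (m1 _ (large_jumps_measurable t T n)) le1.
by move=> /le_lt_trans; apply; exact: finD.
Qed.

Let law n A k : measurable A -> A `<=` large_jumps t T n ->
  Q [set w | jumps M w A = k%:R%:E] = poisson_prob (fine (tilted M phi A)) 0 [set k].
Proof.
move=> mA An; have [_ _ h _ _] := hQ; apply: h => //; last exact: finA An.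
exact: subset_trans (subset_trans An (@D_D n)) (@jump_domain_after t T).
Qed.

Let tilted_ge0 A : measurable A -> A `<=` D -> (0 <= tilted M phi A)%E.
Proof.
move=> mA AD; rewrite tilted_intensity//.
have p1 x : (0 <= (\1_A x)%:E :> \bar R)%E by rewrite lee_fin.
exact: (@intensity_ge0 _ _ R _ _ (idfun : (measurableTypeR R * R)%type -> (R * R)%type) ell rho D
  rho0 _ p1).
Qed.

Let meanN n A : measurable A -> A `<=` large_jumps t T n ->
  (\int[Q]_w jumps M w A = Jint (fun x => (\1_A x)%:E))%E.
Proof.
move=> mA An; have AD := subset_trans An (@D_D n).
rewrite (@poisson_law_expectation _ (fine (tilted M phi A)) _ _ _ Q (fun w => jumps M w A)).
- by rewrite -tilted_intensity// fineK// ge0_fin_numE ?tilted_ge0//; exact: finA An.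
- by rewrite fine_ge0// tilted_ge0.
- exact: mN.
- by [].
- by move=> k; exact: law An.
Qed.

Let sqrN n A : measurable A -> A `<=` large_jumps t T n ->
  (\int[Q]_w (jumps M w A * jumps M w A) = Jint (fun x => (\1_A x)%:E) +
    Jint (fun x => (\1_A x)%:E) * Jint (fun x => (\1_A x)%:E))%E.
Proof.
move=> mA An; have AD := subset_trans An (@D_D n).
rewrite (@poisson_law_sqr _ (fine (tilted M phi A)) _ _ _ Q (fun w => jumps M w A)).
- rewrite expr2 EFinD EFinM -tilted_intensity// fineK// ge0_fin_numE ?tilted_ge0//; exact: finA An.
- by rewrite fine_ge0// tilted_ge0.
- exact: mN.
- by [].
- by move=> k; exact: law An.
Qed.

Let indN n A B : measurable A -> measurable B -> A `<=` large_jumps t T n ->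
  B `<=` large_jumps t T n -> A `&` B = set0 ->
  (\int[Q]_w (jumps M w A * jumps M w B) = \int[Q]_w jumps M w A * \int[Q]_w jumps M w B)%E.
Proof.
move=> mA mB An Bn AB.
have AD := subset_trans An (@D_D n); have BD := subset_trans Bn (@D_D n).
have h : forall C E : set (\bar R), measurable C -> measurable E ->
    Q ((fun w => jumps M w A) @^-1` C `&` (fun w => jumps M w B) @^-1` E) =
    (Q ((fun w => jumps M w A) @^-1` C) * Q ((fun w => jumps M w B) @^-1` E))%E.
  move=> C E mC mE; have [_ _ _ h _] := hQ; apply: h => //.
  - exact: subset_trans AD (@jump_domain_after t T).
  - exact: subset_trans BD (@jump_domain_after t T).
have := @ge0_integral_indepM _ _ _ _ _ _ R Q (fun w => jumps M w A) (fun w => jumps M w B)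
  (mN mA AD) (mN mB BD) h (fun x => maxe x 0%E) (fun x => maxe x 0%E).
(* The independence lemma asks for functions that are nonnegative on all of [\bar R]; [maxe x 0] is
   one, and is the identity on values of a measure. *)
have mm : Tmeasurable (fun x : \bar R => maxe x 0%E).
  by apply: measurable_maxe => //; exact: measurable_cst.
move=> /(_ _ _ mm mm) h2.
have E C w : maxe (jumps M w C) 0%E = jumps M w C by apply/max_idPl.
have h3 : (\int[Q]_w (maxe (jumps M w A) 0%E * maxe (jumps M w B) 0%E) =
   \int[Q]_w maxe (jumps M w A) 0%E * \int[Q]_w maxe (jumps M w B) 0%E)%E.
  by apply: h2 => x; rewrite le_max lexx orbT.
transitivity (\int[Q]_w (maxe (jumps M w A) 0%E * maxe (jumps M w B) 0%E))%E.
  by apply: eq_integral => w _; rewrite !E.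
rewrite h3; congr (_ * _)%E; by apply: eq_integral => w _; rewrite E.
Qed.

Variable F : R * R -> R.
Hypotheses (F0 : forall q, 0 <= F q) (mF : Tmeasurable F).
Hypothesis iF : (Jint (EFin \o F) < +oo)%E.

Definition jump_sum w := fine (\int[jumps M w]_(q in D) (F q)%:E)%E.

Let mFE : Tmeasurable (EFin \o F). Proof. exact/measurable_EFinP. Qed.
Let F0E q : (0 <= (EFin \o F) q)%E. Proof. by rewrite lee_fin. Qed.

Let mNF : Tmeasurable (fun w => \int[jumps M w]_(q in D) (F q)%:E)%E.
Proof. exact: (measurable_random_integral (jump_domain_measurable t T) mN F0E mFE). Qed.

Let NF0 w : (0 <= \int[jumps M w]_(q in D) (F q)%:E)%E.
Proof. by apply: integral_ge0 => q _; rewrite lee_fin. Qed.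

Let mean : (\int[Q]_w \int[jumps M w]_(q in D) (F q)%:E = Jint (EFin \o F))%E.
Proof.
exact: (campbell_mean mid rho0 mrho (jump_domain_measurable t T) (large_jumps_measurable t T)
  (@large_jumps_nondecreasing _ t T) (large_jumps_bigcup t T) mN meanN F0E mFE).
Qed.

Lemma jump_sum_finite : {ae Q, forall w, (\int[jumps M w]_(q in D) (F q)%:E < +oo)%E}.
Proof.
have : Q.-integrable setT (fun w => \int[jumps M w]_(q in D) (F q)%:E)%E.
  apply/integrableP; split => //.
  under eq_integral do rewrite gee0_abs//.
  by rewrite mean.
move=> /(integrable_ae measurableT); apply: filterS => w /(_ I).
by rewrite ge0_fin_numE.
Qed.

Lemma jump_sum_measurable : Tmeasurable jump_sum.
Proof. exact: (measurableT_comp (@fine_measurable R setT measurableT)). Qed.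

Let ZE : {ae Q, forall w, (jump_sum w)%:E = (\int[jumps M w]_(q in D) (F q)%:E)%E}.
Proof. by apply: filterS jump_sum_finite => w h; rewrite fineK// ge0_fin_numE. Qed.

Lemma jump_sum_mean : (\int[Q]_w (jump_sum w)%:E = Jint (EFin \o F))%E.
Proof.
rewrite -mean; apply: ae_eq_integral => //.
  by apply/measurable_EFinP; exact: jump_sum_measurable.
by apply: filterS ZE.
Qed.

Lemma jump_sum_sqr : (\int[Q]_w (jump_sum w ^+ 2)%:E =
  Jint (fun q => (F q ^+ 2)%:E) + Jint (EFin \o F) * Jint (EFin \o F))%E.
Proof.
have := campbell_sqr mid rho0 mrho (jump_domain_measurable t T) (large_jumps_measurable t T)
  (@large_jumps_nondecreasing _ t T) (large_jumps_bigcup t T) mN meanN sqrN indN F0E mFE.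
have -> : (fun q => (EFin \o F) q * (EFin \o F) q)%E = (fun q => (F q ^+ 2)%:E).
  by apply/funext => q; rewrite /= -EFinM expr2.
move=> <-; apply: ae_eq_integral => //.
- by apply/measurable_EFinP; apply: measurable_funX; exact: jump_sum_measurable.
- exact: emeasurable_funM.
- by apply: filterS ZE => w h _; rewrite expr2 EFinM h.
Qed.

End tilted_moments.

(** Almost every jump measure is finite on each set of large jumps, by the mean formula for
    indicators without distortion. Sigma-finiteness is what Tonelli needs for pathwise integrals
    against the jumps. *)
Lemma jumps_sigma_finite t : 0 <= t -> t <= T ->
  {ae P, forall w, forall n, (jumps M w (large_jumps t T n) < +oo)%E}.
Proof.
move=> t0 tT; have nP := noise_from_P hM t0.
apply/ae_foralln => n.
have iF : (intensity (idfun : (measurableTypeR R * R)%type -> (R * R)%type) ell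
    (tilt_density (no_distortion R) t T) (jump_domain t T) (EFin \o \1_(large_jumps t T n)) < +oo)%E.
  have mL := large_jumps_measurable t T n.
  apply: le_lt_trans (large_jumps_finite hM t T n).
  rewrite /intensity.
  have LD : large_jumps t T n `<=` jump_domain t T.
    by rewrite -large_jumps_bigcup; exact: bigcup_sup.
  rewrite (_ : (fun x : R * R => _) = (fun q => (\1_(large_jumps t T n) q)%:E)); last first.
    apply/funext => q; rewrite /= -EFinM /tilt_density/= subr0 mulr1 !indicE.
    case: (boolP (q \in large_jumps t T n)); rewrite ?mul0r// inE => /LD ?.
    by rewrite mem_set// mulr1.
  rewrite integral_indic//; last exact: jump_domain_measurable.
  apply: le_measure; rewrite ?inE//.
  by apply: measurableI => //; exact: jump_domain_measurable.
have := @jump_sum_finite _ t P no_distortion_Theta t0 tT nP (\1_(large_jumps t T n)) _ _ iF.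
have h1 : forall q : R * R, 0 <= (\1_(large_jumps t T n) q : R) by [].
have h2 : Tmeasurable (\1_(large_jumps t T n) : R * R -> R).
  apply: measurable_indic; exact: large_jumps_measurable.
move=> /(_ h1 h2); apply: filterS => w; rewrite integral_indic.
- rewrite (_ : large_jumps t T n `&` _ = large_jumps t T n)//; apply/setIidPl.
  by rewrite -large_jumps_bigcup; exact: bigcup_sup.
- exact: jump_domain_measurable.
- exact: large_jumps_measurable.
Qed.

End jump_moments.

(** * Variation of constants: convolution with the exponential kernel *)

Section sigma_finite_copy.
Context d (U : measurableType d) (R : realType).
Variables (mu : {measure set U -> \bar R}).

(** A copy of [mu] indexed by a proof of sigma-finiteness, so that the structure required by Tonelli
    can be attached to a measure for which it is a hypothesis, here the jumps of a generic
    scenario. *)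
Definition sigma_finite_copy of sigma_finite setT mu : set U -> \bar R := mu.

Variable sf : sigma_finite setT mu.
Notation m := (sigma_finite_copy sf).

Let m0 : m set0 = 0%E. Proof. exact: measure0. Qed.
Let m_ge0 A : (0 <= m A)%E. Proof. exact: measure_ge0. Qed.
Let m_additive : semi_sigma_additive m. Proof. exact: measure_semi_sigma_additive. Qed.

HB.instance Definition _ := isMeasure.Build _ _ _ m m0 m_ge0 m_additive.
HB.instance Definition _ := Measure_isSigmaFinite.Build _ _ _ m sf.

End sigma_finite_copy.

Section exponential_convolution.
Context d (U : measurableType d) (R : realType).
Notation leb := (@lebesgue_measure R).
Variables (mu : {measure set U -> \bar R}) (sf : sigma_finite setT mu).
Variables (r t : R) (D : set U) (time : U -> R) (h : U -> R).
Hypotheses (r0 : 0 < r) (mD : measurable D) (mtime : Tmeasurable time).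
Hypotheses (mh : Tmeasurable h) (h0 : forall x, 0 <= h x).
Hypothesis time_ge : forall x, D x -> t <= time x.

Lemma integral_expR_affine (a b : R) : a <= b ->
  \int[leb]_(s in `[a, b]) expR (r * (s - a)) = (expR (r * (b - a)) - 1) / r.
Proof.
rewrite le_eqVlt => /orP[/eqP<-|ab].
  by rewrite set_itv1 Rintegral_set1 subrr mulr0 expR0 subrr mul0r.
have dF (s : R) : is_derive s 1 (fun s => expR (r * (s - a)) / r) (expR (r * (s - a))).
  by apply: is_derive_eq; rewrite /GRing.scale/=; field; rewrite gt_eqF.
have cE : continuous (fun s : R => expR (r * (s - a))).
  move=> s; apply: continuous_comp; last exact: continuous_expR.
  by apply: cvgM; [exact: cvg_cst|apply: (@cvgB _ R^o); [exact: cvg_id|exact: cvg_cst]].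
rewrite /Rintegral (@continuous_FTC2 _ _ (fun s => expR (r * (s - a)) / r))//.
- by rewrite -EFinB/= subrr mulr0 expR0; field; rewrite gt_eqF.
- exact: continuous_subspaceT.
- have cF s : {for s, continuous (fun s => expR (r * (s - a)) / r)}.
    by apply: differentiable_continuous; apply/derivable1_diffP; have [] := dF s.
  split; first by move=> s _; have [] := dF s.
  + exact/cvg_at_right_filter/cF.
  + exact/cvg_at_left_filter/cF.
- by move=> s _; rewrite derive1E; have [_ ->] := dF s.
Qed.

Definition exp_kernel (s : R) (x : U) : R :=
  \1_D x * \1_(`[0, +oo[) (s - time x) * expR (r * (s - time x)) * h x.

Definition past_mass (s : R) (x : U) : R := \1_D x * \1_(`[0, +oo[) (s - time x) * h x.

Lemma exp_kernel_ge0 s x : 0 <= exp_kernel s x.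
Proof. by rewrite /exp_kernel !mulr_ge0// expR_ge0. Qed.

Lemma past_mass_ge0 s x : 0 <= past_mass s x.
Proof. by rewrite /past_mass !mulr_ge0. Qed.

Lemma exp_kernel_measurable : Tmeasurable (fun q : R * U => exp_kernel q.1 q.2).
Proof.
have mt : Tmeasurable (fun q : R * U => q.1 - time q.2).
  by apply: measurable_funB => //; exact: (measurableT_comp mtime measurable_snd).
apply: measurable_funM; last exact: (measurableT_comp mh measurable_snd).
apply: measurable_funM; last first.
  by apply: (measurableT_comp (@measurable_expR R)); apply: measurable_funM.
apply: measurable_funM.
  exact: (measurableT_comp (measurable_indic mD) measurable_snd).
exact: (measurableT_comp (measurable_indic (measurable_itv `[0, +oo[)) mt).
Qed.

Lemma past_mass_measurable s : Tmeasurable (past_mass s).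
Proof.
apply: measurable_funM => //; apply: measurable_funM; first exact: measurable_indic.
apply: (measurableT_comp (measurable_indic (measurable_itv `[0, +oo[))).
exact: measurable_funB.
Qed.

Let inner u x : (\int[leb]_(s in `[t, u]) (exp_kernel s x)%:E =
  (past_mass u x * ((expR (r * (u - time x)) - 1) / r))%:E)%E.
Proof.
rewrite /exp_kernel /past_mass.
have [xD|xD] := pselect (D x); last first.
  rewrite integral0_eq => [|s _]; rewrite indicE memNset// ?mul0r//.
rewrite (indicE _ D) mem_set// mul1r; have tx := time_ge xD.
have E s : (\1_(`[0%R, +oo[) (s - time x) : R) = ((time x <= s)%R : bool)%:R.
  rewrite indicE (_ : (s - time x \in `[0%R, +oo[%classic) = (time x <= s)%R)//.
  by apply/idP/idP; rewrite inE/= in_itv/= andbT subr_ge0.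
under eq_integral do rewrite mul1r E; rewrite E.
have [xu|ux] := leP (time x) u; last first.
  rewrite !mul0r integral0_eq// => s /=; rewrite in_itv/= => /andP[_ su].
  by rewrite leNgt (le_lt_trans su ux)/= !mul0r.
rewrite mul1r -integral_expR_affine// mulrC.
transitivity (\int[leb]_(s in `[time x, u]) ((expR (r * (s - time x)))%:E * (h x)%:E)%E)%E.
  rewrite integral_mkcond [RHS]integral_mkcond; apply: eq_integral => s _; rewrite !patchE.
  case: ifPn => s1; case: ifPn => s2//.
  - move: s2; rewrite inE/= in_itv/= => /andP[-> _].
    by rewrite mul1r EFinM.
  - move: s1 s2; rewrite inE/= in_itv/= => /andP[_ su]; rewrite notin_setE/= in_itv/= su andbT => /negP/negbTE ->.
    by rewrite !mul0r.
  - move: s1 s2; rewrite notin_setE inE/= !in_itv/= => s1 /andP[s2 s3]; exfalso; apply: s1.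
    by rewrite (le_trans tx s2) s3.
rewrite ge0_integralZr//.
- rewrite EFinM; congr (_ * _)%E; rewrite /Rintegral fineK//.
  have -> : (\int[leb]_(x0 in `[time x, u]) (expR (r * (x0 - time x)))%:E)%E =
     (\int[leb]_(x0 in `[time x, u]) ((expR \o (fun s => r * (s - time x))) x0)%:E)%E by [].
  rewrite ge0_fin_numE; last by apply: integral_ge0 => s _; rewrite lee_fin expR_ge0.
  have : L1 leb `[time x, u] (expR \o (fun s : R => r * (s - time x))).
    apply: (@bounded_integrable_itv _ _ (expR (r * (u - time x)))).
      apply: measurable_funTS; apply: measurableT_comp => //.
      by apply: measurable_funM => //; exact: measurable_funB.
    move=> s /andP[s1 s2]; rewrite /= ger0_norm ?expR_ge0// ler_expR ler_wpM2l ?(ltW r0)//.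
    by rewrite lerD2r.
  by move=> /integrableP[_]; under eq_integral do rewrite gee0_abs ?lee_fin ?expR_ge0//.
- apply/measurable_EFinP; apply: measurable_funTS; apply: measurableT_comp => //.
  by apply: measurable_funM => //; exact: measurable_funB.
- by rewrite lee_fin.
Qed.

Let m := sigma_finite_copy sf.

Lemma exp_kernel_integral_measurable :
  Tmeasurable (fun s => \int[mu]_x (exp_kernel s x)%:E)%E.
Proof.
have := @measurable_fun_fubini_tonelli_F _ _ _ _ R m (fun q : R * U => (exp_kernel q.1 q.2)%:E).
apply; first by apply/measurable_EFinP; exact: exp_kernel_measurable.
by move=> q; rewrite lee_fin exp_kernel_ge0.
Qed.

(** For each mass point, [expR (r * (u - time x))] is 1 plus [r] times its own integral over the
    elapsed time. Integrating this against [mu] and exchanging the integrals gives the linear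
    integral equation for the accrued sum. *)
Lemma exp_convolution u :
  (\int[mu]_x (exp_kernel u x)%:E = \int[mu]_x (past_mass u x)%:E +
    r%:E * \int[leb]_(s in `[t, u]) \int[mu]_x (exp_kernel s x)%:E)%E.
Proof.
pose f (q : R * U) := (\1_(`[t, u]) q.1 * exp_kernel q.1 q.2)%:E.
have mf : Tmeasurable f.
  apply/measurable_EFinP; apply: measurable_funM; last exact: exp_kernel_measurable.
  exact: (measurableT_comp (measurable_indic (measurable_itv `[t, u])) measurable_fst).
have f0 q : (0 <= f q)%E by rewrite lee_fin mulr_ge0// exp_kernel_ge0.
have -> : (\int[leb]_(s in `[t, u]) \int[mu]_x (exp_kernel s x)%:E =
    \int[mu]_x \int[leb]_s f (s, x))%E.
  rewrite -(@fubini_tonelli _ _ _ _ R leb m f mf f0) integral_mkcond.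
  apply: eq_integral => s _; rewrite patchE /f/= indicE; case: ifPn => _.
    by apply: eq_integral => x _; rewrite mul1r.
  by rewrite integral0_eq// => x _; rewrite mul0r.
have mp := past_mass_measurable u.
have e0 x : 0 <= past_mass u x * ((expR (r * (u - time x)) - 1) / r).
  rewrite /past_mass indicE; case: (boolP (x \in D)) => xD; last by rewrite !mul0r.
  rewrite indicE; case: (boolP (_ \in _)) => xu; last by rewrite mulr0 !mul0r.
  rewrite !mul1r mulr_ge0// divr_ge0 ?(ltW r0)// subr_ge0 -expR0 ler_expR mulr_ge0 ?(ltW r0)//.
  by move: xu; rewrite inE/= in_itv/= andbT.
have me : Tmeasurable (fun x => past_mass u x * ((expR (r * (u - time x)) - 1) / r)).
  apply: measurable_funM => //; apply: measurable_funM => //; apply: measurable_funB => //.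
  by apply: measurableT_comp => //; apply: measurable_funM => //; exact: measurable_funB.
have -> : (\int[mu]_x \int[leb]_s f (s, x) =
    \int[mu]_x (past_mass u x * ((expR (r * (u - time x)) - 1) / r))%:E)%E.
  apply: eq_integral => x _; rewrite -inner [RHS]integral_mkcond.
  apply: eq_integral => s _; rewrite patchE /f/= indicE; case: ifPn => _.
    by rewrite mul1r.
  by rewrite mul0r.
rewrite -ge0_integralZl_EFin ?(ltW r0)//; first last.
- exact/measurable_EFinP.
- by move=> x _; rewrite lee_fin.
rewrite -ge0_integralD//; first last.
- by apply: emeasurable_funM; [exact: measurable_cst|exact/measurable_EFinP].
- by move=> x _; rewrite -EFinM lee_fin mulr_ge0 ?(ltW r0).
- exact/measurable_EFinP.
- by move=> x _; rewrite lee_fin past_mass_ge0.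
apply: eq_integral => x _; rewrite -EFinM -EFinD; congr (_%:E).
by rewrite /exp_kernel /past_mass; field; rewrite gt_eqF.
Qed.

Hypothesis fin_h : (\int[mu]_x (\1_D x * h x)%:E < +oo)%E.

Definition exp_past u := fine (\int[mu]_x (exp_kernel u x)%:E)%E.
Definition past u := fine (\int[mu]_x (past_mass u x)%:E)%E.

Let exp_kernel_le u s x : t <= u -> s <= u -> exp_kernel s x <= expR (r * (u - t)) * (\1_D x * h x).
Proof.
move=> tu su; rewrite /exp_kernel (indicE _ D); case: (boolP (x \in D)) => xD; last by rewrite !mul0r mulr0.
rewrite !mul1r indicE; case: (boolP (_ \in _)) => [sx|_]; last by rewrite !mul0r mulr_ge0// expR_ge0.
rewrite mul1r ler_wpM2r// ler_expR ler_wpM2l ?(ltW r0)//.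
by rewrite lerB//; apply: time_ge; move: xD; rewrite inE.
Qed.

Lemma exp_past_finite u s : t <= u -> s <= u -> (\int[mu]_x (exp_kernel s x)%:E <=
  (expR (r * (u - t)))%:E * \int[mu]_x (\1_D x * h x)%:E)%E.
Proof.
move=> tu su; have mDh : Tmeasurable (fun x => (\1_D x * h x)%:E).
  by apply/measurable_EFinP; apply: measurable_funM => //; exact: measurable_indic.
rewrite -ge0_integralZl_EFin ?expR_ge0//; last by move=> x _; rewrite lee_fin mulr_ge0.
apply: ge0_le_integral => //.
- by move=> x _; rewrite lee_fin exp_kernel_ge0.
- apply/measurable_EFinP.
  exact: (measurableT_comp exp_kernel_measurable (@measurable_pair1 _ _ _ _ s)).
- by apply: emeasurable_funM => //; exact: measurable_cst.
- by move=> x _; rewrite -EFinM lee_fin; exact: exp_kernel_le.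
Qed.

Let fin_c (c : R) : 0 <= c -> (c%:E * \int[mu]_x (\1_D x * h x)%:E < +oo)%E.
Proof.
by move=> c0; apply: lte_mul_pinfty => //; rewrite ?lee_fin.
Qed.

Let exp_fin s : (\int[mu]_x (exp_kernel s x)%:E)%E \is a fin_num.
Proof.
rewrite ge0_fin_numE; last by apply: integral_ge0 => x _; rewrite lee_fin exp_kernel_ge0.
apply: (le_lt_trans (exp_past_finite (u := Num.max s t) _ _)); rewrite ?le_max ?lexx ?orbT//.
by apply: fin_c; exact: expR_ge0.
Qed.

Lemma exp_past_measurable : Tmeasurable exp_past.
Proof. exact: (measurableT_comp (@fine_measurable R setT measurableT) exp_kernel_integral_measurable). Qed.

Lemma exp_past_integrable u : L1 leb `[t, u] exp_past.
Proof.
apply: (@bounded_integrable_itv _ _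
  (expR (r * (Num.max u t - t)) * fine (\int[mu]_x (\1_D x * h x)%:E)%E)).
  by apply: measurable_funTS; exact: exp_past_measurable.
move=> s /andP[ts su]; have K0 : (0 <= \int[mu]_x (\1_D x * h x)%:E)%E.
  by apply: integral_ge0 => x _; rewrite lee_fin mulr_ge0.
have e0 : (0 <= \int[mu]_x (exp_kernel s x)%:E)%E.
  by apply: integral_ge0 => x _; rewrite lee_fin exp_kernel_ge0.
rewrite /exp_past ger0_norm ?fine_ge0//.
rewrite -lee_fin fineK ?exp_fin// EFinM fineK; last by rewrite ge0_fin_numE.
by apply: exp_past_finite; rewrite le_max ?su ?lexx ?orbT.
Qed.

Lemma exp_pastE u : exp_past u = past u + r * \int[leb]_(s in `[t, u]) exp_past s.
Proof.
apply: EFin_inj; rewrite EFinD EFinM /exp_past fineK ?exp_fin// exp_convolution; congr (_ + _ * _)%E.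
- rewrite /past fineK// ge0_fin_numE; last by apply: integral_ge0 => x _; rewrite lee_fin past_mass_ge0.
  apply: le_lt_trans fin_h; apply: ge0_le_integral => //.
  + by move=> x _; rewrite lee_fin past_mass_ge0.
  + by apply/measurable_EFinP; exact: past_mass_measurable.
  + by apply/measurable_EFinP; apply: measurable_funM => //; exact: measurable_indic.
  + move=> x _; rewrite lee_fin /past_mass ler_wpM2r// ler_piMr//.
- rewrite /Rintegral fineK; last by exact: (integrable_fin_num _ (exp_past_integrable u)).
  by apply: eq_integral => s _ /=; rewrite /exp_past fineK ?exp_fin.
Qed.

End exponential_convolution.

Section lebesgue_convolution.
Context {R : realType}.
Notation leb := (@lebesgue_measure R).
Variables (r t T : R).
Hypotheses (r0 : 0 < r) (tT : t <= T).

Lemma measurable_indicM d (U : measurableType d) (A : set U) (f : U -> R) : measurable A ->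
  measurable_fun A f -> Tmeasurable (fun x => \1_A x * f x).
Proof.
move=> mA mf; rewrite (_ : (fun x => _) = f \_ A).
  exact/(measurable_restrictT _ mA).
by apply/funext => x; rewrite patchE indicE; case: (_ \in _); rewrite ?mul1r ?mul0r.
Qed.

Section nonnegative.
Variable h : R -> R.
Hypotheses (mh : Tmeasurable h) (h0 : forall s, 0 <= h s).
Hypothesis hout : forall s, ~ (t <= s <= T) -> h s = 0.
Hypothesis ih : L1 leb `[t, T] h.

Let D : set (measurableTypeR R) := `[t, T].
Let time : measurableTypeR R -> R := id.
Let h' : measurableTypeR R -> R := h.

Let mD : measurable D. Proof. exact: measurable_itv. Qed.
Let mtime : Tmeasurable time. Proof. by move=> _ B mB; rewrite setTI. Qed.
Let mh' : Tmeasurable h'. Proof. exact: mh. Qed.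
Let h'0 s : 0 <= h' s. Proof. exact: h0. Qed.
Let Dt s : D s -> t <= time s. Proof. by rewrite /D/= in_itv/= => /andP[]. Qed.
Let fin_h : (\int[leb]_x (\1_D x * h' x)%:E < +oo)%E.
Proof.
have /integrableP[_] := ih; under eq_integral do rewrite gee0_abs ?lee_fin ?h0//.
rewrite integral_mkcond; apply: le_lt_trans; apply: eqW.
by apply: eq_integral => s _; rewrite patchE indicE; case: ifPn; rewrite ?mul1r ?mul0r.
Qed.

Let sf := @sigma_finiteT _ _ _ leb.

Let kernelE u s : u <= T -> exp_kernel r D time h' u s =
  \1_(`[t, u]) s * (expR (r * (u - s)) * h s).
Proof.
move=> uT; rewrite /exp_kernel /D /time /h' -mulrA; congr (_ * _); rewrite !indicE -natrM mulnb.
congr ((nat_of_bool _)%:R); apply/andP/idP; rewrite !inE/= !in_itv/= andbT subr_ge0.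
  by move=> [/andP[-> _] ->].
by move=> /andP[-> su]; rewrite su (le_trans su uT).
Qed.

Let pastE u s : u <= T -> past_mass D time h' u s = \1_(`[t, u]) s * h s.
Proof.
move=> uT; rewrite /past_mass /D /time /h'; congr (_ * _); rewrite !indicE -natrM mulnb.
congr ((nat_of_bool _)%:R); apply/andP/idP; rewrite !inE/= !in_itv/= andbT subr_ge0.
  by move=> [/andP[-> _] ->].
by move=> /andP[-> su]; rewrite su (le_trans su uT).
Qed.

Let indic_int (A : set R) (g : R -> R) :
  (\int[leb]_s (\1_A s * g s)%:E = \int[leb]_(s in A) (g s)%:E)%E.
Proof.
rewrite [RHS]integral_mkcond; apply: eq_integral => s _; rewrite patchE indicE.
by case: ifPn; rewrite ?mul1r ?mul0r.
Qed.

Let exp_pastE' u : u <= T -> exp_past leb r D time h' u =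
  \int[leb]_(s in `[t, u]) (expR (r * (u - s)) * h s).
Proof.
by move=> uT; rewrite /exp_past /Rintegral; under eq_integral do rewrite kernelE//; rewrite indic_int.
Qed.

(** [exp_pastE] for Lebesgue measure weighted by [h], each point being its own time of
    occurrence. *)
Lemma nonneg_convolution u : t <= u <= T ->
  L1 leb `[t, u] (fun v => \int[leb]_(s in `[t, v]) (expR (r * (v - s)) * h s)) /\
  \int[leb]_(s in `[t, u]) (expR (r * (u - s)) * h s) = \int[leb]_(s in `[t, u]) h s +
    r * \int[leb]_(v in `[t, u]) \int[leb]_(s in `[t, v]) (expR (r * (v - s)) * h s).
Proof.
move=> /andP[tu uT].
have E v : v \in `[t, u]%classic -> exp_past leb r D time h' v =
    \int[leb]_(s in `[t, v]) (expR (r * (v - s)) * h s).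
  by rewrite inE/= in_itv/= => /andP[_ vu]; apply: exp_pastE'; exact: le_trans uT.
split.
  apply: eq_integrable (exp_past_integrable sf r0 mD mtime mh' h'0 Dt fin_h u) => //.
  by move=> v vu; rewrite /= E.
rewrite -exp_pastE'// (exp_pastE sf r0 mD mtime mh' h'0 Dt fin_h); congr (_ + _ * _).
  by rewrite /past /Rintegral; under eq_integral do rewrite pastE//; rewrite indic_int.
exact: eq_Rintegral.
Qed.

Lemma exp_weight_integrable u : t <= u <= T ->
  L1 leb `[t, u] (fun s => expR (r * (u - s)) * h s).
Proof.
move=> /andP[tu uT]; apply: (@le_integrable _ _ _ leb _ _ _ (EFin \o (fun s => expR (r * (u - t)) * h s))) => //.
- apply/measurable_EFinP; apply: measurable_funTS; apply: measurable_funM => //.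
  by apply: measurableT_comp => //; apply: measurable_funM => //; exact: measurable_funB.
- move=> s /=; rewrite in_itv/= => /andP[ts su]; rewrite lee_fin !ger0_norm ?mulr_ge0 ?expR_ge0//.
  by rewrite ler_wpM2r// ler_expR ler_wpM2l ?(ltW r0)// lerD2l lerN2.
- apply: integrable_realZ => //; apply: integrableS ih => //.
  by apply: subset_itv; rewrite bnd_simp.
Qed.

End nonnegative.

(** The signed case, by linearity from the positive and negative parts of [h] cut to [[t, T]]. *)
Lemma convolution_growth (h : R -> R) : measurable_fun `[t, T] h ->
  L1 leb `[t, T] h -> forall u, t <= u <= T ->
  L1 leb `[t, u] (fun v => \int[leb]_(s in `[t, v]) (expR (r * (v - s)) * h s)) /\
  \int[leb]_(s in `[t, u]) (expR (r * (u - s)) * h s) = \int[leb]_(s in `[t, u]) h s +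
    r * \int[leb]_(v in `[t, u]) \int[leb]_(s in `[t, v]) (expR (r * (v - s)) * h s).
Proof.
move=> mh ih u /[dup] tuT /andP[tu uT].
pose hp s := \1_(`[t, T]) s * Num.max (h s) 0; pose hn s := \1_(`[t, T]) s * Num.max (- h s) 0.
have mhp : Tmeasurable hp.
  by apply: measurable_indicM => //; exact: measurable_maxr.
have mhn : Tmeasurable hn.
  by apply: measurable_indicM => //; apply: measurable_maxr => //; exact: measurableT_comp.
have hp0 s : 0 <= hp s by rewrite mulr_ge0// le_max lexx orbT.
have hn0 s : 0 <= hn s by rewrite mulr_ge0// le_max lexx orbT.
have ind1 s : t <= s <= T -> (\1_(`[t, T]) s : R) = 1.
  by move=> sT; rewrite indicE mem_set//= in_itv.
have ind0 s : ~ (t <= s <= T) -> (\1_(`[t, T]) s : R) = 0.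
  by move=> sT; rewrite indicE memNset//= in_itv.
have ihp : L1 leb `[t, T] hp.
  apply: le_integrable ih => //; first by apply/measurable_EFinP; exact: measurable_funTS.
  move=> s /=; rewrite in_itv/= lee_fin => sT; rewrite /hp ind1// mul1r ger0_norm ?le_max ?lexx ?orbT//.
  by rewrite ge_max ler_norm normr_ge0.
have ihn : L1 leb `[t, T] hn.
  apply: le_integrable ih => //; first by apply/measurable_EFinP; exact: measurable_funTS.
  move=> s /=; rewrite in_itv/= lee_fin => sT; rewrite /hn ind1// mul1r ger0_norm ?le_max ?lexx ?orbT//.
  by rewrite ge_max normr_ge0 andbT -normrN ler_norm.
have hE s : t <= s <= T -> h s = hp s - hn s.
  move=> sT; rewrite /hp /hn ind1// !mul1r; case: (leP 0 (h s)) => h0.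
    by rewrite (max_idPr _) ?subr0// oppr_le0.
  by rewrite (max_idPl _) ?sub0r ?opprK// oppr_ge0 ltW.
have hpo s : ~ (t <= s <= T) -> hp s = 0 by move=> sT; rewrite /hp ind0// mul0r.
have hno s : ~ (t <= s <= T) -> hn s = 0 by move=> sT; rewrite /hn ind0// mul0r.
have [gp1 gp2] := nonneg_convolution mhp hp0 ihp tuT.
have [gn1 gn2] := nonneg_convolution mhn hn0 ihn tuT.
pose G (g : R -> R) (v : R) : R := \int[leb]_(s in `[t, v]) (expR (r * (v - s)) * g s).
have GE v : t <= v <= T -> G h v = G hp v - G hn v.
  move=> vT; rewrite /G -RintegralB//; [|exact: exp_weight_integrable|exact: exp_weight_integrable].
  apply: eq_Rintegral => s; rewrite inE/= in_itv/= => /andP[ts sv].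
  by rewrite hE ?mulrBr// ts (le_trans sv)//; case/andP: vT.
have GE' v : v \in `[t, u]%classic -> G hp v - G hn v = G h v.
  by rewrite inE/= in_itv/= => /andP[tv vu]; rewrite GE// tv (le_trans vu uT).
have sub : `[t, u] `<=` `[t, T] by apply: subset_itv; rewrite bnd_simp.
split.
  have i0 : L1 leb `[t, u] (fun v => G hp v - G hn v) by exact: integrable_realB.
  by apply: eq_integrable i0 => // v vu; congr EFin; exact: (GE' v vu).
have gp2' : G hp u = \int[leb]_(s in `[t, u]) hp s + r * \int[leb]_(v in `[t, u]) G hp v := gp2.
have gn2' : G hn u = \int[leb]_(s in `[t, u]) hn s + r * \int[leb]_(v in `[t, u]) G hn v := gn2.
have e1 : \int[leb]_(v in `[t, u]) G h v = \int[leb]_(v in `[t, u]) G hp v - \int[leb]_(v in `[t, u]) G hn v.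
  by rewrite -RintegralB//; apply: eq_Rintegral => v vu; rewrite GE'.
have e2 : \int[leb]_(s in `[t, u]) h s = \int[leb]_(s in `[t, u]) hp s - \int[leb]_(s in `[t, u]) hn s.
  rewrite -RintegralB//; [|exact: integrableS ihp|exact: integrableS ihn].
  apply: eq_Rintegral => v; rewrite inE/= in_itv/= => /andP[tv vu].
  by rewrite hE// tv (le_trans vu uT).
transitivity (G hp u - G hn u); first exact: GE.
by rewrite gp2' gn2' e2 -/(G h) e1 mulrBr opprD addrACA.
Qed.

Section wiener_growth.
Variables (c k C : R) (f g w : R -> R).
Hypotheses (fP : step_smooth t T c k C f g) (cw : {within `[t, T], continuous w}).

(** [parts_integral] for the integrand [expR (r * (u - s)) * f s]: its jump at [c] is
    [expR (r * (u - c)) * k] and its slope [expR (r * (u - s)) * (g s - r * f s)]. *)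
Definition weighted_parts u := parts_integral t c (expR (r * (u - c)) * k)
  (fun s => expR (r * (u - s)) * f s) (fun s => expR (r * (u - s)) * (g s - r * f s)) w u.

Lemma weighted_parts_growth u : t <= u <= T ->
  L1 leb `[t, u] weighted_parts /\
  weighted_parts u = parts_integral t c k f g w u + r * \int[leb]_(s in `[t, u]) weighted_parts s.
Proof.
move=> /[dup] tuT /andP[tu uT].
have sub : `[t, u] `<=` `[t, T] by apply: subset_itv; rewrite bnd_simp.
have mf : measurable_fun `[t, T] f by exact: step_smooth_measurable tT fP.
have mw : measurable_fun `[t, T] w by exact: within_measurable cw.
have [K K0 wK] := within_bounded tT cw.
have gw : L1 leb `[t, T] (fun x => g x * w x).
  exact: (parts_integrand_integrable tT fP cw (lexx t) (lexx T)).
have fw : L1 leb `[t, T] (fun x => f x * w x).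
  apply: (@bounded_integrable_itv _ _ (step_smooth_bound t T k C f * K)).
    exact: measurable_funM.
  by move=> s sT; rewrite normrM ler_pM ?wK ?(step_smooth_le fP).
have rfw : L1 leb `[t, T] (fun x => r * (f x * w x)) by exact: integrable_realZ.
pose h s := g s * w s - r * (f s * w s).
have ih : L1 leb `[t, T] h by exact: integrable_realB.
have mh : measurable_fun `[t, T] h by move/integrableP: (ih) => [/measurable_EFinP].
have [Vi VE] := convolution_growth mh ih tuT.
pose V v := \int[leb]_(s in `[t, v]) (expR (r * (v - s)) * h s).
pose E1 v : R := expR (r * (v - t)); pose E2 v : R := ((t < c <= v)%R : bool)%:R * expR (r * (v - c)).
(* Each term on the right solves or integrates explicitly: [E1] and [E2] are exponentials from [t]
   and from [c], and [V] is a convolution covered by [convolution_growth]. *)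
have PE v : weighted_parts v = f v * w v - f t * w t * E1 v - k * w c * E2 v - V v.
  rewrite /weighted_parts /parts_integral subrr mulr0 expR0 mul1r /E1 /E2 /V.
  have -> : \int[leb]_(x in `[t, v]) (expR (r * (v - x)) * (g x - r * f x) * w x) =
    \int[leb]_(s in `[t, v]) (expR (r * (v - s)) * h s).
    by apply: eq_Rintegral => s _; rewrite /h; ring.
  by ring.
have bexp a v : a >= t -> v <= T -> `|expR (r * (v - a))| <= expR (r * (T - t)).
  move=> ta vT; rewrite ger0_norm ?expR_ge0// ler_expR ler_wpM2l ?(ltW r0)//.
  by rewrite lerB.
have mexp a : Tmeasurable (fun v : R => expR (r * (v - a))).
  by apply: measurableT_comp => //; apply: measurable_funM => //; exact: measurable_funB.
have iE1 : L1 leb `[t, u] E1.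
  apply: (@bounded_integrable_itv _ _ (expR (r * (T - t)))); first exact: (measurable_funTS (mexp t)).
  by move=> s /andP[_ su]; rewrite bexp// (le_trans su uT).
have tc : t <= c by case: fP => /andP[].
have E2E v : E2 v = ((t < c)%R : bool)%:R * \1_(`[c, +oo[) v * expR (r * (v - c)).
  rewrite /E2 -mulnb natrM indicE (_ : (v \in `[c, +oo[%classic) = (c <= v)%R)//.
  by apply/idP/idP; rewrite inE/= in_itv/= andbT.
have iE2 : L1 leb `[t, u] E2.
  apply: (@bounded_integrable_itv _ _ (expR (r * (T - t)))).
    apply: measurable_funTS; rewrite (_ : E2 = fun v => ((t < c)%R : bool)%:R * \1_(`[c, +oo[) v * expR (r * (v - c))).
      apply: measurable_funM => //; apply: measurable_funM => //; exact: measurable_indic.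
    by apply/funext => v; rewrite E2E.
  move=> s /andP[_ su]; rewrite /E2 normrM; apply: le_trans (bexp c s tc (le_trans su uT)).
  by rewrite ler_piMl//; case: (_ && _); rewrite ?normr1 ?normr0.
have ifw : L1 leb `[t, u] (fun s => f s * w s) by exact: integrableS fw.
have iaE1 : L1 leb `[t, u] (fun s => f t * w t * E1 s) by exact: integrable_realZ.
have ikE2 : L1 leb `[t, u] (fun s => k * w c * E2 s) by exact: integrable_realZ.
have i1 : L1 leb `[t, u] (fun s => f s * w s - f t * w t * E1 s).
  exact: integrable_realB.
have i2 : L1 leb `[t, u] (fun s => f s * w s - f t * w t * E1 s - k * w c * E2 s).
  exact: integrable_realB.
have i3 : L1 leb `[t, u] (fun s => f s * w s - f t * w t * E1 s - k * w c * E2 s - V s).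
  exact: integrable_realB.
split.
  by apply: eq_integrable i3 => // v _; rewrite /= PE.
have -> : \int[leb]_(s in `[t, u]) weighted_parts s =
    \int[leb]_(s in `[t, u]) (f s * w s - f t * w t * E1 s - k * w c * E2 s - V s).
  by apply: eq_Rintegral => s _; rewrite PE.
rewrite RintegralB// RintegralB// RintegralB// RintegralZl// RintegralZl//.
have -> : \int[leb]_(x in `[t, u]) E1 x = (E1 u - 1) / r by exact: integral_expR_affine.
have R0 (A : set R) : \int[leb]_(s in A) (0 : R) = 0 by rewrite /Rintegral integral0.
have IE2 : \int[leb]_(x in `[t, u]) E2 x = (E2 u - ((t < c <= u)%R : bool)%:R) / r.
  rewrite /E2; case: (ltP t c) => tc'; last first.
    rewrite /= !mul0r subrr mul0r; under eq_Rintegral do rewrite mul0r.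
    exact: R0.
  case: (leP c u) => cu /=; last first.
    rewrite !mul0r subrr mul0r; rewrite -[RHS](R0 `[t, u]%classic).
    apply: eq_Rintegral => s; rewrite inE/= in_itv/= => /andP[_ su].
    by rewrite leNgt (le_lt_trans su cu) mul0r.
  rewrite mul1r -integral_expR_affine// [LHS]Rintegral_mkcond [RHS]Rintegral_mkcond.
  apply: eq_Rintegral => s _; rewrite !patchE.
  case: ifPn => s1; case: ifPn => s2//.
  - by move: s2; rewrite inE/= in_itv/= => /andP[-> _]; rewrite mul1r.
  - move: s1 s2; rewrite inE/= in_itv/= => /andP[_ su]; rewrite notin_setE/= in_itv/= su andbT => /negP/negbTE ->.
    by rewrite mul0r.
  - move: s1 s2; rewrite notin_setE inE/= !in_itv/= => s1 /andP[s2 s3]; exfalso; apply: s1.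
    by rewrite (le_trans tc s2) s3.
rewrite IE2 PE /V VE -/V.
have -> : \int[leb]_(s in `[t, u]) h s = \int[leb]_(s in `[t, u]) (g s * w s) -
    r * \int[leb]_(s in `[t, u]) (f s * w s).
  rewrite RintegralB//; last exact: integrableS rfw.
    by rewrite RintegralZl.
  exact: integrableS gw.
by rewrite /parts_integral; field; rewrite gt_eqF.
Qed.

End wiener_growth.
End lebesgue_convolution.

Section pieces.
Context {R : realType}.
Notation leb := (@lebesgue_measure R).
Variables (t T c : R) (F1 F2 G1 G2 : R -> R).
Hypotheses (tT : t <= T) (tcT : t <= c <= T).
Hypotheses (dF1 : forall s : R, is_derive s 1 F1 (G1 s)) (dF2 : forall s : R, is_derive s 1 F2 (G2 s)).
Hypotheses (cG1 : continuous G1) (cG2 : continuous G2).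

Definition piece s := if s < c then F1 s else F2 s.
(** The cut to [[t, T]] makes the slope bounded on the whole line, as [step_smooth] asks. *)
Definition piece_slope s := \1_(`[t, T]) s * (if s < c then G1 s else G2 s).

Let FTC (F G : R -> R) (a b : R) : (forall s : R, is_derive s 1 F (G s)) -> continuous G -> a <= b ->
  F b - F a = \int[leb]_(s in `[a, b]) G s.
Proof.
move=> dF cG; rewrite le_eqVlt => /orP[/eqP<-|ab]; first by rewrite set_itv1 Rintegral_set1 subrr.
have cF s : {for s, continuous F}.
  by apply: differentiable_continuous; apply/derivable1_diffP; have [] := dF s.
rewrite /Rintegral (@continuous_FTC2 _ _ F)//.
- exact: continuous_subspaceT.
- split; first by move=> s _; have [] := dF s.
  + exact/cvg_at_right_filter/cF.
  + exact/cvg_at_left_filter/cF.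
- by move=> s _; rewrite derive1E; have [_ ->] := dF s.
Qed.

Lemma step_smooth_pieces : exists C, step_smooth t T c (F2 c - F1 c) C piece piece_slope.
Proof.
have [K1 K10 GK1] := within_bounded tT (continuous_subspaceT (A := `[t, T]) cG1).
have [K2 K20 GK2] := within_bounded tT (continuous_subspaceT (A := `[t, T]) cG2).
exists (K1 + K2); split => //.
- apply: measurable_funM => //.
  apply: measurable_fun_ifT; last 2 first.
  + exact: continuous_measurable_fun.
  + exact: continuous_measurable_fun.
  + exact: measurable_fun_ltr.
- move=> s; rewrite /piece_slope indicE; case: (boolP (_ \in _)) => [|_]; last by rewrite mul0r normr0 addr_ge0.
  rewrite inE/= in_itv/= mul1r => sT; case: ifP => _.
    by apply: (le_trans (GK1 s sT)); rewrite lerDl.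
  by apply: (le_trans (GK2 s sT)); rewrite lerDr.
move=> s u ts su uT.
have ind x : s <= x <= u -> (\1_(`[t, T]) x : R) = 1.
  by move=> /andP[sx xu]; rewrite indicE mem_set//= in_itv/= (le_trans ts sx) (le_trans xu uT).
have [uc|cu] := ltP u c.
  rewrite /piece (le_lt_trans su uc) uc andbF mulr0 add0r (FTC dF1 cG1 su).
  apply: eq_Rintegral => x; rewrite inE/= in_itv/= => /[dup] sxu /andP[_ xu].
  by rewrite /piece_slope ind// mul1r (le_lt_trans xu uc).
have [cs|sc] := leP c s.
  rewrite /piece ltNge cu ltNge cs /= mulr0 add0r (FTC dF2 cG2 su).
  apply: eq_Rintegral => x; rewrite inE/= in_itv/= => /[dup] sxu /andP[sx _].
  by rewrite /piece_slope ind// mul1r ltNge (le_trans cs sx).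
rewrite /piece sc ltNge cu /= mulr1.
have ig : L1 leb `[s, u] piece_slope.
  apply: (@bounded_integrable_itv _ _ (K1 + K2)).
    apply: measurable_funTS; apply: measurable_funM => //.
    apply: measurable_fun_ifT; last 2 first.
    + exact: continuous_measurable_fun.
    + exact: continuous_measurable_fun.
    + exact: measurable_fun_ltr.
  move=> x sxu; rewrite /piece_slope ind// mul1r.
  have xT : t <= x <= T by case/andP: sxu => sx xu; rewrite (le_trans ts sx) (le_trans xu uT).
  case: ifP => _; first by apply: (le_trans (GK1 x xT)); rewrite lerDl.
  by apply: (le_trans (GK2 x xT)); rewrite lerDr.
have ig1 : L1 leb `[s, c] piece_slope.
  by apply: integrableS ig => //; apply: subset_itv; rewrite bnd_simp.
have iG1 : L1 leb `[s, c] G1.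
  apply: (@bounded_integrable_itv _ _ K1).
    by apply: measurable_funTS; exact: continuous_measurable_fun.
  by move=> x /andP[sx xc]; apply: GK1; rewrite (le_trans ts sx) (le_trans xc)//; case/andP: tcT.
have -> : \int[leb]_(x in `[s, u]) piece_slope x =
   \int[leb]_(x in `[s, c]) G1 x + \int[leb]_(x in `[c, u]) G2 x.
  have := @Rintegral_itvB R piece_slope (BLeft s) (BRight u) c ig.
  rewrite !bnd_simp => /(_ (ltW sc) cu)/eqP; rewrite subr_eq addrC => /eqP ->.
  congr (_ + _).
    rewrite -!Rintegral_itv_bndo_bndc//; last 2 first.
    - by apply: integrableS iG1 => //; apply: subset_itv; rewrite bnd_simp.
    - by apply: integrableS ig1 => //; apply: subset_itv; rewrite bnd_simp.
    apply: eq_Rintegral => x; rewrite inE/= in_itv/= => /andP[sx xc].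
    by rewrite /piece_slope xc ind ?mul1r// sx (le_trans (ltW xc) cu).
  rewrite Rintegral_itv_obnd_cbnd; last first.
    by apply: integrableS ig => //; apply: subset_itv; rewrite bnd_simp// ltW.
  apply: eq_Rintegral => x; rewrite inE/= in_itv/= => /andP[cx xu].
  by rewrite /piece_slope ltNge cx/= ind ?mul1r// (le_trans (ltW sc) cx) xu.
rewrite -(FTC dF1 cG1 (ltW sc)) -(FTC dF2 cG2 cu); ring.
Qed.

End pieces.

(** * Uniqueness for the linear equation, accrued Wiener integrals, uncorrelated sums *)

Section linear_ode.
Context {R : realType}.
Notation leb := (@lebesgue_measure R).

(** Let [K u] be the integral of [|D|] up to [u]. If it vanishes up to [a], then over a further time
    [1 / (2 * r)] one has [K u <= r * K u * (u - a) <= K u / 2], hence [K u = 0]; steps of this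
    length reach any time. *)
Lemma linear_ode_zero (r t T : R) (D : R -> R) : 0 < r -> t <= T ->
  L1 leb `[t, T] D ->
  (forall u, t <= u <= T -> D u = r * \int[leb]_(s in `[t, u]) D s) ->
  forall u, t <= u <= T -> D u = 0.
Proof.
move=> r0 tT iD DE; pose dl := (2 * r)^-1; have dl0 : 0 < dl by rewrite invr_gt0 mulr_gt0.
have iDu a u : t <= a -> u <= T -> L1 leb `[a, u] D.
  by move=> ta uT; apply: integrableS iD => //; apply: subset_itv; rewrite bnd_simp.
have inDu a u : t <= a -> u <= T -> L1 leb `[a, u] (fun s => `|D s|).
  by move=> ta uT; apply: integrable_norm; exact: iDu.
pose K u := \int[leb]_(s in `[t, u]) `|D s|.
have K_mono v u : t <= v -> v <= u -> u <= T -> K v <= K u.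
  move=> tv vu uT; have := @Rintegral_itvB R (fun s => `|D s|) (BLeft t) (BRight u) v (inDu t u (lexx t) uT).
  rewrite !bnd_simp => /(_ tv vu) h; rewrite -subr_ge0 h.
  by apply: Rintegral_ge0 => s _; exact: normr_ge0.
have DK v u : t <= v -> v <= u -> u <= T -> `|D v| <= r * K u.
  move=> tv vu uT; rewrite DE ?tv ?(le_trans vu uT)// normrM (gtr0_norm r0) ler_wpM2l ?(ltW r0)//.
  apply: le_trans (K_mono v u tv vu uT).
  by apply: le_normr_Rintegral => //; apply: iDu => //; exact: le_trans uT.
have main n : forall u, t <= u <= T -> u <= t + n%:R * dl -> K u = 0.
  elim: n => [u /andP[tu uT]|n ih u /andP[tu uT] un].
    rewrite mul0r addr0 => ut; have -> : u = t by apply/eqP; rewrite eq_le ut tu.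
    by rewrite /K set_itv1 Rintegral_set1.
  pose a := Num.min (t + n%:R * dl) u.
  have ta : t <= a by rewrite le_min tu lerDl mulr_ge0// ltW.
  have au : a <= u by rewrite ge_min lexx orbT.
  have Ka : K a = 0 by apply: ih; rewrite ?ta ?(le_trans au uT)// ge_min lexx.
  have := @Rintegral_itvB R (fun s => `|D s|) (BLeft t) (BRight u) a (inDu t u (lexx t) uT).
  rewrite !bnd_simp => /(_ ta au); rewrite -!/(K _) Ka subr0.
  rewrite Rintegral_itv_obnd_cbnd; last first.
    by apply: integrableS (inDu a u ta uT) => //; apply: subset_itv; rewrite bnd_simp.
  move=> KE; have Ku0 : 0 <= K u by apply: Rintegral_ge0 => s _; exact: normr_ge0.
  have : K u <= r * K u * (u - a).
    rewrite {1}KE; apply: (@le_trans _ _ (\int[leb]_(s in `[a, u]) (r * K u))).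
      apply: le_Rintegral => //; first exact: inDu.
        apply: (@bounded_integrable_itv _ _ (r * K u)); first exact: measurable_cst.
        by move=> s _; rewrite ger0_norm// mulr_ge0// ltW.
      by move=> s /=; rewrite in_itv/= => /andP[as_ su]; apply: DK => //; exact: le_trans as_.
    rewrite Rintegral_cst//= lebesgue_measure_itv/= lte_fin.
    by case: ltP => h //=; rewrite mulr0 mulr_ge0 ?subr_ge0// mulr_ge0// ltW.
  have ua : u - a <= dl.
    rewrite /a; case: (leP (t + n%:R * dl) u) => _; last by rewrite subrr ltW.
    by move: un; rewrite -natr1 mulrDl mul1r; lra.
  have : r * K u * (u - a) <= r * K u * dl by rewrite ler_wpM2l// mulr_ge0// ltW.
  have -> : r * K u * dl = K u / 2 by rewrite /dl; field; rewrite gt_eqF.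
  lra.
move=> u /[dup] tuT /andP[tu uT]; apply/eqP; rewrite -normr_le0.
have [n un] : exists n, u <= t + n%:R * dl.
  exists (Num.truncn ((u - t) / dl)).+1.
  rewrite -lerBlDl -ler_pdivrMr//; apply: ltW.
  by rewrite truncnS_gt.
by rewrite (le_trans (DK u u tu (lexx u) uT))// (main n u tuT un) mulr0.
Qed.

End linear_ode.

Section ito_congruence.
Context {R : realType} {d} {Omega : measurableType d}.
Variable M : market R Omega.
Notation T := (horizon (par M)).

Lemma predictable_congr t (f f' : R -> Omega -> R) :
  (forall s w, t < s <= T -> f s w = f' s w) -> predictable M t f -> predictable M t f'.
Proof.
move=> ff' pf B mB; rewrite (_ : _ `&` _ = (`]t, T] `*` setT) `&` [set q | B (f q.1 q.2)]).
  exact: pf.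
by apply/seteqP; split => -[s w] /= [[]]; rewrite in_itv/= => sT _; rewrite ff'.
Qed.

Lemma ito_congr W t (f f' I : R -> Omega -> R) :
  (forall s w, t <= s <= T -> f s w = f' s w) -> ito M W t f I -> ito M W t f' I.
Proof.
move=> ff' [pf GI cI [S [okS Sf SI]]]; split => //.
  by apply: predictable_congr pf => s w /andP[ts sT]; rewrite ff'// (ltW ts).
exists S; split => //.
suff -> : (fun n w => (\int[lebesgue_measure]_(s in `[t, T]) ((simple_value (S n) s w - f' s w) ^+ 2)%:E)%E) =
  (fun n w => (\int[lebesgue_measure]_(s in `[t, T]) ((simple_value (S n) s w - f s w) ^+ 2)%:E)%E) by [].
apply/funext => n; apply/funext => w; apply: eq_integral => s.
by rewrite inE/= in_itv/= => sT; rewrite ff'.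
Qed.

End ito_congruence.

Section coefficient.
Context {R : realType} {d} {Omega : measurableType d} (M : market R Omega) (hM : market_ok M).
Notation P := (Pr M).
Notation T := (horizon (par M)).
Notation r := (rate (par M)).
Notation leb := (@lebesgue_measure R).
Variables (t c : R) (F1 F2 G1 G2 : R -> R).
Hypotheses (t0 : 0 <= t) (tT : t <= T) (tcT : t <= c <= T).
Hypotheses (dF1 : forall s : R, is_derive s 1 F1 (G1 s)) (dF2 : forall s : R, is_derive s 1 F2 (G2 s)).
Hypotheses (cG1 : continuous G1) (cG2 : continuous G2).

Lemma rate_gt0 : 0 < r. Proof. by have [[? _ _ _ _] _] := params_okM hM. Qed.

Lemma accr_bounds s : 0 <= s <= T -> 1 <= accr (par M) s <= accr (par M) 0.
Proof.
move=> /andP[s0 sT]; have r0 := ltW (rate_gt0).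
rewrite /accr -{1}expR0 !ler_expR mulr_ge0 ?subr_ge0//=.
by rewrite ler_wpM2l// lerD2l lerN2.
Qed.

Lemma accr_measurable : Tmeasurable (accr (par M)).
Proof.
apply: (measurableT_comp (@measurable_expR R)); apply: measurable_funM => //.
exact: measurable_funB.
Qed.

Let cF (F G : R -> R) : (forall s : R, is_derive s 1 F (G s)) -> continuous F.
Proof.
by move=> dF s; apply: differentiable_continuous; apply/derivable1_diffP; have [] := dF s.
Qed.

Definition weight (u : R) (F : R -> R) (s : R) : R := expR (r * (u - s)) * F s.
Definition weight_slope (u : R) (F G : R -> R) (s : R) : R := expR (r * (u - s)) * (G s - r * F s).

Let dweight u F G : (forall s : R, is_derive s 1 F (G s)) ->
  forall s : R, is_derive s 1 (weight u F) (weight_slope u F G s).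
Proof.
move=> dF s; have h := dF s; rewrite /weight /weight_slope.
by apply: is_derive_eq; rewrite /GRing.scale/=; ring.
Qed.

Let cweight u F G : (forall s : R, is_derive s 1 F (G s)) -> continuous G ->
  continuous (weight_slope u F G).
Proof.
move=> dF cG s; rewrite /weight_slope; apply: cvgM.
  apply: (@continuous_comp _ _ _ (fun s => r * (u - s)) expR); last exact: continuous_expR.
  by apply: cvgM; [exact: cvg_cst|apply: (@cvgB _ R^o); [exact: cvg_cst|exact: cvg_id]].
apply: (@cvgB _ R^o); first exact: cG.
by apply: cvgM; [exact: cvg_cst|exact: (cF dF)].
Qed.

Notation f := (piece c F1 F2).
Notation g := (piece_slope t T c G1 G2).
Notation k := (F2 c - F1 c).

Definition weighted_jump u := weight u F2 c - weight u F1 c.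
Definition weighted_coef u := piece c (weight u F1) (weight u F2).
Definition weighted_slope u :=
  piece_slope t T c (weight_slope u F1 G1) (weight_slope u F2 G2).

Lemma weighted_step_smooth u :
  exists C, step_smooth t T c (weighted_jump u) C (weighted_coef u) (weighted_slope u).
Proof.
apply: step_smooth_pieces => //; try exact: dweight; exact: cweight.
Qed.

Lemma coef_step_smooth : exists C, step_smooth t T c k C f g.
Proof. exact: step_smooth_pieces. Qed.

Lemma weighted_coefE u s : weighted_coef u s = expR (r * (u - s)) * f s.
Proof. by rewrite /weighted_coef /piece /weight; case: ifP. Qed.

Lemma weighted_partsE w u : t <= u <= T ->
  parts_integral t c (weighted_jump u) (weighted_coef u) (weighted_slope u) w u =
  weighted_parts r t c k f g w u.
Proof.
move=> /andP[tu uT]; rewrite /weighted_parts /parts_integral !weighted_coefE.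
rewrite (_ : weighted_jump u = expR (r * (u - c)) * k); last first.
  by rewrite /weighted_jump /weight [RHS]mulrBr.
congr (_ - _); apply: eq_Rintegral => s; rewrite inE/= in_itv/= => /andP[ts su].
rewrite /weighted_slope /piece_slope indicE mem_set/= ?in_itv/= ?ts ?(le_trans su uT)//.
by rewrite !mul1r /weight_slope /piece; case: ifP.
Qed.

Variable W : R -> Omega -> R.
Hypothesis hW : brownian_from M P t W.
Hypothesis cW : {ae P, forall w, {within `[t, T], continuous (W ^~ w)}}.

(** The Wiener gain accrued with interest up to [u]. It solves the linear equation driven by the
    plain Wiener integral, and at [T] it is itself a Wiener integral. *)
Definition growth_integral u w := weighted_parts r t c k f g (W ^~ w) u.

Lemma growth_integral_Gmeasurable u : t <= u <= T -> Gmeasurable M u (growth_integral u).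
Proof.
move=> tuT; have [C sC] := weighted_step_smooth u.
have := @wiener_Gmeasurable _ _ _ M t c (weighted_jump u) C (weighted_coef u) (weighted_slope u) tT sC W hW cW u tuT.
by congr (Gmeasurable M u _); apply/funext => w; rewrite /wiener weighted_partsE.
Qed.

Lemma coef_ito : ito M W t (fun s _ => f s) (wiener t c k f g W).
Proof. by have [C sC] := coef_step_smooth; exact: wiener_ito sC W hW cW. Qed.

Lemma growth_integralE : {ae P, forall w, forall u, t <= u <= T ->
  L1 leb `[t, u] (growth_integral ^~ w) /\
  growth_integral u w = wiener t c k f g W u w + r * \int[leb]_(s in `[t, u]) growth_integral s w}.
Proof.
have [C sC] := coef_step_smooth; apply: filterS cW => w cw u tuT.
exact: (weighted_parts_growth rate_gt0 tT sC cw tuT).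
Qed.

Lemma growth_integral_terminal w :
  growth_integral T w = wiener t c (weighted_jump T) (weighted_coef T) (weighted_slope T) W T w.
Proof. by rewrite /wiener weighted_partsE// tT lexx. Qed.

End coefficient.

Section uncorrelated.
Context d (T : measurableType d) (R : realType).
Variables (Q : probability T R) (A B Z X : T -> R) (k : R).
Hypotheses (mA : Tmeasurable A) (mB : Tmeasurable B) (mZ : Tmeasurable Z)
  (mX : Tmeasurable X).
Hypotheses (iA : L1 Q setT (fun w => A w ^+ 2))
  (iB : L1 Q setT (fun w => B w ^+ 2))
  (iZ : L1 Q setT (fun w => Z w ^+ 2)).
Hypotheses (EA : \int[Q]_w A w = 0) (EB : \int[Q]_w B w = 0).
Hypotheses (AB : \int[Q]_w (A w * B w) = 0) (AZ : \int[Q]_w (A w * Z w) = 0)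
  (BZ : \int[Q]_w (B w * Z w) = 0).
Hypothesis XE : {ae Q, forall w, X w = k + A w + B w - Z w}.

Notation m := (\int[Q]_w Z w).

Let iA1 := integrable_of_sqr mA iA.
Let iB1 := integrable_of_sqr mB iB.
Let iZ1 := integrable_of_sqr mZ iZ.

Lemma uncorrelated_expectation : ('E_Q[X] = (k - m)%:E)%E.
Proof.
have ik := @integrable_cst _ T R Q k.
have i1 : L1 Q setT (fun w => k + A w) by exact: integrable_realD.
have i2 : L1 Q setT (fun w => k + A w + B w) by exact: integrable_realD.
have i3 : L1 Q setT (fun w => k + A w + B w - Z w) by exact: integrable_realB.
rewrite unlock; transitivity (\int[Q]_w (k + A w + B w - Z w)%:E)%E; last first.
  rewrite -[LHS](fineK (integrable_fin_num measurableT i3)); congr (_%:E).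
  rewrite -/(\int[Q]_w (k + A w + B w - Z w)).
  rewrite (RintegralB _ i2)// (RintegralD _ i1)// (RintegralD _ ik)// EA EB expectation_cst_real.
  by rewrite !addr0.
apply: ae_eq_integral => //.
- exact/measurable_EFinP.
- by have /integrableP[] := i3.
- by apply: filterS XE => w /= -> _.
Qed.

Lemma uncorrelated_variance :
  ('V_Q[X] = (\int[Q]_w (A w ^+ 2) + \int[Q]_w (B w ^+ 2) + (\int[Q]_w (Z w ^+ 2) - m ^+ 2))%:E)%E.
Proof.
rewrite /variance unlock uncorrelated_expectation/= unlock.
(* The square of the centred [X], expanded so that each group has a known integral: squares,
   products that integrate to 0, and an affine part in [A], [B] and [Z]. *)
pose G w := A w ^+ 2 + B w ^+ 2 + Z w ^+ 2 + (2 * (A w * B w) - 2 * (A w * Z w) - 2 * (B w * Z w))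
  + (2 * m * (A w + B w - Z w) + m ^+ 2).
have j1 : L1 Q setT (fun w => A w ^+ 2 + B w ^+ 2) by exact: integrable_realD.
have j2 : L1 Q setT (fun w => A w ^+ 2 + B w ^+ 2 + Z w ^+ 2) by exact: integrable_realD.
have c1 : L1 Q setT (fun w => A w * B w) by exact: integrable_sqr_mul.
have c2 : L1 Q setT (fun w => A w * Z w) by exact: integrable_sqr_mul.
have c3 : L1 Q setT (fun w => B w * Z w) by exact: integrable_sqr_mul.
have d1 : L1 Q setT (fun w => 2 * (A w * B w)) by exact: integrable_realZ.
have d2 : L1 Q setT (fun w => 2 * (A w * Z w)) by exact: integrable_realZ.
have d3 : L1 Q setT (fun w => 2 * (B w * Z w)) by exact: integrable_realZ.
have d12 : L1 Q setT (fun w => 2 * (A w * B w) - 2 * (A w * Z w)).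
  exact: integrable_realB.
have d123 : L1 Q setT (fun w => 2 * (A w * B w) - 2 * (A w * Z w) - 2 * (B w * Z w)).
  exact: integrable_realB.
have l1 : L1 Q setT (fun w => A w + B w) by exact: integrable_realD.
have l2 : L1 Q setT (fun w => A w + B w - Z w) by exact: integrable_realB.
have l3 : L1 Q setT (fun w => 2 * m * (A w + B w - Z w)) by exact: integrable_realZ.
have ik := @integrable_cst _ T R Q (m ^+ 2).
have l4 : L1 Q setT (fun w => 2 * m * (A w + B w - Z w) + m ^+ 2) by exact: integrable_realD.
have j3 : L1 Q setT (fun w => A w ^+ 2 + B w ^+ 2 + Z w ^+ 2
    + (2 * (A w * B w) - 2 * (A w * Z w) - 2 * (B w * Z w))) by exact: integrable_realD.
have iG : L1 Q setT G by exact: integrable_realD.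
transitivity (\int[Q]_w (G w)%:E)%E; last first.
  rewrite -[LHS](fineK (integrable_fin_num measurableT iG)); congr (_%:E).
  rewrite -/(\int[Q]_w (G w)) /G (RintegralD _ j3)// (RintegralD _ j2)// (RintegralD _ j1)// (RintegralD _ iA)//.
  rewrite (RintegralB _ d12)// (RintegralB _ d1)// !RintegralZl// AB AZ BZ.
  rewrite (RintegralD _ l3)// RintegralZl// (RintegralB _ l1)// (RintegralD _ iA1)// EA EB.
  by rewrite expectation_cst_real; ring.
apply: ae_eq_integral => //.
- by apply/measurable_EFinP; apply: measurable_funM; apply: measurable_funB.
- by have /integrableP[] := iG.
- apply: filterS XE => w XwE _; congr (_%:E).
  transitivity ((X w - (k - m)) * (X w - (k - m))); first by [].
  by rewrite XwE /G; ring.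
Qed.

End uncorrelated.

(** * Exponential moments of claims and their consequences under a tilt *)

Section exponential_moment.
Context {R : realType} {d} {Omega : measurableType d} (M : market R Omega) (hM : market_ok M).
Notation v := (levy M).
Notation T := (horizon (par M)).
Notation leb := (@lebesgue_measure R).
Notation ell := (leb \x v)%E.

Lemma expR_sub1_le (y : R) : 0 <= y -> expR y - 1 <= y * expR y.
Proof.
move=> y0; have h : expR y * (1 + - y) <= expR y * expR (- y).
  by rewrite ler_wpM2l ?expR_ge0//; exact: expR_ge1Dx.
by move: h; rewrite -expRD subrr expR0; lra.
Qed.

Lemma sub1_expRN_le (y : R) : 0 <= y -> 1 - expR (- y) <= y * expR y.
Proof.
move=> y0; have h1 := expR_ge1Dx (- y); have h2 := expR_ge1Dx y.
have : y <= y * expR y by rewrite ler_peMr//; lra.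
by lra.
Qed.

(** Take [k] at most [1/2] and [c / 2]. Below 1, [k * (z + z^2) <= z] and
    [expR z - 1 <= expR 1 * z], which is integrable; above 1, [z <= z^2] gives
    [k * (z + z^2) <= c * z^2], covered by the Gaussian moment. *)
Lemma levy_exp_moment : exists2 k : R, 0 < k &
  (\int[v]_(z in `]0%R, +oo[) (expR (k * (`|z| + z ^+ 2)) - 1)%:E < +oo)%E.
Proof.
have [_ _ v1 [c c0 v2]] := levy_okM hM.
pose k : R := Num.min (c / 2) (1 / 2); have k0 : 0 < k by rewrite lt_min !divr_gt0.
have kc : k <= c / 2 by rewrite ge_min lexx.
have k1 : k <= 1 / 2 by rewrite ge_min lexx orbT.
exists k => //; pose g (z : R) := expR (k * (`|z| + z ^+ 2)) - 1.
have g0 z : 0 <= g z.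
  by rewrite subr_ge0 -expR0 ler_expR mulr_ge0 ?(ltW k0)// addr_ge0 ?sqr_ge0.
have mg : Tmeasurable g.
  apply: measurable_funB => //; apply: (measurableT_comp (@measurable_expR R)).
  apply: measurable_funM => //; apply: measurable_funD; first exact: normr_measurable.
  exact: (measurable_funX 2 (@measurable_id _ _ setT)).
rewrite (_ : `]0%R, +oo[%classic = `]0%R, 1%R[%classic `|` `[1%R, +oo[%classic); last first.
  by apply/seteqP; split => z /=; rewrite !in_itv/= !andbT; case: (ltP z 1) => h; try lra; tauto.
rewrite ge0_integral_setU//; first last.
- by apply/disj_setPS => z [/=]; rewrite !in_itv/= !andbT => /andP[_ h1] h2; move: h1; rewrite ltNge h2.
- by move=> z _; rewrite lee_fin; exact: g0.
- by apply/measurable_EFinP; exact: measurable_funTS.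
apply: lte_add_pinfty.
  apply: (@le_lt_trans _ _ ((expR 1)%:E * \int[v]_(z in `]0%R, 1%R[) z%:E)%E); last first.
    by apply: lte_mul_pinfty => //; rewrite lee_fin expR_ge0.
  rewrite -ge0_integralZl_EFin ?expR_ge0//; last first.
    by move=> z /=; rewrite in_itv/= => /andP[/ltW h _]; rewrite lee_fin.
  apply: ge0_le_integral => //.
  - by move=> z _; rewrite lee_fin; exact: g0.
  - by apply/measurable_EFinP; exact: measurable_funTS.
  - by apply/measurable_EFinP; apply: measurable_funM.
  - move=> z /=; rewrite in_itv/= => /andP[z0 z1]; rewrite lee_fin /g gtr0_norm//.
    have h : k * (z + z ^+ 2) <= z by nra.
    apply: le_trans (_ : expR z - 1 <= _); first by rewrite lerB// ler_expR.
    apply: le_trans (expR_sub1_le (ltW z0)) _; rewrite mulrC ler_wpM2r ?ltW//.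
    by rewrite ltr_expR.
apply: le_lt_trans v2; apply: ge0_le_integral => //.
- by move=> z _; rewrite lee_fin; exact: g0.
- by apply/measurable_EFinP; exact: measurable_funTS.
- apply/measurable_EFinP; apply: measurable_funTS; apply: (measurableT_comp (@measurable_expR R)).
  by apply: measurable_funM => //; exact: (measurable_funX 2 (@measurable_id _ _ setT)).
- move=> z /=; rewrite in_itv/= andbT => z1; rewrite lee_fin /g ger0_norm ?(le_trans ler01)//.
  apply: le_trans (_ : expR (k * (z + z ^+ 2)) <= _); first by lra.
  rewrite ler_expR; have zz : z <= z ^+ 2 by rewrite expr2 ler_peMl// (le_trans ler01).
  apply: (@le_trans _ _ (k * (z ^+ 2 + z ^+ 2))); first by rewrite ler_wpM2l ?(ltW k0)// lerD2r.
  have : k * z ^+ 2 <= c / 2 * z ^+ 2 by rewrite ler_wpM2r ?sqr_ge0.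
  by lra.
Qed.

Variables (phi : distortion R) (t : R).
Hypotheses (Tphi : Theta M phi) (t0 : 0 <= t) (tT : t <= T).
Notation D := (jump_domain t T).

(** [tilt_young] with [L = k * (|z| + z^2)], then division by [k]: one small exponential moment of
    the Lévy measure controls second moments under every prior. *)
Lemma tilted_second_moment :
  (\int[ell]_(q in D) ((`|q.2| + q.2 ^+ 2)%:E * (tilt_density phi t T q)%:E) < +oo)%E.
Proof.
have [k k0 vk] := levy_exp_moment.
pose g (z : R) := expR (k * (`|z| + z ^+ 2)) - 1.
have mN : Tmeasurable (fun z : R => `|z| + z ^+ 2).
  apply: measurable_funD; first exact: normr_measurable.
  exact: (measurable_funX 2 (@measurable_id _ _ setT)).
have mg : Tmeasurable g.
  apply: measurable_funB => //; apply: (measurableT_comp (@measurable_expR R)).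
  exact: measurable_funM.
have g0 z : 0 <= g z.
  by rewrite subr_ge0 -expR0 ler_expR mulr_ge0 ?(ltW k0)// addr_ge0 ?sqr_ge0.
have mG : Tmeasurable (fun q : R * R => (g q.2)%:E).
  by apply/measurable_EFinP; exact: (measurableT_comp mg measurable_snd).
have mc : Tmeasurable (fun x => (cut_entropy M phi t x)%:E : \bar R).
  by apply/measurable_EFinP; exact: (cut_entropy_measurable Tphi t0).
have mD : measurable D := jump_domain_measurable t T.
have fG : (\int[ell]_(q in D) (g q.2)%:E < +oo)%E.
  have G0 (q : R * R) : (0 <= (g q.2)%:E)%E by rewrite lee_fin.
  rewrite /jump_domain (@integral_setX _ v _ _ _ (measurable_itv _) (measurable_itv _) G0 mG)/=.
  have /fineK <- : (\int[v]_(z in `]0%R, +oo[) (g z)%:E)%E \is a fin_num.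
    by rewrite ge0_fin_numE//; apply: integral_ge0 => z _; rewrite lee_fin.
  set K := fine _.
  have iK : L1 leb `[t, T] (fun=> K).
    by apply: (@bounded_integrable_itv _ _ `|K|) => //; exact: measurable_cst.
  have hK : L1 leb `]t, T] (fun=> K).
    by apply: integrableS iK => //; apply: subset_itv; rewrite bnd_simp.
  exact: integrable_lty hK.
have fE := entropy_setX_finite Tphi t0 tT.
apply: (@le_lt_trans _ _ (\int[ell]_(q in D) ((k^-1)%:E * ((cut_entropy M phi t q)%:E + (g q.2)%:E)))%E).
  apply: ge0_le_integral => //.
  - by move=> q _; rewrite -EFinM lee_fin mulr_ge0 ?(tilt_density_ge0 Tphi t0)// addr_ge0 ?sqr_ge0.
  - apply: measurable_funTS; apply: emeasurable_funM; apply/measurable_EFinP.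
      exact: (measurableT_comp mN measurable_snd).
    exact: (tilt_density_measurable Tphi t0).
  - by apply: measurable_funTS; apply: emeasurable_funM => //; exact: emeasurable_funD.
  - move=> q qD; rewrite -EFinM -EFinD -EFinM lee_fin.
    rewrite -(ler_pM2l k0) [leRHS]mulrA mulfV ?gt_eqF// mul1r mulrA.
    exact: (tilt_young Tphi t0 _ qD).
rewrite ge0_integralZl_EFin//; first last.
- by rewrite invr_ge0 ltW.
- by apply: measurable_funTS; exact: emeasurable_funD.
- by move=> q _; rewrite -EFinD lee_fin addr_ge0// (cut_entropy_ge0 Tphi t0).
apply: lte_mul_pinfty; rewrite ?lee_fin ?invr_ge0 ?(ltW k0)//.
rewrite ge0_integralD//; first exact: lte_add_pinfty.
- by move=> q _; rewrite lee_fin (cut_entropy_ge0 Tphi t0).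
- exact: measurable_funTS.
- by move=> q _; rewrite lee_fin.
- exact: measurable_funTS.
Qed.

(* Either the positions are bounded or there are no jumps at all: this is what
   the first order condition gives for the equilibrium retention. *)
Definition moderate (rk : R -> R) : Prop :=
  (exists K : R, forall s, t <= s <= T -> rk s <= K) \/ v `]0, +oo[%classic = 0%E.

Lemma moderate_finite rk (F : R * R -> R) : moderate rk -> (forall s, 0 <= rk s) ->
  Tmeasurable F -> (forall q, 0 <= F q) ->
  (exists C : R, forall q, D q -> F q <= C * (rk q.1 * `|q.2| + (rk q.1 * `|q.2|) ^+ 2)) ->
  (\int[ell]_(q in D) ((F q)%:E * (tilt_density phi t T q)%:E) < +oo)%E.
Proof.
move=> mo rk0 mF F0 [C FC]; have mD : measurable D := jump_domain_measurable t T.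
have mFE : Tmeasurable (fun q => (F q)%:E * (tilt_density phi t T q)%:E)%E.
  apply: emeasurable_funM; apply/measurable_EFinP => //; exact: (tilt_density_measurable Tphi t0).
case: mo => [[K rkK]|v0]; last first.
  have FE0 q : (0 <= (F q)%:E * (tilt_density phi t T q)%:E)%E.
    by rewrite -EFinM lee_fin mulr_ge0// (tilt_density_ge0 Tphi t0).
  rewrite /jump_domain (@integral_setX _ v _ _ _ (measurable_itv _) (measurable_itv _) FE0 mFE)/=.
  rewrite integral0_eq ?ltry// => s _; apply: null_set_integral => //.
  apply: measurable_funTS; apply: (measurableT_comp mFE); exact: measurable_pair1.
have mN : Tmeasurable (fun z : R => `|z| + z ^+ 2).
  apply: measurable_funD; first exact: normr_measurable.
  exact: (measurable_funX 2 (@measurable_id _ _ setT)).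
pose K' := `|C| * (`|K| + K ^+ 2).
have K'0 : 0 <= K' by rewrite mulr_ge0// addr_ge0// sqr_ge0.
have r0 q : 0 <= tilt_density phi t T q := tilt_density_ge0 Tphi t0 q.
have mr : Tmeasurable (tilt_density phi t T) := tilt_density_measurable Tphi t0.
apply: (@le_lt_trans _ _ (\int[ell]_(q in D) (K'%:E * ((`|q.2| + q.2 ^+ 2)%:E * (tilt_density phi t T q)%:E)))%E).
  apply: ge0_le_integral => //.
  - by move=> q _; rewrite -EFinM lee_fin mulr_ge0.
  - exact: measurable_funTS.
  - apply: measurable_funTS; apply: emeasurable_funM => //; apply: emeasurable_funM; apply/measurable_EFinP => //.
    exact: (measurableT_comp mN measurable_snd).
  - move=> q qD; rewrite -!EFinM lee_fin mulrA ler_wpM2r//; apply: le_trans (FC q qD) _.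
    have [/= + _] := qD; rewrite in_itv/= => /andP[tq qT].
    have hK := rkK q.1; rewrite (ltW tq) qT in hK; have {}hK := hK isT.
    have z0 := normr_ge0 q.2; have zz := real_normK (num_real q.2); have k0 := rk0 q.1.
    apply: (@le_trans _ _ (`|C| * (rk q.1 * `|q.2| + (rk q.1 * `|q.2|) ^+ 2))).
      by rewrite ler_wpM2r ?ler_norm// addr_ge0 ?sqr_ge0// mulr_ge0.
    rewrite -mulrA ler_wpM2l//; rewrite (ger0_norm (le_trans k0 hK)) -zz.
    move: (rk q.1) (`|q.2|) k0 hK z0 => k z k0 hK z0.
    have : k * z <= K * z by rewrite ler_wpM2r.
    have : (k * z) ^+ 2 <= (K * z) ^+ 2 by rewrite lerXn2r ?nnegrE ?mulr_ge0 ?ler_wpM2r// (le_trans k0).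
    have h1 : 0 <= K ^+ 2 * z by rewrite mulr_ge0// sqr_ge0.
    have h2 : 0 <= K * z ^+ 2 by rewrite mulr_ge0 ?sqr_ge0// (le_trans k0).
    rewrite exprMn; lra.
rewrite ge0_integralZl_EFin//; first last.
- apply: measurable_funTS; apply: emeasurable_funM; apply/measurable_EFinP => //.
  exact: (measurableT_comp mN measurable_snd).
- by move=> q _; rewrite -EFinM lee_fin mulr_ge0// addr_ge0 ?sqr_ge0.
by apply: lte_mul_pinfty => //; exact: tilted_second_moment.
Qed.

End exponential_moment.

(** * The reduced objective as a quadratic in the stock *)

Section objective.
Context {R : realType} {d} {Omega : measurableType d} (M : market R Omega) (hM : market_ok M).
Notation p := (par M).
Notation T := (horizon (par M)).
Notation eta0 := (Defs.eta (par M)).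
Notation r := (rate (par M)).
Notation leb := (@lebesgue_measure R).
Notation v := (levy M).
Notation ell := (leb \x v)%E.
Notation b1 := (sigma2 p * rho p).
Notation b2 := (sigma2 p * rhohat p).

Lemma alpha_bounds : 2^-1 <= alpha p <= 1.
Proof. by have [_ [_ _ _ ? _]] := params_okM hM. Qed.

Lemma eta_gt0 : 0 < eta0.
Proof. by have [[_ _ _ /andP[h1 h2] _] _] := params_okM hM; exact: lt_trans h2. Qed.

Lemma quad_gt0 : 0 < quad M.
Proof.
have [g0 b10 b20 _ _] := params_gt0 hM; have /andP[a1 _] := alpha_bounds.
rewrite /quad ltr_wpDr// mulr_ge0//; first by lra.
by rewrite addr_ge0// mulr_ge0 ?sqr_ge0// ltW.
Qed.

Lemma rhohat_sqr : rhohat p ^+ 2 = 1 - rho p ^+ 2.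
Proof.
have [[_ _ /andP[h1 h2] _ _] _] := params_okM hM.
by rewrite sqr_sqrtr// subr_ge0 -subr_ge0 [leRHS](_ : _ = (1 - rho p) * (1 + rho p)) ?mulr_ge0; try lra; ring.
Qed.

(* The part of the objective that depends on the stock position [y], after the
   distortions have been optimised out. *)
Definition stock_objective (s y : R) : R :=
  accr p s * (mu p - r) * y
  - gamma p / 2 * ((accr p s * (sigma1 p + y * b1)) ^+ 2 + (accr p s * (0 + y * b2)) ^+ 2)
  - (2 * alpha p - 1) / 2 * (beta1 p * (accr p s * (sigma1 p + y * b1)) ^+ 2
      + beta2 p * (accr p s * (0 + y * b2)) ^+ 2).

Let pi_sE s : sigma2 p ^+ 2 * quad M * accr p s * pi_s M s =
  mu p - r - sigma1 p * sigma2 p * rho p * gamma p * accr p s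
  - (2 * alpha p - 1) * beta1 p * sigma1 p * sigma2 p * rho p * accr p s.
Proof.
have q0 := quad_gt0; have s20 : sigma2 p != 0 by have [[_ h _ _ _] _] := params_okM hM; rewrite gt_eqF.
have E : expR (- (r * (T - s))) = (accr p s)^-1 by rewrite expRN.
have a0 : accr p s != 0 by rewrite gt_eqF// expR_gt0.
by rewrite /pi_s E; field; rewrite a0 s20 gt_eqF.
Qed.

(** Completion of the square: [pi_s] is the vertex, and the value at the vertex supplies the
    Brownian terms of [B1]. *)
Lemma stock_objectiveE s y : stock_objective s y =
  - 2^-1 * gamma p * sigma1 p ^+ 2 * accr p s ^+ 2
  - (2 * alpha p - 1) / 2 * beta1 p * sigma1 p ^+ 2 * accr p s ^+ 2
  + (mu p - r - sigma1 p * sigma2 p * rho p * gamma p * accr p s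
        - (2 * alpha p - 1) * beta1 p * sigma1 p * sigma2 p * rho p * accr p s)
         ^+ 2 / (2 * sigma2 p ^+ 2 * quad M)
  - sigma2 p ^+ 2 * quad M / 2 * accr p s ^+ 2 * (y - pi_s M s) ^+ 2.
Proof.
have q0 := quad_gt0; have s20 : sigma2 p != 0 by have [[_ h _ _ _] _] := params_okM hM; rewrite gt_eqF.
rewrite -pi_sE; set w := pi_s M s.
have -> : (sigma2 p ^+ 2 * quad M * accr p s * w) ^+ 2 / (2 * sigma2 p ^+ 2 * quad M) =
  sigma2 p ^+ 2 * quad M / 2 * accr p s ^+ 2 * w ^+ 2.
  by field; rewrite s20 gt_eqF.
have E := pi_sE s; rewrite -/w in E.
transitivity (- 2^-1 * gamma p * sigma1 p ^+ 2 * accr p s ^+ 2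
  - (2 * alpha p - 1) / 2 * beta1 p * sigma1 p ^+ 2 * accr p s ^+ 2
  + accr p s * y * (sigma2 p ^+ 2 * quad M * accr p s * w) - sigma2 p ^+ 2 * quad M / 2 * accr p s ^+ 2 * y ^+ 2).
  rewrite E /stock_objective /quad add0r !exprMn rhohat_sqr.
  by field.
by field.
Qed.

Lemma stock_objective_le s y : stock_objective s y <= stock_objective s (pi_s M s).
Proof.
rewrite !stock_objectiveE subrr expr0n/= mulr0 subr0 gerBl.
by have h := ltW quad_gt0; rewrite mulr_ge0 ?sqr_ge0// mulr_ge0 ?sqr_ge0// divr_ge0// mulr_ge0 ?sqr_ge0.
Qed.

End objective.

(** * Wealth of a switching strategy, its criterion, and the cost of a distortion *)

Section strategy.
Context {R : realType} {d} {Omega : measurableType d} (M : market R Omega) (hM : market_ok M).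
Notation P := (Pr M).
Notation p := (par M).
Notation T := (horizon (par M)).
Notation eta0 := (Defs.eta (par M)).
Notation r := (rate (par M)).
Notation leb := (@lebesgue_measure R).
Notation v := (levy M).
Notation ell := (leb \x v)%E.
Variables (t x : R) (pi : feedback R).
Hypotheses (t0 : 0 <= t) (tT : t <= T).

(* Post-default strategies switch once, at time [c]: the stock position is
   [S1] before and [S2] after, so that a constant perturbation of a smooth
   strategy is covered. *)
Variables (c : R) (S1 S2 dS1 dS2 rk : R -> R).
Hypothesis tcT : t <= c <= T.
Hypotheses (D1 : forall s : R, is_derive s 1 S1 (dS1 s)) (D2 : forall s : R, is_derive s 1 S2 (dS2 s)).
Hypotheses (C1 : continuous dS1) (C2 : continuous dS2).
Hypotheses (mrk : Tmeasurable rk) (rk0 : forall s, 0 <= rk s).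
Hypothesis rk2 : L1 leb `[t, T] (fun s => rk s ^+ 2).

Notation st := (piece c S1 S2).

Hypothesis stockE : forall s y, t <= s <= T -> stock (pi s y true) = st s.
Hypothesis riskE : forall s y, t <= s <= T -> risk (pi s y true) = rk s.

Definition exposure (a b : R) (S : R -> R) (s : R) : R := a + S s * b.
Definition exposure_slope (b : R) (S : R -> R) (s : R) : R := S s * b.

Lemma exposure_derive a b (S G : R -> R) : (forall s : R, is_derive s 1 S (G s)) ->
  forall s : R, is_derive s 1 (exposure a b S) (exposure_slope b G s).
Proof.
move=> dS s; have h := dS s; rewrite /exposure /exposure_slope.
by apply: is_derive_eq; rewrite /GRing.scale/=; ring.
Qed.

Lemma exposure_slope_continuous b (G : R -> R) : continuous G -> continuous (exposure_slope b G).
Proof. by move=> cG s; apply: cvgM; [exact: cG|exact: cvg_cst]. Qed.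

Lemma exposure_piece a b s : piece c (exposure a b S1) (exposure a b S2) s = a + st s * b.
Proof. by rewrite /piece /exposure; case: ifP. Qed.

Notation b1 := (sigma2 p * rho p).
Notation b2 := (sigma2 p * rhohat p).

Let hW1 : brownian_from M P t (W1 M).
Proof.
have := brownian_from_noise1 t0 (noise_from_P hM t0).
rewrite (_ : shifted M (W1 M) _ = W1 M)//; apply/funext => u; apply/funext => w.
by rewrite /shifted /Rintegral integral0 addr0.
Qed.

Let hW2 : brownian_from M P t (W2 M).
Proof.
have := brownian_from_noise2 t0 (noise_from_P hM t0).
rewrite (_ : shifted M (W2 M) _ = W2 M)//; apply/funext => u; apply/funext => w.
by rewrite /shifted /Rintegral integral0 addr0.
Qed.

Let cont (W : R -> Omega -> R) : {ae P, forall w, {within `[0, +oo[, continuous (W ^~ w)}} ->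
  {ae P, forall w, {within `[t, T], continuous (W ^~ w)}}.
Proof.
apply: filterS => w; apply: continuous_subspaceW => s /=; rewrite !in_itv/= andbT => /andP[ts _].
exact: le_trans ts.
Qed.

Let cW1 : {ae P, forall w, {within `[t, T], continuous (W1 M ^~ w)}}.
Proof. by apply: cont; have [] := brownian_P1 hM. Qed.

Let cW2 : {ae P, forall w, {within `[t, T], continuous (W2 M ^~ w)}}.
Proof. by apply: cont; have [] := brownian_P2 hM. Qed.

Notation e1 := (exposure (sigma1 p) b1).
Notation e2 := (exposure 0 b2).

Definition brownian_gain1 u w :=
  growth_integral M t c (e1 S1) (e1 S2) (exposure_slope b1 dS1) (exposure_slope b1 dS2) (W1 M) u w.
Definition brownian_gain2 u w :=
  growth_integral M t c (e2 S1) (e2 S2) (exposure_slope b2 dS1) (exposure_slope b2 dS2) (W2 M) u w.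

Let I1 := wiener t c (e1 S2 c - e1 S1 c) (piece c (e1 S1) (e1 S2))
  (piece_slope t T c (exposure_slope b1 dS1) (exposure_slope b1 dS2)) (W1 M).
Let I2 := wiener t c (e2 S2 c - e2 S1 c) (piece c (e2 S1) (e2 S2))
  (piece_slope t T c (exposure_slope b2 dS1) (exposure_slope b2 dS2)) (W2 M).

(** The last term is the compensator of the claims: with it moved into the drift, claims are
    integrated against the jump measure itself. *)
Definition trade_drift s := (mu p - r) * st s
  + (theta p - eta0 + eta0 * rk s) * mean_claim M + rk s * mean_claim M.

Definition drift_gain u := \int[leb]_(s in `[t, u]) (expR (r * (u - s)) * trade_drift s).

(** The absolute value changes nothing on the jump domain and makes the function nonnegative
    everywhere, as the integration lemmas ask. *)
Definition claim (q : R * R) : R := rk q.1 * `|q.2|.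

Definition claim_loss u w :=
  fine (\int[jumps M w]_(q in jump_domain t u) (expR (r * (u - q.1)) * claim q)%:E)%E.

Let claim_sum u w := fine (\int[jumps M w]_(q in jump_domain t u) (claim q)%:E)%E.

Definition wealth_path u w :=
  expR (r * (u - t)) * x + drift_gain u + brownian_gain1 u w + brownian_gain2 u w - claim_loss u w.

Let claim0 q : 0 <= claim q. Proof. by rewrite mulr_ge0. Qed.

Let mclaim : Tmeasurable claim.
Proof.
apply: measurable_funM; first exact: (measurableT_comp mrk measurable_fst).
exact: (measurableT_comp (@normr_measurable R setT) measurable_snd).
Qed.

Lemma risk_integrable : L1 leb `[t, T] rk.
Proof. by apply: sqr_integrable_itv rk2; exact: measurable_funTS. Qed.

Lemma stock_bounded : exists2 K, measurable_fun `[t, T] st & forall s, t <= s <= T -> `|st s| <= K.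
Proof.
have [C sC] := step_smooth_pieces tT tcT D1 D2 C1 C2.
exists (step_smooth_bound t T (S2 c - S1 c) C st); first exact: step_smooth_measurable tT sC.
by move=> s sT; apply: (step_smooth_le sC sT).
Qed.

Lemma stock_integrable : L1 leb `[t, T] st.
Proof. by have [K ms sK] := stock_bounded; exact: bounded_integrable_itv sK. Qed.

Lemma trade_drift_integrable : L1 leb `[t, T] trade_drift.
Proof.
have h : L1 leb `[t, T] (fun s => ((mu p - r) * st s +
    ((eta0 + 1) * mean_claim M) * rk s) + (theta p - eta0) * mean_claim M).
  apply: integrable_realD => //.
    by apply: integrable_realD => //; apply: integrable_realZ => //; [exact: stock_integrable|exact: risk_integrable].
  by apply: (@bounded_integrable_itv _ _ `|(theta p - eta0) * mean_claim M|) => //; exact: measurable_cst.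
apply: eq_integrable h => // s _; rewrite /= /trade_drift; congr (_%:E); ring.
Qed.

Let claim_integral_le : (\int[(leb \x v)%E]_(q in jump_domain t T)
    ((claim q)%:E * (tilt_density (no_distortion R) t T q)%:E) < +oo)%E.
Proof.
have mc : Tmeasurable (fun q : R * R => (claim q)%:E) by exact/measurable_EFinP.
have c0E q : (0 <= (claim q)%:E)%E by rewrite lee_fin.
apply: (@le_lt_trans _ _ (\int[(leb \x v)%E]_(q in jump_domain t T) (claim q)%:E)%E).
  apply: ge0_le_integral.
  - exact: jump_domain_measurable.
  - by move=> q _; rewrite -EFinM lee_fin mulr_ge0// (tilt_density_ge0 (no_distortion_Theta M) t0).
  - apply: measurable_funTS; apply: emeasurable_funM => //; apply/measurable_EFinP.
    exact: (tilt_density_measurable (no_distortion_Theta M) t0).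
  - exact: measurable_funTS.
  - move=> q _; rewrite -EFinM lee_fin ler_piMr// /tilt_density/= subr0 mulr1 indicE.
    by rewrite lern1 leq_b1.
rewrite /jump_domain (@integral_setX _ v _ _ _ (measurable_itv _) (measurable_itv _) c0E mc).
have E s : (\int[v]_(z in `]0%R, +oo[) (claim (s, z))%:E = (mean_claim M * rk s)%:E)%E.
  transitivity (\int[v]_(z in `]0%R, +oo[) ((rk s)%:E * z%:E))%E.
    apply: eq_integral => z; rewrite inE/= in_itv/= andbT => z0.
    by rewrite /claim/= gtr0_norm.
  rewrite ge0_integralZl_EFin//; last by move=> z /=; rewrite in_itv/= andbT => /ltW; rewrite lee_fin.
  by rewrite (mean_claimE hM) -EFinM mulrC.
under eq_integral do rewrite E.
have ir : L1 leb `]t, T] (fun s => mean_claim M * rk s).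
  apply: integrable_realZ => //; apply: integrableS risk_integrable => //.
  by apply: subset_itv; rewrite bnd_simp.
have /integrableP[_] := ir; apply: le_lt_trans; apply: ge0_le_integral => //.
- by move=> s _; rewrite lee_fin mulr_ge0// mean_claim_ge0.
- by apply/measurable_EFinP; apply: measurable_funTS; exact: measurable_funM.
- by apply: measurableT_comp => //; apply/measurable_EFinP; apply: measurable_funTS; exact: measurable_funM.
- by move=> s _; rewrite lee_abs.
Qed.

Let claim_finite : {ae P, forall w, (\int[jumps M w]_(q in jump_domain t T) (claim q)%:E < +oo)%E}.
Proof.
exact: (jump_sum_finite hM (no_distortion_Theta M) t0 tT (noise_from_P hM t0) claim0 mclaim claim_integral_le).
Qed.

(** Scenario by scenario, [exp_pastE] is applied to the jumps restricted to the domain, each jump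
    accruing interest from its own time. *)
Lemma claim_loss_growth : {ae P, forall w, forall u, t <= u <= T ->
  L1 leb `[t, u] (claim_loss ^~ w) /\
  claim_loss u w = claim_sum u w + r * \int[leb]_(s in `[t, u]) claim_loss s w}.
Proof.
have := jumps_sigma_finite hM t0 tT; apply: filterS2 claim_finite => w cf Nf u /andP[tu uT].
pose D := jump_domain t T; have mD : measurable D := jump_domain_measurable t T.
pose N := mrestr (jumps M w) mD.
have NE A : measurable A -> N A = (\int[jumps M w]_(q in A) (\1_D q)%:E)%E.
  by move=> mA; rewrite integral_indic// setIC.
have NI (F : R * R -> \bar R) : (forall q, 0 <= F q)%E -> Tmeasurable F ->
    (\int[N]_q F q = \int[jumps M w]_q (F q * (\1_D q)%:E))%E.
  by apply: ge0_integral_density => //; exact: measurable_indic.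
(* The complement of the domain has mass 0 for the restricted measure, so it may be added to the
   finite pieces to cover the whole plane. *)
have sf : sigma_finite setT N.
  exists (fun n => large_jumps t T n `|` ~` D).
    apply/esym/seteqP; split => // q _; have [qD|qD] := pselect (D q); last by exists 0%N => //; right.
    by move: qD; rewrite /D -large_jumps_bigcup => -[n _ qn]; exists n => //; left.
  move=> n; have mL := large_jumps_measurable t T n.
  have LD : large_jumps t T n `<=` D by rewrite /D -large_jumps_bigcup; exact: bigcup_sup.
  split; first by apply: measurableU => //; exact: measurableC.
  rewrite /N/= /mrestr setIUl setICl setU0 (_ : large_jumps t T n `&` D = large_jumps t T n).
    exact: Nf.
  exact/setIidPl.
have mfst : Tmeasurable (fst : R * R -> R) by exact: measurable_fst.
have Dt q : D q -> t <= q.1 by move=> [/=]; rewrite in_itv/= => /andP[/ltW].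
have fh : (\int[N]_q (\1_D q * claim q)%:E < +oo)%E.
  rewrite NI; first last.
  - by apply/measurable_EFinP; apply: measurable_funM => //; exact: measurable_indic.
  - by move=> q; rewrite lee_fin mulr_ge0.
  move: cf; rewrite integral_mkcond; apply: le_lt_trans; apply: eqW.
  apply: eq_integral => q _; rewrite patchE indicE -/D; case: ifPn => _.
    by rewrite mul1r mule1.
  by rewrite mule0.
have restr (g : R * R -> R) s : s <= T -> (forall q, 0 <= g q) -> Tmeasurable g ->
    (\int[N]_q (\1_D q * \1_(`[0%R, +oo[) (s - q.1) * g q)%:E =
     \int[jumps M w]_(q in jump_domain t s) (g q)%:E)%E.
  move=> sT g0 mg; have m0 : Tmeasurable (fun q : R * R => \1_(`[0%R, +oo[) (s - q.1) : R).
    apply: (measurableT_comp (measurable_indic (measurable_itv `[0%R, +oo[))).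
    exact: measurable_funB.
  rewrite NI; first last.
  - by apply/measurable_EFinP; apply: measurable_funM => //; apply: measurable_funM => //; exact: measurable_indic.
  - by move=> q; rewrite lee_fin !mulr_ge0.
  rewrite [RHS]integral_mkcond; apply: eq_integral => q _; rewrite patchE.
  have -> : (q \in jump_domain t s) = (q \in D) && (s - q.1 \in `[0%R, +oo[%classic).
    apply/idP/andP; rewrite !inE/=.
      move=> [/=]; rewrite !in_itv/= !andbT => /andP[tq qs] q0; rewrite subr_ge0; split => //.
      by split => //=; rewrite in_itv/= ?andbT// tq (le_trans qs sT).
    move=> [[/=]]; rewrite !in_itv/= !andbT subr_ge0 => /andP[tq _] q0 qs.
    by split => //=; rewrite in_itv/= ?andbT// tq qs.
  rewrite !indicE; case: (_ \in D); case: (_ \in _); rewrite /= ?mul1r ?mul0r ?mulr0 ?mul0r ?mule1 ?mule0 ?mul0e//.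
have expE s : s <= T -> exp_past N r D fst claim s = claim_loss s w.
  move=> sT; rewrite /exp_past /claim_loss; congr fine.
  rewrite -restr//.
  - by apply: eq_integral => q _; congr (_%:E); rewrite /exp_kernel [RHS]mulrA.
  - by move=> q; rewrite mulr_ge0// expR_ge0.
  - apply: measurable_funM => //; apply: (measurableT_comp (@measurable_expR R)).
    by apply: measurable_funM => //; exact: measurable_funB.
have pastE : past N D fst claim u = claim_sum u w.
  by rewrite /past /claim_sum -restr.
have rp := rate_gt0 hM.
split.
  apply: eq_integrable (exp_past_integrable sf rp mD mfst mclaim claim0 Dt fh u) => // s.
  by rewrite inE/= in_itv/= => /andP[_ su]; rewrite /= expE// (le_trans su uT).
rewrite -expE// (exp_pastE sf rp mD mfst mclaim claim0 Dt fh) pastE; congr (_ + _ * _).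
apply: eq_Rintegral => s; rewrite inE/= in_itv/= => /andP[_ su].
by rewrite expE// (le_trans su uT).
Qed.

Lemma wealth_path_Gmeasurable u : t <= u <= T -> Gmeasurable M u (wealth_path u).
Proof.
move=> /[dup] tuT /andP[tu uT]; apply: GmeasurableB; last first.
  apply: (jump_integral_Gmeasurable (F := fun q => (expR (r * (u - q.1)) * claim q)%:E)) => //.
    by move=> q; rewrite lee_fin mulr_ge0// expR_ge0.
  apply/measurable_EFinP; apply: measurable_funM => //; apply: (measurableT_comp (@measurable_expR R)).
  by apply: measurable_funM => //; apply: measurable_funB => //; exact: measurable_fst.
apply: GmeasurableD.
  apply: GmeasurableD; first exact: Gmeasurable_cst.
  apply: growth_integral_Gmeasurable => //; try exact: exposure_derive; exact: exposure_slope_continuous.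
apply: growth_integral_Gmeasurable => //; try exact: exposure_derive; exact: exposure_slope_continuous.
Qed.

Let a1 := piece c (e1 S1) (e1 S2).
Let a2 := piece c (e2 S1) (e2 S2).

Let mexposure (a b : R) : measurable_fun `[t, T] (piece c (exposure a b S1) (exposure a b S2)).
Proof.
have [C sC] := coef_step_smooth tT tcT (exposure_derive a b D1) (exposure_derive a b D2)
  (exposure_slope_continuous (b:=b) C1) (exposure_slope_continuous (b:=b) C2).
exact: step_smooth_measurable tT sC.
Qed.

Let itoI1 : ito M (W1 M) t (fun s _ => a1 s) I1.
Proof.
exact: (@coef_ito _ _ _ _ hM _ _ _ _ _ _ t0 tT tcT (exposure_derive (sigma1 p) b1 D1) (exposure_derive (sigma1 p) b1 D2)
  (exposure_slope_continuous (b:=b1) C1) (exposure_slope_continuous (b:=b1) C2) _ hW1 cW1).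
Qed.

Let itoI2 : ito M (W2 M) t (fun s _ => a2 s) I2.
Proof.
exact: (@coef_ito _ _ _ _ hM _ _ _ _ _ _ t0 tT tcT (exposure_derive (0) b2 D1) (exposure_derive (0) b2 D2)
  (exposure_slope_continuous (b:=b2) C1) (exposure_slope_continuous (b:=b2) C2) _ hW2 cW2).
Qed.

Let cE (X : R -> Omega -> R) s w : t <= s <= T ->
  stock (control M pi true X s w) = st s /\ risk (control M pi true X s w) = rk s.
Proof. by move=> sT; rewrite /control /Dleft/= stockE// riskE. Qed.

Let a1E X s w : t <= s <= T ->
  a1 s = sigma1 p + stock (control M pi true X s w) * sigma2 p * rho p.
Proof. by move=> sT; rewrite /a1 exposure_piece (cE X w sT).1 mulrA. Qed.

Let a2E X s w : t <= s <= T -> a2 s = stock (control M pi true X s w) * sigma2 p * rhohat p.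
Proof. by move=> sT; rewrite /a2 exposure_piece (cE X w sT).1 mulrA add0r. Qed.

Let drift X s w := r * X s w + (mu p - r) * stock (control M pi true X s w)
    + (theta p - eta0 + eta0 * risk (control M pi true X s w)) * mean_claim M
    + bond (control M pi true X s w) * (1 - Hfrom M true s w) * (1 - Delta p) * delta p.

Let driftE X s w : t <= s <= T ->
  drift X s w = r * X s w + (trade_drift s - rk s * mean_claim M).
Proof.
by move=> sT; rewrite /drift /trade_drift !(cE X w sT).1 (cE X w sT).2 /Hfrom/= subrr mulr0 !mul0r; ring.
Qed.

Let comp X s w := bond (control M pi true X s w) * (1 - (Dleft M true s w)%:R) * hP p.

Let compE X s w : comp X s w = 0. Proof. by rewrite /comp /Dleft/= subrr mulr0 mul0r. Qed.

Let claimE X w u : u <= T -> forall q, jump_domain t u q ->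
  risk (control M pi true X q.1 w) * q.2 = claim q.
Proof.
move=> uT q [/=]; rewrite !in_itv/= andbT => /andP[tq qu] q0.
by rewrite (cE X w _).2 ?(ltW tq) ?(le_trans qu uT)// /claim gtr0_norm.
Qed.

Let jumpE X w u : u <= T -> \int[jumps M w]_(q in `]t, u] `*` `]0, +oo[)
   (risk (control M pi true X q.1 w) * q.2) = claim_sum u w.
Proof.
move=> uT; rewrite /claim_sum /Rintegral; congr fine; apply: eq_integral => q.
by rewrite inE => qD; congr (_%:E); exact: claimE qD.
Qed.

Let riskI X w u : u <= T -> \int[leb]_(s in `[t, u]) (risk (control M pi true X s w) * mean_claim M) =
  \int[leb]_(s in `[t, u]) (rk s * mean_claim M).
Proof.
move=> uT; apply: eq_Rintegral => s; rewrite inE/= in_itv/= => /andP[ts su].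
by rewrite (cE X w _).2// ts (le_trans su uT).
Qed.

Let rhs X J1 J2 u w := x + \int[leb]_(s in `[t, u]) drift X s w + J1 u w + J2 u w
  - (\int[jumps M w]_(q in `]t, u] `*` `]0, +oo[) (risk (control M pi true X q.1 w) * q.2)
     - \int[leb]_(s in `[t, u]) (risk (control M pi true X s w) * mean_claim M))
  - zeta p * (bond (control M pi true X (tau M w) w) * (Hfrom M true u w - Hfrom M true t w)
     - \int[leb]_(s in `[t, u]) comp X s w).

Let rhsE X J1 J2 u w : u <= T -> rhs X J1 J2 u w =
  x + \int[leb]_(s in `[t, u]) (r * X s w + (trade_drift s - rk s * mean_claim M)) + J1 u w + J2 u w
  - (claim_sum u w - \int[leb]_(s in `[t, u]) (rk s * mean_claim M)).
Proof.
move=> uT; rewrite /rhs jumpE// riskI// /Hfrom/= subrr mulr0.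
have -> : \int[leb]_(s in `[t, u]) comp X s w = 0.
  by under eq_Rintegral do rewrite compE; rewrite /Rintegral integral0.
rewrite subrr mulr0 subr0; congr (_ + _ + _ + _ - _).
apply: eq_Rintegral => s; rewrite inE/= in_itv/= => /andP[ts su].
by rewrite driftE// ts (le_trans su uT).
Qed.

Let iRd : L1 leb `[t, T] (fun s => trade_drift s - rk s * mean_claim M).
Proof.
apply: integrable_realB => //; first exact: trade_drift_integrable.
have h : L1 leb `[t, T] (fun s => mean_claim M * rk s).
  by apply: integrable_realZ => //; exact: risk_integrable.
by apply: eq_integrable h => // s _; rewrite /= mulrC.
Qed.

Let irm u : u <= T -> L1 leb `[t, u] (fun s => rk s * mean_claim M).
Proof.
move=> uT; have h : L1 leb `[t, T] (fun s => mean_claim M * rk s).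
  by apply: integrable_realZ => //; exact: risk_integrable.
have h2 : L1 leb `[t, u] (fun s => mean_claim M * rk s).
  by apply: integrableS h => //; apply: subset_itv; rewrite bnd_simp.
by apply: eq_integrable h2 => // s _; rewrite /= mulrC.
Qed.

Let path_growth : {ae P, forall w, forall u, t <= u <= T ->
  L1 leb `[t, u] (wealth_path ^~ w) /\
  wealth_path u w = x + \int[leb]_(s in `[t, u]) trade_drift s + I1 u w + I2 u w - claim_sum u w
    + r * \int[leb]_(s in `[t, u]) wealth_path s w}.
Proof.
have G1 := growth_integralE hM tT tcT (exposure_derive (sigma1 p) b1 D1) (exposure_derive (sigma1 p) b1 D2)
  (exposure_slope_continuous (b:=b1) C1) (exposure_slope_continuous (b:=b1) C2) cW1.
have G2 := growth_integralE hM tT tcT (exposure_derive 0 b2 D1) (exposure_derive 0 b2 D2)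
  (exposure_slope_continuous (b:=b2) C1) (exposure_slope_continuous (b:=b2) C2) cW2.
apply: filterS3 G1 G2 claim_loss_growth => w g1 g2 cl u tuT; have /andP[tu uT] := tuT.
have [i1 E1] := g1 u tuT; have [i2 E2] := g2 u tuT; have [i3 E3] := cl u tuT.
have mtd : measurable_fun `[t, T] trade_drift.
  by have /integrableP[/measurable_EFinP] := trade_drift_integrable.
have [i4 E4] := convolution_growth (rate_gt0 hM) mtd trade_drift_integrable tuT.
have i0 : L1 leb `[t, u] (fun s => x * expR (r * (s - t))).
  apply: integrable_realZ => //; apply: (@bounded_integrable_itv _ _ (expR (r * (u - t)))).
    by apply: measurable_funTS; apply: measurableT_comp => //; apply: measurable_funM => //; exact: measurable_funB.
  move=> s /andP[_ su]; rewrite ger0_norm ?expR_ge0// ler_expR ler_wpM2l ?(ltW (rate_gt0 hM))//.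
  by rewrite lerD2r.
have pE s : wealth_path s w = x * expR (r * (s - t)) + drift_gain s + brownian_gain1 s w
    + brownian_gain2 s w - claim_loss s w by rewrite /wealth_path (mulrC _ x).
have j1 : L1 leb `[t, u] (fun s => x * expR (r * (s - t)) + drift_gain s).
  exact: integrable_realD.
have j2 : L1 leb `[t, u] (fun s => x * expR (r * (s - t)) + drift_gain s + brownian_gain1 s w).
  exact: integrable_realD.
have j3 : L1 leb `[t, u] (fun s => x * expR (r * (s - t)) + drift_gain s
    + brownian_gain1 s w + brownian_gain2 s w).
  exact: integrable_realD.
have j4 : L1 leb `[t, u] (fun s => x * expR (r * (s - t)) + drift_gain s
    + brownian_gain1 s w + brownian_gain2 s w - claim_loss s w).
  exact: integrable_realB.
split; first by apply: eq_integrable j4 => // s _; rewrite /= pE.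
have -> : \int[leb]_(s in `[t, u]) wealth_path s w = \int[leb]_(s in `[t, u])
    (x * expR (r * (s - t)) + drift_gain s + brownian_gain1 s w + brownian_gain2 s w - claim_loss s w).
  by apply: eq_Rintegral => s _; rewrite pE.
rewrite (RintegralB _ j3)// (RintegralD _ j2)// (RintegralD _ j1)// (RintegralD _ i0)//.
have ix : L1 leb `[t, u] (fun s => expR (r * (s - t))).
  apply: (@bounded_integrable_itv _ _ (expR (r * (u - t)))).
    by apply: measurable_funTS; apply: measurableT_comp => //; apply: measurable_funM => //; exact: measurable_funB.
  move=> s /andP[_ su]; rewrite ger0_norm ?expR_ge0// ler_expR ler_wpM2l ?(ltW (rate_gt0 hM))//.
  by rewrite lerD2r.
rewrite RintegralZl// (integral_expR_affine (rate_gt0 hM) tu).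
have E1' : brownian_gain1 u w = I1 u w + r * \int[leb]_(s in `[t, u]) brownian_gain1 s w := E1.
have E2' : brownian_gain2 u w = I2 u w + r * \int[leb]_(s in `[t, u]) brownian_gain2 s w := E2.
have E4' : drift_gain u = \int[leb]_(s in `[t, u]) trade_drift s + r * \int[leb]_(s in `[t, u]) drift_gain s := E4.
rewrite pE E1' E2' E3 E4'.
move: (\int[leb]_(s in `[t, u]) brownian_gain1 s w) (\int[leb]_(s in `[t, u]) brownian_gain2 s w)
  (\int[leb]_(s in `[t, u]) trade_drift s) (\int[leb]_(s in `[t, u]) drift_gain s)
  (\int[leb]_(s in `[t, u]) claim_loss s w) (I1 u w) (I2 u w) (claim_sum u w) (expR (r * (u - t))) => z1 z2 z3 z4 z5 z6 z7 z8 z9.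
by field; rewrite gt_eqF// rate_gt0.
Qed.

Lemma wealth_path_solution : wealth_solution M pi t x true wealth_path.
Proof.
split; first exact: wealth_path_Gmeasurable.
exists I1, I2; split.
- by apply: ito_congr itoI1 => s w sT; exact: a1E.
- by apply: ito_congr itoI2 => s w sT; exact: a2E.
apply: filterS2 path_growth claim_finite => w pg cf.
have TT : t <= T <= T by rewrite tT lexx.
have [iX _] := pg T TT.
split.
- have h : L1 leb `[t, T] (fun s => r * wealth_path s w + (trade_drift s - rk s * mean_claim M)).
    by apply: integrable_realD => //; exact: integrable_realZ.
  apply: eq_integrable h => // s; rewrite inE/= in_itv/= => sT.
  by congr (_%:E); exact/esym/driftE.
- apply: eq_integrable risk_integrable => // s; rewrite inE/= in_itv/= => sT.
  by congr (_%:E); rewrite (cE _ w sT).2.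
- have h : L1 leb `[t, T] (fun=> 0 : R).
    by apply: (@bounded_integrable_itv _ _ 0) => // s _; rewrite normr0.
  by apply: eq_integrable h => // s _; congr (_%:E); exact/esym/compE.
- apply/integrableP; split.
    have mcl : measurable_fun (jump_domain t T) (fun q => (claim q)%:E).
      by apply: measurable_funTS; exact/measurable_EFinP.
    apply: eq_measurable_fun mcl => q; rewrite inE => qD.
    by congr (_%:E); exact/esym/(claimE _ _ (lexx T) qD).
  move: cf; apply: le_lt_trans; apply: eqW.
  apply: eq_integral => q; rewrite inE => qD.
  by rewrite (claimE wealth_path w (lexx T) qD) gee0_abs// lee_fin.
move=> u tuT; have /andP[tu uT] := tuT; have [iu E] := pg u tuT.
rewrite -[RHS]/(rhs wealth_path I1 I2 u w) rhsE// E.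
have irX : L1 leb `[t, u] (fun s => r * wealth_path s w) by exact: integrable_realZ.
have sub : `[t, u] `<=` `[t, T] by apply: subset_itv; rewrite bnd_simp.
have it : L1 leb `[t, u] trade_drift by exact: integrableS trade_drift_integrable.
have iRu : L1 leb `[t, u] (fun s => trade_drift s - rk s * mean_claim M).
  exact: integrableS iRd.
have irmu := irm uT.
have -> : \int[leb]_(s in `[t, u]) (r * wealth_path s w + (trade_drift s - rk s * mean_claim M)) =
    r * \int[leb]_(s in `[t, u]) wealth_path s w +
    (\int[leb]_(s in `[t, u]) trade_drift s - \int[leb]_(s in `[t, u]) (rk s * mean_claim M)).
  by rewrite -RintegralZl// -RintegralB// -RintegralD.
move: (\int[leb]_(s in `[t, u]) wealth_path s w) (\int[leb]_(s in `[t, u]) trade_drift s)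
  (\int[leb]_(s in `[t, u]) (rk s * mean_claim M)) (I1 u w) (I2 u w) (claim_sum u w) => z1 z2 z3 z4 z5 z6.
by ring.
Qed.

(** Both solutions are driven by the same Ito integrals and the same jumps, so their difference
    solves [D u = r] times the integral of [D], which forces 0. *)
Lemma wealth_solution_unique X Y : wealth_solution M pi t x true X ->
  wealth_solution M pi t x true Y -> {ae P, forall w, forall u, t <= u <= T -> X u w = Y u w}.
Proof.
move=> [_ [J1 [J2 [iX1 iX2 aeX]]]] [_ [K1 [K2 [iY1 iY2 aeY]]]].
have cX1 : ito M (W1 M) t (fun s _ => a1 s) J1.
  by apply: ito_congr iX1 => s w sT; exact/esym/a1E.
have cY1 : ito M (W1 M) t (fun s _ => a1 s) K1.
  by apply: ito_congr iY1 => s w sT; exact/esym/a1E.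
have cX2 : ito M (W2 M) t (fun s _ => a2 s) J2.
  by apply: ito_congr iX2 => s w sT; exact/esym/a2E.
have cY2 : ito M (W2 M) t (fun s _ => a2 s) K2.
  by apply: ito_congr iY2 => s w sT; exact/esym/a2E.
have JL1 : {ae P, forall w, forall u, t <= u <= T -> J1 u w = K1 u w}.
  have [_ _ c1 _] := cX1; have [_ _ c2 _] := cY1.
  apply: (ae_eq_within_continuous tT c1 c2) => u tuT.
  exact: (ito_unique_at hM t0 tT (mexposure _ _) hW1 tuT cX1 cY1).
have JL2 : {ae P, forall w, forall u, t <= u <= T -> J2 u w = K2 u w}.
  have [_ _ c1 _] := cX2; have [_ _ c2 _] := cY2.
  apply: (ae_eq_within_continuous tT c1 c2) => u tuT.
  exact: (ito_unique_at hM t0 tT (mexposure _ _) hW2 tuT cX2 cY2).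
have aeXY : {ae P, forall w, forall u, t <= u <= T -> J1 u w = K1 u w /\ J2 u w = K2 u w}.
  by apply: filterS2 JL1 JL2 => w h1 h2 u tuT; rewrite h1// h2.
apply: filterS3 aeX aeY aeXY => w [dX _ _ _ EX] [dY _ _ _ EY] JL u tuT.
have r_gt0 := rate_gt0 hM.
have iD' X' : L1 leb `[t, T] (drift X' ^~ w) ->
    L1 leb `[t, T] (fun s => r * X' s w + (trade_drift s - rk s * mean_claim M)).
  move=> h; apply: eq_integrable h => // s; rewrite inE/= in_itv/= => sT.
  by congr (_%:E); exact: driftE.
have iX := iD' X dX; have iY := iD' Y dY.
have iXY : L1 leb `[t, T] (fun s => X s w - Y s w).
  have h : L1 leb `[t, T] (fun s => r^-1 * (r * X s w + (trade_drift s - rk s * mean_claim M)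
      - (r * Y s w + (trade_drift s - rk s * mean_claim M)))).
    by apply: integrable_realZ => //; exact: integrable_realB.
  apply: eq_integrable h => // s _; congr (_%:E).
  by field; rewrite gt_eqF.
suff : X u w - Y u w = 0 by move/eqP; rewrite subr_eq0 => /eqP.
apply: (linear_ode_zero r_gt0 tT iXY _ tuT) => {}u {}tuT; have /andP[tu uT] := tuT.
have EX' : X u w = rhs X J1 J2 u w := EX u tuT.
have EY' : Y u w = rhs Y K1 K2 u w := EY u tuT.
have [j1 j2] := JL u tuT.
rewrite EX' EY' !rhsE// j1 j2.
have sub : `[t, u] `<=` `[t, T] by apply: subset_itv; rewrite bnd_simp.
have iXu : L1 leb `[t, u] (fun s => r * X s w + (trade_drift s - rk s * mean_claim M)).
  exact: integrableS iX.
have iYu : L1 leb `[t, u] (fun s => r * Y s w + (trade_drift s - rk s * mean_claim M)).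
  exact: integrableS iY.
have iXYu : L1 leb `[t, u] (fun s => X s w - Y s w) by exact: integrableS iXY.
rewrite -RintegralZl//.
have -> : \int[leb]_(s in `[t, u]) (r * (X s w - Y s w)) =
    \int[leb]_(s in `[t, u]) (r * X s w + (trade_drift s - rk s * mean_claim M)) -
    \int[leb]_(s in `[t, u]) (r * Y s w + (trade_drift s - rk s * mean_claim M)).
  by rewrite -RintegralB//; apply: eq_Rintegral => s _; ring.
move: (\int[leb]_(s in `[t, u]) (r * X s w + _)) (\int[leb]_(s in `[t, u]) (r * Y s w + _))
  (K1 u w) (K2 u w) (claim_sum u w) (\int[leb]_(s in `[t, u]) (rk s * mean_claim M)) => z1 z2 z3 z4 z5 z6.
by ring.
Qed.

Lemma unique_strong_solution_path : unique_strong_solution M pi t x true.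
Proof. by split; [exists wealth_path; exact: wealth_path_solution|exact: wealth_solution_unique]. Qed.

Lemma wealth_is_solution : wealth_solution M pi t x true (wealth M pi t x true).
Proof.
rewrite /wealth; apply: (@xgetPex _ (fun _ _ => 0) [set X | wealth_solution M pi t x true X]).
by exists wealth_path; exact: wealth_path_solution.
Qed.

(** [wealth] is a solution picked by choice; uniqueness ties it to the explicit path. *)
Lemma wealth_terminal : {ae P, forall w, wealth M pi t x true T w = wealth_path T w}.
Proof.
have := wealth_solution_unique wealth_is_solution wealth_path_solution.
by apply: filterS => w; apply; rewrite tT lexx.
Qed.

Lemma wealth_terminal_measurable : Tmeasurable (wealth M pi t x true T).
Proof.
have [GX _] := wealth_is_solution.
by apply: (Gmeasurable_measurable hM (le_trans t0 tT)); apply: GX; rewrite tT lexx.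
Qed.

Definition volatility (a b s : R) : R := accr p s * (a + st s * b).

Definition terminal_claim (q : R * R) : R := accr p q.1 * claim q.

Lemma terminal_claim_ge0 q : 0 <= terminal_claim q.
Proof. by rewrite !mulr_ge0// expR_ge0. Qed.

Lemma terminal_claim_measurable : Tmeasurable terminal_claim.
Proof.
apply: measurable_funM; last exact: mclaim.
exact: (measurableT_comp (accr_measurable M) measurable_fst).
Qed.

Hypothesis mod_rk : moderate M t rk.

Notation D := (jump_domain t T).

Section fixed_distortion.
Variable phi : distortion R.
Hypothesis Tphi : Theta M phi.
Let Q := priorC M phi t true.

Let hQ : noise_from M Q t phi. Proof. exact: noise_from_priorC. Qed.
Let PQ (S : set Omega) : {ae P, forall w, S w} -> {ae Q, forall w, S w}.
Proof. exact: priorC_ae. Qed.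

Let mphi1 : measurable_fun `[0, T] (phi1 phi). Proof. by case: Tphi. Qed.
Let mphi2 : measurable_fun `[0, T] (phi2 phi). Proof. by case: Tphi. Qed.
Let T0 : 0 <= (0 : R) <= T. Proof. by rewrite lexx (le_trans t0 tT). Qed.
Let tT0 : 0 <= t <= T. Proof. by rewrite t0. Qed.
Let iphi1 : L1 leb `[0, T] (phi1 phi).
Proof. by apply: sqr_integrable_itv => //; exact: (Theta_sqr_integrable Tphi T0).1. Qed.
Let iphi2 : L1 leb `[0, T] (phi2 phi).
Proof. by apply: sqr_integrable_itv => //; exact: (Theta_sqr_integrable Tphi T0).2. Qed.

Let sw (a b : R) (W : R -> Omega -> R) (ph : R -> R) := shifted_wiener M t c
  (weighted_jump M c (exposure a b S1) (exposure a b S2) T)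
  (weighted_coef M c (exposure a b S1) (exposure a b S2) T)
  (weighted_slope M t c (exposure a b S1) (exposure a b S2) (exposure_slope b dS1) (exposure_slope b dS2) T)
  W ph.

Let smooth a b : exists C, step_smooth t T c
  (weighted_jump M c (exposure a b S1) (exposure a b S2) T) C
  (weighted_coef M c (exposure a b S1) (exposure a b S2) T)
  (weighted_slope M t c (exposure a b S1) (exposure a b S2) (exposure_slope b dS1) (exposure_slope b dS2) T).
Proof.
exact: (@weighted_step_smooth _ _ _ M t c _ _ _ _ tT tcT (exposure_derive a b D1) (exposure_derive a b D2)
  (exposure_slope_continuous (b:=b) C1) (exposure_slope_continuous (b:=b) C2) T).
Qed.

Lemma volatilityE a b s :
  weighted_coef M c (exposure a b S1) (exposure a b S2) T s = volatility a b s.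
Proof. by rewrite weighted_coefE /volatility /piece /exposure; case: ifP. Qed.

Lemma volatility_bounded a b : exists2 K, measurable_fun `[t, T] (volatility a b) &
  forall s, t <= s <= T -> `|volatility a b s| <= K.
Proof.
have [C sC] := smooth a b.
have E : weighted_coef M c (exposure a b S1) (exposure a b S2) T = volatility a b.
  by apply/funext => s; exact: volatilityE.
rewrite -E; eexists; first exact: step_smooth_measurable tT sC.
by move=> s sT; apply: (step_smooth_le sC sT).
Qed.

Let A := sw (sigma1 p) b1 (W1 M) (phi1 phi).
Let B := sw 0 b2 (W2 M) (phi2 phi).
Let Z := jump_sum M t terminal_claim.

(** The Wiener integrals are rewritten against the Brownian motions under [Q], so that [A] and [B]
    are centred there; the drift corrections move into the constant. *)
Let path_terminal w : wealth_path T w =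
  (accr p t * x + \int[leb]_(s in `[t, T]) (accr p s * trade_drift s)
   - \int[leb]_(s in `[t, T]) (volatility (sigma1 p) b1 s * phi1 phi s)
   - \int[leb]_(s in `[t, T]) (volatility 0 b2 s * phi2 phi s)) + A w + B w - Z w.
Proof.
rewrite /wealth_path /A /B /sw /shifted_wiener.
rewrite (_ : brownian_gain1 _ _ = wiener t c
  (weighted_jump M c (e1 S1) (e1 S2) T) (weighted_coef M c (e1 S1) (e1 S2) T)
  (weighted_slope M t c (e1 S1) (e1 S2) (exposure_slope b1 dS1) (exposure_slope b1 dS2) T) (W1 M) T w); last first.
  exact: growth_integral_terminal.
rewrite (_ : brownian_gain2 _ _ = wiener t c
  (weighted_jump M c (e2 S1) (e2 S2) T) (weighted_coef M c (e2 S1) (e2 S2) T)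
  (weighted_slope M t c (e2 S1) (e2 S2) (exposure_slope b2 dS1) (exposure_slope b2 dS2) T) (W2 M) T w); last first.
  exact: growth_integral_terminal.
have E a b (ph : R -> R) : \int[leb]_(s in `[t, T])
    (weighted_coef M c (exposure a b S1) (exposure a b S2) T s * ph s) =
    \int[leb]_(s in `[t, T]) (volatility a b s * ph s).
  by apply: eq_Rintegral => s _; rewrite volatilityE.
rewrite !E.
have -> : claim_loss T w = Z w by [].
have -> : drift_gain T = \int[leb]_(s in `[t, T]) (accr p s * trade_drift s) by [].
have -> : expR (r * (T - t)) = accr p t by [].
move: (wiener _ _ _ _ _ (W1 M) T w) (wiener _ _ _ _ _ (W2 M) T w) (Z w) => z1 z2 z3.
move: (\int[leb]_(s in `[t, T]) (accr p s * _)) (\int[leb]_(s in `[t, T]) (volatility (sigma1 p) b1 s * _))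
  (\int[leb]_(s in `[t, T]) (volatility 0 b2 s * _)) => z4 z5 z6.
by ring.
Qed.

Lemma tilted_claims_finite : (\int[ell]_(q in D) ((terminal_claim q)%:E * (tilt_density phi t T q)%:E) < +oo)%E.
Proof.
apply: (moderate_finite hM Tphi t0 tT mod_rk rk0 terminal_claim_measurable terminal_claim_ge0).
exists (accr p 0) => q [/= + _]; rewrite in_itv/= => /andP[tq qT].
have /andP[_ h] : 1 <= accr p q.1 <= accr p 0 by apply: (accr_bounds hM); rewrite qT (le_trans t0 (ltW tq)).
have k0 : 0 <= rk q.1 * `|q.2| by rewrite mulr_ge0.
rewrite /terminal_claim /claim; apply: (le_trans (ler_wpM2r k0 h)).
by rewrite ler_wpM2l ?expR_ge0// lerDl sqr_ge0.
Qed.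

Lemma tilted_sqr_claims_finite :
  (\int[ell]_(q in D) ((terminal_claim q ^+ 2)%:E * (tilt_density phi t T q)%:E) < +oo)%E.
Proof.
apply: (moderate_finite hM Tphi t0 tT mod_rk rk0 (F := fun q => terminal_claim q ^+ 2)).
- exact: (measurable_funX 2 terminal_claim_measurable).
- by move=> q; exact: sqr_ge0.
exists (accr p 0 ^+ 2) => q [/= + _]; rewrite in_itv/= => /andP[tq qT].
have /andP[h1 h] : 1 <= accr p q.1 <= accr p 0 by apply: (accr_bounds hM); rewrite qT (le_trans t0 (ltW tq)).
have k0 : 0 <= rk q.1 * `|q.2| by rewrite mulr_ge0.
rewrite /terminal_claim /claim exprMn.
apply: (@le_trans _ _ (accr p 0 ^+ 2 * (rk q.1 * `|q.2|) ^+ 2)).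
  by rewrite ler_wpM2r ?sqr_ge0// lerXn2r ?nnegrE ?expR_ge0.
by rewrite ler_wpM2l ?sqr_ge0// lerDr.
Qed.

Definition claim_mean := fine (\int[ell]_(q in D) ((terminal_claim q)%:E * (tilt_density phi t T q)%:E))%E.
Definition claim_sqr_mean :=
  fine (\int[ell]_(q in D) ((terminal_claim q ^+ 2)%:E * (tilt_density phi t T q)%:E))%E.

Let meanE : (\int[ell]_(q in D) ((terminal_claim q)%:E * (tilt_density phi t T q)%:E) = claim_mean%:E)%E.
Proof.
rewrite fineK// ge0_fin_numE ?tilted_claims_finite//; apply: integral_ge0 => q _.
by rewrite -EFinM lee_fin mulr_ge0 ?terminal_claim_ge0// (tilt_density_ge0 Tphi t0).
Qed.

Let sqrE : (\int[ell]_(q in D) ((terminal_claim q ^+ 2)%:E * (tilt_density phi t T q)%:E) = claim_sqr_mean%:E)%E.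
Proof.
rewrite fineK// ge0_fin_numE ?tilted_sqr_claims_finite//; apply: integral_ge0 => q _.
by rewrite -EFinM lee_fin mulr_ge0 ?sqr_ge0// (tilt_density_ge0 Tphi t0).
Qed.

Let mZ : Tmeasurable Z.
Proof.
exact: (jump_sum_measurable hM t0 terminal_claim_ge0 terminal_claim_measurable).
Qed.

Let EZ : (\int[Q]_w (Z w)%:E = claim_mean%:E)%E.
Proof.
rewrite -meanE.
exact: (jump_sum_mean hM Tphi t0 tT hQ terminal_claim_ge0 terminal_claim_measurable tilted_claims_finite).
Qed.

Let EZ2 : (\int[Q]_w (Z w ^+ 2)%:E = (claim_sqr_mean + claim_mean ^+ 2)%:E)%E.
Proof.
have := jump_sum_sqr hM Tphi t0 tT hQ terminal_claim_ge0 terminal_claim_measurable tilted_claims_finite.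
by rewrite /intensity/= sqrE meanE -EFinM -EFinD.
Qed.

Let iZ : L1 Q setT (fun w => Z w ^+ 2).
Proof.
apply: ge0_integrable_real => //; first exact: measurable_funX.
by move=> w _; exact: sqr_ge0.
by rewrite EZ2 ltry.
Qed.

Let hB1 : brownian_from M Q t (shifted M (W1 M) (phi1 phi)).
Proof. exact: brownian_from_noise1 hQ. Qed.

Let hB2 : brownian_from M Q t (shifted M (W2 M) (phi2 phi)).
Proof. exact: brownian_from_noise2 hQ. Qed.

Let iphi12 := (Theta_sqr_integrable Tphi tT0).1.
Let iphi22 := (Theta_sqr_integrable Tphi tT0).2.

Let mA : Tmeasurable A.
Proof.
have [C sC] := smooth (sigma1 p) b1.
exact: (shifted_wiener_measurable hM t0 tT sC hW1 cW1).
Qed.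
Let mB : Tmeasurable B.
Proof.
have [C sC] := smooth 0 b2.
exact: (shifted_wiener_measurable hM t0 tT sC hW2 cW2).
Qed.

Let iA : L1 Q setT (fun w => A w ^+ 2).
Proof.
have [C sC] := smooth (sigma1 p) b1.
exact: (shifted_wiener_sqr_integrable hM t0 tT sC hW1 cW1 hB1 PQ mphi1 iphi1 iphi12).
Qed.
Let iB : L1 Q setT (fun w => B w ^+ 2).
Proof.
have [C sC] := smooth 0 b2.
exact: (shifted_wiener_sqr_integrable hM t0 tT sC hW2 cW2 hB2 PQ mphi2 iphi2 iphi22).
Qed.

Let EA : \int[Q]_w A w = 0.
Proof.
have [C sC] := smooth (sigma1 p) b1.
exact: (shifted_wiener_expectation hM t0 tT sC hW1 cW1 hB1 PQ mphi1 iphi1 iphi12).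
Qed.
Let EB : \int[Q]_w B w = 0.
Proof.
have [C sC] := smooth 0 b2.
exact: (shifted_wiener_expectation hM t0 tT sC hW2 cW2 hB2 PQ mphi2 iphi2 iphi22).
Qed.

Let EA2 : \int[Q]_w (A w ^+ 2) = \int[leb]_(s in `[t, T]) (volatility (sigma1 p) b1 s ^+ 2).
Proof.
have [C sC] := smooth (sigma1 p) b1.
rewrite (shifted_wiener_sqr hM t0 tT sC hW1 cW1 hB1 PQ mphi1 iphi1 iphi12).
by apply: eq_Rintegral => s _; rewrite volatilityE.
Qed.
Let EB2 : \int[Q]_w (B w ^+ 2) = \int[leb]_(s in `[t, T]) (volatility 0 b2 s ^+ 2).
Proof.
have [C sC] := smooth 0 b2.
rewrite (shifted_wiener_sqr hM t0 tT sC hW2 cW2 hB2 PQ mphi2 iphi2 iphi22).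
by apply: eq_Rintegral => s _; rewrite volatilityE.
Qed.

Let A_increments : exists2 Z1 : Omega -> R,
  (forall E : set R, measurable E -> increments t (W1 M) (Z1 @^-1` E)) & {ae Q, forall w, Z1 w = A w}.
Proof.
have [C sC] := smooth (sigma1 p) b1.
exact: (shifted_wiener_increments t0 tT sC cW1 PQ mphi1 iphi1 iphi12).
Qed.

Let B_increments : exists2 Z2 : Omega -> R,
  (forall E : set R, measurable E -> increments t (W2 M) (Z2 @^-1` E)) & {ae Q, forall w, Z2 w = B w}.
Proof.
have [C sC] := smooth 0 b2.
exact: (shifted_wiener_increments t0 tT sC cW2 PQ mphi2 iphi2 iphi22).
Qed.

Let Z_after (E : set R) : measurable E -> jumps_after M t (Z @^-1` E).
Proof.
apply: (@jump_integral_jumps_after _ _ _ M t T (fun q => (terminal_claim q)%:E)).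
  by move=> q; rewrite lee_fin terminal_claim_ge0.
by apply/measurable_EFinP; exact: terminal_claim_measurable.
Qed.

Let tripleE (E1 E2 E3 : set Omega) : increments t (W1 M) E1 -> increments t (W2 M) E2 ->
  jumps_after M t E3 -> Q (E1 `&` E2 `&` E3) = (Q E1 * Q E2 * Q E3)%E.
Proof.
move=> h1 h2 h3; have [_ _ _ _ ind] := hQ.
have := ind t setT E1 E2 E3 (lexx t) (@filtG_setT _ _ _ M t) h1 h2 h3.
by rewrite setTI probability_setT mul1e.
Qed.

(** Only versions [Y1], [Y2] are known to be independent; the mean of the product transfers because
    the variables agree almost surely. *)
Let ae_indep_mean (X1 X2 Y1 Y2 : Omega -> R) : {ae Q, forall w, Y1 w = X1 w} -> {ae Q, forall w, Y2 w = X2 w} ->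
  Tmeasurable X1 -> Tmeasurable X2 ->
  Tmeasurable Y1 -> Tmeasurable Y2 ->
  L1 Q setT X1 -> L1 Q setT X2 ->
  (forall E1 E2, measurable E1 -> measurable E2 ->
    Q (Y1 @^-1` E1 `&` Y2 @^-1` E2) = (Q (Y1 @^-1` E1) * Q (Y2 @^-1` E2))%E) ->
  \int[Q]_w X1 w = 0 -> \int[Q]_w (X1 w * X2 w) = 0.
Proof.
move=> e1 e2 m1 m2 n1 n2 i1 i2 ind E0.
have aeI (f g : Omega -> R) : {ae Q, forall w, f w = g w} -> Tmeasurable f ->
    Tmeasurable g -> \int[Q]_w f w = \int[Q]_w g w.
  move=> fg mf mg; rewrite /Rintegral; congr fine; apply: ae_eq_integral => //.
  - exact/measurable_EFinP.
  - exact/measurable_EFinP.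
  - by apply: filterS fg => w -> _.
have aei (f g : Omega -> R) : {ae Q, forall w, f w = g w} -> Tmeasurable f ->
    L1 Q setT g -> L1 Q setT f.
  move=> fg mf /integrableP[mg ig]; apply/integrableP; split; first exact/measurable_EFinP.
  apply: le_lt_trans ig; apply: eqW; apply: ae_eq_integral => //.
  - by apply: measurableT_comp => //; exact/measurable_EFinP.
  - exact: measurableT_comp.
  - by apply: filterS fg => w /= -> _.
rewrite -(aeI (fun w => Y1 w * Y2 w)); first last.
- exact: measurable_funM.
- exact: measurable_funM.
- by apply: filterS2 e1 e2 => w -> ->.
rewrite (Rintegral_indepM n1 n2 ind (aei _ _ e1 n1 i1) (aei _ _ e2 n2 i2)).
by rewrite (aeI _ _ e1 n1 m1) E0 mul0r.
Qed.

Let inc_meas (W : R -> Omega -> R) (Y : Omega -> R) : (forall u, t <= u -> Tmeasurable (W u)) ->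
  (forall E : set R, measurable E -> increments t W (Y @^-1` E)) -> Tmeasurable Y.
Proof.
move=> mW iY _ E mE; rewrite setTI; apply: (smallest_sub _ _ (iY E mE)).
  exact: sigma_algebra_measurable.
move=> S [u /=]; rewrite in_itv/= andbT => tu [F mF <-].
by apply: measurable_funB => //; apply: mW.
Qed.

Let mW1 u : t <= u -> Tmeasurable (W1 M u).
Proof. by move=> tu; have [h _ _ _] := brownian_P1 hM; apply: h; exact: le_trans tu. Qed.
Let mW2 u : t <= u -> Tmeasurable (W2 M u).
Proof. by move=> tu; have [h _ _ _] := brownian_P2 hM; apply: h; exact: le_trans tu. Qed.

Let AB : \int[Q]_w (A w * B w) = 0.
Proof.
have [Y1 h1 YA] := A_increments; have [Y2 h2 YB] := B_increments.
apply: (ae_indep_mean YA YB mA mB (inc_meas mW1 h1) (inc_meas mW2 h2)) => //.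
- exact: integrable_of_sqr.
- exact: integrable_of_sqr.
move=> E1 E2 mE1 mE2; have := tripleE (h1 _ mE1) (h2 _ mE2) (@sigma_setT _ _).
by rewrite setIT probability_setT mule1.
Qed.

Let AZ : \int[Q]_w (A w * Z w) = 0.
Proof.
have [Y1 h1 YA] := A_increments.
apply: (ae_indep_mean YA _ mA mZ (inc_meas mW1 h1) mZ) => //.
- exact: aeW.
- exact: integrable_of_sqr.
- exact: integrable_of_sqr.
move=> E1 E2 mE1 mE2; have := tripleE (h1 _ mE1) (@sigma_setT _ _) (Z_after mE2).
by rewrite setIT probability_setT mule1.
Qed.

Let BZ : \int[Q]_w (B w * Z w) = 0.
Proof.
have [Y2 h2 YB] := B_increments.
apply: (ae_indep_mean YB _ mB mZ (inc_meas mW2 h2) mZ) => //.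
- exact: aeW.
- exact: integrable_of_sqr.
- exact: integrable_of_sqr.
move=> E1 E2 mE1 mE2; have := tripleE (@sigma_setT _ _) (h2 _ mE1) (Z_after mE2).
by rewrite setTI probability_setT mul1e.
Qed.

(** [A], [B] and [Z] are pairwise uncorrelated. Campbell's formulas make the variance of the claims
    equal to [claim_sqr_mean], the square of the mean cancelling. *)
Lemma mean_varianceE : mean_variance M pi phi t x true =
  (accr p t * x + \int[leb]_(s in `[t, T]) (accr p s * trade_drift s)
   - \int[leb]_(s in `[t, T]) (volatility (sigma1 p) b1 s * phi1 phi s)
   - \int[leb]_(s in `[t, T]) (volatility 0 b2 s * phi2 phi s)
   - gamma p / 2 * (\int[leb]_(s in `[t, T]) (volatility (sigma1 p) b1 s ^+ 2)
       + \int[leb]_(s in `[t, T]) (volatility 0 b2 s ^+ 2))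
   - (claim_mean + gamma p / 2 * claim_sqr_mean))%:E.
Proof.
have XE := PQ wealth_terminal.
have mX := wealth_terminal_measurable.
have {}XE : {ae Q, forall w, wealth M pi t x true T w =
    (accr p t * x + \int[leb]_(s in `[t, T]) (accr p s * trade_drift s)
   - \int[leb]_(s in `[t, T]) (volatility (sigma1 p) b1 s * phi1 phi s)
   - \int[leb]_(s in `[t, T]) (volatility 0 b2 s * phi2 phi s)) + A w + B w - Z w}.
  by apply: filterS XE => w ->; exact: path_terminal.
rewrite /mean_variance -/Q (uncorrelated_expectation mA mB mZ mX iA iB iZ EA EB XE).
rewrite (uncorrelated_variance mA mB mZ mX iA iB iZ EA EB AB AZ BZ XE).
have -> : \int[Q]_w Z w = claim_mean by rewrite /Rintegral EZ.
have -> : \int[Q]_w (Z w ^+ 2) = claim_sqr_mean + claim_mean ^+ 2 by rewrite /Rintegral EZ2.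
by rewrite EA2 EB2 -EFinM -EFinB; congr (_%:E); ring.
Qed.

End fixed_distortion.

Notation f1 := (volatility (sigma1 p) (sigma2 p * rho p)).
Notation f2 := (volatility 0 (sigma2 p * rhohat p)).
Notation F := (terminal_claim).

Definition jump_load (u : R * R) : R := F u + gamma p / 2 * F u ^+ 2.

Definition mean_variance_base : R :=
  accr p t * x + \int[leb]_(s in `[t, T]) (accr p s * trade_drift s)
   - gamma p / 2 * (\int[leb]_(s in `[t, T]) (f1 s ^+ 2) + \int[leb]_(s in `[t, T]) (f2 s ^+ 2)).

(* The contribution of a distortion to the objective: [sg = 1] for [Jlow], and,
   up to the overall sign, [sg = -1] for [Jup]. *)
Definition cost (sg : R) (phi : distortion R) : R :=
  \int[leb]_(s in `[t, T]) (phi1 phi s ^+ 2 / (2 * beta1 p) + phi2 phi s ^+ 2 / (2 * beta2 p)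
     - sg * (f1 s * phi1 phi s + f2 s * phi2 phi s)) +
  (beta3 p)^-1 * \int[ell]_(u in D) (cut_entropy M phi t u
     - sg * (beta3 p * jump_load u * tilt_density phi t T u)).

(** The pointwise minimum of the integrands of [cost], reached at [phi1 = sg * beta1 * f1],
    [phi2 = sg * beta2 * f2] and [phi3 = 1 - expR (sg * beta3 * jump_load)]. *)
Definition best_cost (sg : R) : R :=
  \int[leb]_(s in `[t, T]) (- (beta1 p * f1 s ^+ 2 + beta2 p * f2 s ^+ 2) / 2) +
  (beta3 p)^-1 * \int[ell]_(u in D) (1 - expR (sg * (beta3 p * jump_load u))).

Let b10 : 0 < beta1 p. Proof. by have [] := params_gt0 hM. Qed.
Let b20 : 0 < beta2 p. Proof. by have [] := params_gt0 hM. Qed.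
Let b30 : 0 < beta3 p. Proof. by have [] := params_gt0 hM. Qed.
Let g0 : 0 < gamma p. Proof. by have [] := params_gt0 hM. Qed.
Let mD : measurable D := jump_domain_measurable t T.

Lemma jump_load_ge0 u : 0 <= jump_load u.
Proof.
by rewrite addr_ge0 ?terminal_claim_ge0// mulr_ge0 ?sqr_ge0// divr_ge0// ltW.
Qed.

Lemma jump_load_measurable : Tmeasurable jump_load.
Proof.
have mF := terminal_claim_measurable.
by apply: measurable_funD => //; apply: measurable_funM => //; exact: (measurable_funX 2 mF).
Qed.

Let volb (a b : R) := volatility_bounded a b.

Lemma vol_sqr_integrable a b :
  L1 leb `[t, T] (fun s => volatility a b s ^+ 2).
Proof.
have [K mf fK] := volb a b; apply: (@bounded_integrable_itv _ _ (K ^+ 2)); first exact: measurable_funX.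
move=> s sT; rewrite normrX lerXn2r ?nnegrE ?fK//; exact: le_trans (fK s sT).
Qed.

Lemma base_integrable : L1 leb `[t, T] (fun s => accr p s * trade_drift s).
Proof.
have it := trade_drift_integrable.
have ih : L1 leb `[t, T] (fun s => accr p 0 * `|trade_drift s|).
  by apply: integrable_realZ => //; exact: integrable_norm.
have /integrableP[/measurable_EFinP mt _] := it.
apply: (@le_integrable _ _ _ leb _ _ _ (EFin \o (fun s => accr p 0 * `|trade_drift s|))) => //.
  apply/measurable_EFinP; apply: measurable_funM => //.
  by apply: measurable_funTS; exact: accr_measurable.
move=> s /=; rewrite in_itv/= => /andP[ts sT].
have /andP[h1 h2] : 1 <= accr p s <= accr p 0 by apply: (accr_bounds hM); rewrite sT (le_trans t0 ts).
rewrite lee_fin !normrM normr_id ler_wpM2r// !ger0_norm//; exact: expR_ge0.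
Qed.

Let ibest : L1 leb `[t, T] (fun s => - (beta1 p * f1 s ^+ 2 + beta2 p * f2 s ^+ 2) / 2).
Proof.
have j1 := vol_sqr_integrable (sigma1 p) (sigma2 p * rho p).
have j2 := vol_sqr_integrable 0 (sigma2 p * rhohat p).
have k1 : L1 leb `[t, T] (fun s => - beta1 p / 2 * f1 s ^+ 2) by exact: integrable_realZ.
have k2 : L1 leb `[t, T] (fun s => beta2 p / 2 * f2 s ^+ 2) by exact: integrable_realZ.
have k3 : L1 leb `[t, T] (fun s => - beta1 p / 2 * f1 s ^+ 2 - beta2 p / 2 * f2 s ^+ 2).
  exact: integrable_realB.
by apply: eq_integrable k3 => // s _; congr (_%:E); ring.
Qed.

Section one_distortion.
Variable phi : distortion R.
Hypothesis Tphi : Theta M phi.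

Let tT0 : 0 <= t <= T. Proof. by rewrite t0. Qed.
Let iphi12 := (Theta_sqr_integrable Tphi tT0).1.
Let iphi22 := (Theta_sqr_integrable Tphi tT0).2.
Let sub : `[t, T] `<=` `[0, T]. Proof. by apply: subset_itv; rewrite bnd_simp. Qed.
Let mphi1 : measurable_fun `[t, T] (phi1 phi). Proof. by apply: (measurable_funS _ sub) => //; case: Tphi. Qed.
Let mphi2 : measurable_fun `[t, T] (phi2 phi). Proof. by apply: (measurable_funS _ sub) => //; case: Tphi. Qed.

Let vol_mul_integrable a b (ph : R -> R) : measurable_fun `[t, T] ph ->
  L1 leb `[t, T] (fun s => ph s ^+ 2) ->
  L1 leb `[t, T] (fun s => volatility a b s * ph s).
Proof.
move=> mph iph; have [K mf _] := volb a b; have if2 := vol_sqr_integrable a b.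
apply: (@le_integrable _ _ _ leb _ _ _ (EFin \o (fun s => volatility a b s ^+ 2 + ph s ^+ 2))) => //.
- by apply/measurable_EFinP; exact: measurable_funM.
- move=> s _ /=; rewrite lee_fin normrM [leRHS]ger0_norm ?addr_ge0 ?sqr_ge0//.
  rewrite -(real_normK (num_real (volatility a b s))) -(real_normK (num_real (ph s))).
  move: (normr_ge0 (volatility a b s)) (normr_ge0 (ph s)).
  move: (`|volatility a b s|) (`|ph s|) => y z y0 z0.
  by have := sqr_ge0 (y - z); nra.
- exact: integrable_realD.
Qed.

Let i1 := vol_mul_integrable (sigma1 p) (sigma2 p * rho p) mphi1 iphi12.
Let i2 := vol_mul_integrable 0 (sigma2 p * rhohat p) mphi2 iphi22.

Let pen s := phi1 phi s ^+ 2 / (2 * beta1 p) + phi2 phi s ^+ 2 / (2 * beta2 p).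

Let ipen : L1 leb `[t, T] pen.
Proof.
have j1 : L1 leb `[t, T] (fun s => (2 * beta1 p)^-1 * phi1 phi s ^+ 2) by exact: integrable_realZ.
have j2 : L1 leb `[t, T] (fun s => (2 * beta2 p)^-1 * phi2 phi s ^+ 2) by exact: integrable_realZ.
have j3 : L1 leb `[t, T] (fun s => (2 * beta1 p)^-1 * phi1 phi s ^+ 2
   + (2 * beta2 p)^-1 * phi2 phi s ^+ 2) by exact: integrable_realD.
by apply: eq_integrable j3 => // s _; congr (_%:E); rewrite /pen; congr (_ + _); rewrite mulrC.
Qed.

Let mr : Tmeasurable (tilt_density phi t T) := tilt_density_measurable Tphi t0.
Let r0 u : 0 <= tilt_density phi t T u := tilt_density_ge0 Tphi t0 u.
Let mF : Tmeasurable F := terminal_claim_measurable.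

Lemma cut_entropy_integrable : L1 ell D (cut_entropy M phi t).
Proof.
apply: ge0_integrable_real => //.
- by apply: measurable_funTS; exact: (cut_entropy_measurable Tphi t0).
- by move=> u _; exact: (cut_entropy_ge0 Tphi t0).
- exact: (entropy_setX_finite Tphi t0 tT).
Qed.

Let iF1 : L1 ell D (fun u => F u * tilt_density phi t T u).
Proof.
apply: ge0_integrable_real => //.
- by apply: measurable_funTS; exact: measurable_funM.
- by move=> u _; rewrite mulr_ge0// terminal_claim_ge0.
- exact: (tilted_claims_finite Tphi).
Qed.

Let iF2 : L1 ell D (fun u => F u ^+ 2 * tilt_density phi t T u).
Proof.
apply: ge0_integrable_real => //.
- by apply: measurable_funTS; apply: measurable_funM => //; exact: (measurable_funX 2 mF).
- by move=> u _; rewrite mulr_ge0// sqr_ge0.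
- exact: (tilted_sqr_claims_finite Tphi).
Qed.

Let ijl : L1 ell D (fun u => jump_load u * tilt_density phi t T u).
Proof.
have j : L1 ell D (fun u => F u * tilt_density phi t T u +
   gamma p / 2 * (F u ^+ 2 * tilt_density phi t T u)).
  by apply: integrable_realD => //; exact: integrable_realZ.
by apply: eq_integrable j => // u _; congr (_%:E); rewrite /jump_load; ring.
Qed.

Let ijl3 sg : L1 ell D (fun u => sg * (beta3 p * jump_load u * tilt_density phi t T u)).
Proof.
have j : L1 ell D (fun u => sg * beta3 p * (jump_load u * tilt_density phi t T u)).
  exact: integrable_realZ.
by apply: eq_integrable j => // u _; congr (_%:E); ring.
Qed.

Let jl_split : \int[ell]_(u in D) (jump_load u * tilt_density phi t T u) =
  claim_mean phi + gamma p / 2 * claim_sqr_mean phi.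
Proof.
rewrite /claim_mean /claim_sqr_mean.
transitivity (\int[ell]_(u in D) (F u * tilt_density phi t T u) +
   gamma p / 2 * \int[ell]_(u in D) (F u ^+ 2 * tilt_density phi t T u)); last by [].
rewrite -(RintegralZl _ _ iF2)// -RintegralD//; last exact: integrable_realZ.
by apply: eq_Rintegral => u _; rewrite /jump_load; ring.
Qed.

Lemma cost_jump_integrable sg : L1 ell D (fun u => cut_entropy M phi t u
     - sg * (beta3 p * jump_load u * tilt_density phi t T u)).
Proof. by apply: integrable_realB => //; exact: cut_entropy_integrable. Qed.

Lemma cost_brownian_integrable sg : L1 leb `[t, T] (fun s => phi1 phi s ^+ 2 / (2 * beta1 p)
  + phi2 phi s ^+ 2 / (2 * beta2 p) - sg * (f1 s * phi1 phi s + f2 s * phi2 phi s)).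
Proof.
apply: (integrable_realB _ ipen) => //; apply: integrable_realZ => //; exact: integrable_realD.
Qed.

Lemma costE sg : cost sg phi = \int[leb]_(s in `[t, T]) pen s
  - sg * (\int[leb]_(s in `[t, T]) (f1 s * phi1 phi s) + \int[leb]_(s in `[t, T]) (f2 s * phi2 phi s))
  + (beta3 p)^-1 * \int[ell]_(u in D) cut_entropy M phi t u
  - sg * (claim_mean phi + gamma p / 2 * claim_sqr_mean phi).
Proof.
have i12 : L1 leb `[t, T] (fun s => f1 s * phi1 phi s + f2 s * phi2 phi s).
  exact: integrable_realD.
rewrite /cost (RintegralB _ ipen)//; last exact: integrable_realZ.
rewrite (RintegralZl _ _ i12)// (RintegralD _ i1)//.
rewrite -jl_split.
have -> : \int[ell]_(u in D) (cut_entropy M phi t u - sg * (beta3 p * jump_load u * tilt_density phi t T u)) =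
    \int[ell]_(u in D) cut_entropy M phi t u -
    \int[ell]_(u in D) (sg * (beta3 p * jump_load u * tilt_density phi t T u)).
  by rewrite -(RintegralB _ cut_entropy_integrable).
have -> : \int[ell]_(u in D) (sg * (beta3 p * jump_load u * tilt_density phi t T u)) =
    sg * beta3 p * \int[ell]_(u in D) (jump_load u * tilt_density phi t T u).
  by rewrite -(RintegralZl _ _ ijl)//; apply: eq_Rintegral => u _; ring.
move: (\int[ell]_(u in D) (jump_load u * _)) (\int[ell]_(u in D) cut_entropy M phi t u) => z1 z2.
by field; rewrite gt_eqF.
Qed.

(** The penalty, defined by iterated integrals, is put on the same product domain as the claims so
    that both combine under one integral in [cost]. *)
Lemma penalty_integral : (\int[leb]_(s in `[t, T]) penalty M phi s =
  (\int[leb]_(s in `[t, T]) pen s + (beta3 p)^-1 * \int[ell]_(u in D) cut_entropy M phi t u)%:E)%E.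
Proof.
have mE : Tmeasurable (fun u => (cut_entropy M phi t u)%:E).
  by apply/measurable_EFinP; exact: (cut_entropy_measurable Tphi t0).
have cE0 u : (0 <= (cut_entropy M phi t u)%:E)%E by rewrite lee_fin (cut_entropy_ge0 Tphi t0).
pose e s := (\int[v]_(z in `]0%R, +oo[) (cut_entropy M phi t (s, z))%:E)%E.
have me : Tmeasurable e.
  exact: (@measurable_integral_section _ v `]0%R, +oo[%classic _ (measurable_itv _) cE0 mE).
have e0 s : (0 <= e s)%E by apply: integral_ge0.
have eE s : s \in `]t, T]%classic -> penalty M phi s = ((pen s)%:E + (beta3 p)^-1%:E * e s)%E.
  move=> sT; rewrite /penalty; congr (_ + _ * _)%E; apply: eq_integral => z z0; rewrite /cut_entropy indicE mem_set ?mul1r//.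
  by split; [move: sT|move: z0]; rewrite inE.
have mpen : measurable_fun `[t, T] pen by have /integrableP[/measurable_EFinP] := ipen.
have subo : (`]t, T] : set R) `<=` `[t, T] by apply: subset_itv; rewrite bnd_simp.
have mpo : measurable_fun (`]t, T] : set R) (EFin \o pen).
  by apply/measurable_EFinP; apply: (measurable_funS _ subo) mpen.
have mpe : measurable_fun (`]t, T] : set R) (fun s => (pen s)%:E + (beta3 p)^-1%:E * e s)%E.
  by apply: emeasurable_funD => //; apply: measurable_funTS; exact: emeasurable_funM.
have pen0 s : 0 <= pen s by rewrite addr_ge0// divr_ge0 ?sqr_ge0// mulr_ge0// ltW.
rewrite -integral_itv_obnd_cbnd; last first.
  by apply: eq_measurable_fun mpe => s sT; rewrite eE.
transitivity (\int[leb]_(s in `]t, T]) ((pen s)%:E + (beta3 p)^-1%:E * e s))%E.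
  by apply: eq_integral => s sT; exact: eE.
rewrite ge0_integralD//; first last.
- by apply: measurable_funTS; exact: emeasurable_funM.
- by move=> s _; rewrite mule_ge0// lee_fin invr_ge0 ltW.
- by move=> s _; rewrite lee_fin.
rewrite ge0_integralZl_EFin//; first last.
- by rewrite invr_ge0 ltW.
- exact: measurable_funTS.
rewrite EFinD EFinM; congr (_ + _ * _)%E.
  by rewrite integral_itv_obnd_cbnd// /Rintegral fineK//; exact: integrable_fin_num.
have -> : ((\int[ell]_(u in D) cut_entropy M phi t u)%:E = \int[ell]_(u in D) (cut_entropy M phi t u)%:E)%E.
  by rewrite /Rintegral fineK// ge0_fin_numE; [exact: (entropy_setX_finite Tphi t0 tT)|exact: integral_ge0].
by rewrite (@integral_setX _ v _ _ _ (measurable_itv _) (measurable_itv _) cE0 mE).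
Qed.

Lemma JlowE : Jlow M pi phi t x true = (mean_variance_base + cost 1 phi)%:E.
Proof.
rewrite /Jlow penalty_integral costE /mean_variance_base.
rewrite (mean_varianceE Tphi).
by rewrite -EFinD; congr (_%:E); ring.
Qed.

Lemma JupE : Jup M pi phi t x true = (mean_variance_base - cost (-1) phi)%:E.
Proof.
rewrite /Jup penalty_integral costE /mean_variance_base.
rewrite (mean_varianceE Tphi).
by rewrite -EFinB; congr (_%:E); ring.
Qed.

(** The Brownian part is a sum of two squares over [2 * beta1] and [2 * beta2]; the jump part is
    Young's inequality. Integrability of the optimal integrand is a hypothesis because a real
    integral that diverges would be read as a default value. *)
Lemma best_cost_le sg : sg ^+ 2 = 1 ->
  L1 ell D (fun u => 1 - expR (sg * (beta3 p * jump_load u))) ->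
  best_cost sg <= cost sg phi.
Proof.
move=> sg1 ie; apply: lerD.
  apply: le_Rintegral => //; first exact: cost_brownian_integrable.
  move=> s _; set a := f1 s; set b := f2 s; set y := phi1 phi s; set z := phi2 phi s.
  rewrite -subr_ge0 [leRHS](_ : _ = (y - sg * beta1 p * a) ^+ 2 / (2 * beta1 p)
     + (z - sg * beta2 p * b) ^+ 2 / (2 * beta2 p)).
    by rewrite addr_ge0// divr_ge0 ?sqr_ge0// mulr_ge0// ltW.
  have E1 : (y - sg * beta1 p * a) ^+ 2 = y ^+ 2 - 2 * sg * beta1 p * a * y + sg ^+ 2 * beta1 p ^+ 2 * a ^+ 2 by ring.
  have E2 : (z - sg * beta2 p * b) ^+ 2 = z ^+ 2 - 2 * sg * beta2 p * b * z + sg ^+ 2 * beta2 p ^+ 2 * b ^+ 2 by ring.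
  by rewrite E1 E2 sg1; field; rewrite !gt_eqF.
rewrite ler_wpM2l ?invr_ge0 ?(ltW b30)//; apply: le_Rintegral => //; first exact: cost_jump_integrable.
move=> u uD; have := tilt_young Tphi t0 (sg * (beta3 p * jump_load u)) uD; lra.
Qed.

(** The exponent [l] is arbitrary, so that the same formula evaluates the optimal tilt and the
    capped one. *)
Lemma cost_tilted sg (l : R * R -> R) : sg ^+ 2 = 1 ->
  (forall s, t <= s <= T -> phi1 phi s = sg * beta1 p * f1 s) ->
  (forall s, t <= s <= T -> phi2 phi s = sg * beta2 p * f2 s) ->
  (forall u, D u -> phi3 phi u.1 u.2 = 1 - expR (l u)) ->
  cost sg phi = \int[leb]_(s in `[t, T]) (- (beta1 p * f1 s ^+ 2 + beta2 p * f2 s ^+ 2) / 2) +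
    (beta3 p)^-1 * \int[ell]_(u in D) (l u * expR (l u) + 1 - expR (l u)
      - sg * (beta3 p * jump_load u * expR (l u))) /\
  L1 ell D (fun u => l u * expR (l u) + 1 - expR (l u)
      - sg * (beta3 p * jump_load u * expR (l u))).
Proof.
move=> sg1 e1 e2 e3.
have E u : D u -> cut_entropy M phi t u - sg * (beta3 p * jump_load u * tilt_density phi t T u) =
    l u * expR (l u) + 1 - expR (l u) - sg * (beta3 p * jump_load u * expR (l u)).
  by move=> uD; rewrite /cut_entropy /tilt_density indicE mem_set// !mul1r e3// entropy_expR subKr.
split; last first.
  by apply: eq_integrable (cost_jump_integrable sg) => // u; rewrite inE => uD; congr (_%:E); exact: E.
congr (_ + _ * _).
  apply: eq_Rintegral => s; rewrite inE/= in_itv/= => sT; rewrite e1// e2//.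
  set a := f1 s; set b := f2 s.
  have -> : (sg * beta1 p * a) ^+ 2 = sg ^+ 2 * (beta1 p * a) ^+ 2 by ring.
  have -> : (sg * beta2 p * b) ^+ 2 = sg ^+ 2 * (beta2 p * b) ^+ 2 by ring.
  have -> : sg * (a * (sg * beta1 p * a) + b * (sg * beta2 p * b)) = sg ^+ 2 * (beta1 p * a ^+ 2 + beta2 p * b ^+ 2) by ring.
  by rewrite sg1; field; rewrite !gt_eqF.
by apply: eq_Rintegral => u; rewrite inE => uD; exact: E.
Qed.

(** At the optimal exponent the terms [l * expR l] cancel. Membership in [Theta] thus yields the
    integrability of the optimal integrand as a by-product. *)
Lemma cost_eq_best sg : sg ^+ 2 = 1 ->
  (forall s, t <= s <= T -> phi1 phi s = sg * beta1 p * f1 s) ->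
  (forall s, t <= s <= T -> phi2 phi s = sg * beta2 p * f2 s) ->
  (forall u, D u -> phi3 phi u.1 u.2 = 1 - expR (sg * (beta3 p * jump_load u))) ->
  cost sg phi = best_cost sg /\
  L1 ell D (fun u => 1 - expR (sg * (beta3 p * jump_load u))).
Proof.
move=> sg1 e1 e2 e3; have [-> i] := cost_tilted sg1 e1 e2 e3.
have E u : sg * (beta3 p * jump_load u) * expR (sg * (beta3 p * jump_load u)) + 1 -
    expR (sg * (beta3 p * jump_load u)) - sg * (beta3 p * jump_load u * expR (sg * (beta3 p * jump_load u))) =
    1 - expR (sg * (beta3 p * jump_load u)) by ring.
split; last by apply: eq_integrable i => // u _; congr (_%:E); exact: E.
by congr (_ + _ * _); apply: eq_Rintegral => u _; exact: E.
Qed.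

End one_distortion.

(** On the seeking side the exponent is negative and [1 - expR (- y) <= y], so the integrability of
    the load suffices and holds for every moderate retention. *)
Lemma seeking_integrable :
  L1 ell D (fun u => 1 - expR (-1 * (beta3 p * jump_load u))).
Proof.
have T0 := no_distortion_Theta M.
have mL := jump_load_measurable.
have i0 := cost_jump_integrable T0 (-1).
have ic := cut_entropy_integrable T0.
(* The load is recovered as the difference of two integrable functions, the jump integrand of [cost]
   for the trivial distortion and its entropy. *)
have ih : L1 ell D (fun u => beta3 p * jump_load u * tilt_density (no_distortion R) t T u).
  have j : L1 ell D (fun u => cut_entropy M (no_distortion R) t u
     - -1 * (beta3 p * jump_load u * tilt_density (no_distortion R) t T u) - cut_entropy M (no_distortion R) t u).
    exact: integrable_realB.
  by apply: eq_integrable j => // u _; congr (_%:E); ring.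
apply: (@le_integrable _ _ _ ell _ _ _ (EFin \o (fun u => beta3 p * jump_load u * tilt_density (no_distortion R) t T u))) => //.
  apply/measurable_EFinP; apply: measurable_funTS; apply: measurable_funB => //.
  apply: (measurableT_comp (@measurable_expR R)); apply: measurable_funM => //.
  exact: measurable_funM.
move=> u uD; rewrite lee_fin /tilt_density indicE mem_set//= subr0 mul1r mulr1 mulN1r.
have l0 : 0 <= beta3 p * jump_load u by rewrite mulr_ge0 ?jump_load_ge0// ltW.
have h1 := expR_ge1Dx (- (beta3 p * jump_load u)).
have h2 : expR (- (beta3 p * jump_load u)) <= 1 by rewrite -expR0 ler_expR lerNl oppr0.
by rewrite !ger0_norm//; lra.
Qed.

Definition premium_gain (s : R) : R := accr p s * ((theta p - eta0 + (1 + eta0) * rk s) * mean_claim M).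

(** The averse value enters with weight [alpha] and a plus sign, the seeking one with weight
    [1 - alpha] and a minus sign; their equal Brownian parts leave the factor [2 * alpha - 1]. *)
Lemma combined_objective :
  mean_variance_base + (2 * alpha p - 1) *
    \int[leb]_(s in `[t, T]) (- (beta1 p * f1 s ^+ 2 + beta2 p * f2 s ^+ 2) / 2) =
  accr p t * x + \int[leb]_(s in `[t, T]) (premium_gain s + stock_objective M s (st s)) /\
  L1 leb `[t, T] (fun s => premium_gain s + stock_objective M s (st s)).
Proof.
have j1 := vol_sqr_integrable (sigma1 p) (sigma2 p * rho p).
have j2 := vol_sqr_integrable 0 (sigma2 p * rhohat p).
have j0 := base_integrable.
have j12 : L1 leb `[t, T] (fun s => f1 s ^+ 2 + f2 s ^+ 2) by exact: integrable_realD.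
have k12 : L1 leb `[t, T] (fun s => gamma p / 2 * (f1 s ^+ 2 + f2 s ^+ 2)) by exact: integrable_realZ.
have k : L1 leb `[t, T] (fun s => (2 * alpha p - 1) *
    (- (beta1 p * f1 s ^+ 2 + beta2 p * f2 s ^+ 2) / 2)) by exact: integrable_realZ.
have l1 : L1 leb `[t, T] (fun s => accr p s * trade_drift s
    - gamma p / 2 * (f1 s ^+ 2 + f2 s ^+ 2)) by exact: integrable_realB.
have l2 : L1 leb `[t, T] (fun s => accr p s * trade_drift s
    - gamma p / 2 * (f1 s ^+ 2 + f2 s ^+ 2) + (2 * alpha p - 1) *
    (- (beta1 p * f1 s ^+ 2 + beta2 p * f2 s ^+ 2) / 2)) by exact: integrable_realD.
have E s : accr p s * trade_drift s - gamma p / 2 * (f1 s ^+ 2 + f2 s ^+ 2)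
    + (2 * alpha p - 1) * (- (beta1 p * f1 s ^+ 2 + beta2 p * f2 s ^+ 2) / 2) =
    premium_gain s + stock_objective M s (st s).
  by rewrite /trade_drift /premium_gain /stock_objective /volatility; ring.
split; last by apply: eq_integrable l2 => // s _; congr (_%:E); exact: E.
rewrite /mean_variance_base -(RintegralZl _ _ ibest)// -(RintegralD _ j1)// -(RintegralZl _ _ j12)//.
rewrite -addrA -addrA; congr (_ + _).
rewrite addrA -(RintegralB _ j0)// -(RintegralD _ l1)//.
by apply: eq_Rintegral => s _; exact: E.
Qed.

End strategy.

Section iterated.
Context {R : realType} (v : {sigma_finite_measure set R -> \bar R}).
Notation leb := (@lebesgue_measure R).
Notation ell := (leb \x v)%E.

(** [fins] guarantees that [fine], which sends an infinite section to 0, loses nothing. *)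
Lemma Rintegral_jump_domain (t T : R) (F : R * R -> R) : t <= T -> Tmeasurable F ->
  (forall u, 0 <= F u) -> (\int[ell]_(u in jump_domain t T) (F u)%:E < +oo)%E ->
  (forall s, t <= s <= T -> (\int[v]_(z in `]0%R, +oo[) (F (s, z))%:E < +oo)%E) ->
  \int[ell]_(u in jump_domain t T) F u = \int[leb]_(s in `[t, T]) \int[v]_(z in `]0, +oo[) F (s, z) /\
  L1 leb `[t, T] (fun s => \int[v]_(z in `]0, +oo[) F (s, z)).
Proof.
move=> tT mF F0 fin fins.
have F0E u : (0 <= (F u)%:E)%E by rewrite lee_fin.
have mFE : Tmeasurable (fun u => (F u)%:E) by exact/measurable_EFinP.
have mI := @measurable_integral_section _ v `]0%R, +oo[%classic _ (measurable_itv _) F0E mFE.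
have I0 s : (0 <= \int[v]_(z in `]0%R, +oo[) (F (s, z))%:E)%E by apply: integral_ge0.
have E : (\int[ell]_(u in jump_domain t T) (F u)%:E =
    \int[leb]_(s in `[t, T]) (\int[v]_(z in `]0, +oo[) F (s, z))%:E)%E.
  rewrite /jump_domain (@integral_setX _ v _ _ _ (measurable_itv _) (measurable_itv _) F0E mFE)/=.
  rewrite integral_itv_obnd_cbnd; last exact: measurable_funTS.
  apply: eq_integral => s; rewrite inE/= in_itv/= => sT.
  by rewrite /Rintegral fineK// ge0_fin_numE// fins.
split; first by rewrite /Rintegral E.
apply: ge0_integrable_real => //.
- apply: measurable_funTS; exact: (measurableT_comp (@fine_measurable R setT measurableT) mI).
- by move=> s _; apply: Rintegral_ge0.
- by rewrite -E.
Qed.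

End iterated.

(** * What the first order condition gives: bounds and integrability *)

Section retention.
Context {R : realType} {d} {Omega : measurableType d} (M : market R Omega) (hM : market_ok M).
Notation p := (par M).
Notation T := (horizon (par M)).
Notation eta0 := (Defs.eta (par M)).
Notation leb := (@lebesgue_measure R).
Notation v := (levy M).
Notation ell := (leb \x v)%E.

(** Serves both the extreme and the capped distortions. The majorant [G] will be built from
    [marginal], whose Lévy integral the first order condition evaluates. *)
Lemma Theta_bounded phi (K : R) (G : R * R -> R) :
  measurable_fun `[0, T] (phi1 phi) -> measurable_fun `[0, T] (phi2 phi) ->
  (forall s, 0 <= s <= T -> `|phi1 phi s| <= K /\ `|phi2 phi s| <= K) ->
  Tmeasurable (fun u : R * R => phi3 phi u.1 u.2) ->
  (forall s z, phi3 phi s z < 1) ->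
  Tmeasurable G -> (forall u, 0 <= G u) ->
  (forall s z, 0 <= s <= T -> 0 < z -> entropy (phi3 phi s z) <= G (s, z)) ->
  (\int[leb]_(s in `[0%R, T]) \int[v]_(z in `]0%R, +oo[) (G (s, z))%:E < +oo)%E ->
  Theta M phi.
Proof.
move=> m1 m2 b m3 lt1 mG G0 entG GT; split => //.
  exact: measurable_funTS.
move=> t tT; have /andP[t0 _] := tT.
have sub : `[t, T] `<=` `[0, T] by apply: subset_itv; rewrite bnd_simp.
have x_fin : (\int[leb]_(s in `[t, T]) ((phi1 phi s ^+ 2 + phi2 phi s ^+ 2) / 2)%:E < +oo)%E.
  apply: (@integrable_lty _ _ _ leb).
    exact: measurable_itv.
  have h : L1 leb `[t, T] (fun s => (phi1 phi s ^+ 2 + phi2 phi s ^+ 2) / 2); last exact: h.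
  apply: (@bounded_integrable_itv _ _ (K ^+ 2)).
    apply: measurable_funM => //; apply: measurable_funD; apply: measurable_funX.
      exact: (measurable_funS _ sub m1).
    exact: (measurable_funS _ sub m2).
  move=> s /andP[ts sT]; have [|b1 b2] := b s; first by rewrite sT (le_trans t0 ts).
  rewrite ger0_norm ?divr_ge0 ?addr_ge0 ?sqr_ge0//.
  have : `|phi1 phi s| ^+ 2 <= K ^+ 2 by rewrite lerXn2r ?nnegrE// (le_trans _ b1).
  have : `|phi2 phi s| ^+ 2 <= K ^+ 2 by rewrite lerXn2r ?nnegrE// (le_trans _ b2).
  by rewrite !real_normK ?num_real//; lra.
have mE : Tmeasurable (fun u : R * R => (entropy (phi3 phi u.1 u.2))%:E).
  have m13 : Tmeasurable (fun u : R * R => 1 - phi3 phi u.1 u.2) by exact: measurable_funB.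
  apply/measurable_EFinP; rewrite /entropy; apply: measurable_funD => //; apply: measurable_funM => //.
  exact: (measurableT_comp (@measurable_ln R)).
have E0 (u : R * R) : (0 <= (entropy (phi3 phi u.1 u.2))%:E)%E by rewrite lee_fin entropy_ge0.
have G0E u : (0 <= (G u)%:E)%E by rewrite lee_fin.
have mGE : Tmeasurable (fun u => (G u)%:E) by exact/measurable_EFinP.
have mI (F : R * R -> \bar R) : (forall u, 0 <= F u)%E -> Tmeasurable F ->
    Tmeasurable (fun s => \int[v]_(z in `]0%R, +oo[) F (s, z))%E.
  by move=> F0 mF; exact: (@measurable_integral_section _ v `]0%R, +oo[%classic _ (measurable_itv _) F0 mF).
have y_fin : (\int[leb]_(s in `[t, T]) \int[v]_(z in `]0%R, +oo[) (entropy (phi3 phi s z))%:E < +oo)%E.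
  apply: (@le_lt_trans _ _ (\int[leb]_(s in `[t, T]) \int[v]_(z in `]0%R, +oo[) (G (s, z))%:E)%E).
    apply: ge0_le_integral => //.
    - by move=> s _; apply: integral_ge0 => z _; exact: (E0 (s, z)).
    - by apply: measurable_funTS; exact: (mI _ E0 mE).
    - by apply: measurable_funTS; exact: (mI _ G0E mGE).
    - move=> s /=; rewrite in_itv/= => /andP[ts sT]; apply: ge0_le_integral => //.
      + by move=> z _; exact: (E0 (s, z)).
      + by apply: measurable_funTS; exact: (measurableT_comp mE (measurable_pair1 s)).
      + by apply: measurable_funTS; exact: (measurableT_comp mGE (measurable_pair1 s)).
      + move=> z /=; rewrite in_itv/= andbT => z0; rewrite lee_fin entG// sT (le_trans t0 ts)//.
  apply: le_lt_trans GT; apply: ge0_subset_integral => //.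
    by apply: measurable_funTS; exact: (mI _ G0E mGE).
  by move=> s _; apply: integral_ge0.
have x0 : (0 <= \int[leb]_(s in `[t, T]) ((phi1 phi s ^+ 2 + phi2 phi s ^+ 2) / 2)%:E)%E.
  by apply: integral_ge0 => s _; rewrite lee_fin divr_ge0// addr_ge0 ?sqr_ge0.
have y0 : (0 <= \int[leb]_(s in `[t, T]) \int[v]_(z in `]0%R, +oo[) (entropy (phi3 phi s z))%:E)%E.
  by apply: integral_ge0 => s _; apply: integral_ge0 => z _; exact: (E0 (s, z)).
have gen (x y : \bar R) : (0 <= x -> 0 <= y -> x < +oo -> y < +oo -> expeR (x + y) < +oo)%E.
  by case: x => [x| |]//; case: y => [y| |]// *; rewrite ltry.
exact: gen.
Qed.

Variable q : R -> R.
Hypotheses (mq : Tmeasurable q) (q0 : forall s, 0 <= q s).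
Hypothesis q2 : L1 leb `[0, T] (fun s => q s ^+ 2).
Hypothesis hq : solves_foc M q.

Notation L := (fun s z => beta3 p * load M q s z).

Lemma load_ge0 s z : 0 <= z -> 0 <= load M q s z.
Proof.
have [g0 _ _ _ _] := params_gt0 hM => z0.
by rewrite addr_ge0// !mulr_ge0 ?sqr_ge0 ?expR_ge0// ltW.
Qed.

Let L0 s z : 0 <= z -> 0 <= L s z.
Proof. by have [_ _ _ b30 _] := params_gt0 hM => z0; rewrite mulr_ge0 ?load_ge0// ltW. Qed.

(** As [alpha >= 1/2], the mixture is at least the hyperbolic cosine, which is at least 1. *)
Lemma tilt_mix_ge1 l : 0 <= l -> 1 <= alpha p * expR l + alphahat p * expR (- l).
Proof.
move=> l0; have /andP[a1 a2] := (alpha_bounds hM).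
have h1 := expR_ge1Dx l; have h2 := expR_ge1Dx (- l).
have h3 : expR (- l) <= expR l by rewrite ler_expR; lra.
rewrite /alphahat; have : 0 <= (alpha p - 2^-1) * (expR l - expR (- l)) by rewrite mulr_ge0//; lra.
by lra.
Qed.

(** The derivative in the retention of [alpha * expR L - alphahat * expR (- L)], divided by [beta3].
    The first order condition says that its Lévy integral is the marginal premium,
    [(1 + eta) * accr * mean_claim]. *)
Definition marginal (s z : R) : R :=
  (z * accr p s + gamma p * q s * z ^+ 2 * accr p s ^+ 2) *
  (alpha p * expR (L s z) + alphahat p * expR (- L s z)).

Lemma focE s z : foc M q s z = (1 + eta0) * accr p s * z - marginal s z.
Proof. by rewrite /foc /marginal; ring. Qed.

Let g0 : 0 < gamma p. Proof. by have [] := params_gt0 hM. Qed.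
Let b30 : 0 < beta3 p. Proof. by have [] := params_gt0 hM. Qed.
Let a0 s : 0 < accr p s. Proof. exact: expR_gt0. Qed.

Let dz s z : 0 <= z -> 0 <= z * accr p s + gamma p * q s * z ^+ 2 * accr p s ^+ 2.
Proof.
move=> z0; have h := ltW g0; have h1 := ltW (a0 s).
by rewrite addr_ge0// !mulr_ge0 ?sqr_ge0.
Qed.

Lemma marginal_ge s z : 0 <= z ->
  z * accr p s + gamma p * q s * z ^+ 2 * accr p s ^+ 2 <= marginal s z.
Proof. by move=> z0; rewrite /marginal ler_peMr ?dz// tilt_mix_ge1 ?L0. Qed.

Lemma marginal_ge0 s z : 0 <= z -> 0 <= marginal s z.
Proof. by move=> z0; apply: le_trans (marginal_ge s z0); exact: dz. Qed.

Lemma marginal_exp_ge s z : 0 <= z ->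
  alpha p * ((z * accr p s + gamma p * q s * z ^+ 2 * accr p s ^+ 2) * expR (L s z)) <= marginal s z.
Proof.
move=> z0; rewrite /marginal mulrCA ler_wpM2l ?dz// lerDl mulr_ge0 ?expR_ge0//.
by have /andP[_ h] := (alpha_bounds hM); rewrite /alphahat subr_ge0.
Qed.

Lemma load_measurable : Tmeasurable (fun u : R * R => load M q u.1 u.2).
Proof.
have m1 : Tmeasurable (fun u : R * R => q u.1) by exact: (measurableT_comp mq measurable_fst).
have m2 : Tmeasurable (fun u : R * R => accr p u.1).
  exact: (measurableT_comp (accr_measurable M) measurable_fst).
have m3 : Tmeasurable (snd : R * R -> R) by exact: measurable_snd.
rewrite /load; apply: measurable_funD.
  by apply: measurable_funM => //; exact: measurable_funM.
apply: measurable_funM; last exact: (measurable_funX 2 m2).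
apply: measurable_funM; last exact: (measurable_funX 2 m3).
by apply: measurable_funM => //; exact: (measurable_funX 2 m1).
Qed.

Lemma marginal_measurable : Tmeasurable (fun u : R * R => marginal u.1 u.2).
Proof.
have m1 : Tmeasurable (fun u : R * R => q u.1) by exact: (measurableT_comp mq measurable_fst).
have m2 : Tmeasurable (fun u : R * R => accr p u.1).
  exact: (measurableT_comp (accr_measurable M) measurable_fst).
have m3 : Tmeasurable (snd : R * R -> R) by exact: measurable_snd.
have mL : Tmeasurable (fun u : R * R => beta3 p * load M q u.1 u.2).
  by apply: measurable_funM => //; exact: load_measurable.
apply: measurable_funM.
  apply: measurable_funD; first exact: measurable_funM.
  apply: measurable_funM; last exact: (measurable_funX 2 m2).
  apply: measurable_funM; last exact: (measurable_funX 2 m3).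
  exact: measurable_funM.
apply: measurable_funD; apply: measurable_funM => //.
  exact: (measurableT_comp (@measurable_expR R) mL).
apply: (measurableT_comp (@measurable_expR R)); exact: measurableT_comp.
Qed.

Lemma marginal_mean s : 0 <= s <= T ->
  (\int[v]_(z in `]0%R, +oo[) (marginal s z)%:E = ((1 + eta0) * accr p s * mean_claim M)%:E)%E.
Proof.
move=> sT; have [_ ifoc foc0] := hq sT.
have iz : L1 v `]0, +oo[ (fun z => (1 + eta0) * accr p s * z).
  by apply: integrable_realZ => //; exact: (levy_mean_integrable hM).
have im : L1 v `]0, +oo[ (fun z => (1 + eta0) * accr p s * z - foc M q s z).
  exact: integrable_realB.
have E : \int[v]_(z in `]0, +oo[) ((1 + eta0) * accr p s * z - foc M q s z) =
   (1 + eta0) * accr p s * mean_claim M.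
  rewrite (RintegralB _ iz)// foc0 subr0 RintegralZl//; exact: (levy_mean_integrable hM).
rewrite -E [RHS]fineK; last exact: integrable_fin_num.
by apply: eq_integral => z _; rewrite focE; congr (_%:E); ring.
Qed.

(** The load is at most [q] times its own derivative in [q], and that derivative times [expR L] is
    at most [marginal / alpha]. Since the entropy of the optimal tilt is at most [L * expR L], this
    is what places it in [Theta]. *)
Lemma load_exp_le s z : 0 <= z -> L s z * expR (L s z) <= beta3 p / alpha p * (q s * marginal s z).
Proof.
move=> z0; have /andP[al _] := (alpha_bounds hM); have al0 : 0 < alpha p by apply: lt_le_trans al; rewrite invr_gt0.
apply: (@le_trans _ _ (beta3 p / alpha p * (q s * (alpha p * ((z * accr p s + gamma p * q s * z ^+ 2 * accr p s ^+ 2) * expR (L s z)))))).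
  rewrite [leRHS](_ : _ = beta3 p * (q s * (z * accr p s + gamma p * q s * z ^+ 2 * accr p s ^+ 2)) * expR (L s z)).
    rewrite ler_wpM2r ?expR_ge0// ler_wpM2l ?(ltW b30)// /load.
    have : 0 <= gamma p * q s ^+ 2 * z ^+ 2 * accr p s ^+ 2 by rewrite !mulr_ge0 ?sqr_ge0// ltW.
    by lra.
  by field; rewrite gt_eqF.
by rewrite ler_wpM2l ?divr_ge0 ?(ltW b30) ?(ltW al0)// ler_wpM2l// marginal_exp_ge.
Qed.

(* A bound on the exponentially weighted claims: for a small retention [q] the
   Gaussian moments of the claims suffice, for a large one the first order
   condition gives it. *)
Lemma exp_claim_le : exists k K1 K2 : R, [/\ 0 <= K1, 0 <= K2,
  (\int[v]_(z in `]0%R, +oo[) (expR (k * (`|z| + z ^+ 2)) - 1)%:E < +oo)%E,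
  0 < k & forall s z, 0 <= s <= T -> 0 < z ->
  (z + z ^+ 2) * expR (L s z) <= K1 * (expR (k * (`|z| + z ^+ 2)) - 1) + K2 * marginal s z].
Proof.
have [k k0 vk] := levy_exp_moment hM.
have /andP[al _] := (alpha_bounds hM); have al0 : 0 < alpha p by apply: lt_le_trans al; rewrite invr_gt0.
pose A := accr p 0; have A0 : 0 < A := a0 0.
pose c := beta3 p * A * (1 + gamma p * A); have c0 : 0 < c.
  by rewrite !mulr_gt0// addr_gt0// mulr_gt0.
(* The threshold between small and large retention. For [q s <= e], the constant [c] gives
   [beta3 * load <= k / 2 * (z + z^2)], half of the available exponent; the other half absorbs the
   factor [z + z^2]. *)
pose e := Num.min 1 (k / (2 * c)); have e0 : 0 < e by rewrite lt_min ltr01 divr_gt0// mulr_gt0.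
have e1 : e <= 1 by rewrite ge_min lexx.
have ek : e * c <= k / 2.
  have : e <= k / (2 * c) by rewrite ge_min lexx orbT.
  rewrite ler_pdivlMr ?(mulr_gt0 _ c0)// => h.
  by rewrite ler_pdivlMr//; apply: le_trans h; apply: eqW; ring.
exists k, (2 / k), ((alpha p)^-1 * (1 + (gamma p * e)^-1)); split => //.
- by rewrite divr_ge0// ltW.
- by rewrite mulr_ge0 ?invr_ge0 ?(ltW al0)// addr_ge0// invr_ge0 ltW// mulr_gt0.
move=> s z sT z0; have /andP[A1 AA] := accr_bounds hM sT; rewrite -/A in AA.
have zz0 : 0 <= z + z ^+ 2 by rewrite addr_ge0 ?sqr_ge0// ltW.
have E0 : 0 <= expR (k * (`|z| + z ^+ 2)) - 1.
  by rewrite subr_ge0 -expR0 ler_expR mulr_ge0 ?(ltW k0)// addr_ge0 ?sqr_ge0.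
have m0 := marginal_ge0 s (ltW z0).
have [qe|eq] := leP (q s) e.
  apply: (@le_trans _ _ (2 / k * (expR (k * (`|z| + z ^+ 2)) - 1))); last first.
    rewrite lerDl mulr_ge0// mulr_ge0 ?invr_ge0 ?(ltW al0)// addr_ge0// invr_ge0 ltW// mulr_gt0//.
  rewrite (gtr0_norm z0); set y := k / 2 * (z + z ^+ 2).
  have y0 : 0 <= y by rewrite mulr_ge0// divr_ge0// ltW.
  have Ly : L s z <= y.
    have h1 : q s * z * accr p s <= e * A * z.
      rewrite mulrAC ler_wpM2r ?(ltW z0)//; apply: ler_pM => //; exact/ltW.
    have h2 : q s ^+ 2 * z ^+ 2 * accr p s ^+ 2 <= e * A ^+ 2 * z ^+ 2.
      rewrite mulrAC ler_wpM2r ?sqr_ge0//; apply: ler_pM; rewrite ?sqr_ge0//.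
        by apply: (le_trans _ qe); rewrite expr2 ler_piMr// (le_trans qe).
      by rewrite lerXn2r ?nnegrE// ltW.
    apply: (@le_trans _ _ (e * c * (z + z ^+ 2))); last by rewrite ler_wpM2r.
    rewrite /c /load.
    have h3 : gamma p / 2 * (q s ^+ 2 * z ^+ 2 * accr p s ^+ 2) <= gamma p / 2 * (e * A ^+ 2 * z ^+ 2).
      by rewrite ler_wpM2l// divr_ge0// ltW.
    have h4 : 0 <= e * A * z ^+ 2 by rewrite !mulr_ge0 ?sqr_ge0// ltW.
    have h5 : 0 <= gamma p * e * A ^+ 2 * z by rewrite !mulr_ge0 ?sqr_ge0// ltW.
    have h6 : 0 <= gamma p * e * A ^+ 2 * z ^+ 2 by rewrite !mulr_ge0 ?sqr_ge0// ltW.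
    rewrite [leRHS](_ : _ = beta3 p * (e * A * (1 + gamma p * A) * (z + z ^+ 2))); last by ring.
    rewrite ler_wpM2l ?(ltW b30)//.
    by lra.
  apply: (@le_trans _ _ (2 / k * (y * expR y))).
    rewrite [leRHS](_ : _ = (z + z ^+ 2) * expR y); last by rewrite /y; field; rewrite gt_eqF.
    by rewrite ler_wpM2l// ler_expR.
  rewrite ler_wpM2l ?divr_ge0 ?(ltW k0)//.
  have -> : k * (z + z ^+ 2) = y + y by rewrite /y; field.
  rewrite expRD; have h1 := expR_ge1Dx y.
  have : 0 <= (expR y - 1 - y) * expR y by rewrite mulr_ge0 ?expR_ge0//; lra.
  by lra.
apply: (@le_trans _ _ ((alpha p)^-1 * (1 + (gamma p * e)^-1) * marginal s z)); last first.
  by rewrite lerDr mulr_ge0// divr_ge0// ltW.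
apply: (@le_trans _ _ ((alpha p)^-1 * (1 + (gamma p * e)^-1) *
   (alpha p * ((z * accr p s + gamma p * q s * z ^+ 2 * accr p s ^+ 2) * expR (L s z))))); last first.
  rewrite ler_wpM2l ?marginal_exp_ge ?(ltW z0)// mulr_ge0 ?invr_ge0 ?(ltW al0)// addr_ge0// invr_ge0 ltW// mulr_gt0//.
rewrite [leRHS](_ : _ = (1 + (gamma p * e)^-1) * (z * accr p s + gamma p * q s * z ^+ 2 * accr p s ^+ 2) * expR (L s z)).
  rewrite ler_wpM2r ?expR_ge0//.
  set u := (gamma p * e)^-1; have u0 : 0 < u by rewrite invr_gt0 mulr_gt0.
  have h1 : z <= z * accr p s by rewrite ler_peMr// ltW.
  (* For [q s > e] the quadratic term of [marginal] dominates [z^2], and the constant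
     [(gamma * e)^-1] is the price. *)
  have h2 : z ^+ 2 <= u * (gamma p * q s * z ^+ 2 * accr p s ^+ 2).
    rewrite [leRHS](_ : _ = z ^+ 2 * (q s / e * accr p s ^+ 2)); last first.
      by rewrite /u; field; rewrite !gt_eqF.
    rewrite ler_peMr ?sqr_ge0// mulr_ege1 ?exprn_ege1//.
    by rewrite ler_pdivlMr// mul1r ltW.
  have h3 : 0 <= u * (z * accr p s) by rewrite !mulr_ge0// ltW.
  have h4 : 0 <= gamma p * q s * z ^+ 2 * accr p s ^+ 2 by rewrite !mulr_ge0 ?sqr_ge0// ltW.
  by lra.
by field; rewrite !gt_eqF.
Qed.

(** [marginal] dominates [z * a + gamma * q * z^2 * a^2] with [a = accr >= 1]. Integrating and using
    the first order condition, [gamma * q * m2 <= eta * mean_claim], where [m2] is the second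
    moment. This bounds [q] if [m2 > 0], and [m2 = 0] means that there are no jumps. *)
Lemma retention_moderate t : 0 <= t -> moderate M t q.
Proof.
move=> t0; pose m2 := (\int[v]_(z in `]0%R, +oo[) (z ^+ 2)%:E)%E.
have m20 : (0 <= m2)%E by apply: integral_ge0 => z _; rewrite lee_fin sqr_ge0.
have mz2 : Tmeasurable (fun z : R => (z ^+ 2)%:E).
  by apply/measurable_EFinP; exact: (measurable_funX 2 (@measurable_id _ _ setT)).
have main s : 0 <= s <= T -> ((gamma p * q s)%:E * m2 <= (eta0 * mean_claim M)%:E)%E.
  move=> sT; have /andP[A1 _] := accr_bounds hM sT.
  have hm := marginal_mean sT.
  have le1 : (\int[v]_(z in `]0%R, +oo[) ((accr p s)%:E * z%:E + (gamma p * q s * accr p s ^+ 2)%:E * (z ^+ 2)%:E)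
      <= ((1 + eta0) * accr p s * mean_claim M)%:E)%E.
    rewrite -hm; apply: ge0_le_integral => //.
    - move=> z /=; rewrite in_itv/= andbT => /ltW z0.
      by rewrite -!EFinM -EFinD lee_fin addr_ge0// !mulr_ge0 ?sqr_ge0// ltW.
    - apply: measurable_funTS; apply: emeasurable_funD; apply: emeasurable_funM => //.
    - apply/measurable_EFinP; apply: measurable_funTS.
      exact: (measurableT_comp marginal_measurable (measurable_pair1 s)).
    - move=> z /=; rewrite in_itv/= andbT => /ltW z0; rewrite -!EFinM -EFinD lee_fin.
      by apply: le_trans (marginal_ge s z0); apply: eqW; ring.
  move: le1; rewrite ge0_integralD//; first last.
  - by apply: measurable_funTS; apply: emeasurable_funM.
  - by move=> z _; rewrite -EFinM lee_fin mulr_ge0 ?sqr_ge0// mulr_ge0 ?sqr_ge0// mulr_ge0// ltW.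
  - by apply: measurable_funTS; apply: emeasurable_funM.
  - by move=> z /=; rewrite in_itv/= andbT => /ltW z0; rewrite -EFinM lee_fin mulr_ge0// ltW.
  rewrite ge0_integralZl_EFin//; first last.
  - exact: ltW.
  - by move=> z /=; rewrite in_itv/= andbT => /ltW; rewrite lee_fin.
  rewrite ge0_integralZl_EFin//; first last.
  - by rewrite !mulr_ge0 ?sqr_ge0// ltW.
  - exact: measurable_funTS.
  - by move=> z _; rewrite lee_fin sqr_ge0.
  rewrite (mean_claimE hM) -/m2; case: m2 m20 => [m| |]// m0.
    rewrite -!EFinM -EFinD !lee_fin => h; rewrite -(ler_pM2l (a0 s)).
    apply: le_trans (_ : gamma p * q s * accr p s ^+ 2 * m <= _); last by lra.
    rewrite [leRHS](_ : _ = accr p s * (gamma p * q s * m) * accr p s); last by ring.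
    by rewrite ler_peMr// !mulr_ge0// ltW.
  have [->|qs0] := eqVneq (q s) 0.
    by rewrite !(mulr0,mul0r) !mul0e => _; rewrite lee_fin; apply: mulr_ge0; [exact: ltW (eta_gt0 hM)|exact: mean_claim_ge0].
  have qs : 0 < q s by rewrite lt_neqAle eq_sym qs0 q0.
  by rewrite gt0_muley ?lte_fin ?mulr_gt0 ?exprn_gt0// -EFinM addey.
have [m2_0|m2_0] := eqVneq m2 0%E.
  right; have mz2' : measurable_fun (`]0%R, +oo[ : set R) (fun z : R => (z ^+ 2)%:E) by exact: measurable_funTS.
  have : (\int[v]_(z in `]0%R, +oo[) `|(z ^+ 2)%:E| = 0)%E.
    by rewrite -m2_0; apply: eq_integral => z _; rewrite gee0_abs// lee_fin sqr_ge0.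
  move=> /(ae_eq_integral_abs v (measurable_itv _) mz2')[N [mN vN DN]].
  apply: (subset_measure0 _ mN _ vN) => // z z0; apply: DN => /= /(_ z0)[] /eqP.
  by move: z0; rewrite /= in_itv/= andbT sqrf_eq0 => z0; rewrite gt_eqF.
left; exists (eta0 * mean_claim M / (gamma p * fine m2)) => s /andP[ts sT].
have := main s; rewrite (le_trans t0 ts) sT => /(_ isT); clear main.
case: m2 m20 m2_0 => [m| |]//= m0 m_0.
  have m1 : 0 < m by move: m0 m_0; rewrite lee_fin eqe lt_neqAle eq_sym => -> ->.
  rewrite -EFinM lee_fin ler_pdivlMr ?mulr_gt0// => h.
  by apply: le_trans h; apply: eqW; ring.
(* Here [m2 = +oo], whose finite part is 0, so the claimed bound is 0 by the convention on inverses;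
   indeed [q s] must vanish. *)
have [->|qs0] := eqVneq (q s) 0; first by rewrite mulr0 invr0 mulr0.
have qs : 0 < q s by rewrite lt_neqAle eq_sym qs0 q0.
by rewrite gt0_muley ?lte_fin ?mulr_gt0.
Qed.

Notation mg := marginal.

Lemma retention_integrable : L1 leb `[0, T] q.
Proof. by apply: sqr_integrable_itv => //; exact: measurable_funTS. Qed.

(** The absolute value is harmless for [z > 0], and gives a function that is nonnegative on the
    whole line, as Tonelli requires. *)
Lemma marginal_section (h : R) s : 0 <= h -> 0 <= s <= T ->
  (\int[v]_(z in `]0%R, +oo[) (h * `|mg s z|)%:E = (h * ((1 + eta0) * accr p s * mean_claim M))%:E)%E.
Proof.
move=> h0 sT; rewrite EFinM -(marginal_mean sT) -ge0_integralZl_EFin//; first last.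
- apply: measurable_funTS; apply/measurable_EFinP.
  exact: (measurableT_comp marginal_measurable (measurable_pair1 s)).
- by move=> z /=; rewrite in_itv/= andbT => /ltW z0; rewrite lee_fin marginal_ge0.
apply: eq_integral => z; rewrite inE/= in_itv/= andbT => /ltW z0.
by rewrite ger0_norm ?marginal_ge0.
Qed.

Let mnorm : Tmeasurable (fun u : R * R => `|mg u.1 u.2|).
Proof.
exact: (measurableT_comp (@normr_measurable R setT) marginal_measurable).
Qed.

Let a_le s : 0 <= s <= T -> (1 + eta0) * accr p s * mean_claim M <= (1 + eta0) * accr p 0 * mean_claim M.
Proof.
move=> sT; have /andP[_ h] := accr_bounds hM sT.
by rewrite ler_wpM2r ?mean_claim_ge0// ler_wpM2l// addr_ge0// (ltW (eta_gt0 hM)).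
Qed.

Let a_ge0 s : 0 <= (1 + eta0) * accr p s * mean_claim M.
Proof. by rewrite !mulr_ge0 ?mean_claim_ge0 ?expR_ge0// addr_ge0// ltW// (eta_gt0 hM). Qed.

Lemma charge_integrable t (h : R -> R) : 0 <= t -> t <= T -> Tmeasurable h -> (forall s, 0 <= h s) ->
  L1 leb `[t, T] h ->
  L1 leb `[t, T] (fun s => h s * ((1 + eta0) * accr p s * mean_claim M)).
Proof.
move=> t0 tT mh h0 ih.
have i1 : L1 leb `[t, T] (fun s => (1 + eta0) * accr p 0 * mean_claim M * h s).
  exact: integrable_realZ.
apply: (@le_integrable _ _ _ leb _ _ _ (EFin \o (fun s => (1 + eta0) * accr p 0 * mean_claim M * h s))) => //.
  apply/measurable_EFinP; apply: measurable_funTS; apply: measurable_funM => //.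
  by apply: measurable_funM => //; apply: measurable_funM => //; exact: accr_measurable.
have key (s : R) : t <= s -> s <= T -> `|h s * ((1 + eta0) * accr p s * mean_claim M)| <=
    `|(1 + eta0) * accr p 0 * mean_claim M * h s|.
  move=> ts sT; rewrite mulrC !normrM ler_wpM2r// -!normrM !ger0_norm// a_le// sT (le_trans t0 ts)//.
by move=> s /=; rewrite in_itv/= => /andP[ts sT]; rewrite lee_fin; exact: key.
Qed.

Lemma marginal_setX t (h : R -> R) : 0 <= t -> t <= T -> Tmeasurable h -> (forall s, 0 <= h s) ->
  L1 leb `[t, T] h ->
  L1 ell (jump_domain t T) (fun u => h u.1 * `|mg u.1 u.2|) /\
  \int[ell]_(u in jump_domain t T) (h u.1 * `|mg u.1 u.2|) =
    \int[leb]_(s in `[t, T]) (h s * ((1 + eta0) * accr p s * mean_claim M)).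
Proof.
move=> t0 tT mh h0 ih; have mD := jump_domain_measurable t T.
have mF : Tmeasurable (fun u : R * R => (h u.1 * `|mg u.1 u.2|)%:E).
  apply/measurable_EFinP; apply: measurable_funM => //; exact: (measurableT_comp mh measurable_fst).
have F0 (u : R * R) : (0 <= (h u.1 * `|mg u.1 u.2|)%:E)%E by rewrite lee_fin mulr_ge0.
have ic := charge_integrable t0 tT mh h0 ih.
have E : (\int[ell]_(u in jump_domain t T) (h u.1 * `|mg u.1 u.2|)%:E =
    \int[leb]_(s in `[t, T]) (h s * ((1 + eta0) * accr p s * mean_claim M))%:E)%E.
  rewrite /jump_domain (@integral_setX _ v _ _ _ (measurable_itv _) (measurable_itv _) F0 mF)/=.
  transitivity (\int[leb]_(s in `]t, T]) (h s * ((1 + eta0) * accr p s * mean_claim M))%:E)%E.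
    apply: eq_integral => s; rewrite inE/= in_itv/= => /andP[/ltW ts sT].
    by rewrite marginal_section// sT (le_trans t0 ts).
  rewrite integral_itv_obnd_cbnd//; apply/measurable_EFinP; apply: measurable_funTS.
  apply: measurable_funM => //; apply: measurable_funM => //.
  by apply: measurable_funM => //; exact: accr_measurable.
split; last by rewrite /Rintegral E.
apply: ge0_integrable_real => //.
- by apply: measurable_funTS; exact/measurable_EFinP.
- by move=> u _; rewrite mulr_ge0.
- by rewrite E; exact: integrable_lty ic.
Qed.

Lemma marginal_iterated_finite (h : R -> R) : Tmeasurable h -> (forall s, 0 <= h s) ->
  L1 leb `[0, T] h ->
  (\int[leb]_(s in `[0%R, T]) \int[v]_(z in `]0%R, +oo[) (h s * `|mg s z|)%:E < +oo)%E.
Proof.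
move=> mh h0 ih; have T0 : 0 <= T by have [_ _ _ _ /ltW] := params_gt0 hM.
have ic := charge_integrable (lexx 0) T0 mh h0 ih.
rewrite (_ : (\int[leb]_(s in _) _)%E = \int[leb]_(s in `[0%R, T]) (h s * ((1 + eta0) * accr p s * mean_claim M))%:E)%E.
  exact: integrable_lty ic.
by apply: eq_integral => s; rewrite inE/= in_itv/= => sT; rewrite marginal_section.
Qed.

Notation jl := (jump_load M).

Lemma jump_loadE (rk : R -> R) s z : 0 <= z -> jl rk (s, z) = load M rk s z.
Proof. by move=> z0; rewrite /jump_load /terminal_claim /claim/= ger0_norm// /load; ring. Qed.

Let al0 : 0 < alpha p.
Proof. by have /andP[h _] := alpha_bounds hM; apply: lt_le_trans h; rewrite invr_gt0. Qed.

Lemma pi_s_derive (s : R) : is_derive s 1 (pi_s M) (rate p * ((mu p - rate p) * expR (- (rate p * (T - s))))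
  / (sigma2 p ^+ 2 * quad M)).
Proof.
rewrite /pi_s; apply: is_derive_eq; rewrite /GRing.scale/=; ring.
Qed.

Lemma pi_s_slope_continuous : continuous (fun s : R => rate p * ((mu p - rate p) * expR (- (rate p * (T - s))))
  / (sigma2 p ^+ 2 * quad M)).
Proof.
move=> s; apply: cvgM; last exact: cvg_cst.
apply: cvgM; first exact: cvg_cst.
apply: cvgM; first exact: cvg_cst.
apply: (@continuous_comp _ _ _ (fun s => - (rate p * (T - s))) expR); last exact: continuous_expR.
apply: (@cvgN _ R^o); apply: cvgM; first exact: cvg_cst.
by apply: (@cvgB _ R^o); [exact: cvg_cst|exact: cvg_id].
Qed.

Lemma pi_s_continuous : continuous (pi_s M).
Proof.
move=> s; apply: differentiable_continuous; apply/derivable1_diffP.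
by have [] := pi_s_derive s.
Qed.

Lemma exposure_bounded (a b : R) : exists K, forall s, 0 <= s <= T -> `|(a + b * pi_s M s) * accr p s| <= K.
Proof.
have T0 : 0 <= T by have [_ _ _ _ /ltW] := params_gt0 hM.
have tcT : 0 <= T <= T by rewrite T0 lexx.
have [K _ h] := volatility_bounded (M := M) T0 tcT pi_s_derive pi_s_derive pi_s_slope_continuous pi_s_slope_continuous a b.
exists K => s sT; have := h s sT; rewrite /volatility.
have -> : piece T (pi_s M) (pi_s M) s = pi_s M s by rewrite /piece; case: ifP.
by rewrite mulrC [b * _]mulrC.
Qed.

(** For either sign the entropy of [1 - expR (sg * l)] is at most [l * expR l], which [load_exp_le]
    bounds by a multiple of [q] times [marginal]. *)
Lemma extreme_Theta sg : sg ^+ 2 = 1 -> Theta M (extreme M sg q).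
Proof.
move=> sg1; have sgn : sg = 1 \/ sg = -1.
  have : (sg - 1) * (sg + 1) == 0 by apply/eqP; rewrite -(subrr 1) -{3}sg1; ring.
  by rewrite mulf_eq0 => /orP[]; rewrite ?subr_eq0 ?addr_eq0 => /eqP; [left|right].
have [K1 hK1] := exposure_bounded (beta1 p * sigma1 p) (beta1 p * sigma2 p * rho p).
have [K2 hK2] := exposure_bounded 0 (beta2 p * sigma2 p * rhohat p).
have n1 : `|sg| = 1 by case: sgn => ->; rewrite ?normrN normr1.
have mpi : Tmeasurable (pi_s M) by apply: continuous_measurable_fun; exact: pi_s_continuous.
apply: (@Theta_bounded _ (Num.max K1 K2) (fun u => beta3 p / alpha p * q u.1 * `|mg u.1 u.2|)).
- apply: measurable_funTS; apply: measurable_funM; last exact: accr_measurable.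
  by apply: measurable_funM => //; apply: measurable_funD => //; exact: measurable_funM.
- apply: measurable_funTS; apply: measurable_funM; last exact: accr_measurable.
  exact: measurable_funM.
- move=> s sT; split => /=.
    rewrite le_max (_ : _ * _ * accr p s = sg * ((beta1 p * sigma1 p + beta1 p * sigma2 p * rho p * pi_s M s) * accr p s)); last by ring.
    by rewrite normrM n1 mul1r hK1.
  rewrite le_max (_ : _ * _ * accr p s = sg * ((0 + beta2 p * sigma2 p * rhohat p * pi_s M s) * accr p s)); last by ring.
  by rewrite normrM n1 mul1r hK2// orbT.
- apply: measurable_funB => //; apply: (measurableT_comp (@measurable_expR R)).
  by apply: measurable_funM => //; exact: load_measurable.
- by move=> s z; rewrite /= gtrBl expR_gt0.
- apply: measurable_funM => //; apply: measurable_funM => //; exact: (measurableT_comp mq measurable_fst).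
- by move=> u; apply: mulr_ge0 => //; apply: mulr_ge0 => //; apply: divr_ge0; exact: ltW.
- move=> s z sT z0 /=.
  have l0 : 0 <= beta3 p * load M q s z.
    by rewrite mulr_ge0 ?(ltW b30)// load_ge0// ltW.
  apply: (@le_trans _ _ (beta3 p * load M q s z * expR (beta3 p * load M q s z))); last first.
    rewrite ger0_norm ?marginal_ge0 ?(ltW z0)//; apply: le_trans (load_exp_le s (ltW z0)) _.
    by rewrite [leLHS]mulrA.
  rewrite entropy_expR (_ : sg * beta3 p * load M q s z = sg * (beta3 p * load M q s z)); last by rewrite mulrA.
  move: l0; set l := beta3 p * load M q s z => l0.
  have h1 := expR_ge1Dx l; have h2 := expR_ge1Dx (- l); have e0 := expR_ge0 (- l).
  case: sgn => ->; first by rewrite mul1r; lra.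
  rewrite mulN1r; have : l <= l * expR l by rewrite ler_peMr//; lra.
  have : 0 <= l * expR (- l) by rewrite mulr_ge0.
  by lra.
- apply: (marginal_iterated_finite (h := fun s => beta3 p / alpha p * q s)).
  + exact: measurable_funM.
  + by move=> s; apply: mulr_ge0 => //; apply: divr_ge0; exact: ltW.
  + by apply: integrable_realZ => //; exact: retention_integrable.
Qed.

(* A near optimal distortion for a strategy whose retention [rk] is [k] or [q].
   The tilt of the claims is the optimal one, with exponent
   [beta3 * jump_load rk], capped relative to that of [q] to stay in [Theta]. *)
Definition capped_load (rk : R -> R) (u : R * R) : R :=
  Num.min (beta3 p * jl rk u) (beta3 p * jl q u + 1).

Definition capped_distortion (t : R) (f1 f2 rk : R -> R) : distortion R := Distortion
  (fun s => \1_(`[t, T]) s * (beta1 p * f1 s)) (fun s => \1_(`[t, T]) s * (beta2 p * f2 s))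
  (fun s z => 1 - expR (capped_load rk (s, z))).

Lemma capped_Theta t (f1 f2 rk : R -> R) (k : R) : 0 <= t -> t <= T -> 0 <= k ->
  measurable_fun `[t, T] f1 -> measurable_fun `[t, T] f2 ->
  (exists K, forall s, t <= s <= T -> `|f1 s| <= K) ->
  (exists K, forall s, t <= s <= T -> `|f2 s| <= K) ->
  Tmeasurable rk -> (forall s, 0 <= rk s) ->
  (forall s, 0 <= s <= T -> rk s = k \/ rk s = q s) ->
  Theta M (capped_distortion t f1 f2 rk).
Proof.
move=> t0 tT k0 mf1 mf2 [K1 hK1] [K2 hK2] mrk rk0 rkE.
have [kp [A1 [A2 [A10 A20 gfin kp0 hA]]]] := exp_claim_le.
pose g (z : R) := expR (kp * (`|z| + z ^+ 2)) - 1.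
have g_ge0 z : 0 <= g z.
  by rewrite subr_ge0 -expR0 ler_expR mulr_ge0 ?(ltW kp0)// addr_ge0 ?sqr_ge0.
have mg' : Tmeasurable g.
  apply: measurable_funB => //; apply: (measurableT_comp (@measurable_expR R)).
  apply: measurable_funM => //; apply: measurable_funD; first exact: normr_measurable.
  exact: (measurable_funX 2 (@measurable_id _ _ setT)).
pose C := beta3 p * (accr p 0 * k + gamma p / 2 * accr p 0 ^+ 2 * k ^+ 2).
have C0 : 0 <= C.
  rewrite mulr_ge0 ?(ltW b30)// addr_ge0// ?mulr_ge0 ?expR_ge0 ?sqr_ge0// ltW//.
(* Where the retention is [q] the cap is inactive and the entropy is bounded as for the extreme
   distortion, by the term in [q]. Where it is [k], the entropy is at most [C * (z + z^2) * expR
   (beta3 * load q + 1)], and [exp_claim_le] yields the terms in [A1] and [A2]. *)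
pose G (u : R * R) := (beta3 p / alpha p * q u.1 + C * expR 1 * A2) * `|mg u.1 u.2| + C * expR 1 * A1 * g u.2.
have cf0 s : 0 <= beta3 p / alpha p * q s + C * expR 1 * A2.
  apply: addr_ge0; first by apply: mulr_ge0 => //; apply: divr_ge0; exact: ltW.
  exact: (mulr_ge0 (mulr_ge0 C0 (expR_ge0 1)) A20).
have CA : 0 <= C * expR 1 * A1 := mulr_ge0 (mulr_ge0 C0 (expR_ge0 1)) A10.
have ind_restr (f : R -> R) b : (fun s => \1_(`[t, T]) s * (b * f s)) = (fun s => b * f s) \_ `[t, T].
  by apply/funext => s; rewrite patchE indicE; case: (_ \in _); rewrite ?mul1r ?mul0r.
have jl0 (r : R -> R) : (forall s, 0 <= r s) -> forall u, 0 <= beta3 p * jl r u.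
  by move=> r0 u; rewrite mulr_ge0 ?(ltW b30)// (jump_load_ge0 hM r0).
have mjl (r : R -> R) : Tmeasurable r -> Tmeasurable (fun u => beta3 p * jl r u).
  by move=> mr; apply: measurable_funM => //; exact: jump_load_measurable.
apply: (@Theta_bounded _ (Num.max (beta1 p * K1) (beta2 p * K2)) G).
- rewrite /= ind_restr; apply: measurable_funTS; apply/(measurable_restrictT _ (measurable_itv _)).
  exact: measurable_funM.
- rewrite /= ind_restr; apply: measurable_funTS; apply/(measurable_restrictT _ (measurable_itv _)).
  exact: measurable_funM.
- have [_ b10 b20 _ _] := params_gt0 hM.
  move=> s sT /=; rewrite indicE; have [sD|_] := boolP (s \in _); last first.
    rewrite !mul0r normr0; have : 0 <= K1 by apply: le_trans (hK1 t _); rewrite ?lexx ?tT.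
    by move=> h; split; rewrite le_max mulr_ge0// ltW.
  move: sD; rewrite inE/= in_itv/= => sD; rewrite !mul1r !normrM (gtr0_norm b10) (gtr0_norm b20) !le_max.
  by rewrite ler_pM2l// hK1//= ler_pM2l// hK2// orbT.
- apply: measurable_funB => //; apply: (measurableT_comp (@measurable_expR R)).
  apply: (measurable_minr (mjl _ mrk)); apply: measurable_funD => //; exact: mjl.
- by move=> s z; rewrite /= gtrBl expR_gt0.
- apply: measurable_funD; apply: measurable_funM => //; last exact: (measurableT_comp mg' measurable_snd).
  apply: measurable_funD => //; apply: measurable_funM => //; exact: (measurableT_comp mq measurable_fst).
- by move=> u; rewrite addr_ge0// mulr_ge0.
- move=> s z sT z0 /=; rewrite /capped_load.
  have m0 := marginal_ge0 s (ltW z0); rewrite /G/= (ger0_norm m0).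
  have Lq := jl0 _ q0 (s, z); have Lk := jl0 _ rk0 (s, z).
  have hent (l : R) : 0 <= l -> entropy (1 - expR l) <= l * expR l.
    by move=> l0; rewrite entropy_expR; have := expR_ge1Dx l; lra.
  have gz : 0 <= C * expR 1 * A1 * g z by exact: mulr_ge0.
  have Lqm := load_exp_le s (ltW z0); rewrite -(jump_loadE _ _ (ltW z0)) in Lqm.
  have CAm : 0 <= C * expR 1 * A2 * mg s z.
    exact: (mulr_ge0 (mulr_ge0 (mulr_ge0 C0 (expR_ge0 1)) A20) m0).
  have bq : 0 <= beta3 p / alpha p * q s * mg s z.
    by apply: mulr_ge0 => //; apply: mulr_ge0 => //; apply: divr_ge0; exact: ltW.
  case: (rkE s sT) => rs; last first.
    have -> : jl rk (s, z) = jl q (s, z) by rewrite !jump_loadE ?(ltW z0)// /load rs.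
    rewrite min_l ?lerDl//; apply: le_trans (hent _ Lq) _; apply: le_trans Lqm _.
    by move: gz CAm; lra.
  set l := Num.min _ _; have l0 : 0 <= l by rewrite le_min Lk addr_ge0.
  have lk : l <= beta3 p * jl rk (s, z) by rewrite ge_min lexx.
  have lq : l <= beta3 p * jl q (s, z) + 1 by rewrite ge_min lexx orbT.
  apply: le_trans (hent _ l0) _.
  apply: (@le_trans _ _ (C * expR 1 * ((z + z ^+ 2) * expR (beta3 p * load M q s z)))); last first.
    have h := hA s z sT z0; rewrite -/(g z) in h.
    apply: (@le_trans _ _ (C * expR 1 * (A1 * g z + A2 * mg s z))).
      by rewrite ler_wpM2l// mulr_ge0// expR_ge0.
    by move: bq; lra.
  apply: (@le_trans _ _ (beta3 p * jl rk (s, z) * expR (beta3 p * jl q (s, z) + 1))).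
    by apply: ler_pM => //; rewrite ?expR_ge0 ?ler_expR.
  rewrite expRD -(jump_loadE q s (ltW z0)).
  rewrite [leRHS](_ : _ = C * (z + z ^+ 2) * (expR (beta3 p * jl q (s, z)) * expR 1)); last by ring.
  rewrite ler_wpM2r ?mulr_ge0 ?expR_ge0//.
  apply: (@le_trans _ _ (beta3 p * ((accr p 0 * k + gamma p / 2 * accr p 0 ^+ 2 * k ^+ 2) * (z + z ^+ 2)))); last by rewrite mulrA.
  rewrite jump_loadE ?(ltW z0)// /load rs ler_wpM2l ?(ltW b30)//.
  have /andP[A_1 AA] := accr_bounds hM sT.
  have h1 : k * z * accr p s <= accr p 0 * k * z.
    by rewrite mulrC mulrA ler_wpM2r ?(ltW z0)// ler_wpM2r.
  have h2 : k ^+ 2 * z ^+ 2 * accr p s ^+ 2 <= accr p 0 ^+ 2 * k ^+ 2 * z ^+ 2.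
    rewrite mulrC mulrA ler_wpM2r ?sqr_ge0// ler_wpM2r ?sqr_ge0// lerXn2r ?nnegrE ?expR_ge0//.
  have h3 : gamma p / 2 * (k ^+ 2 * z ^+ 2 * accr p s ^+ 2) <= gamma p / 2 * (accr p 0 ^+ 2 * k ^+ 2 * z ^+ 2).
    by rewrite ler_wpM2l// divr_ge0// ltW.
  have z0' := ltW z0; have ac0 : 0 <= accr p 0 := expR_ge0 _; have g0' := ltW g0.
  have h4 : 0 <= accr p 0 * k * z ^+ 2 by rewrite !mulr_ge0 ?sqr_ge0.
  have h5 : 0 <= gamma p * accr p 0 ^+ 2 * k ^+ 2 * z by rewrite !mulr_ge0 ?sqr_ge0.
  by lra.
- pose h s := beta3 p / alpha p * q s + C * expR 1 * A2.
  have mh : Tmeasurable h by apply: measurable_funD => //; exact: measurable_funM.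
  have T0 : 0 <= T := le_trans t0 tT.
  have ih : L1 leb `[0, T] h.
    apply: integrable_realD => //; first by apply: integrable_realZ => //; exact: retention_integrable.
    by apply: (@bounded_integrable_itv _ _ `|C * expR 1 * A2|) => //; exact: measurable_cst.
  have fin1 := marginal_iterated_finite mh cf0 ih.
  set w : R := fine (\int[v]_(z in `]0%R, +oo[) (g z)%:E)%E.
  have wE : (\int[v]_(z in `]0%R, +oo[) (g z)%:E = w%:E)%E.
    by rewrite fineK// ge0_fin_numE//; apply: integral_ge0 => z _; rewrite lee_fin.
  have mG1 : Tmeasurable (fun u : R * R => (h u.1 * `|mg u.1 u.2|)%:E).
    by apply/measurable_EFinP; apply: measurable_funM => //; exact: (measurableT_comp mh measurable_fst).
  have G10 (u : R * R) : (0 <= (h u.1 * `|mg u.1 u.2|)%:E)%E by rewrite lee_fin mulr_ge0// cf0.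
  have E s : (\int[v]_(z in `]0%R, +oo[) (G (s, z))%:E =
      \int[v]_(z in `]0%R, +oo[) (h s * `|mg s z|)%:E + (C * expR 1 * A1 * w)%:E)%E.
    rewrite EFinM -wE -ge0_integralZl_EFin//; first last.
    - by apply: measurable_funTS; exact/measurable_EFinP.
    - by move=> z _; rewrite lee_fin.
    rewrite -ge0_integralD//.
    - by move=> z _; exact: (G10 (s, z)).
    - by apply: measurable_funTS; exact: (measurableT_comp mG1 (measurable_pair1 s)).
    - by move=> z _; rewrite -EFinM lee_fin mulr_ge0.
    - by apply: measurable_funTS; apply: emeasurable_funM => //; exact/measurable_EFinP.
  under eq_integral do rewrite E.
  have w0 : 0 <= w by apply: fine_ge0; apply: integral_ge0 => z _; rewrite lee_fin.
  rewrite ge0_integralD//.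
  + apply: lte_add_pinfty => //; apply: (@integrable_lty _ _ _ leb); first exact: measurable_itv.
    have ic : L1 leb `[0, T] (fun=> C * expR 1 * A1 * w); last exact: ic.
    by apply: (@bounded_integrable_itv _ _ `|C * expR 1 * A1 * w|) => //; exact: measurable_cst.
  + by move=> s _; apply: integral_ge0 => z _; exact: (G10 (s, z)).
  + apply: measurable_funTS.
    exact: (@measurable_integral_section _ v `]0%R, +oo[%classic _ (measurable_itv _) G10 mG1).
  + by move=> s _; rewrite lee_fin mulr_ge0.
Qed.

(** * Equilibrium value, and comparison with a perturbed strategy *)

Section horizon.
Variables (t x : R).
Hypotheses (t0 : 0 <= t) (tT : t <= T).
Notation D := (jump_domain t T).
Notation L := (fun u => beta3 p * jump_load M q u).
Notation al := (alpha p).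
Notation alh := (alphahat p).

Let mD : measurable D := jump_domain_measurable t T.
Let q2t : L1 leb `[t, T] (fun s => q s ^+ 2).
Proof. by apply: integrableS q2 => //; apply: subset_itv; rewrite bnd_simp. Qed.
Let alh0 : 0 <= alh.
Proof. by have /andP[_ h] := alpha_bounds hM; rewrite subr_ge0. Qed.
Let TtT : t <= T <= T. Proof. by rewrite tT lexx. Qed.
Let L_ge0 u : 0 <= L u. Proof. by rewrite mulr_ge0 ?(ltW b30)// (jump_load_ge0 hM q0). Qed.

Let o1 : (1 : R) ^+ 2 = 1. Proof. by rewrite expr1n. Qed.
Let o2 : (-1 : R) ^+ 2 = 1. Proof. by rewrite sqrrN expr1n. Qed.

Let piece_id (f : R -> R) (c : R) : piece c f f = f.
Proof. by apply/funext => s; rewrite /piece; case: ifP. Qed.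

Notation f1 := (volatility M T (pi_s M) (pi_s M) (sigma1 p) (sigma2 p * rho p)).
Notation f2 := (volatility M T (pi_s M) (pi_s M) 0 (sigma2 p * rhohat p)).

Lemma extreme_equations sg :
  [/\ forall s, t <= s <= T -> phi1 (extreme M sg q) s = sg * beta1 p * f1 s,
      forall s, t <= s <= T -> phi2 (extreme M sg q) s = sg * beta2 p * f2 s &
      forall u, D u -> phi3 (extreme M sg q) u.1 u.2 = 1 - expR (sg * L u)].
Proof.
split.
- by move=> s _; rewrite /= /volatility piece_id; ring.
- by move=> s _; rewrite /= /volatility piece_id; ring.
- move=> [s z] [/= _]; rewrite in_itv/= andbT => /ltW z0.
  by rewrite (jump_loadE _ _ z0) mulrA.
Qed.

Notation best := (best_cost M t T (pi_s M) (pi_s M) q).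
Notation base := (mean_variance_base M t x T (pi_s M) (pi_s M) q).

Lemma equilibrium_tilt_integrable sg : sg ^+ 2 = 1 ->
  L1 ell D (fun u => 1 - expR (sg * L u)).
Proof.
move=> sg1; have [e1 e2 e3] := extreme_equations sg.
exact: (cost_eq_best hM t0 tT mq q0 (retention_moderate t0) (extreme_Theta sg1) sg1 e1 e2 e3).2.
Qed.

Section value.
Variable pi : feedback R.
Hypothesis hpi : forall s y, t <= s <= T -> pi s y true = Position (pi_s M s) 0 (q s).

Let stockE s y : t <= s <= T -> stock (pi s y true) = piece T (pi_s M) (pi_s M) s.
Proof. by move=> sT; rewrite hpi// piece_id. Qed.
Let riskE s y : t <= s <= T -> risk (pi s y true) = q s.
Proof. by move=> sT; rewrite hpi. Qed.

Let JlE phi (Tphi : Theta M phi) := JlowE hM x t0 tT TtT pi_s_derive pi_s_derive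
  pi_s_slope_continuous pi_s_slope_continuous mq q0 q2t stockE riskE
  (retention_moderate t0) Tphi.
Let JuE phi (Tphi : Theta M phi) := JupE hM x t0 tT TtT pi_s_derive pi_s_derive
  pi_s_slope_continuous pi_s_slope_continuous mq q0 q2t stockE riskE
  (retention_moderate t0) Tphi.
Let best_le phi (Tphi : Theta M phi) sg (sg1 : sg ^+ 2 = 1) := best_cost_le hM t0 tT TtT pi_s_derive pi_s_derive
  pi_s_slope_continuous pi_s_slope_continuous mq q0
  (retention_moderate t0) Tphi sg1 (equilibrium_tilt_integrable sg1).

Let eqb phi (Tphi : Theta M phi) sg (sg1 : sg ^+ 2 = 1) := cost_eq_best hM t0 tT (c := T) (S1 := pi_s M) (S2 := pi_s M) mq q0
  (retention_moderate t0) Tphi sg1.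

Lemma Jlow_inf : ereal_inf [set Jlow M pi psi t x true | psi in Theta M] = (base + best 1)%:E.
Proof.
have TE := extreme_Theta o1; have [e1 e2 e3] := extreme_equations 1.
apply/eqP; rewrite eq_le; apply/andP; split.
  by apply: ereal_inf_lbound; exists (extreme M 1 q) => //; rewrite JlE// (eqb TE o1 e1 e2 e3).1.
by apply: le_ereal_inf_tmp => _ [psi Tpsi <-]; rewrite JlE// lee_fin lerD2l; exact: best_le.
Qed.

Lemma Jup_sup : ereal_sup [set Jup M pi psi t x true | psi in Theta M] = (base - best (-1))%:E.
Proof.
have TE := extreme_Theta o2; have [e1 e2 e3] := extreme_equations (-1).
apply/eqP; rewrite eq_le; apply/andP; split; last first.
  by apply: ereal_sup_ubound; exists (extreme M (-1) q) => //; rewrite JuE// (eqb TE o2 e1 e2 e3).1.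
by apply: ge_ereal_sup => _ [psi Tpsi <-]; rewrite JuE// lee_fin lerD2l lerN2; exact: best_le.
Qed.

(** Only the values on the horizon matter, so agreement with the extreme distortions there is
    enough. This allows replacing [q] by a modification outside [[0, T]]. *)
Lemma extreme_attains phi psi : Theta M phi -> Theta M psi ->
  (forall s, t <= s <= T -> phi1 phi s = phi1 (extreme M 1 q) s) ->
  (forall s, t <= s <= T -> phi2 phi s = phi2 (extreme M 1 q) s) ->
  (forall u, D u -> phi3 phi u.1 u.2 = phi3 (extreme M 1 q) u.1 u.2) ->
  (forall s, t <= s <= T -> phi1 psi s = phi1 (extreme M (-1) q) s) ->
  (forall s, t <= s <= T -> phi2 psi s = phi2 (extreme M (-1) q) s) ->
  (forall u, D u -> phi3 psi u.1 u.2 = phi3 (extreme M (-1) q) u.1 u.2) ->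
  attains_inf M pi t x true phi /\ attains_sup M pi t x true psi.
Proof.
move=> Tphi Tpsi h1 h2 h3 k1 k2 k3; split; split => //.
  rewrite Jlow_inf JlE//; have [e1 e2 e3] := extreme_equations 1; congr (_ + _)%:E.
  apply: (eqb Tphi o1 _ _ _).1 => [s sT|s sT|u uD]; by rewrite ?h1 ?h2 ?h3 ?e1 ?e2 ?e3.
rewrite Jup_sup JuE//; have [e1 e2 e3] := extreme_equations (-1); congr (_ - _)%:E.
apply: (eqb Tpsi o2 _ _ _).1 => [s sT|s sT|u uD]; by rewrite ?k1 ?k2 ?k3 ?e1 ?e2 ?e3.
Qed.

Notation gain := (premium_gain M q).

Definition equilibrium_value : R :=
  accr p t * x + \int[leb]_(s in `[t, T]) (gain s + stock_objective M s (pi_s M s))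
  + (beta3 p)^-1 * (al * \int[ell]_(u in D) (1 - expR (L u)) - alh * \int[ell]_(u in D) (1 - expR (- L u))).

Let combined := combined_objective hM x t0 tT TtT pi_s_derive pi_s_derive
  pi_s_slope_continuous pi_s_slope_continuous mq q2t.

Lemma J_equilibrium : J M pi t x true = equilibrium_value%:E.
Proof.
rewrite /J Jlow_inf Jup_sup -!EFinM -EFinD; congr (_%:E).
have := combined.1; rewrite piece_id => E; rewrite /equilibrium_value -E /best_cost.
have -> : \int[ell]_(u in D) (1 - expR (1 * L u)) = \int[ell]_(u in D) (1 - expR (L u)).
  by apply: eq_Rintegral => u _; rewrite mul1r.
have -> : \int[ell]_(u in D) (1 - expR (-1 * L u)) = \int[ell]_(u in D) (1 - expR (- L u)).
  by apply: eq_Rintegral => u _; rewrite mulN1r.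
by rewrite /alphahat; ring.
Qed.

Lemma equilibrium_valueE : equilibrium_value = accr p t * x + B1 M q t.
Proof.
rewrite /equilibrium_value -addrA; congr (_ + _).
have mL : Tmeasurable L.
  by apply: measurable_funM => //; exact: jump_load_measurable.
have h1 := equilibrium_tilt_integrable o1; have h2 := equilibrium_tilt_integrable o2.
have i1 : L1 ell D (fun u => expR (L u) - 1).
  have := @integrable_realZ _ _ _ ell D mD (-1) _ h1; apply: eq_integrable => // u _.
  by congr (_%:E); rewrite mul1r; ring.
have i2 : L1 ell D (fun u => 1 - expR (- L u)).
  by apply: eq_integrable h2 => // u _; congr (_%:E); rewrite mulN1r.
have p1 u : 0 <= expR (L u) - 1 by rewrite subr_ge0 -expR0 ler_expR.
have p2 u : 0 <= 1 - expR (- L u) by rewrite subr_ge0 -expR0 ler_expR lerNl oppr0.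
have m1 : Tmeasurable (fun u => expR (L u) - 1).
  by apply: measurable_funB => //; apply: (measurableT_comp (@measurable_expR R)).
have m2 : Tmeasurable (fun u => 1 - expR (- L u)).
  apply: measurable_funB => //; apply: (measurableT_comp (@measurable_expR R)); exact: measurableT_comp.
(* Finiteness of every section, from the marginal bound; the jump integrals can then be iterated as
   in [B1]. The integrands are taken with the sign that makes them nonnegative. *)
have bound s (F : R * R -> R) : t <= s <= T -> Tmeasurable F -> (forall u, 0 <= F u) ->
    (forall u, F u <= L u * expR (L u)) -> (\int[v]_(z in `]0%R, +oo[) (F (s, z))%:E < +oo)%E.
  move=> /andP[ts sT] mF F0 FL; have sT0 : 0 <= s <= T by rewrite sT (le_trans t0 ts).
  have hs := marginal_section (_ : 0 <= beta3 p / al * q s) sT0.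
  apply: (@le_lt_trans _ _ (\int[v]_(z in `]0%R, +oo[) (beta3 p / al * q s * `|mg s z|)%:E)%E); last first.
    by rewrite hs ?ltry// mulr_ge0// divr_ge0// ltW.
  apply: ge0_le_integral => //.
  - by move=> z _; rewrite lee_fin.
  - by apply/measurable_EFinP; apply: measurable_funTS; exact: (measurableT_comp mF (measurable_pair1 s)).
  - apply/measurable_EFinP; apply: measurable_funTS; apply: measurable_funM => //.
    apply: (measurableT_comp (@normr_measurable R setT)).
    exact: (measurableT_comp marginal_measurable (measurable_pair1 s)).
  - move=> z /=; rewrite in_itv/= andbT => /ltW z0; rewrite lee_fin; apply: le_trans (FL _) _.
    rewrite (jump_loadE _ _ z0) ger0_norm ?marginal_ge0//.
    by apply: le_trans (load_exp_le s z0) _; rewrite [leLHS]mulrA.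
have l1 u : expR (L u) - 1 <= L u * expR (L u) by apply: expR_sub1_le; exact: L_ge0.
have l2 u : 1 - expR (- L u) <= L u * expR (L u) by apply: sub1_expRN_le; exact: L_ge0.
have f1' : (\int[ell]_(u in D) (expR (L u) - 1)%:E < +oo)%E by exact: integrable_lty i1.
have f2' : (\int[ell]_(u in D) (1 - expR (- L u))%:E < +oo)%E by exact: integrable_lty i2.
have [E1 j1] := Rintegral_jump_domain tT m1 p1 f1' (fun s sT => bound s _ sT m1 p1 l1).
have [E2 j2] := Rintegral_jump_domain tT m2 p2 f2' (fun s sT => bound s _ sT m2 p2 l2).
have := combined.2; rewrite piece_id => ig.
have -> : \int[ell]_(u in D) (1 - expR (L u)) = - \int[leb]_(s in `[t, T]) \int[v]_(z in `]0, +oo[) (expR (L (s, z)) - 1).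
  by rewrite -E1 -[RHS]mulN1r -(RintegralZl _ _ i1)//; apply: eq_Rintegral => u _; ring.
rewrite E2.
have k1 : L1 leb `[t, T] (fun s => - (al / beta3 p) * \int[v]_(z in `]0, +oo[) (expR (L (s, z)) - 1)) by exact: integrable_realZ.
have k2 : L1 leb `[t, T] (fun s => - (alh / beta3 p) * \int[v]_(z in `]0, +oo[) (1 - expR (- L (s, z)))) by exact: integrable_realZ.
have k12 : L1 leb `[t, T] (fun s => - (al / beta3 p) * \int[v]_(z in `]0, +oo[) (expR (L (s, z)) - 1)
  + - (alh / beta3 p) * \int[v]_(z in `]0, +oo[) (1 - expR (- L (s, z)))) by exact: integrable_realD.
transitivity (\int[leb]_(s in `[t, T]) (gain s + stock_objective M s (pi_s M s)) +
  \int[leb]_(s in `[t, T]) (- (al / beta3 p) * \int[v]_(z in `]0, +oo[) (expR (L (s, z)) - 1)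
  + - (alh / beta3 p) * \int[v]_(z in `]0, +oo[) (1 - expR (- L (s, z))))).
  rewrite (RintegralD _ k1)// !RintegralZl//.
  move: (\int[leb]_(s in `[t, T]) \int[v]_(z in `]0, +oo[) (expR (L (s, z)) - 1))
    (\int[leb]_(s in `[t, T]) \int[v]_(z in `]0, +oo[) (1 - expR (- L (s, z)))) => z1 z2.
  by congr (_ + _); field; rewrite gt_eqF.
rewrite -RintegralD//; apply: eq_Rintegral => s; rewrite inE/= in_itv/= => sT.
have F1 : L1 v `]0, +oo[ (fun z => expR (L (s, z)) - 1).
  apply: ge0_integrable_real => //; last exact: (bound s _ sT m1 p1 l1).
  by apply: measurable_funTS; exact: (measurableT_comp m1 (measurable_pair1 s)).
have -> : \int[v]_(z in `]0, +oo[) (expR (L (s, z)) - 1) = - \int[v]_(z in `]0, +oo[) (1 - expR (beta3 p * load M q s z)).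
  have F1' : L1 v `]0, +oo[ (fun z => 1 - expR (beta3 p * load M q s z)).
    have := @integrable_realZ _ _ _ v `]0, +oo[%classic (measurable_itv _) (-1) _ F1; apply: eq_integrable => // z.
    by rewrite inE/= in_itv/= andbT => /ltW z0; congr (_%:E); rewrite (jump_loadE _ _ z0); ring.
  rewrite -[RHS]mulN1r -(RintegralZl _ _ F1')//; apply: eq_Rintegral => z.
  by rewrite inE/= in_itv/= andbT => /ltW z0; rewrite (jump_loadE _ _ z0); ring.
have -> : \int[v]_(z in `]0, +oo[) (1 - expR (- L (s, z))) = \int[v]_(z in `]0, +oo[) (1 - expR (- (beta3 p * load M q s z))).
  by apply: eq_Rintegral => z; rewrite inE/= in_itv/= andbT => /ltW z0; rewrite (jump_loadE _ _ z0).
rewrite stock_objectiveE// subrr expr0n/= mulr0 subr0 /premium_gain.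
move: (\int[v]_(z in `]0, +oo[) (1 - expR (beta3 p * load M q s z)))
  (\int[v]_(z in `]0, +oo[) (1 - expR (- (beta3 p * load M q s z)))) => z1 z2.
by ring.
Qed.

End value.

Section comparison.
Variables (k : R) (pi : feedback R).
Hypothesis k0 : 0 <= k.
Variables (c : R) (S1 S2 dS1 dS2 rk : R -> R).
Hypothesis tcT : t <= c <= T.
Hypotheses (D1 : forall s : R, is_derive s 1 S1 (dS1 s)) (D2 : forall s : R, is_derive s 1 S2 (dS2 s)).
Hypotheses (C1 : continuous dS1) (C2 : continuous dS2).
Hypotheses (mrk : Tmeasurable rk) (rk0 : forall s, 0 <= rk s).
Hypothesis rkE : forall s, 0 <= s <= T -> rk s = k \/ rk s = q s.
Notation st := (piece c S1 S2).
Hypothesis stockE : forall s y, t <= s <= T -> stock (pi s y true) = st s.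
Hypothesis riskE : forall s y, t <= s <= T -> risk (pi s y true) = rk s.

Notation Lq := (fun u => beta3 p * jump_load M q u).
Notation Lk := (fun u => beta3 p * jump_load M rk u).
Notation f1 := (volatility M c S1 S2 (sigma1 p) (sigma2 p * rho p)).
Notation f2 := (volatility M c S1 S2 0 (sigma2 p * rhohat p)).
Notation l := (capped_load rk).

Let sub : `[t, T] `<=` `[0, T]. Proof. by apply: subset_itv; rewrite bnd_simp. Qed.
Let iq : L1 leb `[t, T] q.
Proof. by apply: integrableS retention_integrable. Qed.

Lemma switched_sqr_integrable : L1 leb `[t, T] (fun s => rk s ^+ 2).
Proof.
have h : L1 leb `[t, T] (fun s => q s ^+ 2 + k ^+ 2).
  apply: integrable_realD => //.
  by apply: (@bounded_integrable_itv _ _ `|k ^+ 2|) => //; exact: measurable_cst.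
apply: (@le_integrable _ _ _ leb _ _ _ (EFin \o (fun s => q s ^+ 2 + k ^+ 2))) => //.
  by apply/measurable_EFinP; apply: measurable_funTS; exact: (measurable_funX 2 mrk).
have key (s : R) : t <= s -> s <= T -> `|rk s ^+ 2| <= `|q s ^+ 2 + k ^+ 2|.
  move=> ts sT; rewrite !ger0_norm ?addr_ge0 ?sqr_ge0//.
  by have [|->|->] := @rkE s; rewrite ?(le_trans t0 ts)// ?lerDl ?lerDr sqr_ge0.
by move=> s /=; rewrite in_itv/= => /andP[ts sT]; rewrite lee_fin; exact: key.
Qed.

Lemma switched_moderate : moderate M t rk.
Proof.
have [[K hK]|v0] := retention_moderate t0; last by right.
left; exists (Num.max k K) => s /andP[ts sT].
have [|->|->] := @rkE s; first by rewrite sT (le_trans t0 ts).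
  by rewrite le_max lexx.
by rewrite le_max hK ?ts// orbT.
Qed.

Let irk : L1 leb `[t, T] rk.
Proof. by apply: sqr_integrable_itv switched_sqr_integrable; exact: measurable_funTS. Qed.

Let phi := capped_distortion t f1 f2 rk.

Let Tphi : Theta M phi.
Proof.
have [K1 m1 h1] := volatility_bounded (M := M) tT tcT D1 D2 C1 C2 (sigma1 p) (sigma2 p * rho p).
have [K2 m2 h2] := volatility_bounded (M := M) tT tcT D1 D2 C1 C2 0 (sigma2 p * rhohat p).
by apply: (capped_Theta t0 tT k0) => //; [exists K1|exists K2].
Qed.

Let e1 s : t <= s <= T -> phi1 phi s = 1 * beta1 p * f1 s.
Proof. by move=> sT; rewrite /= indicE mem_set//= !mul1r. Qed.
Let e2 s : t <= s <= T -> phi2 phi s = 1 * beta2 p * f2 s.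
Proof. by move=> sT; rewrite /= indicE mem_set//= !mul1r. Qed.
Let e3 u : D u -> phi3 phi u.1 u.2 = 1 - expR (l u). Proof. by case: u. Qed.

Let tilted := cost_tilted hM t0 tT mrk rk0 switched_moderate Tphi o1 e1 e2 e3.

Notation X := (fun u => l u * expR (l u) + 1 - expR (l u) - 1 * (beta3 p * jump_load M rk u * expR (l u))).
Notation Y := (fun u => 1 - expR (-1 * (beta3 p * jump_load M rk u))).
Notation Zp := (fun u => 1 - expR (1 * (beta3 p * jump_load M q u))).
Notation Zm := (fun u => 1 - expR (-1 * (beta3 p * jump_load M q u))).

Let iY : L1 ell D Y := seeking_integrable hM t0 tT mrk rk0 switched_moderate.
Let iZp : L1 ell D Zp := equilibrium_tilt_integrable o1.
Let iZm : L1 ell D Zm := equilibrium_tilt_integrable o2.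

(** [capped_tilt_bound] leaves the term [(Lk - Lq)] times the mixed tilt. The load is convex in the
    retention, so [Lk - Lq] is at least [beta3 * (rk - q)] times the derivative of the load at [q],
    and that derivative times the mixed tilt is [marginal]. *)
Let pointwise u : D u -> al * X u - alh * Y u <=
  al * Zp u - alh * Zm u - beta3 p * (rk u.1 * `|mg u.1 u.2|) + beta3 p * (q u.1 * `|mg u.1 u.2|).
Proof.
case: u => s z [/= _]; rewrite in_itv/= andbT => /ltW z0.
have x0 : 0 <= Lk (s, z) by rewrite mulr_ge0 ?(ltW b30)// (jump_load_ge0 hM rk0).
have lq0 : 0 <= Lq (s, z) by rewrite mulr_ge0 ?(ltW b30)// (jump_load_ge0 hM q0).
have := capped_tilt_bound (alpha_bounds hM) x0 lq0; cbv zeta => h.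
have m0 := marginal_ge0 s z0.
rewrite (ger0_norm m0) !mul1r !mulN1r; apply: le_trans h _.
rewrite -/alh.
have conv : beta3 p * ((rk s - q s) * (z * accr p s + gamma p * q s * z ^+ 2 * accr p s ^+ 2)) <= Lk (s, z) - Lq (s, z).
  rewrite /= !jump_loadE// -mulrBr ler_wpM2l ?(ltW b30)// /load -subr_ge0.
  rewrite [leRHS](_ : _ = gamma p / 2 * (z ^+ 2 * accr p s ^+ 2) * (rk s - q s) ^+ 2); last by field.
  by rewrite mulr_ge0 ?sqr_ge0// mulr_ge0 ?(mulr_ge0 (sqr_ge0 _) (sqr_ge0 _))// divr_ge0// ltW.
have mE : mg s z = (z * accr p s + gamma p * q s * z ^+ 2 * accr p s ^+ 2) *
    (al * expR (Lq (s, z)) + alh * expR (- Lq (s, z))).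
  by rewrite /= !jump_loadE.
have tm := tilt_mix_ge1 lq0.
rewrite mE -subr_ge0; apply: le_trans (_ : (Lk (s, z) - Lq (s, z) - beta3 p * ((rk s - q s) *
  (z * accr p s + gamma p * q s * z ^+ 2 * accr p s ^+ 2))) * (al * expR (Lq (s, z)) + alh * expR (- Lq (s, z))) <= _).
  by rewrite mulr_ge0 ?subr_ge0// (le_trans ler01).
by apply: eqW; ring.
Qed.

(** The pointwise inequality integrated; by the first order condition each [marginal] integrates to
    the marginal premium. *)
Let jump_comparison : al * \int[ell]_(u in D) X u - alh * \int[ell]_(u in D) Y u <=
  al * \int[ell]_(u in D) Zp u - alh * \int[ell]_(u in D) Zm u
  - beta3 p * \int[leb]_(s in `[t, T]) (rk s * ((1 + eta0) * accr p s * mean_claim M))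
  + beta3 p * \int[leb]_(s in `[t, T]) (q s * ((1 + eta0) * accr p s * mean_claim M)).
Proof.
have iX : L1 ell D X := tilted.2.
have [im1 Em1] := marginal_setX t0 tT mrk rk0 irk.
have [im2 Em2] := marginal_setX t0 tT mq q0 iq.
have a1 : L1 ell D (fun u => al * X u) by exact: integrable_realZ.
have a2 : L1 ell D (fun u => alh * Y u) by exact: integrable_realZ.
have a3 : L1 ell D (fun u => al * Zp u) by exact: integrable_realZ.
have a4 : L1 ell D (fun u => alh * Zm u) by exact: integrable_realZ.
have a5 : L1 ell D (fun u => beta3 p * (rk u.1 * `|mg u.1 u.2|)) by exact: integrable_realZ.
have a6 : L1 ell D (fun u => beta3 p * (q u.1 * `|mg u.1 u.2|)) by exact: integrable_realZ.
have a12 : L1 ell D (fun u => al * X u - alh * Y u) by exact: integrable_realB.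
have a34 : L1 ell D (fun u => al * Zp u - alh * Zm u) by exact: integrable_realB.
have a345 : L1 ell D (fun u => al * Zp u - alh * Zm u - beta3 p * (rk u.1 * `|mg u.1 u.2|)).
  exact: integrable_realB.
have a3456 : L1 ell D (fun u => al * Zp u - alh * Zm u - beta3 p * (rk u.1 * `|mg u.1 u.2|)
   + beta3 p * (q u.1 * `|mg u.1 u.2|)) by exact: integrable_realD.
rewrite -Em1 -Em2 -(RintegralZl _ _ iX)// -(RintegralZl _ _ iY)// -(RintegralZl _ _ iZp)// -(RintegralZl _ _ iZm)//.
rewrite -(RintegralZl _ _ im1)// -(RintegralZl _ _ im2)//.
rewrite -(RintegralB _ a1)// -(RintegralB _ a3)// -(RintegralB _ a34)// -(RintegralD _ a345)//.
by apply: le_Rintegral => // u uD; exact: pointwise.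
Qed.

Notation base := (mean_variance_base M t x c S1 S2 rk).
Notation best := (best_cost M t c S1 S2 rk).

Let combined := combined_objective hM x t0 tT tcT D1 D2 C1 C2 mrk switched_sqr_integrable.

(** The premium is affine in the retention with exactly the slope that appears in [jump_comparison],
    so the two corrections cancel when the comparisons are added. The stock part is at its maximum
    at [pi_s]. *)
Let trade_comparison :
  \int[leb]_(s in `[t, T]) (premium_gain M rk s + stock_objective M s (st s)) <=
  \int[leb]_(s in `[t, T]) (premium_gain M q s + stock_objective M s (pi_s M s)) +
  \int[leb]_(s in `[t, T]) (rk s * ((1 + eta0) * accr p s * mean_claim M)) -
  \int[leb]_(s in `[t, T]) (q s * ((1 + eta0) * accr p s * mean_claim M)).
Proof.
have TT : t <= T <= T by rewrite tT lexx.
have := (combined_objective hM x t0 tT TT pi_s_derive pi_s_derive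
  pi_s_slope_continuous pi_s_slope_continuous mq q2t).2.
have -> : piece T (pi_s M) (pi_s M) = pi_s M by apply/funext => s; rewrite /piece; case: ifP.
move=> i1; have i2 := charge_integrable t0 tT mrk rk0 irk; have i3 := charge_integrable t0 tT mq q0 iq.
have i12 : L1 leb `[t, T] (fun s => premium_gain M q s + stock_objective M s (pi_s M s)
   + rk s * ((1 + eta0) * accr p s * mean_claim M)) by exact: integrable_realD.
have i123 : L1 leb `[t, T] (fun s => premium_gain M q s + stock_objective M s (pi_s M s)
   + rk s * ((1 + eta0) * accr p s * mean_claim M) - q s * ((1 + eta0) * accr p s * mean_claim M)).
  exact: integrable_realB.
rewrite -(RintegralD _ i1)// -(RintegralB _ i12)//; apply: le_Rintegral => //; first exact: combined.2.
have key (s : R) : premium_gain M rk s + stock_objective M s (st s) <= premium_gain M q s + stock_objective M s (pi_s M s)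
   + rk s * ((1 + eta0) * accr p s * mean_claim M) - q s * ((1 + eta0) * accr p s * mean_claim M).
  rewrite -subr_ge0 [leRHS](_ : _ = stock_objective M s (pi_s M s) - stock_objective M s (st s)).
    by rewrite subr_ge0 stock_objective_le.
  by rewrite /premium_gain; ring.
by move=> s _; exact: key.
Qed.

(** The infimum is bounded above by its value at the capped distortion, which may not be optimal,
    and the supremum by its dual bound [best_cost], whose integrand is always integrable on that
    side. *)
Lemma J_le_equilibrium_value : (J M pi t x true <= (equilibrium_value)%:E)%E.
Proof.
have Jl := JlowE hM x t0 tT tcT D1 D2 C1 C2 mrk rk0 switched_sqr_integrable stockE riskE switched_moderate Tphi.
have i_le : (ereal_inf [set Jlow M pi psi t x true | psi in Theta M] <= (base + cost M t c S1 S2 rk 1 phi)%:E)%E.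
  by apply: ereal_inf_lbound; exists phi.
have s_le : (ereal_sup [set Jup M pi psi t x true | psi in Theta M] <= (base - best (-1))%:E)%E.
  apply: ge_ereal_sup => _ [psi Tpsi <-].
  rewrite (JupE hM x t0 tT tcT D1 D2 C1 C2 mrk rk0 switched_sqr_integrable stockE riskE switched_moderate Tpsi).
  rewrite lee_fin lerD2l lerN2.
  exact: (best_cost_le hM t0 tT tcT D1 D2 C1 C2 mrk rk0 switched_moderate Tpsi o2 iY).
apply: (@le_trans _ _ (al%:E * (base + cost M t c S1 S2 rk 1 phi)%:E + alh%:E * (base - best (-1))%:E)%E).
  by apply: leeD; apply: lee_wpmul2l => //; rewrite lee_fin ltW.
rewrite -!EFinM -EFinD lee_fin tilted.1 /best_cost /equilibrium_value.
have Ec := combined.1; have jc := jump_comparison; have tc := trade_comparison.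
have -> : \int[ell]_(u in D) (1 - expR (beta3 p * jl q u)) = \int[ell]_(u in D) Zp u.
  by apply: eq_Rintegral => u _; rewrite mul1r.
have -> : \int[ell]_(u in D) (1 - expR (- (beta3 p * jl q u))) = \int[ell]_(u in D) Zm u.
  by apply: eq_Rintegral => u _; rewrite mulN1r.
move: Ec jc tc.
move: (\int[leb]_(s in `[t, T]) (- (beta1 p * f1 s ^+ 2 + beta2 p * f2 s ^+ 2) / 2)).
move: (\int[ell]_(u in D) X u) (\int[ell]_(u in D) Y u) (\int[ell]_(u in D) Zp u) (\int[ell]_(u in D) Zm u).
move: (\int[leb]_(s in `[t, T]) (premium_gain M rk s + _)) (\int[leb]_(s in `[t, T]) (premium_gain M q s + _)).
move: (\int[leb]_(s in `[t, T]) (rk s * _)) (\int[leb]_(s in `[t, T]) (q s * _)).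
move: base => b rq qq vr vq zx zy zp zm kk Ec jc tc.
have b3i : 0 <= (beta3 p)^-1 by rewrite invr_ge0 ltW.
have := ler_wpM2l b3i jc.
have -> : (beta3 p)^-1 * (al * zp - alh * zm - beta3 p * rq + beta3 p * qq) =
  (beta3 p)^-1 * (al * zp - alh * zm) - rq + qq by field; rewrite gt_eqF.
rewrite (_ : al * (b + (kk + (beta3 p)^-1 * zx)) + alh * (b - (kk + (beta3 p)^-1 * zy)) =
  b + (2 * al - 1) * kk + (beta3 p)^-1 * (al * zx - alh * zy)); last by rewrite /alphahat; ring.
by rewrite Ec; lra.
Qed.

End comparison.

End horizon.
End retention.

(** * From a retention given on the horizon to the equilibrium property *)

Section truncation.
Context {R : realType} {d : measure_display} {Omega : measurableType d}.
Variable M : market R Omega.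
Hypothesis hM : market_ok M.
Notation p := (par M).
Notation T := (horizon (par M)).
Notation leb := (@lebesgue_measure R).
Variable q : R -> R.
Hypothesis mq : measurable_fun `[0, T] q.
Hypothesis q2 : (\int[leb]_(s in `[0%R, T]) (q s ^+ 2)%:E < +oo)%E.
Hypothesis hq : solves_foc M q.

(** The retention is constrained on [[0, T]] only; extension by 0 provides the global measurability
    and sign used above, without changing any quantity of the problem. *)
Definition truncated (s : R) : R := (q \_ `[0, T]) s.

Lemma truncatedE s : 0 <= s <= T -> truncated s = q s.
Proof. by move=> sT; rewrite /truncated patchE mem_set//= in_itv. Qed.

Lemma truncated_measurable : Tmeasurable truncated.
Proof. exact/(measurable_restrictT _ (measurable_itv _)). Qed.

Lemma truncated_ge0 s : 0 <= truncated s.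
Proof.
rewrite /truncated patchE; case: ifPn => //; rewrite inE/= in_itv/= => sT.
by have [] := hq sT.
Qed.

Lemma truncated_sqr_integrable : L1 leb `[0, T] (fun s => truncated s ^+ 2).
Proof.
have h : L1 leb `[0, T] (fun s => q s ^+ 2).
  apply: ge0_integrable_real => //; first exact: measurable_funX.
  by move=> s _; exact: sqr_ge0.
apply: eq_integrable h => // s; rewrite inE/= in_itv/= => sT.
by congr (_%:E); rewrite truncatedE.
Qed.

Lemma truncated_load s z : 0 <= s <= T -> load M truncated s z = load M q s z.
Proof. by move=> sT; rewrite /load truncatedE. Qed.

Lemma truncated_solves_foc : solves_foc M truncated.
Proof.
move=> s sT; have [q0 i E] := hq sT.
have -> : foc M truncated s = foc M q s.
  by apply/funext => z; rewrite /foc truncated_load// truncatedE.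
by rewrite truncatedE.
Qed.

Lemma truncated_B1 t : 0 <= t -> B1 M truncated t = B1 M q t.
Proof.
move=> t0; apply: eq_Rintegral => s; rewrite inE/= in_itv/= => /andP[ts sT].
have sT0 : 0 <= s <= T by rewrite sT (le_trans t0 ts).
have E1 : \int[levy M]_(z in `]0, +oo[) (1 - expR (beta3 p * load M truncated s z)) =
    \int[levy M]_(z in `]0, +oo[) (1 - expR (beta3 p * load M q s z)).
  by apply: eq_Rintegral => z _; rewrite truncated_load.
have E2 : \int[levy M]_(z in `]0, +oo[) (1 - expR (- (beta3 p * load M truncated s z))) =
    \int[levy M]_(z in `]0, +oo[) (1 - expR (- (beta3 p * load M q s z))).
  by apply: eq_Rintegral => z _; rewrite truncated_load.
by rewrite E1 E2 (truncatedE sT0).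
Qed.

Lemma truncated_extreme_Theta sg : sg ^+ 2 = 1 -> Theta M (extreme M sg q).
Proof.
move=> sg1.
have [m1 m2 m3 lt1 fin] := extreme_Theta hM truncated_measurable truncated_ge0
  truncated_sqr_integrable truncated_solves_foc sg1.
have E s z : 0 <= s <= T -> phi3 (extreme M sg truncated) s z = phi3 (extreme M sg q) s z.
  by move=> sT; rewrite /= truncated_load.
split; [exact: m1|exact: m2| | | ].
- apply: eq_measurable_fun m3 => -[s z]; rewrite inE => -[/= + _]; rewrite in_itv/= => sT.
  by rewrite truncated_load.
- by move=> s z sT z0; rewrite -E//; exact: lt1.
- move=> t tT; have /andP[t0 _] := tT.
  have EI : (\int[leb]_(s in `[t, T]) \int[levy M]_(z in `]0%R, +oo[) (entropy (phi3 (extreme M sg truncated) s z))%:E =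
      \int[leb]_(s in `[t, T]) \int[levy M]_(z in `]0%R, +oo[) (entropy (phi3 (extreme M sg q) s z))%:E)%E.
    apply: eq_integral => s; rewrite inE/= in_itv/= => /andP[ts sT].
    by apply: eq_integral => z _; rewrite truncated_load// sT (le_trans t0 ts).
  by rewrite -EI; exact: (fin t tT).
Qed.

Variable pi : feedback R.
Hypothesis hpi : forall t x, 0 <= t <= T -> pi t x true = Position (pi_s M t) 0 (q t).

Variables t x : R.
Hypotheses (t0 : 0 <= t) (tT : t <= T).

Let hpi' s y : t <= s <= T -> pi s y true = Position (pi_s M s) 0 (truncated s).
Proof.
move=> /andP[ts sT]; have sT0 : 0 <= s <= T by rewrite sT (le_trans t0 ts).
by rewrite hpi// truncatedE.
Qed.

Lemma equilibrium_J : J M pi t x true = (accr p t * x + B1 M q t)%:E.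
Proof.
rewrite (J_equilibrium hM truncated_measurable truncated_ge0 truncated_sqr_integrable truncated_solves_foc x t0 tT hpi').
rewrite (equilibrium_valueE hM truncated_measurable truncated_ge0 truncated_sqr_integrable truncated_solves_foc x t0 tT).
by rewrite truncated_B1.
Qed.

Lemma equilibrium_attains :
  attains_inf M pi t x true (extreme M 1 q) /\ attains_sup M pi t x true (extreme M (-1) q).
Proof.
apply: (extreme_attains hM truncated_measurable truncated_ge0 truncated_sqr_integrable truncated_solves_foc x t0 tT hpi') => //.
- by apply: truncated_extreme_Theta; rewrite expr1n.
- by apply: truncated_extreme_Theta; rewrite sqrrN expr1n.
- move=> u [/= + _]; rewrite in_itv/= => /andP[tu uT].
  by rewrite truncated_load// uT (le_trans t0 (ltW tu)).
- move=> u [/= + _]; rewrite in_itv/= => /andP[tu uT].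
  by rewrite truncated_load// uT (le_trans t0 (ltW tu)).
Qed.

Lemma equilibrium_admissible : admissible M pi t x true.
Proof.
have TT : t <= T <= T by rewrite tT lexx.
have piece_id : piece T (pi_s M) (pi_s M) = pi_s M by apply/funext => s; rewrite /piece; case: ifP.
have qt2 : L1 leb `[t, T] (fun s => truncated s ^+ 2).
  by apply: integrableS truncated_sqr_integrable => //; apply: subset_itv; rewrite bnd_simp.
have cE (X : R -> Omega -> R) s w : t <= s <= T -> control M pi true X s w = Position (pi_s M s) 0 (truncated s).
  by move=> sT; rewrite /control /Dleft/= hpi'.
have cE' (X : R -> Omega -> R) s w : t < s <= T -> control M pi true X s w = Position (pi_s M s) 0 (truncated s).
  by move=> /andP[/ltW ts sT]; apply: cE; rewrite ts.
have mpi : Tmeasurable (pi_s M) by apply: continuous_measurable_fun; exact: pi_s_continuous.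
have sq phi : square_integrable M pi t x true phi.
  rewrite /square_integrable.
  have [K hK] : exists K, forall s, 0 <= s <= T -> `|pi_s M s| <= K.
    have [K hK] := exposure_bounded hM 0 1; exists K => s sT; apply: le_trans (hK s sT).
    have -> : (0 + 1 * pi_s M s) * accr p s = pi_s M s * accr p s by ring.
    have /andP[a1 _] := accr_bounds hM sT.
    by rewrite [leRHS]normrM; apply: ler_peMr => //; exact: le_trans a1 (ler_norm _).
  have iS : L1 leb `[t, T] (fun s => K ^+ 2 + truncated s ^+ 2).
    apply: integrable_realD => //.
    by apply: (@bounded_integrable_itv _ _ `|K ^+ 2|) => //; exact: measurable_cst.
  pose C := (\int[leb]_(u in `[t, T]) (pi_s M u ^+ 2 + 0 ^+ 2 + truncated u ^+ 2)%:E)%E.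
  have Cy : (C < +oo)%E.
    apply: (@le_lt_trans _ _ (\int[leb]_(u in `[t, T]) (K ^+ 2 + truncated u ^+ 2)%:E)%E).
      apply: ge0_le_integral => //.
      - by move=> s _; rewrite lee_fin !addr_ge0 ?sqr_ge0.
      - apply/measurable_EFinP; apply: measurable_funTS; apply: measurable_funD.
          by apply: measurable_funD => //; exact: (measurable_funX 2 mpi).
        exact: (measurable_funX 2 truncated_measurable).
      - apply/measurable_EFinP; apply: measurable_funTS; apply: measurable_funD => //.
        exact: (measurable_funX 2 truncated_measurable).
      - move=> s /=; rewrite in_itv/= => /andP[ts sT]; rewrite lee_fin lerD2r expr0n/= addr0.
        rewrite -(real_normK (num_real (pi_s M s))) lerXn2r ?nnegrE ?hK ?sT ?(le_trans t0 ts)//.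
        by apply: le_trans (hK s _); rewrite ?sT ?(le_trans t0 ts).
    exact: integrable_lty iS.
  rewrite (_ : (\int[_]_w _)%E = \int[priorC M phi t true]_w cst C w)%E.
    by rewrite integral_cst//= probability_setT mule1.
  apply: eq_integral => w _; apply: eq_integral => s; rewrite inE/= in_itv/= => sT.
  by rewrite cE.
have [ai as_] := equilibrium_attains.
split.
- apply: (unique_strong_solution_path hM x t0 tT TT (pi_s_derive M) (pi_s_derive M)
    (@pi_s_slope_continuous _ _ _ M) (@pi_s_slope_continuous _ _ _ M) truncated_measurable truncated_ge0 qt2) => s y sT.
  + by rewrite hpi'// piece_id.
  + by rewrite hpi'.
- split.
  + apply: (predictable_congr (f := fun s _ => pi_s M s)); last by apply: predictable_det; exact: measurable_funTS.
    by move=> s w sT; rewrite cE'.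
  + apply: (predictable_congr (f := fun s _ => 0)); last by apply: predictable_det.
    by move=> s w sT; rewrite cE'.
  + apply: (predictable_congr (f := fun s _ => truncated s)).
      by move=> s w sT; rewrite cE'.
    by apply: predictable_det; apply: measurable_funTS; exact: truncated_measurable.
- by move=> s w sT; rewrite cE'//=; split => //; exact: truncated_ge0.
- by exists (extreme M 1 q).
- by exists (extreme M (-1) q).
Qed.

Lemma equilibrium_perturb (e : R) (c : position R) : 0 < e -> 0 <= risk c ->
  (J M (perturb pi t e c) t x true <= J M pi t x true)%E.
Proof.
move=> e0 c0.
rewrite (J_equilibrium hM truncated_measurable truncated_ge0 truncated_sqr_integrable truncated_solves_foc x t0 tT hpi').
(* The switch is at [min (t + e) T], and [piece] takes its second branch at the switching time. If
   [t + e > T] the constant position still holds at [T], so the second branch must be the constant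
   as well. *)
pose S2 := if t + e <= T then pi_s M else cst (stock c).
pose dS2 := if t + e <= T then (fun s : R => rate p * ((mu p - rate p) * expR (- (rate p * (T - s))))
  / (sigma2 p ^+ 2 * quad M)) else cst 0.
pose rk s := if s < t + e then risk c else truncated s.
have d1 (s : R) : is_derive s 1 (cst (stock c) : R -> R) ((cst 0 : R -> R) s) by exact: is_derive_cst.
have d2 (s : R) : is_derive s 1 S2 (dS2 s).
  by rewrite /S2 /dS2; case: ifP => _; [exact: pi_s_derive|exact: d1].
have c1 : continuous (cst 0 : R -> R) by move=> s; exact: cvg_cst.
have c2 : continuous dS2 by rewrite /dS2; case: ifP => _; [exact: pi_s_slope_continuous|exact: c1].
have cT : t <= Num.min (t + e) T <= T by rewrite le_min tT lerDl (ltW e0) ge_min lexx orbT.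
have mrk : Tmeasurable rk.
  apply: measurable_fun_if => //.
  - apply: measurable_fun_ltr => //.
  - by apply: measurable_funTS; exact: truncated_measurable.
have rk0 s : 0 <= rk s by rewrite /rk; case: ifP => _ //; exact: truncated_ge0.
have rkE s : 0 <= s <= T -> rk s = risk c \/ rk s = truncated s.
  by move=> _; rewrite /rk; case: ifP => _; [left|right].
apply: (J_le_equilibrium_value hM truncated_measurable truncated_ge0 truncated_sqr_integrable truncated_solves_foc
  x t0 tT c0 cT d1 d2 c1 c2 mrk rk0 rkE) => s y sT.
  have /andP[ts sT'] := sT; rewrite /perturb ts/= /piece /S2.
  have [se|es] := ltP s (t + e).
    case: (leP (t + e) T) => teT; first by rewrite se.
    by case: ifP.
  case: (leP (t + e) T) => teT; first by rewrite ltNge es hpi'.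
  by have := le_lt_trans sT' teT; rewrite ltNge es.
have /andP[ts _] := sT; rewrite /perturb ts/= /rk.
by case: ifP => // _; rewrite hpi'.
Qed.

End truncation.

Lemma sub_real_ge0 (R : realType) (a : R) (y : \bar R) : (y <= a%:E -> 0 <= a%:E - y)%E.
Proof. by move=> ya; rewrite subre_ge0. Qed.

Unset Implicit Arguments.
Unset Strict Implicit.
Theorem theorem4p1 (R : realType) (d : measure_display)
    (Omega : measurableType d) (M : market R Omega) (hM : market_ok M)
    (q : R -> R)
    (mq : measurable_fun `[0, horizon (par M)] q)
    (q2 : (\int[@lebesgue_measure R]_(s in `[0%R, horizon (par M)])
             (q s ^+ 2)%:E < +oo)%E)
    (hq : solves_foc M q)
    (pi : feedback R)
    (hpi : forall t x, 0 <= t <= horizon (par M) ->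
       pi t x true = Position (pi_s M t) 0 (q t)) :
  [/\ equilibrium M true pi,
      forall t x, 0 <= t <= horizon (par M) ->
        J M pi t x true = (accr (par M) t * x + B1 M q t)%:E &
      forall t x, 0 <= t <= horizon (par M) ->
        attains_inf M pi t x true (extreme M 1 q) /\
        attains_sup M pi t x true (extreme M (-1) q)].

Proof.
have post t x : 0 <= t <= horizon (par M) -> J M pi t x true = (accr (par M) t * x + B1 M q t)%:E.
  by move=> /andP[t0 tT]; exact: equilibrium_J.
split => //.
- move=> t x /andP[t0 tT]; split; first exact: (equilibrium_admissible hM mq q2 hq hpi).
  (* The lower limit is a supremum of infima over neighbourhoods. As the perturbation does not
     improve for any [e > 0], the set of all positive [e] serves as the neighbourhood. *)
  move=> c c0; rewrite limf_einfE; apply: (@le_trans _ _ (ereal_inf ((fun e : R =>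
    (J M pi t x true - J M (perturb pi t e c) t x true) * (e^-1)%:E)%E @` [set e | 0 < e]))).
    apply: le_ereal_inf_tmp => _ [e e0 <-]; apply: mule_ge0; last by rewrite lee_fin invr_ge0 ltW.
    have Jpi := post t x (introT andP (conj t0 tT)).
    have := equilibrium_perturb hM mq q2 hq hpi x t0 tT e0 c0.
    by rewrite Jpi; exact: sub_real_ge0.
  by apply: ereal_sup_ubound; exists [set e | 0 < e] => //; exact: nbhs_right_gt.
- by move=> t x /andP[t0 tT]; exact: (equilibrium_attains hM mq q2 hq hpi).
Qed.
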